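(* Let $\Omega\subset\mathbb{R}^3$ be a bounded connected open set with $C^{1,1}$ boundary $\Gamma$, let $\theta>0$, $\alpha<A_1$ and $\eta\ge c_{\alpha,\theta}$. Then the operator $\mathcal{A}^{\Gamma}_{\eta}:=-\pi_T\circ(\mathcal{L}^{\eta}_{\alpha,\theta})^{-1}\circ\mathcal{J}:TL^2(\Gamma)\to TL^2(\Gamma)$ is compact and self-adjoint in $TL^2(\Gamma)$.
   Context: Functions are complex-valued; $a\cdot b=\sum_i a_ib_i$ (no conjugation); $\nu$ is the unit outer normal to $\Gamma$, $d\sigma$ the surface measure. $X_T(\Omega)=\{u\in(L^2(\Omega))^3:\operatorname{curl}u\in(L^2(\Omega))^3,\ \operatorname{div}u\in L^2(\Omega),\ \nu\cdot u=0\text{ on }\Gamma\}$ with norm $\|u\|^2=\|u\|^2_{L^2}+\|\operatorname{curl}u\|^2_{L^2}+\|\operatorname{div}u\|^2_{L^2}$; for $C^{1,1}$ boundary it equals $\{u\in(H^1(\Omega))^3:\nu\cdot u=0\text{ on }\Gamma\}$ with continuous embedding into $(H^1(\Omega))^3$. $TL^2(\Gamma)=\{f\in(L^2(\Gamma))^3:\nu\cdot f=0\text{ on }\Gamma\}$ with the standard scalar product $\int_\Gamma f\cdot\bar g\,d\sigma$. $\pi_Tu=\nu\times(u\times\nu)$ is the tangential components trace on $\Gamma$, which coincides with the usual trace for $u\in X_T(\Omega)$. $A_1=\inf\left\{\frac{\int_\Omega|\operatorname{curl}u|^2dx+\theta\int_\Omega|\operatorname{div}u|^2dx}{\int_\Omega|u|^2dx}:u\in(H^1_0(\Omega))^3,u\ne0\right\}$.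 $c_{\alpha,\theta}\ge0$ is a fixed constant such that for every $\eta\ge c_{\alpha,\theta}$ the quadratic form $\int_\Omega|\operatorname{curl}u|^2-\alpha|u|^2+\theta|\operatorname{div}u|^2dx+\eta\int_\Gamma|u|^2d\sigma$ is coercive on $X_T(\Omega)$ (such a constant exists when $\alpha<A_1$). $\mathcal{L}^{\eta}_{\alpha,\theta}:X_T(\Omega)\to(X_T(\Omega))'$ is defined by $\langle\mathcal{L}^{\eta}_{\alpha,\theta}(u),\varphi\rangle=\int_\Omega\operatorname{curl}u\cdot\operatorname{curl}\varphi\,dx-\alpha\int_\Omega u\cdot\varphi\,dx+\theta\int_\Omega\operatorname{div}u\operatorname{div}\varphi\,dx+\eta\int_\Gamma u\cdot\varphi\,d\sigma$; it is invertible for $\eta\ge c_{\alpha,\theta}$. $\mathcal{J}:TL^2(\Gamma)\to(X_T(\Omega))'$ is defined by $\langle\mathcal{J}(f),\varphi\rangle=\int_\Gamma f\cdot\varphi\,d\sigma$. *)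

(* Defs.v *)
From HB Require Import structures.
From mathcomp Require Import all_boot all_order all_algebra.
From mathcomp Require Import all_classical all_reals all_analysis.
From mathcomp Require Import complex.

Set Implicit Arguments.
Unset Strict Implicit.
Unset Printing Implicit Defensive.

Import Order.TTheory GRing.Theory Num.Theory.
Import numFieldNormedType.Exports.

Local Open Scope classical_set_scope.
Local Open Scope complex_scope.
Local Open Scope ring_scope.

(* The product R * R * R is used for the points of R^3 because the library has
   its Borel sets and its Lebesgue measure; its library norm is the sup norm,
   so Euclidean lengths are computed in coordinates. The notation mpt is the
   same type (up to conversion) with the measurable structure on which
   lebesgue_measure is defined. Functions on Omega or Gamma are total functions
   of which only the restriction to Omega, or to Gamma, matters. *)
Notation pt R := (R * R * R)%type.
Notation mpt R := (measurableTypeR R * measurableTypeR R * measurableTypeR R)%type.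
Notation vfield R := (pt R -> 'rV[R[i]]_3).

Section Coordinates.
Variable R : realType.

Definition coords (x : pt R) : 'rV[R]_3 := \row_i [:: x.1.1; x.1.2; x.2]`_i.

Definition of_coords (y : 'rV[R]_3) : pt R := (y 0 0, y 0 1, y 0 2).

Definition leb2 :
    {measure set (measurableTypeR R * measurableTypeR R) -> \bar R} :=
  (@lebesgue_measure R \x @lebesgue_measure R)%E.
Definition leb3 : {measure set (mpt R) -> \bar R} :=
  ((@lebesgue_measure R \x @lebesgue_measure R) \x @lebesgue_measure R)%E.

Definition eball (x0 : pt R) (r : R) : set (pt R) :=
  [set x | \sum_i coords (x - x0) 0 i ^+ 2 < r ^+ 2].

End Coordinates.

Section Vectors.
Variable K : comPzRingType.

Definition dotv (a b : 'rV[K]_3) : K := \sum_i a 0 i * b 0 i.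

(* Indices are taken modulo 3. *)
Definition crossv (a b : 'rV[K]_3) : 'rV[K]_3 :=
  \row_i (a 0 (i + 1) * b 0 (i + 2) - a 0 (i + 2) * b 0 (i + 1)).

End Vectors.

Section ComplexFunctions.
Variable R : realType.
Local Notation C := R[i].

Definition conjv (a : 'rV[C]_3) : 'rV[C]_3 := map_mx (@conjc R) a.

Definition sqmod (z : C) : R := complex.Re z ^+ 2 + complex.Im z ^+ 2.
Definition sqmodv (a : 'rV[C]_3) : R := \sum_i sqmod (a 0 i).

Section Integral.
Context d (T : measurableType d).
Variables (mu : {measure set T -> \bar R}) (D : set T).

Definition Cint (f : T -> C) : C :=
  (\int[mu]_(x in D) complex.Re (f x)) +i* (\int[mu]_(x in D) complex.Im (f x)).

Definition L2 (f : T -> C) : Prop :=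
  [/\ measurable_fun D (fun x => complex.Re (f x)),
      measurable_fun D (fun x => complex.Im (f x))
    & (\int[mu]_(x in D) (sqmod (f x))%:E < +oo)%E].

Definition L2v (u : T -> 'rV[C]_3) : Prop :=
  forall i, L2 (fun x => u x 0 i).

Definition sqL2 (f : T -> C) : R := \int[mu]_(x in D) sqmod (f x).
Definition sqL2v (u : T -> 'rV[C]_3) : R := \int[mu]_(x in D) sqmodv (u x).

End Integral.

Definition dpartial (i : 'I_3) (f : pt R -> C) (x : pt R) : C :=
  ('D_(of_coords (delta_mx 0 i)) (fun y => complex.Re (f y)) x) +i*
  ('D_(of_coords (delta_mx 0 i)) (fun y => complex.Im (f y)) x).

Definition smooth (f : pt R -> C) : Prop :=
  forall (l : seq 'I_3) (x : pt R),
    differentiable (fun y => complex.Re (foldr dpartial f l y)) x /\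
    differentiable (fun y => complex.Im (foldr dpartial f l y)) x.

Definition test_function (Omega : set (pt R)) (f : pt R -> C) : Prop :=
  smooth f /\ exists K : set (pt R),
    [/\ compact K, K `<=` Omega & forall x, ~ K x -> f x = 0].

Definition grad (f : pt R -> C) : vfield R :=
  fun x => \row_i dpartial i f x.

Definition curl (u : vfield R) : vfield R :=
  fun x => \row_i (dpartial (i + 1) (fun y => u y 0 (i + 2)) x
                 - dpartial (i + 2) (fun y => u y 0 (i + 1)) x).

End ComplexFunctions.

Section WeakDerivatives.
Variables (R : realType) (Omega : set (pt R)).
Local Notation C := R[i].
Local Notation mu := (leb3 R).

Definition is_wgrad (f : pt R -> C) (G : vfield R) : Prop :=
  L2v mu Omega G /\ forall phi, test_function Omega phi -> forall i,
    Cint mu Omega (fun x => f x * dpartial i phi x)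
    = - Cint mu Omega (fun x => G x 0 i * phi x).

Definition is_wcurl (u : vfield R) (w : vfield R) : Prop :=
  L2v mu Omega w /\
  forall phi : vfield R, (forall i, test_function Omega (fun x => phi x 0 i)) ->
    Cint mu Omega (fun x => dotv (u x) (curl phi x))
    = Cint mu Omega (fun x => dotv (w x) (phi x)).

Definition is_wdiv (u : vfield R) (h : pt R -> C) : Prop :=
  L2 mu Omega h /\ forall phi, test_function Omega phi ->
    Cint mu Omega (fun x => dotv (u x) (grad phi x))
    = - Cint mu Omega (fun x => h x * phi x).

(* The weak derivatives in L^2 are unique up to null sets; one representative
   is chosen. The value is meaningless if the derivative is not in L^2. *)
Definition wgrad (f : pt R -> C) : vfield R := xget 0 [set G | is_wgrad f G].
Definition wcurl (u : vfield R) : vfield R := xget 0 [set w | is_wcurl u w].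
Definition wdiv (u : vfield R) : pt R -> C := xget 0 [set h | is_wdiv u h].

Definition H1 (f : pt R -> C) : Prop :=
  L2 mu Omega f /\ exists G, is_wgrad f G.

Definition sqH1 (f : pt R -> C) : R :=
  sqL2 mu Omega f + sqL2v mu Omega (wgrad f).

Definition H10 (f : pt R -> C) : Prop :=
  H1 f /\ exists w : nat -> pt R -> C,
    (forall n, test_function Omega (w n)) /\
    (fun n => sqH1 (w n - f)) @ \oo --> (0 : R).

Definition A1 (theta : R) : \bar R :=
  ereal_inf [set q | exists u : vfield R,
    [/\ forall i, H10 (fun x => u x 0 i), sqL2v mu Omega u != 0
      & q = ((sqL2v mu Omega (wcurl u) + theta * sqL2 mu Omega (wdiv u))
             / sqL2v mu Omega u)%:E]].

(* nu . u = 0 on Gamma, as an element of H^(-1/2)(Gamma): the normal trace of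
   a field with divergence in L^2 is the functional
   phi |-> \int_Omega (u . grad phi + (div u) phi) on the traces of H^1. *)
Definition normal_trace0 (u : vfield R) : Prop :=
  forall phi, H1 phi ->
    Cint mu Omega (fun x => dotv (u x) (wgrad phi x) + wdiv u x * phi x) = 0.

Definition XT (u : vfield R) : Prop :=
  [/\ L2v mu Omega u, exists w, is_wcurl u w, exists h, is_wdiv u h
    & normal_trace0 u].

Definition sqXT (u : vfield R) : R :=
  sqL2v mu Omega u + sqL2v mu Omega (wcurl u) + sqL2 mu Omega (wdiv u).

End WeakDerivatives.

Section Boundary.
Variables (R : realType) (Omega : set (pt R)).
Local Notation C := R[i].

Definition boundary : set (pt R) := closure Omega `\` interior Omega.

(* A C^{1,1} function on a disc agrees on a smaller disc with one whose gradient
   is globally Lipschitz. *)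
Definition C11 (g : R * R -> R) : Prop :=
  [/\ forall y, differentiable g y,
      lipschitz ('D_(1 : R, 0 : R) g) & lipschitz ('D_(0 : R, 1 : R) g)].

(* The rows of e are an orthonormal frame; in the Euclidean ball of radius r
   around x0, Omega is the set below the graph of g in the coordinates
   y_i = (x - x0) . e_i. *)
Definition chart (x0 : pt R) (e : 'M[R]_3) (g : R * R -> R) (r : R) : Prop :=
  [/\ 0 < r, e *m e^T = 1%:M, C11 g
    & forall x, eball x0 r x ->
        let y := coords (x - x0) *m e^T in
        Omega x <-> y 0 2 < g (y 0 0, y 0 1)].

Definition C11_boundary : Prop :=
  forall x0, boundary x0 -> exists e g r, chart x0 e g r.

(* Omega lies below the graph, so the outer normal points upwards. As x0 is in
   Gamma, it is the point of the graph above y = (0, 0). *)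
Definition chart_normal (e : 'M[R]_3) (g : R * R -> R) : 'rV[R]_3 :=
  let g1 := 'D_(1 : R, 0 : R) g (0, 0) in
  let g2 := 'D_(0 : R, 1 : R) g (0, 0) in
  (Num.sqrt (1 + g1 ^+ 2 + g2 ^+ 2))^-1 *: (coords (- g1, - g2, 1) *m e).

(* The outer normal does not depend on the chart. *)
Definition outer_normal (x : pt R) : 'rV[R]_3 :=
  xget 0 [set n | exists e g r, chart x e g r /\ n = chart_normal e g].

Definition nu (x : pt R) : 'rV[C]_3 := map_mx (real_complex R) (outer_normal x).

Definition graph_point (x0 : pt R) (e : 'M[R]_3) (g : R * R -> R) (y : R * R) :
  pt R := x0 + of_coords (coords (y.1, y.2, g y) *m e).

(* The two conditions determine the measure, since Gamma is covered by
   countably many charts. *)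
Definition is_surface_measure (sigma : {measure set (mpt R) -> \bar R}) : Prop :=
  sigma (~` boundary) = 0%E /\
  forall x0 e g r, boundary x0 -> chart x0 e g r ->
  forall A : set (mpt R), measurable A -> A `<=` eball x0 r ->
    sigma A = (\int[leb2 R]_(y in graph_point x0 e g @^-1` A)
      (Num.sqrt (1 + ('D_(1 : R, 0 : R) g y) ^+ 2
                   + ('D_(0 : R, 1 : R) g y) ^+ 2))%:E)%E.

Variable sigma : {measure set (mpt R) -> \bar R}.

(* Trace of an H^1 function: extension by continuity of the restriction to
   Gamma of smooth functions, for bounded Omega. *)
Definition is_trace (f g : pt R -> C) : Prop :=
  [/\ H1 Omega f, L2 sigma boundary g & exists w : nat -> pt R -> C,
    [/\ forall n, smooth (w n),
        (fun n => sqH1 Omega (w n - f)) @ \oo --> (0 : R)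
      & (fun n => sqL2 sigma boundary (w n - g)) @ \oo --> (0 : R)]].

Definition trace (u : vfield R) : vfield R :=
  xget 0 [set g : vfield R | forall i, is_trace (fun x => u x 0 i) (fun x => g x 0 i)].

Definition piT (u : vfield R) : vfield R :=
  fun x => crossv (nu x) (crossv (trace u x) (nu x)).

Definition TL2 (f : vfield R) : Prop :=
  L2v sigma boundary f /\
  \forall x \ae sigma, boundary x -> dotv (nu x) (f x) = 0.

Definition TL2dot (f g : vfield R) : C :=
  Cint sigma boundary (fun x => dotv (f x) (conjv (g x))).

Definition TL2eq (f g : vfield R) : Prop :=
  f = g %[ae sigma in boundary].

(* Operators on TL^2(Gamma) act on representatives, so a linear operator is a
   map compatible with equality almost everywhere and linear modulo it. *)
Definition TL2_operator (A : vfield R -> vfield R) : Prop :=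
  [/\ forall f, TL2 f -> TL2 (A f),
      forall f g, TL2 f -> TL2 g -> TL2eq f g -> TL2eq (A f) (A g)
    & forall (a : C) f g, TL2 f -> TL2 g ->
        TL2eq (A (fun x => a *: f x + g x)) (fun x => a *: A f x + A g x)].

(* Images of bounded sequences have convergent subsequences. *)
Definition TL2_compact (A : vfield R -> vfield R) : Prop :=
  forall f : nat -> vfield R, (forall n, TL2 (f n)) ->
  (exists M, forall n, sqL2v sigma boundary (f n) <= M) ->
  exists (k : nat -> nat) (g : vfield R),
    [/\ {homo k : m n / (m < n)%N}, TL2 g
      & (fun n => sqL2v sigma boundary (A (f (k n)) - g)) @ \oo --> (0 : R)].

Definition TL2_selfadjoint (A : vfield R -> vfield R) : Prop :=
  forall f g, TL2 f -> TL2 g -> TL2dot (A f) g = TL2dot f (A g).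

Definition coercive_XT (alpha theta eta : R) : Prop :=
  exists2 k : R, 0 < k & forall u, XT Omega u ->
    k * sqXT Omega u <=
      sqL2v (leb3 R) Omega (wcurl Omega u) - alpha * sqL2v (leb3 R) Omega u
      + theta * sqL2 (leb3 R) Omega (wdiv Omega u)
      + eta * sqL2v sigma boundary (trace u).

Definition calL (alpha theta eta : R) (u phi : vfield R) : C :=
  Cint (leb3 R) Omega (fun x => dotv (wcurl Omega u x) (wcurl Omega phi x))
  - alpha%:C * Cint (leb3 R) Omega (fun x => dotv (u x) (phi x))
  + theta%:C * Cint (leb3 R) Omega (fun x => wdiv Omega u x * wdiv Omega phi x)
  + eta%:C * Cint sigma boundary (fun x => dotv (trace u x) (trace phi x)).

Definition calJ (f phi : vfield R) : C :=
  Cint sigma boundary (fun x => dotv (f x) (trace phi x)).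

(* Elements of the dual of X_T are functionals compared on X_T only. When calL
   is invertible the solution u is unique up to a null set, and one
   representative is chosen. *)
Definition calLinv (alpha theta eta : R) (l : vfield R -> C) : vfield R :=
  xget 0 [set u : vfield R | XT Omega u /\
    forall phi, XT Omega phi -> calL alpha theta eta u phi = l phi].

Definition calA (alpha theta eta : R) (f : vfield R) : vfield R :=
  - piT (calLinv alpha theta eta (calJ f)).

End Boundary.

(* Main.v *)
(* For f in TL^2(Gamma) the solution u of the variational problem satisfies
   E(u, v) = Re \int_Gamma f . conj v, where E(u, v) is the real part of the
   form of L^eta at u and conj v: a symmetric form, coercive on X_T by
   hypothesis. As soon as traces are bounded on X_T, Riesz' theorem yields u;
   A f is minus the tangential part of its trace, and the symmetry of E makes A
   self-adjoint.

   Neither Gaffney's inequality nor Rellich's theorem is needed. If every field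
   of X_T has a trace, it has a weak gradient, and the gradient is bounded on
   X_T by the uniform boundedness principle. For every eps there are finitely
   many psi_k in L^2(Omega) with
     \int_Gamma w^2 <= \sum_k <w, psi_k>^2 + eps \int_Omega |grad w|^2
   for all smooth w: a value of w on a small cell of Gamma is compared with the
   average of w over a box below the cell. This bounds the traces; and along an
   ultrafilter all the numbers <u_n, psi_k> of a bounded sequence of X_T
   converge, which gives a subsequence whose traces converge.

   If some field of X_T has no trace, its trace is 0 by the junk value of the
   choice operator. Coercivity at the fields without trace, which are dense in
   X_T, then shows that the form without its boundary term is coercive, and a
   solution, which annihilates the fields without trace, vanishes: A = 0. *)
Require Import Defs.
From HB Require Import structures.
From mathcomp Require Import all_boot all_order all_algebra.
From mathcomp Require Import all_classical all_reals all_analysis.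
From mathcomp Require Import complex measurable_realfun.
From mathcomp Require Import ring lra.
Set Implicit Arguments.
Unset Strict Implicit.
Unset Printing Implicit Defensive.
Import Order.TTheory GRing.Theory Num.Theory.
Import numFieldNormedType.Exports.
Local Open Scope classical_set_scope.
Local Open Scope ring_scope.

(** * Pre-Hilbert spaces *)

(** Functions are total and nothing is quotiented, so [wcurl], [wdiv], [wgrad] and [trace] are
    choices that are linear only up to null functions. The proof therefore uses semidefinite real
    forms on subsets of function spaces; a null vector is orthogonal to everything ([ph_null]), and
    this replaces equality almost everywhere. Complex fields form a real space whose product is the
    real part of the integral of f . conj g. The complex bilinear form of L^eta is recovered by
    testing at conj v and at i conj v, so X_T and traces must be stable under conjugation; complex
    self-adjointness comes back from real symmetry and complex linearity. X_T is complete because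
    the weak curl and the divergence with zero normal trace are closed relations. The trace
    inequality is proved for smooth functions only; [is_trace] contains an approximation by smooth
    functions in H^1, which carries it over to traces. The boxes lie below the graph at a depth
    comparable to their side d, so every gradient term gets a factor d; refining the grid makes eps
    arbitrary, at the price of more psi_k. *)

Definition cauchy_wrt (R : realType) (q : nat -> nat -> R) :=
  forall e : R, 0 < e -> exists N, forall n m, (N <= n)%N -> (N <= m)%N -> q n m < e.

Definition tends0 (R : realType) (q : nat -> R) :=
  forall e : R, 0 < e -> exists N, forall n, (N <= n)%N -> q n < e.

Lemma tends0P (R : realType) (q : nat -> R) : (forall n, 0 <= q n) ->
  (q @ \oo --> (0 : R)) <-> tends0 q.
Proof.
move=> q0; split=> [/cvgrPdist_lt h e e0|h].
  have [N _ hN] := h e e0; exists N => n Nn.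
  by have := hN n Nn; rewrite sub0r normrN ger0_norm.
apply/cvgrPdist_lt => e e0; have [N hN] := h e e0; exists N => // n Nn.
by rewrite sub0r normrN ger0_norm //; apply: hN.
Qed.

Lemma tends0_le (R : realType) (p q : nat -> R) (C : R) : 0 <= C ->
  (forall n, p n <= C * q n) -> tends0 q -> tends0 p.
Proof.
move=> C0 pq hq e e0.
(* The division is by C + 1, so that C = 0 is not a special case. *)
have C1 : 0 < C + 1 by rewrite ltr_wpDl.
have [N hN] := hq (e / (C + 1)) (divr_gt0 e0 C1); exists N => n Nn.
have := hN n Nn; rewrite ltr_pdivlMr // => h.
apply: le_lt_trans (pq n) _.
have [qn|qn] := leP 0 (q n).
  by apply: le_lt_trans h; rewrite mulrC ler_wpM2l // lerDl.
by apply: le_lt_trans e0; rewrite mulr_ge0_le0 // ltW.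
Qed.

Lemma tends0D (R : realType) (p q : nat -> R) :
  tends0 p -> tends0 q -> tends0 (fun n => p n + q n).
Proof.
move=> hp hq e e0; have e2 : 0 < e / 2 by rewrite divr_gt0.
have [N hN] := hp _ e2; have [M hM] := hq _ e2; exists (maxn N M) => n.
by rewrite geq_max => /andP[/hN ? /hM ?]; rewrite [e]splitr ltrD.
Qed.

Lemma tends0_invn (R : realType) : tends0 (fun n => n.+1%:R^-1 : R).
Proof.
by apply/tends0P; [move=> n; rewrite invr_ge0|exact: cvg_harmonic].
Qed.

Lemma tends0_le0 (R : realType) (x : R) (q : nat -> R) :
  (forall n, x <= q n) -> tends0 q -> x <= 0.
Proof.
move=> xq hq; rewrite leNgt; apply/negP => /hq[N /(_ N (leqnn N))].
by rewrite ltNge xq.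
Qed.

(** At t = 1/(n+1) and t = -1/(n+1) the hypothesis gives |b| <= |a|/(n+1), and n is arbitrary. *)
Lemma quad_ge0_linear0 (R : realType) (a b : R) :
  (forall t : R, 0 <= t ^+ 2 * a + t * b) -> b = 0.
Proof.
move=> h; have h' : tends0 (fun n => n.+1%:R^-1 * `|a| : R).
  apply: (@tends0_le _ _ (fun n => n.+1%:R^-1) `|a|) => //; last exact: tends0_invn.
  by move=> n; rewrite mulrC.
suff : `|b| <= 0 by rewrite normr_le0 => /eqP.
apply: tends0_le0 h' => n.
set t : R := n.+1%:R^-1; have t0 : 0 < t by rewrite invr_gt0.
rewrite -(ler_pM2l t0) -[X in X * _](gtr0_norm t0) -normrM ler_norml.
have ta := ler_norm a.
have t2 : t ^+ 2 * a <= t ^+ 2 * `|a| by rewrite ler_wpM2l // sqr_ge0.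
have t2E : t * (t * `|a|) = t ^+ 2 * `|a| by rewrite mulrA expr2.
have := h t; have := h (- t); rewrite sqrrN !mulNr t2E => h1 h2.
by lra.
Qed.

Section Prehilbert.
Variables (R : realType) (V : zmodType) (sc : R -> V -> V).

(** The laws are asked on [S] only and the form is merely semidefinite, because functions that
    vanish almost everywhere are not identified with 0. The scalar action [sc] is a parameter:
    complex-valued functions are used as a real space. *)
Record prehilbert (S : V -> Prop) (B : V -> V -> R) : Prop := Prehilbert {
  ph_0 : S 0;
  ph_D : forall u v, S u -> S v -> S (u + v);
  ph_N : forall u, S u -> S (- u);
  ph_Z : forall t u, S u -> S (sc t u);
  ph_C : forall u v, S u -> S v -> B u v = B v u;
  ph_BD : forall u v w, S u -> S v -> S w -> B (u + v) w = B u w + B v w;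
  ph_BZ : forall t u w, S u -> S w -> B (sc t u) w = t * B u w;
  ph_ge0 : forall u, S u -> 0 <= B u u }.

Definition ph_complete (S : V -> Prop) (B : V -> V -> R) :=
  forall u : nat -> V, (forall n, S (u n)) ->
  cauchy_wrt (fun n m => B (u n - u m) (u n - u m)) ->
  exists2 v, S v & tends0 (fun n => B (u n - v) (u n - v)).

Section Theory.
Variables (S : V -> Prop) (B : V -> V -> R).
Hypothesis H : prehilbert S B.

Lemma ph_B u v : S u -> S v -> S (u - v).
Proof. by move=> Su Sv; apply: (ph_D H) => //; apply: (ph_N H). Qed.

Lemma ph_DB u v w : S u -> S v -> S w -> B w (u + v) = B w u + B w v.
Proof.
by move=> Su Sv Sw; rewrite !(ph_C H Sw) ?(ph_BD H) //; apply: (ph_D H).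
Qed.

Lemma ph_ZB t u w : S u -> S w -> B w (sc t u) = t * B w u.
Proof. by move=> Su Sw; rewrite !(ph_C H Sw) ?(ph_BZ H) //; apply: (ph_Z H). Qed.

Lemma ph_B0 w : S w -> B 0 w = 0.
Proof.
move=> Sw; have := ph_BD H (ph_0 H) (ph_0 H) Sw; rewrite addr0 => h.
by apply: (@addrI _ (B 0 w)); rewrite addr0 -h.
Qed.

Lemma ph_BN u w : S u -> S w -> B (- u) w = - B u w.
Proof.
move=> Su Sw; apply/eqP; rewrite -addr_eq0 -(ph_BD H) ?addNr ?ph_B0 //.
exact: (ph_N H).
Qed.

Lemma ph_NB u w : S u -> S w -> B w (- u) = - B w u.
Proof. by move=> Su Sw; rewrite !(ph_C H Sw) ?ph_BN //; apply: (ph_N H). Qed.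

Lemma ph_sqD u v : S u -> S v -> B (u + v) (u + v) = B u u + 2 * B u v + B v v.
Proof.
move=> Su Sv; have Suv := ph_D H Su Sv.
by rewrite (ph_BD H) // !ph_DB // (ph_C H Sv Su); ring.
Qed.

Lemma ph_sqB u v : S u -> S v -> B (u - v) (u - v) = B u u - 2 * B u v + B v v.
Proof.
move=> Su Sv; have Nv := ph_N H Sv; rewrite ph_sqD // ph_NB // ph_BN //.
by rewrite ph_NB // ; ring.
Qed.

Lemma ph_sqZ t u : S u -> B (sc t u) (sc t u) = t ^+ 2 * B u u.
Proof. by move=> Su; rewrite (ph_BZ H) ?ph_ZB //; [ring|apply: (ph_Z H)]. Qed.

Lemma ph_sqBC u v : S u -> S v -> B (u - v) (u - v) = B (v - u) (v - u).
Proof. by move=> Su Sv; rewrite !ph_sqB // (ph_C H Su Sv); ring. Qed.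

Lemma ph_sqD_le u v : S u -> S v -> B (u + v) (u + v) <= 2 * B u u + 2 * B v v.
Proof.
move=> Su Sv; have := ph_ge0 H (ph_B Su Sv).
by rewrite ph_sqB // ph_sqD //; lra.
Qed.

Lemma ph_sqB_le u v : S u -> S v -> B (u - v) (u - v) <= 2 * B u u + 2 * B v v.
Proof.
move=> Su Sv; have := ph_ge0 H (ph_D H Su Sv).
by rewrite ph_sqB // ph_sqD //; lra.
Qed.

Lemma ph_CS u v : S u -> S v -> B u v ^+ 2 <= B u u * B v v.
Proof.
move=> Su Sv; have h s t : 0 <= s ^+ 2 * B u u + 2 * s * t * B u v + t ^+ 2 * B v v.
  have := ph_ge0 H (ph_D H (ph_Z H s Su) (ph_Z H t Sv)).
  rewrite ph_sqD ?ph_sqZ ?(ph_BZ H) ?ph_ZB //; do ?exact: (ph_Z H).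
  by move=> h; apply: le_trans h _; rewrite le_eqVlt; apply/orP; left; apply/eqP; ring.
have [v0|v0] := eqVneq (B v v) 0.
  suff -> : B u v = 0 by rewrite expr0n mulr_ge0 //; apply: (ph_ge0 H).
  have : 2 * B u v = 0.
    apply: (@quad_ge0_linear0 _ 0) => t.
    move: (h t (-1)) (h t 1) => _ _.
    have h2 r : 0 <= B u u + r * (2 * B u v).
      by have := h 1 r; rewrite v0 expr1n; lra.
    have [b0|b0] := eqVneq (B u v) 0; first by rewrite b0; lra.
    exfalso; have := h2 (- (B u u + 1) / (2 * B u v)).
    rewrite divfK ?mulf_neq0 //; lra.
  by move/eqP; rewrite mulf_eq0 pnatr_eq0 /= => /eqP.
have v0' : 0 < B v v by rewrite lt_def v0 (ph_ge0 H).
(* These coefficients are those of the projection of u along v, multiplied by B v v to avoid a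
   division. *)
have := h (B v v) (- B u v).
rewrite [X in 0 <= X](_ : _ = B v v * (B u u * B v v - B u v ^+ 2)); last by ring.
by rewrite pmulr_rge0 // subr_ge0.
Qed.

(** Cauchy-Schwarz. This takes the place of the quotient by null vectors: changing a representative
    does not change any product. *)
Lemma ph_null u v : S u -> S v -> B u u = 0 -> B u v = 0.
Proof.
move=> Su Sv u0; apply/eqP; rewrite -sqrf_eq0 eq_le sqr_ge0 andbT.
by apply: le_trans (ph_CS Su Sv) _; rewrite u0 mul0r.
Qed.

Definition phn u := Num.sqrt (B u u).

Lemma phn_ge0 u : 0 <= phn u. Proof. exact: sqrtr_ge0. Qed.

Lemma phn_sq u : S u -> phn u ^+ 2 = B u u.
Proof. by move=> Su; rewrite sqr_sqrtr // (ph_ge0 H). Qed.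

Lemma phn_CS u v : S u -> S v -> `|B u v| <= phn u * phn v.
Proof.
move=> Su Sv; rewrite -(@ler_pXn2r _ 2) ?nnegrE ?mulr_ge0 ?phn_ge0 //.
by rewrite exprMn !phn_sq // real_normK ?num_real // ph_CS.
Qed.

Lemma phnD u v : S u -> S v -> phn (u + v) <= phn u + phn v.
Proof.
move=> Su Sv; rewrite -(@ler_pXn2r _ 2) ?nnegrE ?addr_ge0 ?phn_ge0 //.
rewrite phn_sq ?ph_sqD //; last exact: (ph_D H).
rewrite sqrrD !phn_sq // lerD2r lerD2l -(mulr_natl (phn u * _)) ler_pM2l //.
by apply: le_trans (ler_norm _) _; exact: phn_CS.
Qed.

Lemma phnBC u v : S u -> S v -> phn (u - v) = phn (v - u).
Proof. by move=> Su Sv; rewrite /phn ph_sqBC. Qed.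

Lemma phnZ t u : S u -> phn (sc t u) = `|t| * phn u.
Proof.
by move=> Su; rewrite /phn ph_sqZ // sqrtrM ?sqr_ge0 // sqrtr_sqr.
Qed.

Lemma phn_lt u e : S u -> 0 < e -> (phn u < e) = (B u u < e ^+ 2).
Proof.
move=> Su e0; rewrite -phn_sq // -(@ltr_pXn2r _ 2) ?nnegrE ?phn_ge0 //; exact: ltW.
Qed.

Lemma phn_le u e : S u -> 0 <= e -> (phn u <= e) = (B u u <= e ^+ 2).
Proof.
by move=> Su e0; rewrite -phn_sq // -(@ler_pXn2r _ 2) ?nnegrE ?phn_ge0.
Qed.

Lemma tends0_phn u : (forall n, S (u n)) -> tends0 (fun n => B (u n) (u n)) ->
  tends0 (fun n => phn (u n)).
Proof.
move=> Su h e e0; have [N hN] := h _ (exprn_gt0 2 e0); exists N => n Nn.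
by rewrite phn_lt // hN.
Qed.

(* The minimizing sequence of [B v v - 2 l v] is Cauchy by the parallelogram
   law. *)
Lemma riesz (l : V -> R) (K : R) : ph_complete S B ->
  (forall u v, S u -> S v -> l (u + v) = l u + l v) ->
  (forall t u, S u -> l (sc t u) = t * l u) ->
  (forall u, S u -> l u ^+ 2 <= K * B u u) ->
  exists2 u, S u & forall v, S v -> B u v = l v.
Proof.
move=> cpl lD lZ lK.
pose J v := B v v - 2 * l v.
have K0 u : S u -> 0 <= K * B u u by move=> Su; apply: le_trans (lK _ Su); rewrite sqr_ge0.
have l0 : l 0 = 0.
  have := lD _ _ (ph_0 H) (ph_0 H); rewrite addr0 => h.
  by apply: (@addrI _ (l 0)); rewrite addr0 -h.
have lN u : S u -> l (- u) = - l u.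
  by move=> Su; apply/eqP; rewrite -addr_eq0 -lD ?addNr ?l0 //; apply: (ph_N H).
(* The arithmetic-geometric inequality: |l v| <= sqrt(|K| B v v), so 2 |l v| <= |K| + B v v. *)
have Jlb v : S v -> - `|K| <= J v.
  move=> Sv; have b0 := ph_ge0 H Sv.
  have h : l v ^+ 2 <= `|K| * B v v.
    by apply: le_trans (lK _ Sv) _; rewrite ler_wpM2r // ler_norm.
  rewrite /J; have k0 := normr_ge0 K; rewrite leNgt; apply/negP => h2.
  have h3 : 0 <= (`|K| - B v v) ^+ 2 by rewrite sqr_ge0.
  have h4 : (`|K| + B v v) ^+ 2 < (2 * l v) ^+ 2.
    by rewrite ltr_pXn2r ?nnegrE //; lra.
  by lra.
pose E : set R := [set J v | v in S].
have hE : has_inf E.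
  split; first by exists (J 0), 0 => //; exact: (ph_0 H).
  by exists (- `|K|) => _ [v Sv <-]; exact: Jlb.
pose d := inf E.
have dJ v : S v -> d <= J v by move=> Sv; apply: (ge_inf hE.2); exists v.
have hu n : {u | S u /\ J u < d + n.+1%:R^-1}.
  apply/cid; have n0 : 0 < n.+1%:R^-1 :> R by rewrite invr_gt0.
  have [_ [u Su <-] Ju] := inf_adherent n0 hE.
  by exists u.
pose u n := projT1 (hu n).
have Su n : S (u n) by rewrite /u; case: (hu n) => ? [].
have Ju n : J (u n) < d + n.+1%:R^-1 by rewrite /u; case: (hu n) => ? [].
(* The linear terms cancel in the parallelogram identity. Since J is at least d at the midpoint,
   values J x and J y close to d force x close to y. *)
have par x y : S x -> S y -> B (x - y) (x - y) = 2 * J x + 2 * J y - 4 * J (sc (1/2) (x + y)).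
  move=> Sx Sy; have Sxy := ph_D H Sx Sy.
  by rewrite ph_sqB // /J lZ // lD // ph_sqZ // ph_sqD //; field.
have [|v Sv uv] := cpl u Su.
  move=> e e0; have e4 : 0 < e / 4 by rewrite divr_gt0.
  have [N hN] := tends0_invn e4; exists N => n m /hN Nn /hN Nm.
  rewrite par //.
  have := dJ _ (ph_Z H (1/2) (ph_D H (Su n) (Su m))); move: (Ju n) (Ju m) Nn Nm.
  move: (J (u n)) (J (u m)) (J _) (d) (n.+1%:R^-1) (m.+1%:R^-1) => j1 j2 j3 d' x y.
  by lra.
have Sun n : S (u n - v) by exact: ph_B.
(* Expanding J at v around u n leaves errors bounded by a multiple of phn (u n - v), so J v <= d in
   the limit. *)
have Jv : J v <= d.
  rewrite -subr_le0.
  have t1 := tends0_phn Sun uv.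
  have h : tends0 (fun n => n.+1%:R^-1 + (2 * (phn v + `|K| + 1)) * phn (u n - v)).
    apply: tends0D; first exact: tends0_invn.
    apply: (@tends0_le _ _ (fun n => phn (u n - v)) (2 * (phn v + `|K| + 1))) => //.
    by rewrite mulr_ge0 // addr_ge0 // addr_ge0 ?phn_ge0.
  apply: tends0_le0 h => n.
  have Juv : J v = J (u n) - B (u n - v) (u n - v) - 2 * B v (u n - v) + 2 * l (u n - v).
    have Nv := ph_N H Sv.
    by rewrite /J ph_sqB // lD // lN // ph_DB // ph_NB // (ph_C H Sv (Su n)); ring.
  have b1 := phn_CS Sv (Sun n); have b2 := ph_ge0 H (Sun n).
  have b3 : l (u n - v) <= (`|K| + 1) * phn (u n - v).
    apply: le_trans (ler_norm _) _.
    rewrite -(@ler_pXn2r _ 2) ?nnegrE ?mulr_ge0 ?phn_ge0 // ?addr_ge0 //.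
    rewrite exprMn phn_sq // real_normK ?num_real //.
    apply: le_trans (lK _ (Sun n)) _; rewrite ler_wpM2r //.
    by have := ler_norm K; have := normr_ge0 K; nra.
  have b4 : - B v (u n - v) <= phn v * phn (u n - v).
    by apply: le_trans b1; rewrite -normrN ler_norm.
  have := Ju n; rewrite Juv; move: (n.+1%:R^-1) => x; lra.
exists v => // w Sw.
(* As v minimizes J, the polynomial J (v + t w) - J v is nonnegative in t, hence its linear
   coefficient is 0. *)
suff : 2 * (B v w - l w) = 0 by move=> h; lra.
apply: (@quad_ge0_linear0 _ (B w w)) => t.
have := dJ _ (ph_D H Sv (ph_Z H t Sw)).
rewrite /J ph_sqD ?lD ?lZ ?ph_sqZ ?ph_ZB //; do ?exact: (ph_Z H).
move: Jv; rewrite /J; lra.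
Qed.

(* Nested balls: on the n-th one, some functional is at least n. *)
Lemma uniform_boundedness (I : Type) (l : I -> V -> R) (K : I -> R) :
  ph_complete S B ->
  (forall i u v, S u -> S v -> l i (u + v) = l i u + l i v) ->
  (forall i t u, S u -> l i (sc t u) = t * l i u) ->
  (forall i u, S u -> l i u ^+ 2 <= K i * B u u) ->
  (forall u, S u -> exists M, forall i, `|l i u| <= M) ->
  exists2 C, 0 <= C & forall i u, S u -> l i u ^+ 2 <= C * B u u.
Proof.
move=> cpl lD lZ lK lM.
have lN i u : S u -> l i (- u) = - l i u.
  move=> Su; apply/eqP; rewrite -addr_eq0 -lD ?addNr //; last exact: (ph_N H).
  have := lD i _ _ (ph_0 H) (ph_0 H); rewrite addr0 => h.
  by apply/eqP; apply: (@addrI _ (l i 0)); rewrite addr0 -h.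
apply: contrapT => nC.
have nC' C : 0 <= C -> exists i u, S u /\ C * B u u < l i u ^+ 2.
  move=> C0; apply: contrapT => h; apply: nC; exists C => // i u Su.
  by rewrite leNgt; apply/negP => h'; apply: h; exists i, u.
have lK' i u : S u -> `|l i u| <= (`|K i| + 1) * phn u.
  move=> Su; rewrite -(@ler_pXn2r _ 2) ?nnegrE ?mulr_ge0 ?phn_ge0 // ?addr_ge0 //.
  rewrite exprMn phn_sq // real_normK ?num_real //.
  apply: le_trans (lK _ _ Su) _; rewrite ler_wpM2r ?(ph_ge0 H) //.
  by have := ler_norm (K i); have := normr_ge0 (K i); nra.
(* Centre, radius and rank of a ball. [step] asks for a ball inside the previous one on which some
   functional is at least the old rank. *)
pose T := {p : V * R * nat | S p.1.1 /\ 0 < p.1.2}.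
pose step (p q : T) := let x := (projT1 p).1.1 in let y := (projT1 q).1.1 in
  let r := (projT1 p).1.2 in let s := (projT1 q).1.2 in
  [/\ (projT1 q).2 = (projT1 p).2.+1, s <= r / 2, phn (y - x) <= r / 2 &
   exists i, forall z, S z -> phn (z - y) <= s -> (projT1 p).2%:R <= `|l i z|].
have next p : {q | step p q}.
  apply/cid; case: p => [[[x r] n] /= [Sx r0]].
  (* With this C the multiple z of w of norm r / 2 satisfies |l i z| >= n + 2; 1 is given up below,
     on the ball of radius s where l i varies by at most 1. *)
  pose C : R := ((n.+1%:R + 1) / (r / 2)) ^+ 2.
  have [i [w [Sw wC]]] := nC' C (sqr_ge0 _).
  have nw0 : 0 < phn w.
    rewrite lt_def phn_ge0 andbT; apply/negP => /eqP w0.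
    have := lK' i w Sw; rewrite w0 mulr0 normr_le0 => /eqP lw.
    by move: wC; rewrite lw -phn_sq // w0 !expr0n mulr0 ltxx.
  pose z := sc (r / 2 / phn w) w.
  have Sz : S z by exact: (ph_Z H).
  have r2 : 0 < r / 2 by rewrite divr_gt0.
  have nz : phn z = r / 2.
    by rewrite phnZ // gtr0_norm ?divr_gt0 // divfK // gt_eqF.
  have lz : n.+1%:R + 1 <= `|l i z|.
    rewrite lZ // normrM gtr0_norm ?divr_gt0 //.
    have : (n.+1%:R + 1) / (r / 2) * phn w < `|l i w|.
      rewrite -(@ltr_pXn2r _ 2) ?nnegrE ?mulr_ge0 ?phn_ge0 ?divr_ge0 ?invr_ge0 ?(ltW r2) ?(ltW r0) //.
      by rewrite exprMn phn_sq // real_normK ?num_real.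
    move=> /ltW h; rewrite mulrAC ler_pdivlMr // -ler_pdivrMl //.
    by apply: le_trans h; rewrite mulrA [X in X * _]mulrC.
  (* l i (x + z) and l i (x - z) differ by 2 l i z, so one of them is at least as large as l i z in
     absolute value. *)
  have [y [Sy xy ly]] : exists y, [/\ S y, phn (y - x) <= r / 2 & n.+1%:R + 1 <= `|l i y|].
    have [h|h] := leP (n.+1%:R + 1 : R) `|l i (x + z)|.
      by exists (x + z); split => //; [exact: (ph_D H)|rewrite addrC addKr nz].
    exists (x - z); split; first exact: ph_B.
      by rewrite phnBC //; [rewrite opprB addrC subrK nz|exact: ph_B].
    move: h lz; rewrite !lD ?lN //; last exact: (ph_N H).
    move=> h1 h2; have := ler_normB (l i x + l i z) (l i x - l i z).
    rewrite (_ : _ + _ - _ = 2 * l i z); last by ring.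
    by rewrite normrM gtr0_norm //; lra.
  have K1 : 0 < `|K i| + 1 by rewrite ltr_wpDl.
  pose s := Num.min (r / 2) (`|K i| + 1)^-1.
  have s0 : 0 < s by rewrite lt_min r2 invr_gt0.
  exists (exist _ (y, s, n.+1) (conj Sy s0)); split => //=.
    by rewrite ge_min lexx.
  exists i => t St ts; have Sty := ph_B St Sy.
  have : `|l i (t - y)| <= 1.
    apply: le_trans (lK' _ _ Sty) _; rewrite mulrC -ler_pdivlMr // mul1r.
    by apply: le_trans ts _; rewrite ge_min lexx orbT.
  rewrite lD ?lN //; last exact: (ph_N H).
  move=> h1; have := ler_normB (l i t) (l i t - l i y).
  by rewrite opprB addrCA subrr addr0; move: ly; rewrite -natr1; lra.
have [f [f0 fS]] := dependent_choice next (exist _ (0, 1, 0%N) (conj (ph_0 H) ltr01)).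
pose x n := (projT1 (f n)).1.1; pose r n := (projT1 (f n)).1.2.
have Sx n : S (x n) := (projT2 (f n)).1.
have r_gt0 n : 0 < r n := (projT2 (f n)).2.
have idx n : (projT1 (f n)).2 = n.
  by elim: n => [|n IH]; [rewrite f0|have [-> _ _ _] := fS n; rewrite IH].
have rS n : r n.+1 <= r n / 2 by have [] := fS n.
have xS n : phn (x n.+1 - x n) <= r n / 2 by have [] := fS n.
have rn n : r n <= n.+1%:R^-1.
  elim: n => [|n IH]; first by rewrite /r f0 invr1.
  apply: le_trans (rS n) _; rewrite ler_pdivrMr //.
  apply: le_trans IH _; rewrite -ler_pdivrMr // -invfM lef_pV2 ?posrE //.
  by rewrite -natrM ler_nat muln2 -addnn -(addn1 n.+1) leq_add2l.
(* A step moves the centre by at most r / 2 and at least halves the radius, so displacement plus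
   radius does not grow. *)
have nested k j : phn (x (k + j)%N - x k) + r (k + j)%N <= r k.
  elim: j => [|j IH]; first by rewrite addn0 subrr /phn ph_B0 ?sqrtr0 ?add0r //; apply: (ph_0 H).
  rewrite addnS; apply: le_trans IH.
  have := phnD (ph_B (Sx (k + j).+1) (Sx (k + j)%N)) (ph_B (Sx (k + j)%N) (Sx k)).
  by rewrite addrA subrK; have := rS (k + j)%N; have := xS (k + j)%N; lra.
have nest k m : (k <= m)%N -> phn (x m - x k) <= r k.
  by move=> /subnKC <-; have := nested k (m - k)%N; have := r_gt0 (k + (m - k))%N; lra.
have [|v Sv xv] := cpl x Sx.
  move=> e e0; have s0 : 0 < Num.sqrt e / 2 by rewrite divr_gt0 // sqrtr_gt0.
  have [N hN] := tends0_invn s0; exists N => n m Nn Nm.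
  rewrite -(sqr_sqrtr (ltW e0)) -phn_lt; [|exact: ph_B|by rewrite sqrtr_gt0].
  have h := phnD (ph_B (Sx n) (Sx N)) (ph_B (Sx N) (Sx m)).
  move: h; rewrite addrA subrK (phnBC (Sx N) (Sx m)).
  by have := nest N n Nn; have := nest N m Nm; have := rn N; have := hN N (leqnn N);
    move: (N.+1%:R^-1) => z; lra.
have vx k : phn (v - x k) <= r k.
  rewrite -subr_le0.
  have t1 := tends0_phn (fun n => ph_B (Sx n) Sv) xv.
  apply: (@tends0_le0 _ _ (fun n => phn (x (k + n)%N - v))); last first.
    by move=> e /t1[N hN]; exists N => n Nn; apply: hN; rewrite (leq_trans Nn) ?leq_addl.
  move=> n; have := phnD (ph_B Sv (Sx (k + n)%N)) (ph_B (Sx (k + n)%N) (Sx k)).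
  by rewrite addrA subrK (phnBC Sv) //; have := nest k (k + n)%N (leq_addr _ _); lra.
have [M hM] := lM v Sv.
have [_ _ _ [i hi]] := fS (Num.truncn `|M|).+1.
have := hi v Sv (vx _); rewrite idx => h1.
have := truncnS_gt `|M|; have := hM i; have := ler_norm M; lra.
Qed.

End Theory.
End Prehilbert.

(** * Square integrable functions *)

Section RealL2.
Context d (T : measurableType d) (R : realType).
Variables (mu : {measure set T -> \bar R}) (D : set T).
Hypothesis mD : measurable D.

Definition rL2 (f : T -> R) :=
  measurable_fun D f /\ (\int[mu]_(x in D) (f x ^+ 2)%:E < +oo)%E.

Definition rdot (f g : T -> R) : R := \int[mu]_(x in D) (f x * g x).

Lemma rL2_integrable_sq f : rL2 f -> mu.-integrable D (EFin \o (fun x => f x ^+ 2)).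
Proof.
move=> [mf ff]; apply/integrableP; split.
  by apply/measurable_EFinP; apply: measurable_funX.
under eq_integral do rewrite /= ger0_norm ?sqr_ge0 //.
exact: ff.
Qed.

Lemma rL2_integrable f g : rL2 f -> rL2 g ->
  mu.-integrable D (EFin \o (fun x => f x * g x)).
Proof.
move=> hf hg; have [mf _] := hf; have [mg _] := hg.
apply: (@le_integrable _ _ _ _ _ mD _ (EFin \o (fun x => f x ^+ 2 + g x ^+ 2))).
- by apply/measurable_EFinP; apply: measurable_funM.
- move=> x _ /=; rewrite lee_fin normrM [leRHS]ger0_norm ?addr_ge0 ?sqr_ge0 //.
  rewrite -(real_normK (num_real (f x))) -(real_normK (num_real (g x))).
  have := sqr_ge0 (`|f x| - `|g x|); have := normr_ge0 (f x).
  by have := normr_ge0 (g x); nra.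
- by have := integrableD mD (rL2_integrable_sq hf) (rL2_integrable_sq hg).
Qed.

Lemma rL2P (f : T -> R) : measurable_fun D f ->
  mu.-integrable D (EFin \o (fun x => f x ^+ 2)) -> rL2 f.
Proof.
move=> mf /integrableP[_ h]; split=> //; apply: le_lt_trans h.
apply: ge0_le_integral => //.
- by move=> x _; rewrite lee_fin sqr_ge0.
- by apply/measurable_EFinP; apply: measurable_funX.
- by apply: measurableT_comp => //; apply/measurable_EFinP; apply: measurable_funX.
- by move=> x _ /=; rewrite lee_fin ler_norm.
Qed.

Lemma rL2D f g : rL2 f -> rL2 g -> rL2 (f + g).
Proof.
move=> hf hg; have [mf _] := hf; have [mg _] := hg.
apply: rL2P; first exact: measurable_funD.
have i1 := rL2_integrable_sq hf; have i2 := rL2_integrable_sq hg.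
have i3 := rL2_integrable hf hg.
have := integrableD mD (integrableD mD i1 i2) (integrableD mD i3 i3).
apply: eq_integrable => // x _; rewrite /= -!EFinD; congr (_%:E).
by rewrite addrfctE; ring.
Qed.

Lemma rL2Z t f : rL2 f -> rL2 (fun x => t * f x).
Proof.
move=> hf; have [mf _] := hf; apply: rL2P; first exact: measurable_funM.
have := integrableZl mD (t ^+ 2) (rL2_integrable_sq hf).
by apply: eq_integrable => // x _; rewrite /= -EFinM exprMn.
Qed.

Lemma rL2N f : rL2 f -> rL2 (- f).
Proof.
move=> /(rL2Z (-1)); rewrite (_ : (fun x => _) = - f) //.
by apply/funext => x; rewrite mulN1r.
Qed.

Lemma rL2_0 : rL2 0.
Proof.
split; first exact: measurable_cst.
by under eq_integral do rewrite expr0n /=; rewrite integral0.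
Qed.

Lemma rL2_prehilbert : prehilbert (fun t (f : T -> R) x => t * f x) rL2 rdot.
Proof.
split.
- exact: rL2_0.
- exact: rL2D.
- exact: rL2N.
- exact: rL2Z.
- by move=> u v _ _; apply: eq_Rintegral => x _; rewrite mulrC.
- move=> u v w hu hv hw; rewrite /rdot -RintegralD //; try exact: rL2_integrable.
  by apply: eq_Rintegral => x _; rewrite -mulrDl.
- move=> t u w hu hw; rewrite /rdot -RintegralZl //; try exact: rL2_integrable.
  by apply: eq_Rintegral => x _; rewrite mulrA.
- by move=> u _; apply: Rintegral_ge0 => x _; rewrite -expr2 sqr_ge0.
Qed.

Lemma rdotE f : rL2 f -> ((rdot f f)%:E = \int[mu]_(x in D) (f x ^+ 2)%:E)%E.
Proof.
move=> [mf ff]; rewrite /rdot /Rintegral fineK.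
  by apply: eq_integral => x _; rewrite expr2.
rewrite ge0_fin_numE; last by apply: integral_ge0 => x _; rewrite lee_fin -expr2 sqr_ge0.
by under eq_integral do rewrite -expr2.
Qed.

Lemma rdot_lt_rL2 (f : T -> R) (e : R) : measurable_fun D f ->
  (\int[mu]_(x in D) (f x ^+ 2)%:E <= e%:E)%E -> rL2 f /\ rdot f f <= e.
Proof.
move=> mf h; have hf : rL2 f by split=> //; apply: le_lt_trans h _; rewrite ltry.
by split=> //; rewrite -lee_fin rdotE.
Qed.

(* A subsequence with [|f_(k+1) - f_k|^2 <= 8^-k] converges absolutely wherever
   [\sum_k 4^k |f_(k+1) - f_k|^2] is finite; Fatou's lemma does the rest. *)
Lemma rL2_complete : ph_complete rL2 rdot.
Proof.
move=> f hf fC; have H := rL2_prehilbert.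
(* k n is the maximum of i and N i over all i <= n, which makes k monotone with n <= k n. *)
have [k [kS kn kC]] : exists k : nat -> nat, [/\ forall n, (k n <= k n.+1)%N, forall n, (n <= k n)%N &
    forall n m, (k n <= m)%N -> rdot (f (k n) - f m) (f (k n) - f m) < 8 ^- n].
  have hk n : {N | forall i j, (N <= i)%N -> (N <= j)%N ->
      rdot (f i - f j) (f i - f j) < 8 ^- n}.
    by apply/cid/fC; rewrite invr_gt0 exprn_gt0.
  pose N n := projT1 (hk n).
  have hN n i j : (N n <= i)%N -> (N n <= j)%N ->
      rdot (f i - f j) (f i - f j) < 8 ^- n by exact: (projT2 (hk n)).
  exists (fun n => \max_(i < n.+1) maxn i (N i))%N; split.
  - by move=> n; rewrite [leqRHS]big_ord_recr /= leq_maxl.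
  - by move=> n; apply: leq_trans (leq_bigmax (ord_max : 'I_n.+1)); rewrite leq_maxl.
  - have kN n : (N n <= \max_(i < n.+1) maxn i (N i))%N.
      by apply: leq_trans (leq_bigmax (ord_max : 'I_n.+1)); rewrite leq_maxr.
    by move=> n m nm; apply: hN => //; apply: leq_trans nm.
pose g n := f (k n).
have kmono n m : (n <= m)%N -> (k n <= k m)%N.
  by move=> nm; apply: (homo_leq (f := k) leqnn leq_trans kS).
have gS n : rL2 (g n) by exact: hf.
have gd n : rL2 (g n.+1 - g n) by exact: (ph_B H).
pose s (x : T) := (\sum_(0 <= n <oo) (4 ^+ n * ((g n.+1 - g n) x) ^+ 2)%:E)%E.
have ms n : measurable_fun D (fun x => (4 ^+ n * ((g n.+1 - g n) x) ^+ 2)%:E : \bar R).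
  apply/measurable_EFinP; apply: measurable_funM => //.
  by apply: measurable_funX; exact: (gd n).1.
have s0 n x : (0 <= (4 ^+ n * ((g n.+1 - g n) x) ^+ 2)%:E :> \bar R)%E.
  by rewrite lee_fin mulr_ge0 ?sqr_ge0 // exprn_ge0.
(* The weight leaves 4^n 8^-n = 2^-n, which is summable: s has a finite integral and is finite
   almost everywhere. *)
have intn n : (\int[mu]_(x in D) (4 ^+ n * ((g n.+1 - g n) x) ^+ 2)%:E <= (2 ^- n)%:E)%E.
  under eq_integral do rewrite EFinM.
  rewrite ge0_integralZl //; do ?[by move=> x _; rewrite lee_fin sqr_ge0 |
    by rewrite lee_fin exprn_ge0 |
    by apply/measurable_EFinP/measurable_funX; exact: (gd n).1].
  rewrite -rdotE // -EFinM lee_fin.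
  have -> : 2 ^- n = 4 ^+ n * 8 ^- n :> R.
    rewrite (_ : 8 = 4 * 2 :> R); last by rewrite -natrM.
    by rewrite exprMn invfM mulrA divff ?mul1r // expf_neq0.
  rewrite ler_wpM2l ?exprn_ge0 // (ph_sqBC H) //.
  by apply/ltW/kC; exact: kS.
have ints : (\int[mu]_(x in D) s x < +oo)%E.
  rewrite integral_nneseries //.
  apply: (@le_lt_trans _ _ (\sum_(0 <= n <oo) ((2 ^- n)%:E : \bar R))%E).
    by apply: lee_nneseries => // n _ _; apply: integral_ge0 => x _; exact: s0.
  rewrite (_ : \sum_(0 <= n <oo) _ = (2 / 2 ^+ 0)%:E)%E ?ltry //.
  apply/cvg_lim => //; rewrite [X in X @ _ --> _](_ : _ =
    eseries (fun n => (2 / (2 ^ (n + 1))%:R)%:E)); first exact: cvg_geometric_eseries_half.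
  apply/funext => n; apply: eq_bigr => i _; congr (_%:E).
  by rewrite addn1 expnS natrM invfM mulrA divff ?mul1r ?pnatr_eq0 // natrX.
have ae_s : \forall x \ae mu, D x -> s x \is a fin_num.
  apply: integrable_ae => //; apply/integrableP; split.
    by apply: ge0_emeasurable_sum => // n x _ _; exact: s0.
  under eq_integral do rewrite gee0_abs ?nneseries_ge0 //.
  exact: ints.
(* The upper limit is measurable without any convergence, and it is the limit wherever the sequence
   converges. *)
pose h (x : T) : R := fine (limn_esup (fun n => (g n x)%:E)).
have mh : measurable_fun D h.
  apply: measurableT_comp => //.
  by apply: measurable_fun_limn_esup => n; apply/measurable_EFinP; exact: (gS n).1.
have cvg_h : \forall x \ae mu, D x -> (fun n => g n x) @ \oo --> h x.
  apply: filterS ae_s => x hx Dx; have {hx} sx := hx Dx.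
  have M0 : 0 <= fine (s x) by rewrite fine_ge0 // nneseries_ge0.
  have dM n : `|(g n.+1 - g n) x| <= Num.sqrt (fine (s x)) * 2 ^- n.
    rewrite -(@ler_pXn2r _ 2) ?nnegrE ?mulr_ge0 ?sqrtr_ge0 ?invr_ge0 ?exprn_ge0 //.
    rewrite real_normK ?num_real // exprMn sqr_sqrtr // exprVn -exprM mulnC exprM.
    rewrite (_ : 2 ^+ 2 = 4 :> R); last by rewrite -natrX.
    rewrite ler_pdivlMr ?exprn_gt0 // mulrC -lee_fin fineK //.
    apply: le_trans (@nneseries_lim_ge _ _ xpredT 0 n.+1 _) => //.
    by rewrite big_nat_recr //= leeDr // sume_ge0.
  have c : cvgn (fun n => g n x).
    rewrite (_ : (fun n => g n x) = (fun n => series (fun i => (g i.+1 - g i) x) n + g 0%N x)); last first.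
      apply/funext => n; rewrite /series /=.
      rewrite (eq_bigr (fun i => g i.+1 x - g i x)) //.
      by rewrite telescope_sumr // subrK.
    apply: is_cvgD; last exact: is_cvg_cst.
    apply: normed_cvg; apply: series_le_cvg (@is_cvg_geometric_series _ (Num.sqrt (fine (s x))) (2^-1) _).
    - by move=> n; exact: normr_ge0.
    - by move=> n; rewrite mulr_ge0 ?sqrtr_ge0 // exprn_ge0.
    - by move=> n; rewrite /= exprVn.
    - by rewrite gtr0_norm // invf_lt1 // ltr1n.
  have ce : (fun n => (g n x)%:E) @ \oo --> (limn (fun n => g n x))%:E.
    by apply: cvg_EFin => //; exact: nearW.
  by rewrite /h (cvg_limn_einf_sup ce).2.
(* Fatou's lemma for the squares of g n - g (n + m) as m grows: the bound 8^-n survives in the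
   limit. *)
have fat n : rL2 (g n - h) /\ rdot (g n - h) (g n - h) <= 8 ^- n.
  apply: rdot_lt_rL2; first by apply: measurable_funB => //; exact: (gS n).1.
  pose q m (x : T) := ((((g n - g (n + m)%N) x) ^+ 2)%:E : \bar R).
  have q0 m x : (0 <= q m x)%E by rewrite lee_fin sqr_ge0.
  have mq m : measurable_fun D (q m).
    by apply/measurable_EFinP/measurable_funX; exact: (ph_B H (gS n) (gS _)).1.
  have F := fatou mu mD mq (fun m x _ => q0 m x).
  apply: (@le_trans _ _ (\int[mu]_(x in D) limn_einf (q^~ x))%E).
    rewrite le_eqVlt; apply/orP; left; apply/eqP.
    apply: ae_eq_integral => //.
    - apply/measurable_EFinP/measurable_funX/measurable_funB => //; exact: (gS n).1.
    - rewrite (_ : (fun x => _) = (fun x => - limn_esup (-%E \o q^~ x))%E); last first.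
        by apply/funext => x; rewrite limn_esupN oppeK.
      apply: measurableT_comp => //; apply: measurable_fun_limn_esup => m.
      exact: measurableT_comp.
    - apply: filterS cvg_h => x hx Dx.
      rewrite (cvg_limn_einf_sup (l := (((g n - h) x) ^+ 2)%:E) _).1 //.
      apply: cvg_EFin; first exact: nearW.
      rewrite (_ : fine \o _ = (fun m => (g n x - g (n + m)%N x) * (g n x - g (n + m)%N x))); last first.
        by apply/funext => m; rewrite /= -expr2.
      rewrite expr2.
      have c : (fun m => g n x - g (n + m)%N x) @ \oo --> (g n - h) x.
        apply: cvgB; first exact: cvg_cst.
        rewrite (_ : (fun m => g (n + m)%N x) = (fun m => g (m + n)%N x)).
          by rewrite (cvg_shiftn n (fun m => g m x)); exact: hx.
        by apply/funext => m; rewrite addnC.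
      exact: cvgM.
  apply: le_trans F _; rewrite limn_einf_lim; apply: lime_le; first exact: is_cvg_einfs.
  apply: nearW => m; apply: le_trans (ereal_inf_lbound _) _; first by exists m => /=.
  rewrite -rdotE; last exact: (ph_B H (gS n) (gS _)).
  by rewrite lee_fin; apply/ltW/kC/kmono/leq_addr.
exists h.
  have [h0 _] := fat 0%N.
  have -> : h = g 0%N - (g 0%N - h) by rewrite opprB addrC subrK.
  exact: (ph_B H).
have hh : rL2 h.
  have [h0 _] := fat 0%N.
  have -> : h = g 0%N - (g 0%N - h) by rewrite opprB addrC subrK.
  exact: (ph_B H).
move=> e e0; have e4 : 0 < e / 4 by rewrite divr_gt0.
have [N1 hN1] := fC _ e4.
have [N2 hN2] : exists N, forall n, (N <= n)%N -> 8 ^- n < e / 4 :> R.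
  have : geometric 1 (8^-1 : R) @ \oo --> 0.
    by apply: cvg_geometric; rewrite gtr0_norm // invf_lt1 // ltr1n.
  move/tends0P => h8; have [|N hN] := h8 _ _ e4; first by move=> n; rewrite /= mul1r exprn_ge0.
  by exists N => n /hN; rewrite /= mul1r exprVn.
exists N1 => n Nn.
pose m := maxn N1 N2.
have km : (N1 <= k m)%N by apply: leq_trans (kn m); rewrite leq_maxl.
have := ph_sqD_le H (ph_B H (hf n) (gS m)) (fat m).1.
rewrite addrA subrK; have := (fat m).2; have := hN2 m (leq_maxr _ _).
by have := hN1 n (k m) Nn km; rewrite -/(g m); move: (8 ^- m) => z; lra.
Qed.

End RealL2.

(** * Finite products of pre-Hilbert spaces *)

Section Family.
Variables (R : realType) (I : finType) (V V1 : zmodType).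
Variables (sc : R -> V -> V) (sc1 : R -> V1 -> V1).
Variables (S1 : V1 -> Prop) (B1 : V1 -> V1 -> R) (p : I -> V -> V1).
Hypothesis pD : forall i u v, p i (u + v) = p i u + p i v.
Hypothesis pZ : forall i t u, p i (sc t u) = sc1 t (p i u).
Hypothesis H1 : prehilbert sc1 S1 B1.

Lemma family0 i : p i 0 = 0.
Proof. by apply: (@addrI _ (p i 0)); rewrite -pD !addr0. Qed.

Lemma familyN i u : p i (- u) = - p i u.
Proof. by apply: (@addrI _ (p i u)); rewrite -pD !subrr family0. Qed.

(** Used twice: with the real and imaginary parts of a complex function, then with the three
    components of a field. *)
Lemma prehilbert_family : prehilbert sc (fun u => forall i, S1 (p i u))
  (fun u v => \sum_i B1 (p i u) (p i v)).
Proof.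
split.
- by move=> i; rewrite family0; exact: (ph_0 H1).
- by move=> u v hu hv i; rewrite pD; exact: (ph_D H1).
- by move=> u hu i; rewrite familyN; exact: (ph_N H1).
- by move=> t u hu i; rewrite pZ; exact: (ph_Z H1).
- by move=> u v hu hv; apply: eq_bigr => i _; exact: (ph_C H1).
- by move=> u v w hu hv hw; rewrite -big_split; apply: eq_bigr => i _; rewrite pD (ph_BD H1).
- by move=> t u w hu hw; rewrite mulr_sumr; apply: eq_bigr => i _; rewrite pZ (ph_BZ H1).
- by move=> u hu; apply: sumr_ge0 => i _; exact: (ph_ge0 H1).
Qed.

(** Limits exist component by component; [r] assembles them into one element. *)
Lemma complete_family (r : (I -> V1) -> V) : (forall a i, p i (r a) = a i) ->
  ph_complete S1 B1 -> ph_complete (fun u => forall i, S1 (p i u))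
    (fun u v => \sum_i B1 (p i u) (p i v)).
Proof.
move=> pr c1 u Su uC.
have pB i x y : p i (x - y) = p i x - p i y by rewrite pD familyN.
have Sp n m i : S1 (p i (u n - u m)) by rewrite pB; exact: (ph_B H1).
have hlim i : {v | S1 v /\ tends0 (fun n => B1 (p i (u n) - v) (p i (u n) - v))}.
  apply/cid; have [|v Sv hv] := c1 (fun n => p i (u n)) (fun n => Su n i).
    move=> e e0; have [N hN] := uC e e0; exists N => n m Nn Nm.
    apply: le_lt_trans (hN n m Nn Nm); rewrite -pB (bigD1 i) //= lerDl sumr_ge0 //.
    by move=> j _; exact: (ph_ge0 H1).
  by exists v.
exists (r (fun i => projT1 (hlim i))).
  by move=> i; rewrite pr; have [] := projT2 (hlim i).
have : forall s : seq I, tends0 (fun n => \sum_(i <- s)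
   B1 (p i (u n) - projT1 (hlim i)) (p i (u n) - projT1 (hlim i))).
  elim=> [|i s IH].
    by move=> e e0; exists 0%N => n _; rewrite big_nil.
  have := tends0D (projT2 (hlim i)).2 IH.
  by move=> h e e0; have [N hN] := h e e0; exists N => n /hN; rewrite big_cons.
move=> /(_ (index_enum I)) h e e0; have [N hN] := h e e0; exists N => n /hN.
by under eq_bigr do rewrite -[projT1 _](pr (fun i => projT1 (hlim i))) -pB.
Qed.

End Family.

Lemma complete_sub (R : realType) (V : zmodType) (S S' : V -> Prop) (B : V -> V -> R) :
  (forall u, S' u -> S u) ->
  (forall (u : nat -> V) v, (forall n, S' (u n)) -> S v ->
     tends0 (fun n => B (u n - v) (u n - v)) -> S' v) ->
  ph_complete S B -> ph_complete S' B.
Proof.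
move=> SS cl c u Su uC; have [v Sv uv] := c u (fun n => SS _ (Su n)) uC.
by exists v => //; exact: cl uv.
Qed.

Lemma prehilbert_sub (R : realType) (V : zmodType) (sc : R -> V -> V)
    (S S' : V -> Prop) (B : V -> V -> R) :
  (forall u, S' u -> S u) -> S' 0 -> (forall u v, S' u -> S' v -> S' (u + v)) ->
  (forall u, S' u -> S' (- u)) -> (forall t u, S' u -> S' (sc t u)) ->
  prehilbert sc S B -> prehilbert sc S' B.
Proof.
move=> SS h0 hD hN hZ H; split=> //.
- by move=> u v /SS hu /SS hv; exact: (ph_C H).
- by move=> u v w /SS hu /SS hv /SS hw; exact: (ph_BD H).
- by move=> t u w /SS hu /SS hw; exact: (ph_BZ H).
- by move=> u /SS hu; exact: (ph_ge0 H).
Qed.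

(** * Real and imaginary parts, components of fields *)

Section Components.
Variables (R : realType) (T : Type).
Local Notation C := R[i].
Local Notation vf := (T -> 'rV[C]_3).

(** Indexed by [bool] so that a complex function is a family of two real ones in the sense of
    [prehilbert_family]. *)
Definition part (b : bool) (f : T -> C) : T -> R :=
  fun x => if b then complex.Im (f x) else complex.Re (f x).

Definition cscale (t : R) (f : T -> C) : T -> C := fun x => t%:C%C * f x.

Lemma sqmod_ge0 (z : C) : 0 <= sqmod z.
Proof. by rewrite addr_ge0 ?sqr_ge0. Qed.

Lemma sqmodE (f : T -> C) x : sqmod (f x) = \sum_b part b f x ^+ 2.
Proof. by rewrite big_bool /= /sqmod addrC. Qed.

Lemma partD b (f g : T -> C) : part b (f + g) = part b f + part b g.
Proof.
by apply/funext => x; rewrite /part !addrfctE; case: b; rewrite ?raddfD; case: (f x) (g x) => [? ?] [].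
Qed.

Lemma part_inj (f g : T -> C) x : (forall b, part b f x = part b g x) -> f x = g x.
Proof.
move=> h; move: (h true) (h false); rewrite /part.
by case: (f x) (g x) => [? ?] [? ?] /= -> ->.
Qed.

Lemma partZ b t (f : T -> C) : part b (cscale t f) = fun x => t * part b f x.
Proof.
apply/funext => x; rewrite /part /cscale; case: (f x) => a c.
by case: b; rewrite /= mul0r ?subr0 ?addr0.
Qed.

Definition vcomp (i : 'I_3) (u : vf) : T -> C := fun x => u x 0 i.

Definition vscale (t : R) (u : vf) : vf := fun x => t%:C%C *: u x.

Lemma vcompD i (u v : vf) : vcomp i (u + v) = vcomp i u + vcomp i v.
Proof. by apply/funext => x; rewrite /vcomp !addrfctE mxE. Qed.

Lemma vcompZ i t (u : vf) : vcomp i (vscale t u) = cscale t (vcomp i u).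
Proof. by apply/funext => x; rewrite /vcomp /vscale mxE. Qed.

Lemma part_mul b (c : C) f : part b (fun x => c * f x) =
  (fun x => if b then complex.Im c * part false f x + complex.Re c * part true f x
            else complex.Re c * part false f x - complex.Im c * part true f x).
Proof.
apply/funext => x; rewrite /part; case: c (f x) => [a a'] [e e'].
by case: b => //=; rewrite addrC.
Qed.

Definition conjf (g : T -> C) : T -> C := fun x => conjc (g x).

Definition iconjf (g : T -> C) : T -> C := fun x => 'i%C * conjc (g x).

Definition vconj (a : vf) : vf := fun x => conjv (a x).

Definition viconj (a : vf) : vf := fun x => 'i%C *: conjv (a x).

Lemma vcomp_conj i a : vcomp i (vconj a) = conjf (vcomp i a).
Proof. by apply/funext => x; rewrite /vcomp /vconj mxE. Qed.

Lemma vcomp_iconj i a : vcomp i (viconj a) = iconjf (vcomp i a).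
Proof. by apply/funext => x; rewrite /vcomp /viconj !mxE. Qed.

End Components.
Arguments cscale {R T} t f x.
Arguments vscale {R T} t u x.

Section ComplexL2.
Context d (T : measurableType d) (R : realType).
Variables (mu : {measure set T -> \bar R}) (D : set T).
Hypothesis mD : measurable D.
Local Notation C := R[i].
Local Notation vf := (T -> 'rV[C]_3).

(** The real part of the integral of f conj g, written without complex numbers. *)
Definition cdot (f g : T -> C) : R :=
  \sum_b rdot mu D (part b f) (part b g).

Lemma L2P (f : T -> C) : L2 mu D f <-> forall b, rL2 mu D (part b f).
Proof.
split=> [[mr mi fi] b|h].
  have mb : measurable_fun D (part b f) by case: b.
  split=> //; apply: le_lt_trans fi; apply: ge0_le_integral => //.
  - by move=> x _; rewrite lee_fin sqr_ge0.
  - by apply/measurable_EFinP/measurable_funX.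
  - by apply/measurable_EFinP; apply: measurable_funD; exact: measurable_funX.
  - move=> x _; rewrite lee_fin sqmodE (bigD1 b) //= lerDl sumr_ge0 // => c _.
    exact: sqr_ge0.
split; [exact: (h false).1|exact: (h true).1|].
rewrite (_ : (\int[mu]_(x in D) _ = \int[mu]_(x in D) ((part true f x ^+ 2)%:E + (part false f x ^+ 2)%:E))%E); last first.
  by apply: eq_integral => x _; rewrite sqmodE big_bool EFinD.
rewrite ge0_integralD //.
- by apply: lte_add_pinfty; [exact: (h true).2|exact: (h false).2].
- by move=> x _; rewrite lee_fin sqr_ge0.
- by apply/measurable_EFinP/measurable_funX; exact: (h true).1.
- by move=> x _; rewrite lee_fin sqr_ge0.
- by apply/measurable_EFinP/measurable_funX; exact: (h false).1.
Qed.

Lemma L2E : L2 mu D = fun f => forall b, rL2 mu D (part b f).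
Proof. by apply/funext => f; apply/propext; exact: L2P. Qed.

Lemma cdot_prehilbert : prehilbert cscale (L2 mu D) cdot.
Proof. by rewrite L2E; exact: (prehilbert_family (@partD R T) (@partZ R T) (rL2_prehilbert mu mD)). Qed.

Lemma cdot_complete : ph_complete (L2 mu D) cdot.
Proof.
rewrite L2E; apply: (complete_family (@partD R T) (rL2_prehilbert mu mD)
  (r := fun a x => (a false x +i* a true x)%C)); last exact: rL2_complete.
by move=> a []; apply/funext.
Qed.

Lemma cdotE f g : cdot f g = rdot mu D (part true f) (part true g) +
  rdot mu D (part false f) (part false g).
Proof. by rewrite /cdot big_bool. Qed.

Lemma sqL2E f : L2 mu D f -> sqL2 mu D f = cdot f f.
Proof.
move=> /L2P hf; rewrite /sqL2 cdotE /rdot -RintegralD //.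
- by apply: eq_Rintegral => x _; rewrite sqmodE big_bool -!expr2.
- exact: (rL2_integrable mD (hf true) (hf true)).
- exact: (rL2_integrable mD (hf false) (hf false)).
Qed.

Definition vdot (u v : vf) : R := \sum_i cdot (vcomp i u) (vcomp i v).

Lemma vdot_prehilbert : prehilbert vscale (L2v mu D) vdot.
Proof. exact: (prehilbert_family (@vcompD R T) (@vcompZ R T) cdot_prehilbert). Qed.

Lemma vdot_complete : ph_complete (L2v mu D) vdot.
Proof.
apply: (complete_family (@vcompD R T) cdot_prehilbert
  (r := fun a x => \row_i a i x)); last exact: cdot_complete.
by move=> a i; apply/funext => x; rewrite /vcomp mxE.
Qed.

Definition Cintegrable (f : T -> C) := forall b, mu.-integrable D (EFin \o part b f).

Lemma CintE f : Cint mu D f =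
  ((\int[mu]_(x in D) part false f x) +i* (\int[mu]_(x in D) part true f x))%C.
Proof. by []. Qed.

Lemma CintD f g : Cintegrable f -> Cintegrable g ->
  Cint mu D (f + g) = Cint mu D f + Cint mu D g.
Proof.
move=> hf hg; rewrite !CintE !partD RintegralD // RintegralD //.
Qed.

Lemma CintegrableD f g : Cintegrable f -> Cintegrable g -> Cintegrable (f + g).
Proof.
move=> hf hg b; rewrite partD; have := integrableD mD (hf b) (hg b).
by apply: eq_integrable => // x _; rewrite /= addrfctE EFinD.
Qed.

Lemma CintegrableZ c f : Cintegrable f -> Cintegrable (fun x => c * f x).
Proof.
move=> hf b; rewrite part_mul; case: b.
  have := integrableD mD (integrableZl mD (complex.Im c) (hf false))
    (integrableZl mD (complex.Re c) (hf true)).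
  by apply: eq_integrable => // x _; rewrite /= EFinD !EFinM.
have := integrableB mD (integrableZl mD (complex.Re c) (hf false))
    (integrableZl mD (complex.Im c) (hf true)).
by apply: eq_integrable => // x _; rewrite /= EFinB !EFinM.
Qed.

Lemma CintZ c f : Cintegrable f -> Cint mu D (fun x => c * f x) = c * Cint mu D f.
Proof.
move=> hf; rewrite !CintE !part_mul /=.
have iz (r : R) b : mu.-integrable D (EFin \o (fun x => r * part b f x)).
  by have := integrableZl mD r (hf b); apply: eq_integrable => // x _; rewrite /= EFinM.
rewrite (RintegralB mD (iz _ false) (iz _ true)) (RintegralD mD (iz _ false) (iz _ true)).
rewrite !(RintegralZl _ mD (hf false)) !(RintegralZl _ mD (hf true)).
by case: c => a a'; congr (_ +i* _)%C; rewrite /= addrC.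
Qed.

Lemma Cint0 : Cint mu D (fun=> 0) = 0.
Proof.
by rewrite CintE; congr (_ +i* _)%C; rewrite /Rintegral integral0_eq.
Qed.

Lemma Cintegrable0 : Cintegrable (fun=> 0).
Proof.
move=> b; rewrite (_ : EFin \o _ = cst 0%E); first exact: integrable0.
by apply/funext => x; case: b.
Qed.

Lemma Cint_sum (I : Type) (s : seq I) (F : I -> T -> C) :
  (forall i, Cintegrable (F i)) ->
  Cintegrable (fun x => \sum_(i <- s) F i x) /\
  Cint mu D (fun x => \sum_(i <- s) F i x) = \sum_(i <- s) Cint mu D (F i).
Proof.
move=> hF; elim: s => [|i s [IH1 IH2]].
  by under eq_fun do rewrite big_nil; rewrite big_nil Cint0; split=> //; exact: Cintegrable0.
have E : (fun x => \sum_(j <- i :: s) F j x) = F i + (fun x => \sum_(j <- s) F j x).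
  by apply/funext => x; rewrite addrfctE big_cons.
by rewrite E CintD // big_cons IH2; split=> //; exact: CintegrableD.
Qed.

Lemma eq_Cint f g : {in D, f =1 g} -> Cint mu D f = Cint mu D g.
Proof. by move=> fg; rewrite /Cint; congr (_ +i* _)%C; apply: eq_Rintegral => x /fg ->. Qed.

Lemma L2_Cintegrable f g : L2 mu D f -> L2 mu D g -> Cintegrable (fun x => f x * g x).
Proof.
move=> /L2P hf /L2P hg b.
have i b1 b2 : mu.-integrable D (EFin \o (fun x => part b1 f x * part b2 g x)).
  exact: rL2_integrable.
case: b.
  have := integrableD mD (i false true) (i true false).
  by apply: eq_integrable => // x _; rewrite /= -EFinD /part; case: (f x) (g x) => [? ?] [].
have := integrableB mD (i false false) (i true true).
by apply: eq_integrable => // x _; rewrite /= -EFinB /part; case: (f x) (g x) => [? ?] [].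
Qed.

Lemma L2_conj g : L2 mu D g -> L2 mu D (conjf g).
Proof.
move=> /L2P h; apply/L2P => -[].
  have -> : part true (conjf g) = - part true g.
    by apply/funext => x; rewrite /part /conjf opprfctE; case: (g x).
  exact: rL2N.
have -> : part false (conjf g) = part false g.
  by apply/funext => x; rewrite /part /conjf; case: (g x).
exact: h.
Qed.

Lemma L2_iconj g : L2 mu D g -> L2 mu D (iconjf g).
Proof.
move=> /L2P h; apply/L2P => -[].
  have -> : part true (iconjf g) = part false g.
    by apply/funext => x; rewrite /part /iconjf; case: (g x) => a b /=; rewrite mul0r mul1r add0r.
  exact: h.
have -> : part false (iconjf g) = part true g.
  by apply/funext => x; rewrite /part /iconjf; case: (g x) => a b /=; rewrite mul0r mul1r sub0r opprK.
exact: h.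
Qed.

(** Re (f g) is the real product of f with conj g, and Im (f g) = Re (f conj (i conj g)) is the one
    with i conj g. All bilinear complex integrals are reduced to real products in this way. *)
Lemma Cint_mulE f g : L2 mu D f -> L2 mu D g ->
  Cint mu D (fun x => f x * g x) = (cdot f (conjf g) +i* cdot f (iconjf g))%C.
Proof.
move=> hf hg; move: (hf) (hg) => /L2P Hf /L2P Hg.
have /L2P Hc := L2_conj hg; have /L2P Hi := L2_iconj hg.
rewrite CintE !cdotE /rdot -!RintegralD //; try exact: rL2_integrable.
congr (_ +i* _)%C; apply: eq_Rintegral => x _; rewrite /part /conjf /iconjf;
  case: (f x) (g x) => [a b] [p q] /=; ring.
Qed.

Lemma L2D f g : L2 mu D f -> L2 mu D g -> L2 mu D (f + g).
Proof. exact: (ph_D cdot_prehilbert). Qed.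

Lemma L2Zc c f : L2 mu D f -> L2 mu D (fun x => c * f x).
Proof.
move=> hf; have /L2P h := hf; apply/L2P => b; rewrite part_mul; case: b.
  exact: rL2D (rL2Z _ _ (h false)) (rL2Z _ _ (h true)).
have -> : (fun x => complex.Re c * part false f x - complex.Im c * part true f x) =
  (fun x => complex.Re c * part false f x) + (fun x => - complex.Im c * part true f x).
  by apply/funext => x; rewrite addrfctE mulNr.
exact: rL2D (rL2Z _ _ (h false)) (rL2Z _ _ (h true)).
Qed.

Lemma L2v_conj a : L2v mu D a -> L2v mu D (vconj a).
Proof.
move=> h i; have := L2_conj (h i); congr (L2 mu D _).
by apply/funext => x; rewrite /conjf /vconj /conjv mxE.
Qed.

Lemma L2v_iconj a : L2v mu D a -> L2v mu D (viconj a).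
Proof. by move=> h i; have := L2_iconj (h i); rewrite -vcomp_iconj. Qed.

Lemma L2v_Cintegrable u a : L2v mu D u -> L2v mu D a ->
  Cintegrable (fun x => dotv (u x) (a x)).
Proof. by move=> hu ha; have [] := @Cint_sum _ (index_enum 'I_3) _ (fun i => L2_Cintegrable (hu i) (ha i)). Qed.

Lemma Cint_dotvE u a : L2v mu D u -> L2v mu D a ->
  Cint mu D (fun x => dotv (u x) (a x)) = (vdot u (vconj a) +i* vdot u (viconj a))%C.
Proof.
move=> hu ha; have [_ ->] := @Cint_sum _ (index_enum 'I_3) _ (fun i => L2_Cintegrable (hu i) (ha i)).
rewrite (eq_bigr (fun i => cdot (vcomp i u) (conjf (vcomp i a)) +i* cdot (vcomp i u) (iconjf (vcomp i a)))%C); last first.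
  by move=> i _; rewrite Cint_mulE //.
rewrite /vdot; under [X in (X +i* _)%C]eq_bigr do rewrite vcomp_conj.
under [X in (_ +i* X)%C]eq_bigr do rewrite vcomp_iconj.
by rewrite !big_ord_recr !big_ord0 /= !add0r.
Qed.

Lemma Rintegral_sum (I : Type) (s : seq I) (F : I -> T -> R) :
  (forall i, mu.-integrable D (EFin \o F i)) ->
  mu.-integrable D (EFin \o (fun x => \sum_(i <- s) F i x)) /\
  \int[mu]_(x in D) (\sum_(i <- s) F i x) = \sum_(i <- s) \int[mu]_(x in D) F i x.
Proof.
move=> hF; elim: s => [|i s [IH1 IH2]].
  rewrite (_ : (fun x => _) = cst 0); last by apply/funext => x; rewrite big_nil.
  by rewrite big_nil /Rintegral integral0_eq //; split=> //; exact: integrable0.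
rewrite (_ : (fun x => _) = (fun x => F i x + \sum_(j <- s) F j x)); last first.
  by apply/funext => x; rewrite big_cons.
rewrite big_cons RintegralD // IH2; split=> //.
by have := integrableD mD (hF i) IH1; apply: eq_integrable => // x _; rewrite /= EFinD.
Qed.

Lemma sqL2vE u : L2v mu D u -> sqL2v mu D u = vdot u u.
Proof.
move=> hu; rewrite /sqL2v /vdot.
have i j : mu.-integrable D (EFin \o (fun x => sqmod (u x 0 j))).
  have /L2P h := hu j; have := integrableD mD (rL2_integrable_sq (h true)) (rL2_integrable_sq (h false)).
  by apply: eq_integrable => // x _; rewrite /= -EFinD (sqmodE (fun y => u y 0 j)) big_bool.
have [_ ->] := @Rintegral_sum _ (index_enum 'I_3) _ i.
by apply: eq_bigr => j _; rewrite -sqL2E //; exact: hu.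
Qed.

End ComplexL2.

(** * Lebesgue measure on R^3 *)

Lemma sigma_finite_prod d1 d2 (T1 : measurableType d1) (T2 : measurableType d2)
    (R : realType) (m1 : {sigma_finite_measure set T1 -> \bar R})
    (m2 : {sigma_finite_measure set T2 -> \bar R}) :
  sigma_finite setT (m1 \x m2)%E.
Proof.
have [F TF Foo] := sigma_finiteT m1; have [G TG Goo] := sigma_finiteT m2.
(* All products F i x G j, enumerated by the code of (i, j); a number that codes no pair gives the
   empty set. *)
exists (fun n => if unpickle n is Some p then F p.1 `*` G p.2 else set0).
  apply/esym; rewrite -subTset => -[x y] _.
  have [i _ Fx] : (\bigcup_i F i) x by rewrite -TF.
  have [j _ Gy] : (\bigcup_i G i) y by rewrite -TG.
  by exists (pickle (i, j)) => //; rewrite pickleK.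
move=> n; case: unpickle => [[i j] /=|]; last by split; [exact: measurable0|rewrite measure0].
have [mF Fi] := Foo i; have [mG Gj] := Goo j; split; first exact: measurableX.
by rewrite product_measure1E // lte_mul_pinfty // ge0_fin_numE.
Qed.

(* Copies of [leb2] and [leb3] that are canonically sigma-finite, for Fubini. *)
Definition sleb2 (R : realType) : set (measurableTypeR R * measurableTypeR R)%type -> \bar R := leb2 R.
HB.instance Definition _ (R : realType) := Measure.copy (@sleb2 R) (leb2 R).
HB.instance Definition _ (R : realType) :=
  Measure_isSigmaFinite.Build _ _ _ (@sleb2 R) (sigma_finite_prod lebesgue_measure lebesgue_measure).

Definition sleb3 (R : realType) : set (mpt R) -> \bar R := leb3 R.
HB.instance Definition _ (R : realType) := Measure.copy (@sleb3 R) (leb3 R).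
HB.instance Definition _ (R : realType) :=
  Measure_isSigmaFinite.Build _ _ _ (@sleb3 R) (sigma_finite_prod (@sleb2 R) lebesgue_measure).

Section Borel.
Variable R : realType.

(** The sup-norm balls with rational centre and radius 1/(n+1): a countable base of the topology. *)
Definition rbox (i : (rat * rat * rat) * nat) : set (pt R) :=
  ball ((ratr i.1.1.1, ratr i.1.1.2, ratr i.1.2) : pt R) (i.2.+1%:R^-1 : R).

Lemma rboxE i : rbox i = (ball (ratr i.1.1.1 : R) (i.2.+1%:R^-1) `*`
  ball (ratr i.1.1.2 : R) (i.2.+1%:R^-1)) `*` ball (ratr i.1.2 : R) (i.2.+1%:R^-1).
Proof. by []. Qed.

Lemma measurable_rbox i : measurable (rbox i : set (mpt R)).
Proof. by rewrite rboxE; do 2?apply: measurableX; exact: measurable_ball. Qed.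

(** The closed box is compact, so a bump on [rbox i] is a test function on every open set that
    contains [cbox i]. *)
Definition cbox (i : (rat * rat * rat) * nat) : set (pt R) :=
  [set x | [/\ `|ratr i.1.1.1 - x.1.1| <= i.2.+1%:R^-1, `|ratr i.1.1.2 - x.1.2| <= i.2.+1%:R^-1
    & `|ratr i.1.2 - x.2| <= i.2.+1%:R^-1]].

Lemma rbox_cbox i : rbox i `<=` cbox i.
Proof. by move=> x [[/ltW ? /ltW ?] /ltW ?]; split. Qed.

Lemma rbox_nbhs (U : set (pt R)) x : open U -> U x ->
  exists i, rbox i x /\ cbox i `<=` U.
Proof.
rewrite openE => /[apply] /nbhs_ballP[e /= e0 hU].
have e2 : 0 < e / 2 by rewrite divr_gt0.
have [n _ hn] := near_infty_natSinv_lt (PosNum e2).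
have {}hn := hn n (leqnn _).
have n0 : 0 < n.+1%:R^-1 :> R by rewrite invr_gt0.
have hq (t : R) : exists q : rat, `|ratr q - t| < n.+1%:R^-1.
  have [|q] := @rat_in_itvoo R (t - n.+1%:R^-1) (t + n.+1%:R^-1).
    by rewrite ltrBlDr -addrA ltrDl addr_gt0.
  by rewrite in_itv /= => /andP[h1 h2]; exists q; rewrite ltr_distl h1 h2.
have [[q1 h1] [q2 h2]] := (hq x.1.1, hq x.1.2).
have [q3 h3] := hq x.2.
exists ((q1, q2, q3), n); split; first by split.
move=> y [/= y1 y2 y3]; apply: hU.
have tri (q s t : R) : `|q - s| < n.+1%:R^-1 -> `|q - t| <= n.+1%:R^-1 -> `|s - t| < e.
  move=> hs ht; have := ler_distD q s t; rewrite (distrC s q).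
  by move: hn => /=; move: (n.+1%:R^-1) hs ht => z; lra.
by split; first split; [exact: tri h1 y1|exact: tri h2 y2|exact: tri h3 y3].
Qed.

Lemma open_bigcup_rbox (U : set (pt R)) : open U ->
  U = \bigcup_(i in [set i | rbox i `<=` U]) rbox i.
Proof.
move=> oU; apply/seteqP; split=> [x Ux|x [i /= iU ix]]; last exact: iU.
have [i [ix iU]] := rbox_nbhs oU Ux; exists i => //.
  exact: subset_trans (@rbox_cbox i) iU.
Qed.

(** The topology and the product sigma-algebra of R^3 are independent structures on one type; the
    countable base of rational boxes connects them. *)
Lemma open_measurable3 (U : set (pt R)) : open U -> measurable (U : set (mpt R)).
Proof.
move=> oU; rewrite (open_bigcup_rbox oU) bigcup_mkcond.
apply: countable_bigcupT_measurable; first exact: countableP.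
by move=> i; case: ifP => _ //; exact: measurable_rbox.
Qed.

Lemma closed_measurable3 (U : set (pt R)) : closed U -> measurable (U : set (mpt R)).
Proof.
move=> cU; rewrite -(setCK U); apply: measurableC; apply: open_measurable3.
exact: closed_openC.
Qed.

Lemma continuous_measurable3 (f : pt R -> R) : continuous f ->
  measurable_fun setT (f : mpt R -> R).
Proof.
move=> /continuousP cf; apply: (measurability _ (RGenOpens.measurableE R)).
move=> _ [_ [a [b ->] <-]]; rewrite setTI; apply: open_measurable3.
by apply: cf; exact: interval_open.
Qed.

Lemma mpt_measurable_fun d (T : measurableType d) (f : T -> mpt R) :
  measurable_fun setT (fun x => (f x).1.1) ->
  measurable_fun setT (fun x => (f x).1.2) ->
  measurable_fun setT (fun x => (f x).2) -> measurable_fun setT f.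
Proof.
move=> h1 h2 h3; have := measurable_fun_pair (measurable_fun_pair h1 h2) h3.
by congr (measurable_fun _ _); apply/funext => x; case: (f x) => [[]].
Qed.

Lemma coord_measurable : [/\ measurable_fun setT (fun x : mpt R => x.1.1 : R),
  measurable_fun setT (fun x : mpt R => x.1.2 : R) &
  measurable_fun setT (fun x : mpt R => x.2 : R)].
Proof.
split; last exact: measurable_snd.
  exact: measurableT_comp measurable_fst measurable_fst.
exact: measurableT_comp measurable_snd measurable_fst.
Qed.

End Borel.

(** * Invariance of Lebesgue measure under translations and orthogonal maps *)

Section Invariance.
Variable R : realType.
Local Notation L := (@lebesgue_measure R).

(** The image of the measure under the shift agrees with it on half-open intervals, and these
    determine Lebesgue measure. *)
Lemma leb1_shift (t : R) (A : set (measurableTypeR R)) : measurable A ->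
  L [set x | A (x + t)] = L A.
Proof.
pose phi (x : measurableTypeR R) : measurableTypeR R := x + t.
have mphi : measurable_fun setT phi by exact: measurable_funD.
move=> mA; apply/esym; apply: (@lebesgue_measure_unique R
  (pushforward L phi)) => // X /ocitvP[->|[[a b] /= ab ->]].
  by rewrite !measure0.
rewrite /pushforward /= lebesgue_measure_itv /= lte_fin ab.
rewrite (_ : phi @^-1` _ = `]a - t, b - t]%classic); last first.
  by apply/seteqP; split=> x; rewrite /= !in_itv /= /phi => /andP[h1 h2]; apply/andP; split; lra.
by rewrite lebesgue_measure_itv /= lte_fin ltrD2r ab -!EFinB; congr (_%:E); ring.
Qed.

Lemma integral_shift (t : R) (f : measurableTypeR R -> \bar R) :
  measurable_fun setT f -> (forall x, 0 <= f x)%E ->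
  (\int[L]_x f ((x + t)%R : R) = \int[L]_x f x)%E.
Proof.
pose phi (x : measurableTypeR R) : measurableTypeR R := x + t.
have mphi : measurable_fun setT phi by exact: measurable_funD.
move=> mf f0; have := @ge0_integral_pushforward _ _ _ _ _ _ mphi L setT f measurableT mf (fun x _ => f0 x).
rewrite preimage_setT => <-; apply: eq_measure_integral => A mA _.
exact: leb1_shift.
Qed.

Lemma leb2_fubini (f : (measurableTypeR R * measurableTypeR R)%type -> \bar R) :
  measurable_fun setT f -> (forall x, 0 <= f x)%E ->
  (\int[leb2 R]_x f x = \int[L]_a \int[L]_b f (a, b))%E.
Proof. by move=> mf f0; have := @fubini_tonelli1 _ _ _ _ _ L L f mf f0. Qed.

Lemma leb3_fubini (f : mpt R -> \bar R) : measurable_fun setT f -> (forall x, 0 <= f x)%E ->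
  (\int[leb3 R]_x f x = \int[leb2 R]_y \int[L]_c f (y, c))%E.
Proof. by move=> mf f0; have := @fubini_tonelli1 _ _ _ _ _ (@sleb2 R) L f mf f0. Qed.

Lemma section_measurable d1 d2 (T1 : measurableType d1) (T2 : measurableType d2)
    (f : T1 * T2 -> \bar R) (x : T1) : measurable_fun setT f ->
  measurable_fun setT (fun y => f (x, y)).
Proof. by move=> mf; apply: measurableT_comp mf _; exact: measurable_fun_pair. Qed.

Lemma inner_measurable d1 (T1 : measurableType d1)
    (f : T1 * measurableTypeR R -> \bar R) : measurable_fun setT f ->
  (forall x, 0 <= f x)%E -> measurable_fun setT (fun x => \int[L]_y f (x, y))%E.
Proof. exact: measurable_fun_fubini_tonelli_F. Qed.

(** By Tonelli's theorem the three coordinates are shifted one after the other. *)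
Lemma integral_translate (a : pt R) (f : mpt R -> \bar R) :
  measurable_fun setT f -> (forall x, 0 <= f x)%E ->
  (\int[leb3 R]_x f ((x + a)%R : pt R) = \int[leb3 R]_x f x)%E.
Proof.
move=> mf f0; have [m1 m2 m3] := coord_measurable R.
have mfa : measurable_fun setT (fun x : mpt R => f ((x + a)%R : pt R)).
  by apply: measurableT_comp mf _; apply: mpt_measurable_fun => /=; exact: measurable_funD.
rewrite !leb3_fubini // (eq_integral (fun y : measurableTypeR R * measurableTypeR R =>
  \int[L]_c f ((y.1 + a.1.1)%R, (y.2 + a.1.2)%R, c))%E); last first.
  by move=> [y z] _ /=; rewrite -[RHS](integral_shift a.2) //; exact: section_measurable.
have mF := inner_measurable mf f0.
have mFa : measurable_fun setT (fun y : measurableTypeR R * measurableTypeR R =>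
    \int[L]_c f ((y.1 + a.1.1)%R, (y.2 + a.1.2)%R, c))%E.
  have mt : measurable_fun setT (fun y : measurableTypeR R * measurableTypeR R =>
    ((y.1 + a.1.1)%R : measurableTypeR R, (y.2 + a.1.2)%R : measurableTypeR R)).
    by apply: measurable_fun_pair; apply: measurable_funD.
  exact: measurableT_comp mF mt.
have F0 x : (0 <= \int[L]_c f (x, c))%E by apply: integral_ge0.
rewrite (leb2_fubini mFa (fun x => F0 ((x.1 + a.1.1)%R, (x.2 + a.1.2)%R))) (leb2_fubini mF F0).
under eq_integral => y _.
  rewrite (integral_shift a.1.2 (f := fun z => (\int[L]_c f ((y + a.1.1)%R, z, c))%E)).
  over.
- exact: section_measurable mF.
- by move=> ?; exact: F0.
rewrite (integral_shift a.1.1 (f := fun y => (\int[L]_z \int[L]_c f (y, z, c))%E)) //.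
- exact: inner_measurable mF F0.
- by move=> ?; apply: integral_ge0 => ? _; exact: F0.
Qed.

Lemma leb3_box (A B C : set (measurableTypeR R)) : measurable A -> measurable B ->
  measurable C -> (leb3 R ((A `*` B) `*` C) = L A * L B * L C)%E.
Proof.
move=> mA mB mC.
have := @product_measure1E _ _ _ _ _ (@sleb2 R) L (A `*` B) C (measurableX mA mB) mC.
by rewrite {1}/sleb2 => h; rewrite [LHS]h; congr (_ * _)%E; exact: product_measure1E.
Qed.

Lemma leb3_cube (a b : R) : a < b ->
  leb3 R ((`]a, b[%classic `*` `]a, b[%classic) `*` `]a, b[%classic) = ((b - a) ^+ 3)%:E.
Proof.
move=> ab; rewrite leb3_box // lebesgue_measure_itv /= lte_fin ab -!EFinB -!EFinM.
by congr (_%:E); ring.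
Qed.

(** Right multiplication of row vectors: when the rows of [e] are a frame, this sends frame
    coordinates to the vector, and [rot e^T] goes back. *)
Definition rot (e : 'M[R]_3) (x : pt R) : pt R := of_coords (coords x *m e).

Lemma coordsK : cancel (@coords R) (@of_coords R).
Proof. by case=> [[a b] c]; rewrite /of_coords /coords !mxE. Qed.

Lemma of_coordsK : cancel (@of_coords R) (@coords R).
Proof.
move=> y; apply/rowP => i; rewrite mxE.
by case: i => -[|[|[|//]]] h /=; congr (y _ _); exact/val_inj.
Qed.

Lemma coordsD (x y : pt R) : coords (x + y) = coords x + coords y.
Proof.
by apply/rowP => i; rewrite !mxE; case: i => -[|[|[|//]]] h.
Qed.

Lemma of_coordsD x y : of_coords (x + y) = of_coords x + of_coords y :> pt R.
Proof. by rewrite -[RHS]coordsK coordsD !of_coordsK. Qed.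

Lemma rotD e x y : rot e (x + y) = rot e x + rot e y.
Proof. by rewrite /rot coordsD mulmxDl of_coordsD. Qed.

Lemma rotK e e' : e *m e' = 1%:M -> cancel (rot e) (rot e').
Proof. by move=> h x; rewrite /rot of_coordsK -mulmxA h mulmx1 coordsK. Qed.

Lemma rotN e x : rot e (- x) = - rot e x.
Proof.
have r0 : rot e 0 = 0 by apply: (@addrI _ (rot e 0)); rewrite -rotD !addr0.
by apply/eqP; rewrite -addr_eq0 -rotD addNr r0.
Qed.

Lemma rot_measurable e : measurable_fun setT (rot e : mpt R -> mpt R).
Proof.
have [m1 m2 m3] := coord_measurable R.
have mc i : measurable_fun setT (fun x : mpt R => coords x 0 i : measurableTypeR R).
  by case: i => -[|[|[|//]]] h; [move: m1|move: m2|move: m3]; congr (measurable_fun _ _);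
    apply/funext => x; rewrite mxE.
have mr j : measurable_fun setT (fun x : mpt R => (coords x *m e) 0 j : measurableTypeR R).
  under eq_fun do rewrite mxE; apply: measurable_sum => i.
  exact: measurable_funM (mc i) (measurable_cst _).
by apply: mpt_measurable_fun; exact: mr.
Qed.

Definition sqlen (x : pt R) : R := \sum_i coords x 0 i ^+ 2.

Lemma sqlenE x : sqlen x = x.1.1 ^+ 2 + x.1.2 ^+ 2 + x.2 ^+ 2.
Proof. by rewrite /sqlen !big_ord_recr big_ord0 /= add0r !mxE. Qed.

Lemma sqlen_mx x : sqlen x = (coords x *m (coords x)^T) 0 0.
Proof. by rewrite mxE; apply: eq_bigr => i _; rewrite [(coords x)^T _ _]mxE expr2. Qed.

Lemma sqlen_rot e x : e *m e^T = 1%:M -> sqlen (rot e x) = sqlen x.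
Proof.
by move=> he; rewrite !sqlen_mx /rot of_coordsK trmx_mul mulmxA -(mulmxA _ e) he mulmx1.
Qed.

Lemma measurable_addf d (T : measurableType d) (f g : T -> mpt R) :
  measurable_fun setT f -> measurable_fun setT g ->
  measurable_fun setT (fun x => ((f x : pt R) + (g x : pt R))%R : mpt R).
Proof.
move=> mf mg; have [m1 m2 m3] := coord_measurable R.
apply: mpt_measurable_fun; apply: measurable_funD.
- exact: measurableT_comp m1 mf.
- exact: measurableT_comp m1 mg.
- exact: measurableT_comp m2 mf.
- exact: measurableT_comp m2 mg.
- exact: measurableT_comp m3 mf.
- exact: measurableT_comp m3 mg.
Qed.

Lemma measurable_translate (a : pt R) :
  measurable_fun setT (fun x : mpt R => ((x : pt R) + a)%R : mpt R).
Proof.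
have [m1 m2 m3] := coord_measurable R.
by apply: mpt_measurable_fun => /=; exact: measurable_funD.
Qed.

Lemma leb3_swap (f : mpt R * mpt R -> \bar R) : measurable_fun setT f ->
  (forall x, 0 <= f x)%E ->
  (\int[leb3 R]_x \int[leb3 R]_y f (x, y) = \int[leb3 R]_y \int[leb3 R]_x f (x, y))%E.
Proof. exact: (@fubini_tonelli _ _ _ _ _ (@sleb3 R) (@sleb3 R)). Qed.

(* Uniqueness of the Haar measure: integrating [f (rot e x) * g (y + rot e x)]
   in both orders compares the two sides through the rotation-invariant even
   function [f], the indicator of a Euclidean ball. *)
Lemma integral_rot (e : 'M[R]_3) (g : mpt R -> \bar R) : e *m e^T = 1%:M ->
  measurable_fun setT g -> (forall x, 0 <= g x)%E ->
  (\int[leb3 R]_x g (rot e x) = \int[leb3 R]_x g x)%E.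
Proof.
move=> he mg g0.
have he' : e^T *m e = 1%:M by apply: mulmx1C.
pose B := [set x : pt R | sqlen x < 1].
have msq : measurable_fun setT (sqlen : mpt R -> measurableTypeR R).
  have [m1 m2 m3] := coord_measurable R.
  rewrite (_ : sqlen = fun x => x.1.1 ^+ 2 + x.1.2 ^+ 2 + x.2 ^+ 2); last exact/funext/sqlenE.
  by apply: measurable_funD; first apply: measurable_funD; exact: measurable_funX.
have mB : measurable (B : set (mpt R)).
  have := msq measurableT `]-oo, 1[%classic (measurable_itv _).
  by rewrite setTI; congr measurable; apply/seteqP; split=> x; rewrite /= in_itv.
pose f (x : mpt R) : \bar R := (\1_B x)%:E.
have mf : measurable_fun setT f by apply/measurable_EFinP; exact: measurable_indic.
have f0 x : (0 <= f x)%E by rewrite lee_fin indicE.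
have sqlenN x : sqlen (- x) = sqlen x by rewrite !sqlenE /= !sqrrN.
have fN x : f (- x : pt R) = f x.
  rewrite /f !indicE; congr ((_ : bool)%:R%:E); apply/idP/idP; rewrite !inE /B /= sqlenN //.
have fr x : f (rot e x) = f x.
  by rewrite /f !indicE; congr ((_ : bool)%:R%:E); apply/idP/idP; rewrite !inE /B /= sqlen_rot.
have mr := rot_measurable e.
have intB : (\int[leb3 R]_x f x = leb3 R B)%E by rewrite integral_indic ?setIT.
have mcube (a b : R) : measurable ((`]a, b[%classic `*` `]a, b[%classic) `*` `]a, b[%classic : set (mpt R)).
  by do 2?apply: measurableX.
have sq (t r : R) : 0 < r -> t ^+ 2 < r ^+ 2 -> t \in `]- r, r[.
  move=> r0; rewrite in_itv /= -ltr_norml -[t ^+ 2]real_normK ?num_real //.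
  by rewrite ltr_pXn2r // nnegrE ?ltW.
(* The cubes of half-side 1 and 1/2 around 0 show that the unit ball has positive finite measure, by
   which the final identity is divided. *)
have leB : (leb3 R B <= 8%:E)%E.
  have -> : 8 = (1 - -1) ^+ 3 :> R by ring.
  rewrite -leb3_cube; last by lra.
  apply: le_measure; [exact: mem_set mB|exact: mem_set (mcube _ _)|].
  move=> x; rewrite /B /= sqlenE => h.
  have := sqr_ge0 x.1.1; have := sqr_ge0 x.1.2; have := sqr_ge0 x.2 => h1 h2 h3.
  by split; [split|]; apply: sq => //; rewrite expr1n; lra.
have geB : (0 < leb3 R B)%E.
  apply: (@lt_le_trans _ _ (leb3 R ((`](- (1/2) : R), 1/2[%classic `*` `](- (1/2)), 1/2[%classic) `*` `](- (1/2)), 1/2[%classic))).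
    by rewrite leb3_cube ?lte_fin ?exprn_gt0 //; lra.
  apply: le_measure; [exact: mem_set (mcube _ _)|exact: mem_set mB|].
  move=> x [[/=]]; rewrite !in_itv /= /B /= sqlenE -!ltr_norml => h1 h2 h3.
  have h (t : R) : `|t| < 1/2 -> t ^+ 2 < 1/4.
    move=> ht; rewrite -[t ^+ 2]real_normK ?num_real //.
    by rewrite (_ : 1/4 = (1/2) ^+ 2); [rewrite ltr_pXn2r // nnegrE; lra|field].
  by have := h _ h1; have := h _ h2; have := h _ h3; lra.
have mgr : measurable_fun setT (g \o rot e) by exact: measurableT_comp mg mr.
pose I := (\int[leb3 R]_x g (rot e x))%E.
pose J := (\int[leb3 R]_x g x)%E.
(* With y inside, the translation by rot e x disappears from the integral of g, and f is invariant
   under the rotation. *)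
have h1 : (\int[leb3 R]_x \int[leb3 R]_y (f (rot e x) * g ((y + rot e x)%R : pt R)) = leb3 R B * J)%E.
  transitivity (\int[leb3 R]_x (f x * J))%E.
    apply: eq_integral => x _.
    rewrite (@ge0_integralZl _ _ _ _ _ measurableT (fun y : mpt R => g ((y : pt R) + rot e x))) //.
      by rewrite fr integral_translate.
    apply: measurableT_comp mg _.
    exact: measurable_translate.
  rewrite ge0_integralZr //; first by rewrite intB.
  exact: integral_ge0.
have h2 : (\int[leb3 R]_y \int[leb3 R]_x (f (rot e x) * g ((y + rot e x)%R : pt R)) = I * leb3 R B)%E.
  transitivity (\int[leb3 R]_y \int[leb3 R]_x (f ((rot e x - y)%R : pt R) * g (rot e x)))%E.
    apply: eq_integral => y _.
    (* Translating x by a replaces rot e x by rot e x - y, so that y remains only in the argument of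
       the even function f. *)
    pose a : pt R := - rot e^T y.
    rewrite -(integral_translate a); last 2 first.
    - apply: emeasurable_funM; first exact: measurableT_comp.
      apply: measurableT_comp mg _.
      exact: (measurable_addf (f := cst y) (measurable_cst _) mr).
    - by move=> x; apply: mule_ge0.
    apply: eq_integral => x _; rewrite rotD rotN (rotK he').
    by congr (_ * g _)%E; rewrite addrC subrK.
  have mfs : measurable_fun setT (fun z : mpt R * mpt R => f ((rot e z.2 - z.1)%R : pt R)).
    rewrite (_ : (fun z => _) = fun z : mpt R * mpt R => f ((z.1 : pt R) + rot e (- z.2 : pt R))); last first.
      by apply/funext => z; rewrite -fN rotN opprB.
    apply: measurableT_comp mf _.
    have mN : measurable_fun setT (fun x : mpt R => - x : mpt R).
      have [m1 m2 m3] := coord_measurable R.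
      by apply: mpt_measurable_fun => /=; exact: measurableT_comp.
    apply: (measurable_addf measurable_fst).
    exact: measurableT_comp mr (measurableT_comp mN measurable_snd).
  rewrite (@leb3_swap (fun z => f ((rot e z.2 - z.1)%R : pt R) * g (rot e z.2))%E); last 2 first.
  - apply: emeasurable_funM mfs _; exact: measurableT_comp mgr measurable_snd.
  - by move=> z; apply: mule_ge0.
  transitivity (\int[leb3 R]_x (g (rot e x) * leb3 R B))%E.
    apply: eq_integral => x _; cbv beta.
    rewrite (eq_integral (fun y : mpt R => g (rot e x) * f (((y : pt R) + (- rot e x))%R))%E); last first.
      by move=> y _; rewrite muleC -fN opprB.
    rewrite (@ge0_integralZl _ _ _ _ _ measurableT (fun y : mpt R => f ((y : pt R) + - rot e x))) //.
      by rewrite integral_translate // intB.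
    apply: measurableT_comp mf _.
    exact: measurable_translate.
  by rewrite ge0_integralZr.
have h3 : (leb3 R B * J = I * leb3 R B)%E.
  rewrite -h1 -h2; apply: (@leb3_swap (fun z => f (rot e z.1) * g ((z.2 + rot e z.1)%R : pt R))%E).
    apply: emeasurable_funM.
      exact: measurableT_comp mf (measurableT_comp mr measurable_fst).
    apply: measurableT_comp mg _.
    apply: (measurable_addf measurable_snd).
    exact: measurableT_comp mr measurable_fst.
  by move=> z; apply: mule_ge0.
have fB : leb3 R B \is a fin_num by rewrite ge0_fin_numE // (le_lt_trans leB) ?ltry.
rewrite -/I -/J; move: h3 geB; rewrite -(fineK fB) muleC => h3 b0.
have b0' : 0 < fine (leb3 R B) by rewrite -lte_fin.
have := congr1 (fun z => z * ((fine (leb3 R B))^-1)%:E)%E h3.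
by rewrite -!muleA -!EFinM divff ?gt_eqF // !mule1.
Qed.

End Invariance.

(** * Smooth functions *)

Section SmoothFunctions.
Variable R : realType.
Local Notation P := (pt R).

Definition unitv (i : 'I_3) : P := of_coords (delta_mx 0 i).

Definition coordf (j : 'I_3) (x : P) : R := coords x 0 j.

Lemma coordf_is_linear j : linear (coordf j).
Proof.
by move=> a x y; rewrite /coordf !mxE; case: j => -[|[|[|//]]] h.
Qed.
HB.instance Definition _ j := GRing.isLinear.Build R P R _ (coordf j) (coordf_is_linear j).

Lemma coordf_continuous j : continuous (coordf j).
Proof.
have c1 : continuous (fun x : P => x.1.1).
  by move=> x; apply: (@cvg_comp _ _ _ (fst : P -> R * R) fst); exact: cvg_fst.
have c2 : continuous (fun x : P => x.1.2).
  by move=> x; apply: (@cvg_comp _ _ _ (fst : P -> R * R) snd); [exact: cvg_fst|exact: cvg_snd].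
have c3 : continuous (fun x : P => x.2) by move=> x; exact: cvg_snd.
case: j => -[|[|[|//]]] h;
  [suff -> : coordf (Ordinal h) = (fun x => x.1.1) by exact: c1
  |suff -> : coordf (Ordinal h) = (fun x => x.1.2) by exact: c2
  |suff -> : coordf (Ordinal h) = (fun x => x.2) by exact: c3];
  by apply/funext => x; rewrite /coordf mxE.
Qed.

Lemma coordf_unitv i j : coordf j (unitv i) = (i == j)%:R.
Proof. by rewrite /coordf of_coordsK mxE eqxx eq_sym. Qed.

Lemma coordfZ j a (x : P) : coordf j (a *: x) = a * coordf j x.
Proof. by rewrite /coordf !mxE; case: j => -[|[|[|//]]] h. Qed.

Lemma coordfD j (x y : P) : coordf j (x + y) = coordf j x + coordf j y.
Proof. by rewrite /coordf coordsD mxE. Qed.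

Lemma coordf_inj (x y : P) : (forall j, coordf j x = coordf j y) -> x = y.
Proof. by move=> h; rewrite -[x]coordsK -[y]coordsK; congr of_coords; apply/rowP => j; exact: h. Qed.

Lemma sum_unitv (x : P) : x = \sum_i coordf i x *: unitv i.
Proof.
apply: coordf_inj => j; rewrite linear_sum (bigD1 j) //= big1 ?addr0.
  by rewrite coordfZ coordf_unitv eqxx mulr1.
by move=> i /negPf ij; rewrite coordfZ coordf_unitv ij mulr0.
Qed.

Lemma coordf_differentiable j x : differentiable (coordf j) x.
Proof. exact/linear_differentiable/coordf_continuous. Qed.

Lemma diff_coordf j x v : 'd (coordf j) x v = coordf j v.
Proof. by rewrite diff_lin //; exact: coordf_continuous. Qed.

Definition rpart (i : 'I_3) (f : P -> R) : P -> R := fun x => 'D_(unitv i) f x.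

Lemma diff_rpart (f : P -> R) x v : differentiable f x ->
  'd f x v = \sum_i coordf i v * rpart i f x.
Proof.
move=> df; rewrite {1}(sum_unitv v) linear_sum; apply: eq_bigr => i _.
by rewrite linearZ /rpart deriveE.
Qed.

Definition rsmooth (f : P -> R) :=
  forall (l : seq 'I_3) x, differentiable (foldr rpart f l) x.

(** Iterated partial derivatives never have to be computed: it suffices to exhibit a class of
    differentiable functions that is closed under partial derivatives. *)
Lemma rsmooth_coind (Q : (P -> R) -> Prop) :
  (forall f, Q f -> (forall x, differentiable f x) /\ forall i, Q (rpart i f)) ->
  forall f, Q f -> rsmooth f.
Proof.
move=> hQ f Qf l; suff : Q (foldr rpart f l) by move=> /hQ[].
by elim: l => //= i l /hQ[_]; exact.
Qed.

Lemma rsmooth_diff f x : rsmooth f -> differentiable f x.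
Proof. by move=> /(_ [::] x). Qed.

Lemma rsmooth_continuous f : rsmooth f -> continuous f.
Proof. by move=> sf x; exact/differentiable_continuous/rsmooth_diff. Qed.

Lemma rsmooth_rpart f i : rsmooth f -> rsmooth (rpart i f).
Proof. by move=> sf l x; have := sf (rcons l i) x; rewrite foldr_rcons. Qed.

Lemma rpartD f g i : (forall x, differentiable f x) -> (forall x, differentiable g x) ->
  rpart i (f + g) = rpart i f + rpart i g.
Proof. by move=> df dg; apply/funext => x; rewrite /rpart deriveD //; exact: diff_derivable. Qed.

Lemma rpartM (f g : P -> R) i : (forall x, differentiable f x) -> (forall x, differentiable g x) ->
  rpart i (f * g) = f * rpart i g + g * rpart i f.
Proof. by move=> df dg; apply/funext => x; rewrite /rpart deriveM //; exact: diff_derivable. Qed.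

Lemma rpart_cst (a : R) i : rpart i (cst a) = cst 0.
Proof. by apply/funext => x; rewrite /rpart derive_cst. Qed.

Lemma rsmooth_cst (a : R) : rsmooth (cst a).
Proof.
apply: (rsmooth_coind (Q := fun f => exists a, f = cst a)); last by exists a.
move=> f [b ->]; split; first by move=> x; exact: differentiable_cst.
by move=> i; exists 0; rewrite rpart_cst.
Qed.

(** A class for [rsmooth_coind]: by the Leibniz rule, sums of products of smooth functions are
    closed under partial derivatives. *)
Inductive rsmooth_alg : (P -> R) -> Prop :=
| rsmooth_alg_mul f g : rsmooth f -> rsmooth g -> rsmooth_alg (f * g)
| rsmooth_alg_add f g : rsmooth_alg f -> rsmooth_alg g -> rsmooth_alg (f + g).

Lemma rsmooth_algP f : rsmooth_alg f -> rsmooth f.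
Proof.
apply: rsmooth_coind => {}f; elim=> [{}f g sf sg|{}f g _ [df hf] _ [dg hg]].
  split=> [x|i]; first by apply: differentiableM; exact: rsmooth_diff.
  rewrite rpartM; do ?by move=> x; exact: rsmooth_diff.
  by apply: rsmooth_alg_add; apply: rsmooth_alg_mul => //; exact: rsmooth_rpart.
split=> [x|i]; first exact: differentiableD.
by rewrite rpartD //; apply: rsmooth_alg_add.
Qed.

Lemma rsmoothM f g : rsmooth f -> rsmooth g -> rsmooth (f * g).
Proof. by move=> sf sg; apply/rsmooth_algP/rsmooth_alg_mul. Qed.

Lemma rsmoothD f g : rsmooth f -> rsmooth g -> rsmooth (f + g).
Proof.
move=> sf sg; apply: rsmooth_algP.
have h k : rsmooth k -> rsmooth_alg k.
  move=> sk; rewrite (_ : k = k * cst 1); last by apply/funext => x; rewrite mulrfctE mulr1.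
  by apply: rsmooth_alg_mul => //; exact: rsmooth_cst.
by apply: rsmooth_alg_add; exact: h.
Qed.

Lemma rsmoothZ (a : R) f : rsmooth f -> rsmooth (fun x => a * f x).
Proof. exact: (rsmoothM (rsmooth_cst a)). Qed.

Lemma rsmoothN f : rsmooth f -> rsmooth (- f).
Proof.
move=> /(rsmoothZ (-1)); congr rsmooth.
by apply/funext => x; rewrite mulN1r.
Qed.

(* The functions [t ^- k * exp (- 1 / t)], extended by 0 to the left. *)
Definition flat (k : nat) (t : R) : R :=
  if 0 < t then t ^- k * expR (- t^-1) else 0.

Lemma flat_ge0 k t : 0 <= flat k t.
Proof.
rewrite /flat; case: ltP => // t0; rewrite mulr_ge0 ?expR_ge0 // invr_ge0.
by rewrite exprn_ge0 // ltW.
Qed.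

Lemma flat0_gt0 t : (0 < flat 0 t) = (0 < t).
Proof.
rewrite /flat; case: (ltP 0 t) => t0; last by rewrite ltxx.
by rewrite expr0 invr1 mul1r expR_gt0.
Qed.

Lemma flat0_lt1 t : flat 0 t < 1.
Proof.
rewrite /flat; case: (ltP 0 t) => t0; last exact: ltr01.
by rewrite expr0 invr1 mul1r expR_lt1 oppr_lt0 invr_gt0.
Qed.

(** For t > 0, the exponential series gives exp (1/t) >= t^-(k+2) / (k+2)!. The quadratic bound
    yields the derivative 0 at the origin. *)
Lemma flat_le_sq k t : `|flat k t| <= (k.+2)`!%:R * t ^+ 2.
Proof.
rewrite ger0_norm ?flat_ge0 // /flat; case: ltP => t0; last by rewrite mulr_ge0 // sqr_ge0.
have ti : 0 <= t^-1 by rewrite invr_ge0 ltW.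
have := expR_ge1Dxn k.+1 ti => h.
have {}h : t^-1 ^+ k.+2 <= (k.+2)`!%:R * expR t^-1.
  rewrite mulrC -ler_pdivrMr; last by rewrite ltr0n fact_gt0.
  by apply: le_trans h; rewrite lerDr.
have tn : t != 0 by rewrite gt_eqF.
rewrite expRN ler_pdivrMr ?expR_gt0 // mulrAC -ler_pdivrMr ?exprn_gt0 //.
by apply: le_trans h; rewrite exprVn -invfM -exprD addn2.
Qed.

Lemma is_derive_le_sq (f : R -> R) (C : R) : 0 <= C -> f 0 = 0 ->
  (forall t, `|f t| <= C * t ^+ 2) -> is_derive (0 : R) 1 f 0.
Proof.
move=> C0 f0 fC.
have cv : h^-1 *: ((f \o shift 0) (h *: (1 : R)) - f 0) @[h --> (0 : R)^'] --> (0 : R).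
  apply/cvgrPdist_lt => e e0; have C1 : 0 < C + 1 by rewrite ltr_wpDl.
  near=> h.
  have h0 : h != 0 by near: h; exact: nbhs_dnbhs_neq.
  have he : `|h| < e / (C + 1) by near: h; apply: dnbhs0_lt; rewrite divr_gt0.
  rewrite sub0r normrN f0 subr0 /= addr0 -[_ *: _]/(_ * _) -[X in f X]/(h * 1) mulr1.
  rewrite normrM normfV mulrC ltr_pdivrMr ?normr_gt0 //.
  apply: le_lt_trans (fC h) _; rewrite -[h ^+ 2]real_normK ?num_real // expr2 mulrA.
  rewrite ltr_pM2r ?normr_gt0 //; move: he; rewrite ltr_pdivlMr // mulrC.
  by apply: le_lt_trans; rewrite ler_wpM2r // lerDl.
by split; [apply: cvgP cv|exact: cvg_lim cv].
Unshelve. all: by end_near. Qed.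

(** Differentiating t^-k exp (-1/t) raises the exponent by 1 or by 2: the reason for carrying the
    index k, as the family is closed under derivation. *)
Lemma is_derive_flat k (t : R) :
  is_derive t 1 (flat k) (- (k%:R * flat k.+1 t) + flat k.+2 t).
Proof.
have [t0|t0|->] := ltgtP t 0.
- apply: (@near_eq_is_derive _ _ _ (cst 0)).
    near=> s; rewrite /flat ltNge ltW //=; near: s; exact: lt_nbhsl.
  rewrite /flat !(ltNge 0 t) (ltW t0) /= mulr0 oppr0 addr0.
  exact: is_derive_cst.
- apply: (@near_eq_is_derive R R R ((fun s : R => s ^- k) * (fun s => expR (- s^-1)))).
    near=> s; rewrite /flat ifT //; near: s; exact: lt_nbhsr.
  rewrite /flat t0.
  have tn : t != 0 by rewrite gt_eqF.
  have d1 : is_derive t 1 (fun s : R => s^-1) (- t ^- 2).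
    by apply: is_derive_eq (is_deriveV (f := id) tn (is_derive_id _ _)) _; rewrite scaler1.
  have d2 : is_derive t 1 (fun s : R => s ^- k) (- (k%:R * t ^- k.+1)).
    have tk : t ^+ k != 0 by rewrite expf_neq0.
    have := is_deriveV (f := fun s => s ^+ k) tk (@DeriveDef R R R t 1 _ _ (@exprn_derivable R k t 1) (@exp_derive R k t 1)).
    move=> h; apply: (is_derive_eq h).
    rewrite -[LHS]/(- t ^+ k ^- 2 * (k%:R * t ^+ k.-1 * 1)) mulr1 mulNr; congr (- _).
    case: k tk {h} => [|k] tk; first by rewrite !mul0r mulr0.
    rewrite mulrCA; congr (_ * _); have -> : t ^+ k.+1 ^+ 2 = t ^+ k.+2 * t ^+ k.
      by rewrite -exprM -exprD; congr (_ ^+ _); rewrite addSnnS addnn muln2.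
    by rewrite invfM -mulrA mulVf ?mulr1 // expf_neq0.
  have d3 : is_derive t 1 (fun s : R => expR (- s^-1)) (t ^- 2 * expR (- t^-1)).
    have := is_derive1_comp (f := expR) (g := - (fun s => s^-1)) (is_derive_expR (- t^-1)) (is_deriveN d1).
    by move=> h; apply: (is_derive_eq h); rewrite opprK mulrC.
  have h := is_deriveM d2 d3; apply: (is_derive_eq h).
  rewrite -[_ *: _]/(_ * _) -[X in _ + X]/(_ * _) addrC; congr (_ + _).
    by rewrite mulrN mulrC mulrA.
  by rewrite mulrA -invfM -exprD addn2.
rewrite /flat ltxx mulr0 oppr0 addr0.
apply: (@is_derive_le_sq _ (k.+2)`!%:R) => //; first by rewrite /flat ltxx.
exact: flat_le_sq.
Unshelve. all: by end_near. Qed.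

End SmoothFunctions.

(** * Smooth bumps on cubes *)

Section Bump.
Variable R : realType.
Local Notation P := (pt R).

Lemma derive_comp1 (m : R -> R) (l : P -> R) x v dm : is_derive (l x) 1 m dm ->
  differentiable l x -> differentiable (m \o l) x /\ 'D_v (m \o l) x = 'D_v l x * dm.
Proof.
move=> [hm hd] hl; have dm' : differentiable m (l x) by apply/derivable1_diffP.
have dc : differentiable (m \o l) x by exact: differentiable_comp.
split=> //; rewrite deriveE // diff_comp //= deriveE // diff1E //=.
by rewrite derive1E hd.
Qed.

Definition affine (j : 'I_3) (s a : R) (x : P) : R := s * (coordf j x - a).

Lemma affine_diff j s a x : differentiable (affine j s a) x.
Proof.
apply: differentiableM; first exact: differentiable_cst.
by apply: differentiableB; [exact: coordf_differentiable|exact: differentiable_cst].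
Qed.

Lemma rpart_affine i j s a x : rpart i (affine j s a) x = s * (i == j)%:R.
Proof.
rewrite /rpart (_ : affine j s a = s *: (coordf j - cst a)); last exact/funext.
have d1 := coordf_differentiable j x.
rewrite deriveZ; last by apply/diff_derivable/differentiableB => //; exact: differentiable_cst.
rewrite deriveB; [|exact: diff_derivable|exact: derivable_cst].
by rewrite derive_cst subr0 deriveE // diff_coordf coordf_unitv.
Qed.

(** The class given to [rsmooth_coind]: a partial derivative of a flat function of one affine
    coordinate is a linear combination of such functions. *)
Inductive flats : (P -> R) -> Prop :=
| flats_gen k j s a : flats (flat k \o affine j s a)
| flats_scale c f : flats f -> flats (fun x => c * f x)
| flats_add f g : flats f -> flats g -> flats (f + g).

Lemma flats_smooth f : flats f -> rsmooth f.
Proof.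
apply: rsmooth_coind => {}f; elim=> [k j s a|c {}f _ [df hf]|{}f g _ [df hf] _ [dg hg]].
- split=> [x|i].
    exact: (derive_comp1 0 (is_derive_flat k _) (affine_diff j s a x)).1.
  rewrite (_ : rpart i _ = (fun x => (s * (i == j)%:R) *
    ((fun y => - k%:R * (flat k.+1 \o affine j s a) y) + (flat k.+2 \o affine j s a)) x)).
    by apply: flats_scale; apply: flats_add; [apply: flats_scale|]; exact: flats_gen.
  apply/funext => x; rewrite /rpart (derive_comp1 _ (is_derive_flat k _) (affine_diff j s a x)).2.
  by rewrite -/(rpart i _ x) rpart_affine addrfctE mulNr.
- split=> [x|i]; first by apply: differentiableM => //; exact: differentiable_cst.
  rewrite (_ : rpart i _ = fun x => c * rpart i f x); first exact: flats_scale.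
  by apply/funext => x; rewrite /rpart (deriveZ (f := f)) //; exact: diff_derivable.
- split=> [x|i]; first exact: differentiableD.
  by rewrite rpartD //; exact: flats_add.
Qed.

Lemma rsmooth_prod (I : Type) (s : seq I) (F : I -> P -> R) :
  (forall i, rsmooth (F i)) -> rsmooth (fun x => \prod_(i <- s) F i x).
Proof.
move=> hF; elim: s => [|i s IH].
  by under eq_fun do rewrite big_nil; exact: rsmooth_cst.
by under eq_fun do rewrite big_cons; exact: rsmoothM.
Qed.

Definition bump (q : P) (r : R) (x : P) : R :=
  \prod_(j < 3) (flat 0 (coordf j x - (coordf j q - r)) * flat 0 (coordf j q + r - coordf j x)).

Lemma bump_smooth q r : rsmooth (bump q r).
Proof.
apply: rsmooth_prod => j; apply: rsmoothM.
  have := flats_smooth (flats_gen 0 j 1 (coordf j q - r)).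
  by congr rsmooth; apply/funext => x; rewrite /= /affine mul1r.
have := flats_smooth (flats_gen 0 j (-1) (coordf j q + r)).
by congr rsmooth; apply/funext => x; rewrite /= /affine mulN1r opprB.
Qed.

Lemma bump_ge0 q r x : 0 <= bump q r x.
Proof. by apply: prodr_ge0 => j _; rewrite mulr_ge0 ?flat_ge0. Qed.

(** All factors lie in [0, 1) and one of them is kept. The strict bound gives 0 < 1 - bump, so the
    powers of 1 - bump tend to 0 where the bump is positive. *)
Lemma bump_lt1 q r x : bump q r x < 1.
Proof.
apply: (@le_lt_trans _ _ (flat 0 (coordf 0 x - (coordf 0 q - r)))); last exact: flat0_lt1.
have h (t s : R) : flat 0 t * flat 0 s <= flat 0 t.
  by rewrite ler_piMr ?flat_ge0 // ltW // flat0_lt1.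
have h1 (t s : R) : flat 0 t * flat 0 s <= 1 by apply: le_trans (h t s) _; rewrite ltW // flat0_lt1.
rewrite /bump (bigD1 ord0) //=.
apply: (@le_trans _ _ (flat 0 (coordf 0 x - (coordf 0 q - r)) * flat 0 (coordf 0 q + r - coordf 0 x))); last exact: h.
rewrite ler_piMr ?mulr_ge0 ?flat_ge0 //.
by apply: prodr_ile1 => j _; rewrite mulr_ge0 ?flat_ge0 //= h1.
Qed.

Lemma bump_gt0 q r x : (0 < bump q r x) = [forall j, `|coordf j x - coordf j q| < r].
Proof.
apply/idP/forallP => [h j|h]; last first.
  apply: prodr_gt0 => j _; have := h j; rewrite ltr_distl => /andP[h1 h2].
  by rewrite mulr_gt0 // flat0_gt0 subr_gt0.
have : bump q r x != 0 by rewrite gt_eqF.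
rewrite prodf_seq_neq0 => /allP /(_ j); rewrite mem_index_enum => /(_ isT) /=.
rewrite mulf_eq0 negb_or => /andP[h1 h2].
rewrite ltr_distl; apply/andP; split; rewrite -subr_gt0 -flat0_gt0 lt_def flat_ge0 andbT //.
Qed.

End Bump.

(** * Smooth complex functions and test functions *)

Section SmoothComplex.
Variable R : realType.
Local Notation P := (pt R).
Local Notation C := R[i].

Lemma part_dpartial b i (f : P -> C) : part b (dpartial i f) = rpart i (part b f).
Proof. by case: b. Qed.

Lemma smoothP (f : P -> C) : smooth f <-> forall b, rsmooth (part b f).
Proof.
have h l b : part b (foldr (@dpartial R) f l) = foldr (@rpart R) (part b f) l.
  by elim: l => //= i l IH; rewrite part_dpartial IH.
split=> [sf b l x|sf l x]; last first.
  by split; [have := sf false l x|have := sf true l x]; rewrite -h.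
by rewrite -h; have [h1 h2] := sf l x; case: b.
Qed.

Lemma part_cplx (u v : P -> R) b : part b (fun x => (u x +i* v x)%C) = if b then v else u.
Proof. by case: b. Qed.

Lemma smooth_real (u : P -> R) : rsmooth u -> smooth (fun x => (u x)%:C%C).
Proof.
by move=> su; apply/smoothP => b; rewrite part_cplx; case: b => //; exact: rsmooth_cst.
Qed.

Lemma smooth_dpartial i (f : P -> C) : smooth f -> smooth (dpartial i f).
Proof. by move=> /smoothP h; apply/smoothP => b; rewrite part_dpartial; exact: rsmooth_rpart. Qed.

Lemma smoothD (f g : P -> C) : smooth f -> smooth g -> smooth (f + g).
Proof. by move=> /smoothP hf /smoothP hg; apply/smoothP => b; rewrite partD; exact: rsmoothD. Qed.

Lemma partM b (f g : P -> C) x : part b (f * g) x =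
  if b then part false f x * part true g x + part true f x * part false g x
  else part false f x * part false g x - part true f x * part true g x.
Proof.
rewrite /part -[(f * g) x]/(f x * g x); case: (f x) (g x) => [a a'] [c c'].
by case: b.
Qed.

Lemma smoothM (f g : P -> C) : smooth f -> smooth g -> smooth (f * g).
Proof.
move=> /smoothP hf /smoothP hg; apply/smoothP => b.
rewrite (_ : part b (f * g) = if b
    then part false f * part true g + part true f * part false g
    else part false f * part false g + - (part true f * part true g)).
  by case: b; apply: rsmoothD; do ?apply: rsmoothN; exact: rsmoothM.
by apply/funext => x; rewrite partM; case: b.
Qed.

Lemma smooth_cst (c : C) : smooth (cst c).
Proof.
apply/smoothP => b; have -> : part b (cst c : P -> C) = cst (if b then complex.Im c else complex.Re c).
  by apply: funext => x; case: b.
exact: rsmooth_cst.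
Qed.

Lemma smoothZ c (f : P -> C) : smooth f -> smooth (fun x => c * f x).
Proof. exact: (smoothM (smooth_cst c)). Qed.

Lemma smoothN (f : P -> C) : smooth f -> smooth (- f).
Proof. by move=> /(smoothZ (-1)); congr smooth; apply/funext => x; rewrite mulN1r. Qed.

Lemma smooth_part b (f : P -> C) : smooth f -> rsmooth (part b f).
Proof. by move/smoothP. Qed.

Lemma dpartialM i (f g : P -> C) : smooth f -> smooth g ->
  dpartial i (f * g) = f * dpartial i g + dpartial i f * g.
Proof.
move=> /smoothP hf /smoothP hg; apply/funext => x.
have d (k : P -> R) : rsmooth k -> forall y, differentiable k y.
  by move=> sk y; exact: rsmooth_diff.
have dd b1 b2 y : differentiable (part b1 f * part b2 g) y.
  by apply: differentiableM; exact: rsmooth_diff.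
have rN (k : P -> R) : (forall y, differentiable k y) -> rpart i (- k) = - rpart i k.
  by move=> dk; apply/funext => y; rewrite /rpart deriveN //; exact: diff_derivable.
have e k : dpartial i k x = (rpart i (part false k) x +i* rpart i (part true k) x)%C by [].
have h b : part b (dpartial i (f * g)) x = part b (f * dpartial i g + dpartial i f * g) x.
  rewrite part_dpartial (_ : part b (f * g) = if b
    then part false f * part true g + part true f * part false g
    else part false f * part false g + - (part true f * part true g)); last first.
    by apply/funext => y; rewrite partM; case: b.
  rewrite [RHS]/part -[(_ + _) x]/(f x * dpartial i g x + dpartial i f x * g x) !e.
  case: b.
    rewrite rpartD // !rpartM; do ?exact: d.
    rewrite -[LHS]/((part false f x * rpart i (part true g) x + part true g x * rpart i (part false f) x)
      + (part true f x * rpart i (part false g) x + part false g x * rpart i (part true f) x)).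
    move: (rpart i _ x) (rpart i _ x) (rpart i _ x) (rpart i _ x) => p1 p2 p3 p4.
    by rewrite /part; case: (f x) (g x) => [a a'] [c c'] /=; ring.
  rewrite rpartD ?rN // ?rpartM; do ?exact: d; last by move=> y; exact: differentiableN.
  rewrite -[LHS]/((part false f x * rpart i (part false g) x + part false g x * rpart i (part false f) x)
      - (part true f x * rpart i (part true g) x + part true g x * rpart i (part true f) x)).
  move: (rpart i _ x) (rpart i _ x) (rpart i _ x) (rpart i _ x) => p1 p2 p3 p4.
  by rewrite /part; case: (f x) (g x) => [a a'] [c c'] /=; ring.
exact: part_inj h.
Qed.

End SmoothComplex.

Section TestFunctions.
Variables (R : realType) (Omega : set (pt R)).
Local Notation P := (pt R).
Local Notation C := R[i].

Lemma testD (f g : P -> C) : test_function Omega f -> test_function Omega g -> test_function Omega (f + g).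
Proof.
move=> [sf [K [cK KO fK]]] [sg [K' [cK' KO' gK]]]; split; first exact: smoothD.
exists (K `|` K'); split; first exact: compactU.
  by move=> x [/KO|/KO'].
by move=> x /not_orP[/fK h1 /gK h2]; rewrite addrfctE h1 h2 addr0.
Qed.

Lemma testM (f g : P -> C) : smooth f -> test_function Omega g -> test_function Omega (f * g).
Proof.
move=> sf [sg [K [cK KO gK]]]; split; first exact: smoothM.
by exists K; split=> // x /gK; rewrite mulrfctE => ->; rewrite mulr0.
Qed.

Lemma testZ c (f : P -> C) : test_function Omega f -> test_function Omega (fun x => c * f x).
Proof. exact: (testM (smooth_cst c)). Qed.

Lemma test0 : test_function Omega (fun=> 0 : C).
Proof.
split; first exact: smooth_cst.
by exists set0; split=> //; exact: compact0.
Qed.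

Lemma test_dpartial i (f : P -> C) : test_function Omega f -> test_function Omega (dpartial i f).
Proof.
move=> [sf [K [cK KO fK]]]; split; first exact: smooth_dpartial.
exists K; split=> // x nKx; have oK : open (~` K).
  by apply: closed_openC; apply: compact_closed => //; exact: norm_hausdorff.
have nz : \forall y \near x, 0 = f y.
  have : nbhs x (~` K) by exact: open_nbhs_nbhs.
  by apply: filterS => y /fK.
have h b : 'D_(unitv R i) (part b f) x = 0.
  rewrite -(near_eq_derive (f := cst 0)); first by rewrite derive_cst.
  by apply: filterS nz => y; rewrite /part => <-; case: b.
by rewrite /dpartial; move: (h true) (h false); rewrite /part /unitv => -> ->.
Qed.

End TestFunctions.

Section Bounded.
Variable R : realType.
Local Notation P := (pt R).

Definition cube (M : R) : set P := (`[- M, M]%classic `*` `[- M, M]%classic) `*` `[- M, M]%classic.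

Lemma cube_compact M : compact (cube M).
Proof. by do 2?apply: compact_setX; exact: segment_compact. Qed.

Lemma cubeP M x : cube M x <-> forall j, `|coordf j x| <= M.
Proof.
split=> [[[/= h1 h2] h3] j|h].
  by rewrite /coordf mxE ler_norml; case: j => -[|[|[|//]]] /=;
    rewrite ?in_itv /= in h1 h2 h3 *.
by split; [split|]; rewrite /= in_itv /= -ler_norml;
  [move: (h 0)|move: (h 1)|move: (h 2%R)]; rewrite /coordf mxE.
Qed.

Lemma bounded_cube (A : set P) : bounded_set A -> exists2 M, 0 < M & A `<=` cube M.
Proof.
move=> [M [Mr hM]]; exists (`|M| + 1); first by rewrite ltr_wpDl.
have M1 : M < `|M| + 1 by rewrite (le_lt_trans (ler_norm M)) // ltrDl.
move=> x Ax; have := hM _ M1 x Ax; rewrite /= prod_normE ge_max prod_normE ge_max.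
by move=> /andP[/andP[h1 h2] h3]; split; [split|]; rewrite /= in_itv /= -ler_norml.
Qed.

Lemma continuous_bounded (f : P -> R) (A : set P) : continuous f -> bounded_set A ->
  exists2 c, 0 <= c & forall x, A x -> `|f x| <= c.
Proof.
move=> cf /bounded_cube[M M0 AM].
have [K [Kr hK]] : bounded_set (f @` cube M).
  apply/compact_bounded/continuous_compact; last exact: cube_compact.
  exact: continuous_subspaceT.
exists (`|K| + 1); first by rewrite addr_ge0.
move=> x /AM cx; have K1 : K < `|K| + 1 by rewrite (le_lt_trans (ler_norm K)) // ltrDl.
by apply: (hK _ K1); exists x.
Qed.

Lemma leb3_cube_fin M : (leb3 R (cube M) < +oo)%E.
Proof.
rewrite leb3_box // !lebesgue_measure_itv /=.
by case: ifP => _; rewrite -?EFinB -?EFinM ?mule0 ltry.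
Qed.

Lemma cube_measurable M : measurable (cube M : set (mpt R)).
Proof. by do 2?apply: measurableX. Qed.

Lemma bounded_leb3_fin (A : set P) : measurable (A : set (mpt R)) -> bounded_set A ->
  (leb3 R A < +oo)%E.
Proof.
move=> mA /bounded_cube[M _ AM]; apply: le_lt_trans (leb3_cube_fin M).
by apply: le_measure => //; rewrite inE //; exact: cube_measurable.
Qed.

Lemma continuous_rL2 (mu : {measure set (mpt R) -> \bar R}) (D : set P) (f : P -> R) :
  measurable (D : set (mpt R)) -> (mu D < +oo)%E -> bounded_set D -> continuous f ->
  rL2 mu (D : set (mpt R)) f.
Proof.
move=> mD fD bD cf; have [c c0 hc] := continuous_bounded cf bD.
have mf : measurable_fun (D : set (mpt R)) f.
  by apply: measurable_funTS; exact: continuous_measurable3.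
split=> //; apply: (@le_lt_trans _ _ (\int[mu]_(x in (D : set (mpt R))) (cst (c ^+ 2)%:E) x)%E).
  apply: ge0_le_integral => //.
  - by move=> x _; rewrite lee_fin sqr_ge0.
  - by apply/measurable_EFinP/measurable_funX.
  - move=> x Dx; rewrite lee_fin -[f x ^+ 2]real_normK ?num_real //.
    by rewrite ler_pXn2r ?nnegrE //; exact: hc.
by rewrite integral_cst // lte_mul_pinfty // lee_fin sqr_ge0.
Qed.

Lemma smooth_L2 (mu : {measure set (mpt R) -> \bar R}) (D : set P) (f : P -> R[i]) :
  measurable (D : set (mpt R)) -> (mu D < +oo)%E -> bounded_set D -> smooth f ->
  L2 mu (D : set (mpt R)) f.
Proof.
move=> mD fD bD /smoothP sf; apply/L2P => // b; apply: continuous_rL2 => //.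
exact: rsmooth_continuous.
Qed.

End Bounded.

(** Dominated convergence in the form used twice: for difference quotients, and for test functions
    that tend to an indicator. *)
Lemma integral_limit0 d (T : measurableType d) (R : realType)
    (mu : {measure set T -> \bar R}) (D : set T) (f_ : nat -> T -> R) (f g : T -> R) :
  measurable D -> (forall n, measurable_fun D (f_ n)) -> measurable_fun D f ->
  mu.-integrable D (EFin \o g) -> (forall x, D x -> f_ ^~ x @ \oo --> f x) ->
  (forall n x, D x -> `|f_ n x| <= g x) ->
  (forall n, (\int[mu]_(x in D) (f_ n x)%:E = 0)%E) ->
  (\int[mu]_(x in D) (f x)%:E = 0)%E.
Proof.
move=> mD mf_ mf ig cf bf z.
have m1 n : measurable_fun D (EFin \o f_ n) by apply/measurable_EFinP; exact: mf_.
have m2 : measurable_fun D (EFin \o f) by apply/measurable_EFinP.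
have c : \forall x \ae mu, D x -> (EFin \o f_ n) x @[n --> \oo] --> (EFin \o f) x.
  by apply: nearW => x Dx; apply: cvg_EFin; [exact: nearW|exact: cf].
have b : \forall x \ae mu, forall n, D x -> (`|(EFin \o f_ n) x| <= (EFin \o g) x)%E.
  by apply: nearW => x n Dx; rewrite /= lee_fin; exact: bf.
have [_ _] := dominated_convergence mD m1 m2 c ig b.
rewrite (_ : [sequence _]_n = cst 0%E); last by apply/funext => n; rewrite /= z.
by move=> h; apply: (cvg_unique _ h); [exact: ereal_hausdorff|exact: cvg_cst].
Qed.

(** * The integral of a partial derivative with compact support *)

Section PartialIntegral.
Variable R : realType.
Local Notation P := (pt R).

Lemma is_derive_line (V : normedModType R) (f : V -> R) (x v : V) (t : R) :
  derivable f (x + t *: v) v ->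
  is_derive t 1 (fun s => f (x + s *: v)) ('D_v f (x + t *: v)).
Proof.
move=> df.
have E : (fun h : R => h^-1 *: (((fun s => f (x + s *: v)) \o shift t) (h *: (1 : R)) - f (x + t *: v))) =
    (fun h : R => h^-1 *: ((f \o shift (x + t *: v)) (h *: v) - f (x + t *: v))).
  apply/funext => h; congr (_ *: (f _ - _)) => /=.
  by rewrite -[h *: 1]/(h * 1) mulr1 scalerDl addrCA.
split; first by rewrite /derivable E.
by rewrite {1}/derive E.
Qed.

Lemma integral_translate_sgn (a : P) (f : P -> R) : measurable_fun setT (f : mpt R -> R) ->
  (\int[leb3 R]_x (f ((x : P) + a))%:E = \int[leb3 R]_x (f x)%:E)%E.
Proof.
move=> mf; have mE : measurable_fun setT ((EFin \o f) : mpt R -> \bar R) by apply/measurable_EFinP.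
rewrite integralE [RHS]integralE; congr (_ - _)%E.
  have := integral_translate a (measurable_funepos mE) (fun x => funepos_ge0 _ x).
  by move=> <-; apply: eq_integral => x _; rewrite !funeposE.
have := integral_translate a (measurable_funeneg mE) (fun x => funeneg_ge0 _ x).
by move=> <-; apply: eq_integral => x _; rewrite !funenegE.
Qed.

Lemma cube_translate M (x a : P) j : 0 <= M ->
  cube M (x + a) -> (forall i, `|coordf i a| <= 1) -> `|coordf j x| <= M + 1.
Proof.
move=> M0 /cubeP h ha; have := h j; rewrite coordfD => h1.
have := ler_normB (coordf j x + coordf j a) (coordf j a).
by rewrite addrK; have := ha j; lra.
Qed.

(** The difference quotients have integral 0 by translation invariance. The mean value theorem
    bounds them by a multiple of the indicator of a cube, and they converge to the partial
    derivative. *)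
Lemma integral_rpart0 (f : P -> R) (K : set P) i : rsmooth f -> compact K ->
  (forall x, ~ K x -> f x = 0) -> (\int[leb3 R]_x (rpart i f x)%:E = 0)%E.
Proof.
move=> sf /compact_bounded/bounded_cube[M M0 KM] f0.
have cf := rsmooth_continuous sf; have cd := rsmooth_continuous (rsmooth_rpart i sf).
(* M + 2: the mean value point lies within 1 of a point of the cube M + 1. *)
have [c c0 hc] := continuous_bounded cd (compact_bounded (@cube_compact R (M + 2))).
pose t (n : nat) : R := n.+1%:R^-1.
have t0 n : 0 < t n by rewrite invr_gt0.
have t1 n : t n <= 1 by rewrite invf_le1 // ler1n.
pose g n (x : mpt R) : \bar R := ((t n)^-1 * (f ((x : P) + t n *: unitv R i) - f x))%:E.
have mf : measurable_fun setT (f : mpt R -> R) by exact: continuous_measurable3.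
have mft n : measurable_fun setT (fun x : mpt R => f ((x : P) + t n *: unitv R i)).
  exact: measurableT_comp mf (measurable_translate (t n *: unitv R i)).
have mg n : measurable_fun setT (g n).
  by apply/measurable_EFinP; apply: measurable_funM => //; exact: measurable_funB.
have nf (x : P) : ~ cube M x -> f x = 0 by move=> h; apply: f0 => /KM.
have line (x : P) (s : R) : is_derive s 1 (fun s => f (x + s *: unitv R i)) (rpart i f (x + s *: unitv R i)).
  by apply: is_derive_line; apply/diff_derivable/rsmooth_diff.
have coordt j s : `|s| <= 1 -> `|coordf j (s *: unitv R i)| <= 1.
  move=> s1; rewrite coordfZ coordf_unitv normrM; case: eqP => _.
    by rewrite normr1 mulr1.
  by rewrite normr0 mulr0.
(* Off the cube M + 1 both values of f are 0, because the step t n is at most 1. *)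
have hg n x : (`|g n x| <= (c%:E * (\1_(cube (M + 1)) x)%:E))%E.
  rewrite -EFinM lee_fin.
  have [cx|ncx] := pselect (cube (M + 1) x); last first.
    rewrite indicE memNset // mulr0 nf; last first.
      move=> h; apply: ncx; apply/cubeP => j.
      by apply: (@cube_translate M x (t n *: unitv R i)) => //; [exact: ltW|move=> k; apply: coordt; rewrite gtr0_norm].
    rewrite nf ?subr0 ?mulr0 ?normr0 // => h; apply: ncx; apply/cubeP => j.
    by move/cubeP: h => /(_ j) h; rewrite (le_trans h) // lerDl.
  rewrite indicE mem_set // mulr1 normrM gtr0_norm ?invr_gt0 // mulrC ler_pdivrMr //.
  have m2 : {within `[0, t n], continuous (fun s : R => f ((x : P) + s *: unitv R i))}.
    apply: continuous_subspaceT => s; apply/differentiable_continuous/derivable1_diffP.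
    by have [] := line x s.
  have [s] := MVT_segment (ltW (t0 n)) (fun s _ => line x s) m2.
  rewrite in_itv /= scale0r addr0 subr0 => /andP[s0 s1] ->.
  rewrite normrM (gtr0_norm (t0 n)); apply: ler_wpM2r; [exact: ltW|apply: hc].
  apply/cubeP => j; rewrite coordfD (le_trans (ler_normD _ _)) //.
  move/cubeP: cx => /(_ j) cx; have := coordt j s; rewrite ger0_norm // (le_trans s1) //.
  by move=> /(_ isT); move: cx; lra.
have gcvg (x : P) : (fun n => (t n)^-1 * (f (x + t n *: unitv R i) - f x)) @ \oo --> rpart i f x.
  have := line x 0; rewrite scale0r addr0 => -[dl vl].
  have tcv : t @ \oo --> (0 : R)^'.
    move=> A [e /= e0 hA]; have [N _ hN] := near_infty_natSinv_lt (PosNum e0).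
    exists N => // n Nn; apply: hA => /=; last by rewrite gt_eqF.
    by rewrite sub0r normrN gtr0_norm //; exact: hN.
  have := cvg_comp _ _ tcv dl; rewrite -/(derive _ _ _) vl.
  apply: cvg_trans; apply: near_eq_cvg; apply: nearW => n /=.
  by rewrite -[_ *: _]/(_ * _) -[t n *: 1]/(t n * 1) mulr1 addr0 scale0r addr0.
have icube : (leb3 R).-integrable setT (EFin \o (fun x : mpt R => c * \1_(cube (M + 1)) x)).
  apply/integrableP; split.
    apply/measurable_EFinP; apply: measurable_funM => //.
    by apply: measurable_indic; exact: cube_measurable.
  under eq_integral => x _.
    rewrite /= ger0_norm; last by rewrite mulr_ge0.
    rewrite EFinM; over.
  rewrite ge0_integralZl //; last first.
    by apply/measurable_EFinP/measurable_indic; exact: cube_measurable.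
  rewrite integral_indic ?setIT //; last exact: cube_measurable.
  by rewrite lte_mul_pinfty //; exact: leb3_cube_fin.
apply: (@integral_limit0 _ (mpt R) R (leb3 R) setT (fun n x => (t n)^-1 * (f ((x : P) + t n *: unitv R i) - f x)) (rpart i f) (fun x => c * \1_(cube (M + 1)) x)).
- exact: measurableT.
- by move=> n; apply/measurable_EFinP; exact: mg.
- exact: continuous_measurable3.
- exact: icube.
- by move=> x _; exact: gcvg.
- by move=> n x _; have := hg n x; rewrite -EFinM lee_fin.
move=> n.
have intf a : (leb3 R).-integrable setT (fun x : mpt R => (f ((x : P) + a))%:E).
  have mEf : measurable_fun setT (fun x : mpt R => `|(f x)%:E|%E).
    by apply: measurableT_comp => //; apply/measurable_EFinP.
  apply/integrableP; split.
    by apply/measurable_EFinP; exact: measurableT_comp mf (measurable_translate a).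
  rewrite (integral_translate a mEf (fun x => abse_ge0 _)).
  have [c' c'0 hc'] := continuous_bounded cf (compact_bounded (@cube_compact R M)).
  apply: (@le_lt_trans _ _ (integral (leb3 R) setT (fun x : mpt R => c'%:E * (\1_(cube M : set (mpt R)) x)%:E)%E)).
    apply: ge0_le_integral => //.
    - apply: measurable_funeM; apply/measurable_EFinP/measurable_indic; exact: cube_measurable.
    - move=> x _; rewrite -EFinM lee_fin indicE.
      have [cx|ncx] := pselect (cube M x); first by rewrite mem_set // mulr1; exact: hc'.
      by rewrite memNset // mulr0 nf // normr0.
  rewrite ge0_integralZl //; last first.
    by apply/measurable_EFinP/measurable_indic; exact: cube_measurable.
  rewrite integral_indic ?setIT //; last exact: cube_measurable.
  by rewrite lte_mul_pinfty //; exact: leb3_cube_fin.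
under eq_integral do rewrite EFinM.
have i0 : (leb3 R).-integrable setT (fun x : mpt R => (f x)%:E).
  by have := intf 0; under eq_fun do rewrite addr0.
rewrite integralZl //; last by have := integrableB measurableT (intf (t n *: unitv R i)) i0.
rewrite integralB_EFin //; last exact: (intf (t n *: unitv R i)).
by rewrite integral_translate_sgn // subee ?mule0 //; exact: integrable_fin_num i0.
Qed.

End PartialIntegral.

(** * Test functions *)

Section FundamentalLemma.
Variables (R : realType) (Omega : set (pt R)).
Local Notation P := (pt R).
Local Notation C := R[i].
Local Notation mu := (leb3 R).
Local Notation D := (Omega : set (mpt R)).
Hypothesis oO : open Omega.
Hypothesis bO : bounded_set Omega.

Definition rtest (f : P -> R) := rsmooth f /\ exists K : set P,
  [/\ compact K, K `<=` Omega & forall x, ~ K x -> f x = 0].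

Lemma mOmega : measurable D. Proof. exact: open_measurable3. Qed.

Lemma Omega_fin : (mu D < +oo)%E. Proof. exact: bounded_leb3_fin mOmega bO. Qed.

Lemma rtest_complex (f : P -> R) : rtest f -> test_function Omega (fun x => (f x)%:C%C).
Proof.
by move=> [sf [K [cK KO f0]]]; split; [exact: smooth_real|exists K; split=> // x /f0 ->].
Qed.

Lemma cbox_compact i : compact (@cbox R i).
Proof.
have -> : @cbox R i = (closed_ball (ratr i.1.1.1 : R) (i.2.+1%:R^-1) `*`
  closed_ball (ratr i.1.1.2 : R) (i.2.+1%:R^-1)) `*` closed_ball (ratr i.1.2 : R) (i.2.+1%:R^-1).
  by rewrite !closed_ballE ?invr_gt0 //; apply/seteqP; split=> x => [[]|[[]]].
by do 2?apply: compact_setX; rewrite closed_ball_itv ?invr_gt0 //; exact: segment_compact.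
Qed.

(** An enumeration by natural numbers of the bumps on all rational boxes whose closure lies in U;
    the other codes give 0. *)
Definition obump (U : set P) (k : nat) : P -> R :=
  if unpickle k is Some i then
    if `[< @cbox R i `<=` U >] then bump ((ratr i.1.1.1, ratr i.1.1.2, ratr i.1.2) : P) (i.2.+1%:R^-1) else cst 0
  else cst 0.

(** Tends pointwise to the indicator of an open U: where some bump is positive the product tends to
    0, and off U every factor is 1. Only finitely many bumps occur for each n, so the support stays
    compact in U. *)
Definition approx (U : set P) (n : nat) : P -> R :=
  fun x => 1 - \prod_(k < n) (1 - obump U k x) ^+ n.

Lemma obump_smooth U k : rsmooth (obump U k).
Proof.
rewrite /obump; case: (unpickle k) => [i|]; last exact: rsmooth_cst.
by case: asboolP => _; [exact: bump_smooth|exact: rsmooth_cst].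
Qed.

Lemma obump_ge0 U k x : 0 <= obump U k x.
Proof. by rewrite /obump; case: (unpickle k) => [i|] //; case: asboolP => _ //; exact: bump_ge0. Qed.

Lemma obump_lt1 U k x : obump U k x < 1.
Proof. by rewrite /obump; case: (unpickle k) => [i|] //; case: asboolP => _ //; exact: bump_lt1. Qed.

Lemma coordf3 (q : P) (Q : R -> R -> Prop) x : (forall j, Q (coordf j q) (coordf j x)) ->
  [/\ Q q.1.1 x.1.1, Q q.1.2 x.1.2 & Q q.2 x.2].
Proof.
by move=> h; move: (h 0) (h 1) (h 2%R); rewrite /coordf !mxE.
Qed.

Lemma bump_supp i x : bump ((ratr i.1.1.1, ratr i.1.1.2, ratr i.1.2) : P) (i.2.+1%:R^-1) x != 0 ->
  @cbox R i x.
Proof.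
move=> h; have : 0 < bump ((ratr i.1.1.1, ratr i.1.1.2, ratr i.1.2) : P) (i.2.+1%:R^-1) x.
  by rewrite lt_def h bump_ge0.
rewrite bump_gt0 => /forallP hx.
apply: (@coordf3 (ratr i.1.1.1, ratr i.1.1.2, ratr i.1.2) (fun a b => `|a - b| <= i.2.+1%:R^-1)).
by move=> j; rewrite distrC ltW.
Qed.

Lemma bump_rbox i x : @rbox R i x ->
  0 < bump ((ratr i.1.1.1, ratr i.1.1.2, ratr i.1.2) : P) (i.2.+1%:R^-1) x.
Proof.
move=> [[h1 h2] h3]; rewrite bump_gt0; apply/forallP => j; rewrite distrC /coordf !mxE.
by case: j => -[|[|[|//]]] h.
Qed.

Lemma approx_smooth U n : rsmooth (approx U n).
Proof.
have h k : rsmooth (fun x => (1 - obump U k x) ^+ n).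
  elim: n => [|n IH].
    by under eq_fun do rewrite expr0; exact: rsmooth_cst.
  under eq_fun do rewrite exprS; apply: rsmoothM IH.
  by apply: rsmoothD; [exact: rsmooth_cst|apply: rsmoothN; exact: obump_smooth].
have hp : rsmooth (fun x => \prod_(k < n) (1 - obump U k x) ^+ n) by exact: rsmooth_prod.
exact: (rsmoothD (rsmooth_cst 1) (rsmoothN hp)).
Qed.

Lemma approx_bound U n x : 0 <= approx U n x <= 1.
Proof.
have h k : 0 <= (1 - obump U k x) ^+ n <= 1.
  have := obump_ge0 U k x; have := obump_lt1 U k x => h1 h2.
  by rewrite exprn_ge0 ?exprn_ile1 //; lra.
have : 0 <= \prod_(k < n) (1 - obump U k x) ^+ n <= 1.
  by rewrite prodr_ge0 ?prodr_ile1 // => k _; have /andP[] := h k.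
by rewrite /approx => /andP[h1 h2]; apply/andP; split; lra.
Qed.

Lemma obump_out U k x : ~ U x -> obump U k x = 0.
Proof.
move=> nU; rewrite /obump; case: (unpickle k) => [i|] //; case: asboolP => // iU.
by apply/eqP; apply: contraT => /bump_supp /iU.
Qed.

Lemma approx_cvg U x : open U -> approx U ^~ x @ \oo --> (\1_U x : R).
Proof.
move=> oU; rewrite indicE; have [Ux|nUx] := pselect (U x); last first.
  rewrite memNset // (_ : approx U ^~ x = cst 0); first exact: cvg_cst.
  apply/funext => n; rewrite /approx (eq_bigr (fun=> 1)) ?big1_eq ?subrr // => k _.
  by rewrite obump_out // subr0 expr1n.
rewrite mem_set //.
have [i [ix iU]] := rbox_nbhs oU Ux.
pose k0 := pickle i.
have b0 : 0 < obump U k0 x.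
  by rewrite /obump /k0 pickleK asboolT //; exact: bump_rbox.
have b1 := obump_lt1 U k0 x.
pose z := 1 - obump U k0 x.
have z0 : 0 < z by rewrite subr_gt0.
have zn : (fun n => z ^+ n) @ \oo --> (0 : R).
  have := @cvg_geometric R 1 z; rewrite gtr0_norm //.
  have z1 : z < 1 by rewrite ltrBlDr ltrDl.
  by move=> /(_ z1); apply: cvg_trans; apply: near_eq_cvg; apply: nearW => n; rewrite /= mul1r.
suff : (fun n => \prod_(k < n) (1 - obump U k x) ^+ n) @ \oo --> (0 : R).
  move=> h; rewrite -[X in _ --> X]subr0; apply: cvgB => //; exact: cvg_cst.
apply: (@squeeze_cvgr _ _ _ _ (cst 0) (fun n => z ^+ n)) => //; last exact: cvg_cst.
exists k0.+1 => // n /= kn; rewrite prodr_ge0 /=; last first.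
  by move=> k _; rewrite exprn_ge0 // subr_ge0 ltW // obump_lt1.
rewrite (bigD1 (Ordinal kn)) //=; apply: ler_piMr; first exact: exprn_ge0 (ltW z0).
apply: prodr_ile1 => k _; have := obump_ge0 U k x; have := obump_lt1 U k x => h1 h2.
by rewrite exprn_ge0 ?exprn_ile1 //; lra.
Qed.

Lemma approx_test U n : U `<=` Omega -> rtest (approx U n).
Proof.
move=> UO; split; first exact: approx_smooth.
pose K k : set P := if unpickle k is Some i then (if `[< @cbox R i `<=` U >] then @cbox R i else set0) else set0.
exists (\big[setU/set0]_(k < n) K k); split.
- apply: (big_ind (fun A : set P => compact A)); [exact: compact0|exact: compactU|].
  move=> k _; rewrite /K; case: (unpickle _) => [i|]; last exact: compact0.
  by case: asboolP => _; [exact: cbox_compact|exact: compact0].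
- move=> x; rewrite -bigcup_mkord => -[k _]; rewrite /K; case: (unpickle _) => [i|] //.
  by case: asboolP => // iU /iU /UO.
- move=> x; rewrite -bigcup_mkord => nK; rewrite /approx big1 ?subrr // => k _.
  suff -> : obump U k x = 0 by rewrite subr0 expr1n.
  apply/eqP; apply: contra_notT nK => h; exists k => //=; move: h; rewrite /obump /K.
  case: (unpickle _) => [i|]; last by rewrite eqxx.
  by case: asboolP => _; [exact: bump_supp|rewrite eqxx].
Qed.

(** Lets Dynkin's theorem run over the open sets, which are stable under intersection, in
    [fundamental_lemma]. *)
Lemma open_sigma : @measurable _ (mpt R) = <<s (@open P : set (set (mpt R))) >>.
Proof.
apply/seteqP; split; last first.
  by apply: smallest_sub; [exact: sigma_algebra_measurable|exact: open_measurable3].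
pose G : set (set (mpt R)) := @open P.
have mc (f : P -> R) : continuous f ->
    measurable_fun setT (f : g_sigma_algebraType G -> measurableTypeR R).
  move=> /continuousP cf; apply: (measurability _ (RGenOpens.measurableE R)).
  move=> _ [_ [a [b ->] <-]]; rewrite setTI; apply: sub_sigma_algebra.
  by apply: cf; exact: interval_open.
have mid : measurable_fun setT (id : g_sigma_algebraType G -> mpt R).
  have E j : (coordf j : P -> R) = coordf j by [].
  apply: mpt_measurable_fun.
  - have := mc _ (coordf_continuous (j := 0)); congr measurable_fun.
    by apply/funext => x; rewrite /coordf mxE.
  - have := mc _ (coordf_continuous (j := 1)); congr measurable_fun.
    by apply/funext => x; rewrite /coordf mxE.
  - have := mc _ (coordf_continuous (j := 2%R)); congr measurable_fun.
    by apply/funext => x; rewrite /coordf mxE.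
by move=> A mA; have := mid measurableT A mA; rewrite setTI.
Qed.

(** Testing with [approx] gives integral 0 of u over Omega meet U for every open U; Dynkin's theorem
    extends this to all Borel sets, hence u = 0 almost everywhere in Omega. *)
Lemma fundamental_lemma (u : mpt R -> R) : rL2 mu D u ->
  (forall f, rtest f -> \int[mu]_(x in D) (u x * f x) = 0) -> rdot mu D u u = 0.
Proof.
move=> hu h; have mO := mOmega.
have i1 : rL2 mu D (cst 1).
  apply: continuous_rL2 => //; [exact: Omega_fin|by move=> x; exact: cvg_cst].
have iu : mu.-integrable D (EFin \o u).
  by have := rL2_integrable mO hu i1; apply: eq_integrable => // x _; rewrite /= mulr1.
have ht f : rtest f -> (\int[mu]_(x in D) (u x * f x)%:E = 0)%E.
  move=> tf; have [sf _] := tf.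
  have hf : rL2 mu D f.
    by apply: continuous_rL2 => //; [exact: Omega_fin|exact: rsmooth_continuous].
  have := congr1 (fun z : R => z%:E) (h f tf); rewrite /Rintegral fineK //.
  exact: (integrable_fin_num mO (rL2_integrable mO hu hf)).
pose Q (S : set (mpt R)) := (\int[mu]_(x in D `&` S) (u x)%:E = 0)%E.
have hU (U : set P) : open U -> Q U.
  move=> oU; have oUO : open (Omega `&` U) by exact: openI.
  rewrite /Q integral_mkcondr (eq_integral (fun x => (u x * \1_(Omega `&` U) x)%:E)); last first.
    move=> x; rewrite inE => Dx; rewrite patchE indicE in_setI (mem_set Dx) /=.
    by case: (x \in U); rewrite ?mulr1 ?mulr0.
  apply: (integral_limit0 mO (f_ := fun n x => u x * approx (Omega `&` U) n x) (g := fun x => `|u x|)).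
  - move=> n; apply: measurable_funM; first exact: hu.1.
    by apply: measurable_funTS; apply: continuous_measurable3; apply: rsmooth_continuous; exact: approx_smooth.
  - apply: measurable_funM; first exact: hu.1.
    by apply: measurable_indic; exact: open_measurable3.
  - exact: (integrable_abse iu).
  - by move=> x Dx; apply: cvgM; [exact: cvg_cst|exact: approx_cvg].
  - move=> n x Dx; rewrite normrM ler_piMr //.
    by have /andP[a0 a1] := approx_bound (Omega `&` U) n x; rewrite ger0_norm.
  - by move=> n; apply: ht; apply: approx_test => x [].
have hQ S : measurable S -> Q S.
  rewrite open_sigma; apply: (@dynkin_induction _ (mpt R) (@open P)).
  - exact: open_sigma.
  - by move=> A B; exact: openI.
  - exact/hU/openT.
  - exact: hU.
  - move=> A mA QA.
    have DE : D = (D `&` A) `|` (D `&` ~` A) by rewrite -setIUr setUv setIT.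
    have := hU setT openT; rewrite /Q setIT {1}DE => z.
    have m1 : measurable (D `&` A) by exact: measurableI.
    have m2 : measurable (D `&` ~` A) by apply: measurableI => //; exact: measurableC.
    move: z; rewrite integral_setU //; last 2 first.
    + by rewrite -DE; case/integrableP: iu.
    + by rewrite disj_set2E; apply/eqP; rewrite setIACA setICr setI0.
    by rewrite QA add0e.
  - move=> F mF tF QF; rewrite /Q setI_bigcupr integral_bigcup //.
    + by apply: eseries0 => k _ _; exact: QF.
    + exact: trivIset_setIl.
    + by move=> k; exact: measurableI.
    + rewrite -setI_bigcupr; apply: (integrableS mO) => //.
      by apply: measurableI => //; exact: bigcupT_measurable.
have ae0 : ae_eq mu D (EFin \o u) (cst 0%E).
  apply: (integral_ae_eq mO iu) => // E ED mE.
  have := hQ E mE; rewrite /Q (_ : D `&` E = E); last by apply/setIidr.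
  by move=> ->; rewrite integral0.
rewrite /rdot /Rintegral (@ae_eq_integral _ _ _ mu D (cst 0%E)) ?integral0 //.
- by apply/measurable_EFinP; apply: measurable_funM; exact: hu.1.
- by apply: filterS ae0 => x hx Dx; have := hx Dx => /= -[->]; rewrite mul0r.
Qed.

End FundamentalLemma.

(** * Weak derivatives *)

Section Graph.
Variables (R : realType) (V W : zmodType) (sc : R -> V -> V) (sc1 : R -> W -> W).
Variables (S : V -> Prop) (B : V -> V -> R) (S1 : W -> Prop) (B1 : W -> W -> R).
Hypothesis H : prehilbert sc S B.
Hypothesis H1 : prehilbert sc1 S1 B1.
Variables (rel : V -> W -> Prop) (D : V -> W).
Hypothesis relS : forall u w, rel u w -> S1 w.
Hypothesis rel0 : rel 0 0.
Hypothesis relD : forall u v w z, S u -> S v -> rel u w -> rel v z -> rel (u + v) (w + z).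
Hypothesis relN : forall u w, S u -> rel u w -> rel (- u) (- w).
Hypothesis relZ : forall t u w, S u -> rel u w -> rel (sc t u) (sc1 t w).
Hypothesis relU : forall u w z, S u -> rel u w -> rel u z -> B1 (w - z) (w - z) = 0.
Hypothesis Drel : forall u w, S u -> rel u w -> rel u (D u).

(** [rel u w] stands for: w is a weak derivative of u. [D] chooses one such w and is linear only up
    to null vectors, which is why the laws are stated for [rel]. *)
Definition graph_dom u := S u /\ exists w, rel u w.
Definition graph_form u v := B u v + B1 (D u) (D v).

Lemma ph_null_eq w z x : S1 w -> S1 z -> S1 x -> B1 (w - z) (w - z) = 0 -> B1 w x = B1 z x.
Proof.
move=> Sw Sz Sx h; apply/eqP; rewrite -subr_eq0 -(ph_BN H1) // -(ph_BD H1) //; last exact: (ph_N H1).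
by rewrite (ph_null H1) //; exact: (ph_B H1).
Qed.

Lemma graph_eq u w x : S u -> rel u w -> S1 x -> B1 (D u) x = B1 w x.
Proof.
move=> Su uw Sx; have uD := Drel Su uw; apply: ph_null_eq => //; try exact: (relS uD).
  exact: (relS uw).
exact: relU Su uD uw.
Qed.

Lemma graph_dom_rel u : graph_dom u -> rel u (D u).
Proof. by move=> [Su [w uw]]; exact: Drel uw. Qed.

Lemma graph_dom_S1 u : graph_dom u -> S1 (D u).
Proof. by move=> /graph_dom_rel /relS. Qed.

Lemma graph_domD u v : graph_dom u -> graph_dom v -> graph_dom (u + v).
Proof.
move=> [Su [w uw]] [Sv [z vz]]; split; first exact: (ph_D H).
by exists (w + z); exact: relD.
Qed.

Lemma graph_domN u : graph_dom u -> graph_dom (- u).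
Proof.
move=> [Su [w uw]]; split; first exact: (ph_N H).
by exists (- w); exact: relN.
Qed.

Lemma graph_domZ t u : graph_dom u -> graph_dom (sc t u).
Proof.
move=> [Su [w uw]]; split; first exact: (ph_Z H).
by exists (sc1 t w); exact: relZ.
Qed.

Lemma graph_prehilbert : prehilbert sc graph_dom graph_form.
Proof.
split.
- by split; [exact: (ph_0 H)|exists 0].
- exact: graph_domD.
- exact: graph_domN.
- exact: graph_domZ.
- move=> u v du dv; rewrite /graph_form (ph_C H du.1 dv.1).
  by rewrite (ph_C H1 (graph_dom_S1 du) (graph_dom_S1 dv)).
- move=> u v w du dv dw; have [Su _] := du; have [Sv _] := dv; have [Sw _] := dw.
  rewrite /graph_form (ph_BD H) // (graph_eq (ph_D H Su Sv) (relD Su Sv (graph_dom_rel du) (graph_dom_rel dv))).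
    by rewrite (ph_BD H1); [ring|exact: graph_dom_S1..].
  exact: graph_dom_S1.
- move=> t u w du dw; have [Su _] := du; have [Sw _] := dw.
  rewrite /graph_form (ph_BZ H) // (graph_eq (ph_Z H t Su) (relZ t Su (graph_dom_rel du))).
    by rewrite (ph_BZ H1); [ring|exact: graph_dom_S1..].
  exact: graph_dom_S1.
- move=> u du; apply: addr_ge0; first by apply: (ph_ge0 H); case: du.
  by apply: (ph_ge0 H1); exact: graph_dom_S1.
Qed.

Hypothesis rel_closed : forall (u : nat -> V) v (w : nat -> W) z,
  (forall n, S (u n)) -> S v -> S1 z -> (forall n, rel (u n) (w n)) ->
  tends0 (fun n => B (u n - v) (u n - v)) -> tends0 (fun n => B1 (w n - z) (w n - z)) -> rel v z.

Lemma graph_null u v : graph_dom u -> graph_dom v ->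
  B1 (D (u - v) - (D u - D v)) (D (u - v) - (D u - D v)) = 0.
Proof.
move=> du dv; have dB := graph_domD du (graph_domN dv).
apply: (@relU (u - v)); [by case: dB|exact: graph_dom_rel|].
apply: relD; [by case: du|by case: (graph_domN dv)|exact: graph_dom_rel|].
by apply: relN; [case: dv|exact: graph_dom_rel].
Qed.

Lemma graph_sqB u v : graph_dom u -> graph_dom v ->
  B1 (D (u - v)) (D (u - v)) = B1 (D u - D v) (D u - D v).
Proof.
move=> du dv; have s1 := graph_dom_S1 du; have s2 := graph_dom_S1 dv.
have s3 := graph_dom_S1 (graph_domD du (graph_domN dv)).
have h x : S1 x -> B1 (D (u - v)) x = B1 (D u - D v) x.
  by move=> Sx; apply: ph_null_eq => //; [exact: (ph_B H1)|exact: graph_null].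
rewrite h // (ph_C H1) ?h //; exact: (ph_B H1).
Qed.

(** A Cauchy sequence for the graph form is Cauchy in both spaces, and closedness of [rel] relates
    the two limits. *)
Lemma graph_complete : ph_complete S B -> ph_complete S1 B1 ->
  ph_complete graph_dom graph_form.
Proof.
move=> cS cS1 u du uC.
have dB n m := graph_domD (du n) (graph_domN (du m)).
have [v Sv uv] : exists2 v, S v & tends0 (fun n => B (u n - v) (u n - v)).
  apply: cS; first by move=> n; case: (du n).
  move=> e /uC[N hN]; exists N => n m Nn Nm; apply: le_lt_trans (hN n m Nn Nm).
  by rewrite lerDl; apply: (ph_ge0 H1); exact: graph_dom_S1.
have [w Sw uw] : exists2 w, S1 w & tends0 (fun n => B1 (D (u n) - w) (D (u n) - w)).
  apply: (cS1 (fun n => D (u n))); first by move=> n; exact: graph_dom_S1.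
  move=> e /uC[N hN]; exists N => n m Nn Nm; apply: le_lt_trans (hN n m Nn Nm).
  by rewrite /graph_form graph_sqB // lerDr; apply: (ph_ge0 H); case: (dB n m).
have vw : rel v w.
  by apply: rel_closed uv uw => // n; [case: (du n)|exact: graph_dom_rel].
have dv : graph_dom v by split=> //; exists w.
exists v => //; apply: (tends0_le (C := 1) _ _ (tends0D uv uw)) => // n.
rewrite mul1r lerD2l graph_sqB //.
(* The limit w and the chosen [D v] may differ, but by a null vector, which the form does not
   see. *)
have h : B1 (D v - w) (D v - w) = 0 by apply: relU vw => //; exact: graph_dom_rel.
have sn := graph_dom_S1 (du n); have sv := graph_dom_S1 dv.
have e1 : D (u n) - w = (D (u n) - D v) + (D v - w) by rewrite addrA subrK.
have s1 : S1 (D (u n) - D v) by exact: (ph_B H1).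
have s2 : S1 (D v - w) by exact: (ph_B H1).
by rewrite e1 (ph_sqD H1 s1 s2) h (ph_C H1 s1 s2) (ph_null H1 s2 s1 h) mulr0 !addr0.
Qed.

End Graph.

Lemma ph_lim (R : realType) (V : zmodType) (sc : R -> V -> V) (S : V -> Prop) (B : V -> V -> R)
    (u : nat -> V) v a : prehilbert sc S B -> (forall n, S (u n)) -> S v -> S a ->
  tends0 (fun n => B (u n - v) (u n - v)) -> tends0 (fun n => `|B (u n) a - B v a|).
Proof.
move=> H Su Sv Sa h.
have h2 := tends0_phn (S := S) (B := B) H (fun n => ph_B H (Su n) Sv) h.
apply: (tends0_le (C := phn B a) _ _ h2); first exact: phn_ge0.
move=> n; rewrite -(ph_BN H) // -(ph_BD H) //; last exact: (ph_N H).
by rewrite mulrC; apply: (phn_CS H) => //; exact: (ph_B H).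
Qed.

Lemma tends0_eq (R : realType) (x y : nat -> R) a b : (forall n, x n = y n) ->
  tends0 (fun n => `|x n - a|) -> tends0 (fun n => `|y n - b|) -> a = b.
Proof.
move=> xy h1 h2; apply/eqP; rewrite -subr_eq0 -normr_le0.
apply: (tends0_le0 _ (tends0D h1 h2)) => n; rewrite -xy.
by rewrite (distrC (x n) a) ; apply: le_trans (ler_normD _ _); rewrite addrA subrK.
Qed.

Section CintMore.
Context d (T : measurableType d) (R : realType).
Variables (mu : {measure set T -> \bar R}) (D : set T).
Hypothesis mD : measurable D.
Local Notation C := R[i].
Local Notation vf := (T -> 'rV[C]_3).

Lemma Cint_mul_lin c (f g a : T -> C) : L2 mu D f -> L2 mu D g -> L2 mu D a ->
  Cint mu D (fun x => (c * f x + g x) * a x) =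
  c * Cint mu D (fun x => f x * a x) + Cint mu D (fun x => g x * a x).
Proof.
move=> hf hg ha; have i1 := L2_Cintegrable mD hf ha; have i2 := L2_Cintegrable mD hg ha.
rewrite -(CintZ mD c i1) -(CintD mD (CintegrableZ mD c i1) i2); apply: eq_Cint => x _.
by rewrite /= -[RHS]/(c * (f x * a x) + g x * a x); ring.
Qed.

Lemma Cint_dotv_lin c (u v a : vf) : L2v mu D u -> L2v mu D v -> L2v mu D a ->
  Cint mu D (fun x => dotv (c *: u x + v x) (a x)) =
  c * Cint mu D (fun x => dotv (u x) (a x)) + Cint mu D (fun x => dotv (v x) (a x)).
Proof.
move=> hf hg ha; have i1 := L2v_Cintegrable mD hf ha; have i2 := L2v_Cintegrable mD hg ha.
rewrite -(CintZ mD c i1) -(CintD mD (CintegrableZ mD c i1) i2); apply: eq_Cint => x _.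
rewrite /= -[RHS]/(c * dotv (u x) (a x) + dotv (v x) (a x)).
by rewrite /dotv mulr_sumr -big_split; apply: eq_bigr => i _; rewrite !mxE /=; ring.
Qed.

Lemma L2v_lin c (u v : vf) : L2v mu D u -> L2v mu D v -> L2v mu D (fun x => c *: u x + v x).
Proof.
move=> hu hv i; have := L2D mD (L2Zc mD c (hu i)) (hv i); congr (L2 mu D _).
by apply/funext => x; rewrite !mxE.
Qed.

Lemma L2_lin c (f g : T -> C) : L2 mu D f -> L2 mu D g -> L2 mu D (fun x => c * f x + g x).
Proof. by move=> hf hg; have := L2D mD (L2Zc mD c hf) hg. Qed.

Lemma Cint_conj (f : T -> C) : Cintegrable mu D f ->
  Cint mu D (conjf f) = conjc (Cint mu D f).
Proof.
move=> hf; rewrite !CintE; congr (_ +i* _)%C.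
  by apply: eq_Rintegral => x _; rewrite /part /conjf; case: (f x).
have := RintegralZl (-1) mD (hf true); rewrite mulN1r => <-.
by apply: eq_Rintegral => x _; rewrite /part /conjf mulN1r; case: (f x).
Qed.

Lemma dotv_conj (a b : 'rV[C]_3) : dotv (conjv a) (conjv b) = conjc (dotv a b).
Proof.
rewrite /dotv raddf_sum; apply: eq_bigr => i _; rewrite !mxE.
by case: (a 0 i) (b 0 i) => [? ?] [? ?]; congr (_ +i* _)%C => /=; ring.
Qed.

Lemma conjf_mul (f g : T -> C) : conjf (fun x => f x * g x) = fun x => conjf f x * conjf g x.
Proof.
apply/funext => x; rewrite /conjf; case: (f x) (g x) => [? ?] [? ?].
by congr (_ +i* _)%C => /=; ring.
Qed.

Lemma Cint_mul_conj (f g : T -> C) : L2 mu D f -> L2 mu D g ->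
  Cint mu D (fun x => conjf f x * conjf g x) = conjc (Cint mu D (fun x => f x * g x)).
Proof.
by move=> hf hg; rewrite -Cint_conj ?conjf_mul //; exact: L2_Cintegrable.
Qed.

Lemma Cint_dotv_conj (u v : vf) : L2v mu D u -> L2v mu D v ->
  Cint mu D (fun x => dotv (vconj u x) (vconj v x)) = conjc (Cint mu D (fun x => dotv (u x) (v x))).
Proof.
move=> hf hg; rewrite -Cint_conj; last exact: L2v_Cintegrable.
by apply: eq_Cint => x _; rewrite /vconj dotv_conj.
Qed.

Lemma conjfK (f : T -> C) : conjf (conjf f) = f.
Proof. by apply/funext => x; rewrite /conjf; case: (f x) => a b /=; rewrite opprK. Qed.

Lemma vconjK (u : vf) : vconj (vconj u) = u.
Proof.
by apply/funext => x; apply/rowP => i; rewrite /vconj !mxE; case: (u x 0 i) => a b /=; rewrite opprK.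
Qed.

Lemma Cint_mul_null (f g a : T -> C) : L2 mu D f -> L2 mu D g -> L2 mu D a ->
  cdot mu D (f - g) (f - g) = 0 -> Cint mu D (fun x => f x * a x) = Cint mu D (fun x => g x * a x).
Proof.
move=> hf hg ha h; have Hc := cdot_prehilbert mu mD.
rewrite !(Cint_mulE mD) //; congr (_ +i* _)%C; apply: (ph_null_eq Hc) => //.
  exact: L2_conj.
exact: L2_iconj.
Qed.

Lemma Cint_dotv_null (u v a : vf) : L2v mu D u -> L2v mu D v -> L2v mu D a ->
  vdot mu D (u - v) (u - v) = 0 ->
  Cint mu D (fun x => dotv (u x) (a x)) = Cint mu D (fun x => dotv (v x) (a x)).
Proof.
move=> hf hg ha h; have Hc := vdot_prehilbert mu mD.
rewrite !(Cint_dotvE mD) //; congr (_ +i* _)%C; apply: (ph_null_eq Hc) => //.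
  exact: L2v_conj.
exact: L2v_iconj.
Qed.

End CintMore.

Lemma smooth_conjf (R : realType) (phi : pt R -> R[i]) : smooth phi -> smooth (conjf phi).
Proof.
move=> sp; apply/smoothP => -[]; last first.
  have := smooth_part false sp; congr rsmooth; apply/funext => x.
  by rewrite /part /conjf; case: (phi x).
have := rsmoothN (smooth_part true sp); congr rsmooth; apply/funext => x.
by rewrite -[(- part true phi) x]/(- part true phi x) /part /conjf; case: (phi x).
Qed.

Section WeakDerivativeTheory.
Variables (R : realType) (Omega : set (pt R)).
Local Notation P := (pt R).
Local Notation C := R[i].
Local Notation mu := (leb3 R).
Local Notation D := (Omega : set (mpt R)).
Hypothesis oO : open Omega.
Hypothesis bO : bounded_set Omega.
Let mO : measurable D := mOmega oO.

Lemma smooth_L2_Omega (f : P -> C) : smooth f -> L2 mu D f.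
Proof. exact: (smooth_L2 mO (Omega_fin oO bO) bO). Qed.

Lemma test_L2 (f : P -> C) : test_function Omega f -> L2 mu D f.
Proof. by move=> [sf _]; exact: smooth_L2_Omega. Qed.

Lemma grad_L2v (f : P -> C) : smooth f -> L2v mu D (grad f).
Proof.
move=> sf i; have := smooth_L2_Omega (smooth_dpartial i sf); congr (L2 mu D _).
by apply/funext => x; rewrite mxE.
Qed.

Lemma test_vec_L2v (phi : vfield R) : (forall i, test_function Omega (fun x => phi x 0 i)) -> L2v mu D phi.
Proof. by move=> h i; exact: test_L2. Qed.

Lemma curl_L2v (phi : vfield R) : (forall i, test_function Omega (fun x => phi x 0 i)) -> L2v mu D (curl phi).
Proof.
move=> h i; have [s1 _] := h (i + 2); have [s2 _] := h (i + 1).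
have := L2D mO (smooth_L2_Omega (smooth_dpartial (i + 1) s1))
  (smooth_L2_Omega (smoothN (smooth_dpartial (i + 2) s2))).
by congr (L2 mu D _); apply/funext => x; rewrite mxE.
Qed.

Lemma Cint_dpartial_test i (f : P -> C) : test_function Omega f ->
  Cint mu D (dpartial i f) = 0.
Proof.
move=> tf; have [sd [K [cK KO K0]]] := test_dpartial i tf; have [sf [K' [cK' K'O f0]]] := tf.
have h b : \int[mu]_(x in D) part b (dpartial i f) x = 0.
  rewrite part_dpartial /Rintegral.
  rewrite integral_mkcond (eq_integral (fun x : mpt R => (rpart i (part b f) x)%:E)); last first.
    move=> x _; rewrite patchE; case: ifPn => // /negP nx.
    rewrite -part_dpartial /part K0; first by case: b.
    by move=> /KO Ox; apply: nx; rewrite inE.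
  rewrite (integral_rpart0 i (smooth_part b sf) cK') //.
  by move=> x /f0; rewrite /part => ->; case: b.
by rewrite CintE !h.
Qed.

Lemma Cint_by_parts i (f phi : P -> C) : smooth f -> test_function Omega phi ->
  Cint mu D (fun x => f x * dpartial i phi x) = - Cint mu D (fun x => dpartial i f x * phi x).
Proof.
move=> sf tp; have [sp _] := tp.
have := Cint_dpartial_test i (testM sf tp); rewrite dpartialM //.
have i1 := L2_Cintegrable mO (smooth_L2_Omega sf) (test_L2 (test_dpartial i tp)).
have i2 := L2_Cintegrable mO (smooth_L2_Omega (smooth_dpartial i sf)) (test_L2 tp).
have := CintD mO i1 i2; rewrite -[X in Cint _ _ X]/(f * dpartial i phi + dpartial i f * phi) => ->.
by move/eqP; rewrite addr_eq0 => /eqP.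
Qed.

Lemma wgrad_smooth (f : P -> C) : smooth f -> is_wgrad Omega f (grad f).
Proof.
move=> sf; split; first exact: grad_L2v.
move=> phi tp i; rewrite Cint_by_parts //; congr (- _); apply: eq_Cint => x _.
by rewrite mxE.
Qed.

(** Real test functions suffice: they separate the real and imaginary parts of the integral. *)
Lemma fundamental_complex (f : P -> C) : L2 mu D f ->
  (forall phi, test_function Omega phi -> Cint mu D (fun x => f x * phi x) = 0) ->
  cdot mu D f f = 0.
Proof.
move=> hf h; have /L2P Hf := hf.
have z b (phi : P -> R) : rtest Omega phi -> \int[mu]_(x in D) (part b f x * phi x) = 0.
  move=> /rtest_complex /h; rewrite CintE => -[h1 h2].
  case: b; [rewrite -[RHS]h2|rewrite -[RHS]h1]; apply: eq_Rintegral => x _;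
    by rewrite /part; case: (f x) => a c /=; ring.
have H b : rdot mu D (part b f) (part b f) = 0.
  by apply: (fundamental_lemma oO bO); [exact: Hf|exact: z].
by rewrite cdotE !H addr0.
Qed.

Definition vtest (j : 'I_3) (phi : P -> C) : vfield R :=
  fun x => \row_i (if i == j then phi x else 0).

Lemma vtestE j (phi : P -> C) i : (fun x => vtest j phi x 0 i) = if i == j then phi else fun=> 0.
Proof. by apply/funext => x; rewrite mxE; case: eqP. Qed.

Lemma vtest_test j (phi : P -> C) : test_function Omega phi ->
  forall i, test_function Omega (fun x => vtest j phi x 0 i).
Proof. by move=> h i; rewrite vtestE; case: eqP => // _; exact: test0. Qed.

Lemma dotv_vtest (u : vfield R) j phi x : dotv (u x) (vtest j phi x) = u x 0 j * phi x.
Proof.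
rewrite /dotv (bigD1 j) //= big1 ?addr0 ?mxE ?eqxx // => i /negPf ij.
by rewrite mxE ij mulr0.
Qed.

Lemma fundamental_vector (u : vfield R) : L2v mu D u ->
  (forall phi : vfield R, (forall i, test_function Omega (fun x => phi x 0 i)) ->
     Cint mu D (fun x => dotv (u x) (phi x)) = 0) ->
  vdot mu D u u = 0.
Proof.
move=> hu h; rewrite /vdot big1 // => j _; apply: fundamental_complex => [|phi tp]; first exact: hu.
rewrite -[RHS](h (vtest j phi) (vtest_test j tp)); apply: eq_Cint => x _.
by rewrite dotv_vtest.
Qed.

Lemma vdot_B_null (u v : vfield R) (a : vfield R) :
  L2v mu D u -> L2v mu D v -> L2v mu D a ->
  Cint mu D (fun x => dotv (u x) (a x)) = Cint mu D (fun x => dotv (v x) (a x)) ->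
  Cint mu D (fun x => dotv ((u - v) x) (a x)) = 0.
Proof.
move=> hu hv ha h; have := Cint_dotv_lin mO (-1) hv hu ha; rewrite mulN1r -h addNr => <-.
apply: eq_Cint => x _; congr (dotv _ _).
by rewrite -[(u - v) x]/(u x - v x) scaleN1r addrC.
Qed.

Lemma cdot_B_null (u v : P -> C) (a : P -> C) :
  L2 mu D u -> L2 mu D v -> L2 mu D a ->
  Cint mu D (fun x => u x * a x) = Cint mu D (fun x => v x * a x) ->
  Cint mu D (fun x => (u - v) x * a x) = 0.
Proof.
move=> hu hv ha h; have := Cint_mul_lin mO (-1) hv hu ha; rewrite mulN1r -h addNr => <-.
apply: eq_Cint => x _; congr (_ * _).
by rewrite -[(u - v) x]/(u x - v x) mulN1r addrC.
Qed.

Lemma wgrad_unique f G G' : is_wgrad Omega f G -> is_wgrad Omega f G' ->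
  vdot mu D (G - G') (G - G') = 0.
Proof.
move=> [hG h] [hG' h']; apply: fundamental_vector; first exact: (ph_B (vdot_prehilbert mu mO) hG hG').
move=> phi tp.
have E (H : vfield R) : L2v mu D H -> Cint mu D (fun x => dotv (H x) (phi x)) = \sum_i Cint mu D (fun x => H x 0 i * phi x 0 i).
  move=> hH; have := @Cint_sum _ _ _ mu D mO _ (index_enum 'I_3) (fun i x => H x 0 i * phi x 0 i).
  by case=> // i; exact: (L2_Cintegrable mO (hH i) (test_L2 (tp i))).
apply: vdot_B_null; [exact: hG|exact: hG'|exact: test_vec_L2v|].
rewrite !E //; apply: eq_bigr => i _; apply: oppr_inj.
by rewrite -h // -h'.
Qed.

Lemma wcurl_unique u w w' : is_wcurl Omega u w -> is_wcurl Omega u w' ->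
  vdot mu D (w - w') (w - w') = 0.
Proof.
move=> [hG h] [hG' h']; apply: fundamental_vector; first exact: (ph_B (vdot_prehilbert mu mO) hG hG').
move=> phi tp; apply: vdot_B_null; [exact: hG|exact: hG'|exact: test_vec_L2v|].
by rewrite -h // -h'.
Qed.

Lemma wdiv_unique u w w' : is_wdiv Omega u w -> is_wdiv Omega u w' ->
  cdot mu D (w - w') (w - w') = 0.
Proof.
move=> [hG h] [hG' h']; apply: fundamental_complex; first exact: (ph_B (cdot_prehilbert mu mO) hG hG').
move=> phi tp; apply: cdot_B_null; [exact: hG|exact: hG'|exact: test_L2|].
by apply: oppr_inj; rewrite -h // -h'.
Qed.

Lemma wgradP f G : is_wgrad Omega f G -> is_wgrad Omega f (wgrad Omega f).
Proof. by move=> h; exact: (xgetPex 0 (ex_intro _ G h)). Qed.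

Lemma wcurlP u w : is_wcurl Omega u w -> is_wcurl Omega u (wcurl Omega u).
Proof. by move=> h; exact: (xgetPex 0 (ex_intro _ w h)). Qed.

Lemma wdivP u h : is_wdiv Omega u h -> is_wdiv Omega u (wdiv Omega u).
Proof. by move=> hh; exact: (xgetPex 0 (ex_intro _ h hh)). Qed.

Lemma vcomp_L2 (u : vfield R) i : L2v mu D u -> L2 mu D (fun x => u x 0 i).
Proof. by move=> h; exact: h. Qed.

Lemma wgrad_lin c f g F G : L2 mu D f -> L2 mu D g -> is_wgrad Omega f F -> is_wgrad Omega g G ->
  is_wgrad Omega (fun x => c * f x + g x) (fun x => c *: F x + G x).
Proof.
move=> hf hg [hF h] [hG h']; split; first exact: L2v_lin.
move=> phi tp i.
rewrite (Cint_mul_lin mO c hf hg (test_L2 (test_dpartial i tp))) h // h' //.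
rewrite [X in _ = - X](_ : _ = Cint mu D (fun x => (c * F x 0 i + G x 0 i) * phi x)); last by apply: eq_Cint => x _; rewrite !mxE.
by rewrite (Cint_mul_lin mO c (vcomp_L2 i hF) (vcomp_L2 i hG) (test_L2 tp)) mulrN opprD.
Qed.

Lemma wcurl_lin c u v w z : L2v mu D u -> L2v mu D v -> is_wcurl Omega u w -> is_wcurl Omega v z ->
  is_wcurl Omega (fun x => c *: u x + v x) (fun x => c *: w x + z x).
Proof.
move=> hu hv [hw h] [hz h']; split; first exact: L2v_lin.
move=> phi tp; rewrite (Cint_dotv_lin mO c hu hv (curl_L2v tp)) h // h' //.
by rewrite (Cint_dotv_lin mO c hw hz (test_vec_L2v tp)).
Qed.

(* [rel_div u h]: h is the divergence of u, and the normal trace of u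
   vanishes. *)
Definition rel_div (u : vfield R) (h : P -> C) := L2 mu D h /\
  forall phi G, L2 mu D phi -> is_wgrad Omega phi G ->
    Cint mu D (fun x => dotv (u x) (G x)) = - Cint mu D (fun x => h x * phi x).

Lemma rel_div_lin c u v h k : L2v mu D u -> L2v mu D v -> rel_div u h -> rel_div v k ->
  rel_div (fun x => c *: u x + v x) (fun x => c * h x + k x).
Proof.
move=> hu hv [hh e] [hk e']; split; first exact: L2_lin.
move=> phi G hp hG; have [G2 _] := hG.
rewrite (Cint_dotv_lin mO c hu hv G2) (e phi) // (e' phi) //.
by rewrite (Cint_mul_lin mO c hh hk hp) mulrN opprD.
Qed.

Lemma rel_div_wdiv u h : rel_div u h -> is_wdiv Omega u h.
Proof.
move=> [hh e]; split=> // phi tp; apply: e; first exact: test_L2.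
by apply: wgrad_smooth; case: tp.
Qed.

(** [normal_trace0] speaks of the chosen gradient and divergence. By uniqueness up to null functions
    it becomes a condition on all weak gradients and on some divergence, that is, a linear relation
    to which the graph lemmas apply. *)
Lemma XTP u : XT Omega u <-> (L2v mu D u /\ exists w, is_wcurl Omega u w) /\ exists h, rel_div u h.
Proof.
split=> [[hu [w hw] [h hh] hn]|[[hu [w hw]] [h hh]]].
  split; first by split=> //; exists w.
  have [hd ed] := wdivP hh; exists (wdiv Omega u); split=> // phi G hp hG.
  have hH : H1 Omega phi by split=> //; exists G.
  have hg := wgradP hG; have [g2 _] := hg; have [G2 _] := hG.
  have := hn phi hH.
  have i1 := L2v_Cintegrable mO hu g2; have i2 := L2_Cintegrable mO hd hp.
  have := CintD mO i1 i2 => ->; move/eqP; rewrite addr_eq0 => /eqP <-.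
  have nul : vdot mu D (G - wgrad Omega phi) (G - wgrad Omega phi) = 0 by exact: wgrad_unique hG hg.
  have := Cint_dotv_null mO G2 g2 hu nul.
  have dC (a b : 'rV[C]_3) : dotv a b = dotv b a by apply: eq_bigr => i _; rewrite mulrC.
  under eq_fun do rewrite dC.
  by under [in RHS]eq_fun do rewrite dC.
have hd := wdivP (rel_div_wdiv hh); split=> //; [by exists w|by exists (wdiv Omega u)|].
move=> phi [hp [G hG]]; have hg := wgradP hG; have [g2 _] := hg.
have [d2 _] := hd; have [h2 eh] := hh.
have i1 := L2v_Cintegrable mO hu g2; have i2 := L2_Cintegrable mO d2 hp.
have := CintD mO i1 i2 => ->; rewrite (eh phi) //.
have nul := wdiv_unique (rel_div_wdiv hh) hd.
by rewrite (Cint_mul_null mO h2 d2 hp nul) addNr.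
Qed.

Lemma XT_L2v u : XT Omega u -> L2v mu D u. Proof. by case. Qed.

Lemma XT_wcurl u : XT Omega u -> is_wcurl Omega u (wcurl Omega u).
Proof. by case=> _ [w /wcurlP]. Qed.

Lemma XT_rel_div u : XT Omega u -> rel_div u (wdiv Omega u).
Proof.
move=> /XTP[_ [h hh]]; have hd := wdivP (rel_div_wdiv hh); have [d2 _] := hd.
have [h2 eh] := hh; split=> // phi G hp hG; rewrite (eh phi) //; congr (- _).
exact: Cint_mul_null (wdiv_unique (rel_div_wdiv hh) hd).
Qed.

Lemma XT_lin c u v : XT Omega u -> XT Omega v -> XT Omega (fun x => c *: u x + v x).
Proof.
move=> hu hv; apply/XTP; split; [split|].
- by apply: L2v_lin => //; exact: XT_L2v.
- by exists (fun x => c *: wcurl Omega u x + wcurl Omega v x); apply: wcurl_lin;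
    [exact: XT_L2v|exact: XT_L2v|exact: XT_wcurl|exact: XT_wcurl].
- by exists (fun x => c * wdiv Omega u x + wdiv Omega v x); apply: rel_div_lin;
    [exact: XT_L2v|exact: XT_L2v|exact: XT_rel_div|exact: XT_rel_div].
Qed.

Lemma conjf_test (phi : P -> C) : test_function Omega phi -> test_function Omega (conjf phi).
Proof.
move=> [sp [K [cK KO p0]]]; split; last first.
  by exists K; split=> // x /p0; rewrite /conjf => ->; rewrite conjc0.
exact: smooth_conjf.
Qed.

Lemma dpartial_conjf i (phi : P -> C) : smooth phi -> dpartial i (conjf phi) = conjf (dpartial i phi).
Proof.
move=> sp; apply/funext => x; rewrite /conjf.
have e0 : (fun y => complex.Re (conjf phi y)) = (fun y => complex.Re (phi y)).
  by apply/funext => y; rewrite /conjf; case: (phi y).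
have e1 : (fun y => complex.Im (conjf phi y)) = - (fun y => complex.Im (phi y)).
  by apply/funext => y; rewrite /conjf -[RHS]/(- complex.Im (phi y)); case: (phi y).
rewrite /dpartial e0 e1 deriveN //; apply: diff_derivable.
exact: (rsmooth_diff x (smooth_part true sp)).
Qed.

Lemma conj_opp (z : C) : conjc (- z) = - conjc z. Proof. by rewrite rmorphN. Qed.

Lemma wgrad_conj f F : L2 mu D f -> is_wgrad Omega f F -> is_wgrad Omega (conjf f) (vconj F).
Proof.
move=> hf [hF h]; split; first exact: L2v_conj.
move=> phi tp i; have tc := conjf_test tp; have [sp _] := tp; have [sc _] := tc.
have -> : (fun x => conjf f x * dpartial i phi x) = (fun x => conjf f x * conjf (dpartial i (conjf phi)) x).
  by rewrite -dpartial_conjf // conjfK.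
rewrite Cint_mul_conj //; last exact/test_L2/test_dpartial.
rewrite h // conj_opp -Cint_mul_conj ?conjfK //; last exact: test_L2.
by congr (- _); apply: eq_Cint => x _; rewrite /vconj /conjv mxE.
Qed.

Lemma curl_conj (phi : vfield R) : (forall i, smooth (fun x => phi x 0 i)) ->
  curl (vconj phi) = vconj (curl phi).
Proof.
move=> sp; apply/funext => x; apply/rowP => i; rewrite /curl /vconj /conjv !mxE.
have e j : (fun y : P => map_mx (@conjc R) (phi y) 0 j) = conjf (fun y => phi y 0 j).
  by apply/funext => y; rewrite mxE.
by rewrite !e !dpartial_conjf // rmorphB.
Qed.

Lemma vconj_test (phi : vfield R) : (forall i, test_function Omega (fun x => phi x 0 i)) ->
  forall i, test_function Omega (fun x => vconj phi x 0 i).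
Proof.
move=> tp i; have := conjf_test (tp i); congr test_function.
by apply/funext => x; rewrite /vconj mxE.
Qed.

Lemma wcurl_conj u w : L2v mu D u -> is_wcurl Omega u w -> is_wcurl Omega (vconj u) (vconj w).
Proof.
move=> hu [hw h]; split; first exact: L2v_conj.
move=> phi tp; have tc := vconj_test tp.
have -> : curl phi = vconj (curl (vconj phi)).
  by rewrite -curl_conj ?vconjK // => i; have [] := tc i.
rewrite Cint_dotv_conj //; last exact: curl_L2v.
rewrite h // -Cint_dotv_conj ?vconjK //; exact: test_vec_L2v.
Qed.

Lemma rel_div_conj u h : L2v mu D u -> rel_div u h -> rel_div (vconj u) (conjf h).
Proof.
move=> hu [hh e]; split; first exact: L2_conj.
move=> phi G hp hG; have [G2 _] := hG.
have gc := wgrad_conj hp hG; have [gc2 _] := gc.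
rewrite -{1}[G]vconjK Cint_dotv_conj // (e (conjf phi)) //; last exact: L2_conj.
by rewrite conj_opp -Cint_mul_conj ?conjfK //; exact: L2_conj.
Qed.

Lemma XT_conj u : XT Omega u -> XT Omega (vconj u).
Proof.
move=> hu; apply/XTP; split; [split|].
- by apply: L2v_conj => //; exact: XT_L2v.
- by exists (vconj (wcurl Omega u)); apply: wcurl_conj; [exact: XT_L2v|exact: XT_wcurl].
- by exists (conjf (wdiv Omega u)); apply: rel_div_conj; [exact: XT_L2v|exact: XT_rel_div].
Qed.

End WeakDerivativeTheory.

(** * The space X_T *)

Section ClosedGraph.
Variables (R : realType) (X Y : zmodType) (scX : R -> X -> X) (scY : R -> Y -> Y).
Variables (SX : X -> Prop) (BX : X -> X -> R) (SY : Y -> Prop) (BY : Y -> Y -> R).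
Hypothesis HX : prehilbert scX SX BX.
Hypothesis HY : prehilbert scY SY BY.
Hypothesis cX : ph_complete SX BX.
Hypothesis cY : ph_complete SY BY.
Variable T : Y -> Prop.
Hypothesis TS : forall f, T f -> SY f.
Hypothesis T0 : T 0.
Hypothesis TD : forall f g, T f -> T g -> T (f + g).
Hypothesis TN : forall f, T f -> T (- f).
Hypothesis TZ : forall t f, T f -> T (scY t f).
Hypothesis Ttotal : forall f, SY f -> (forall g, T g -> BY f g = 0) -> BY f f = 0.

(** The sequential closure of [T] is complete, so that [riesz] applies to it. *)
Definition closure_of f := SY f /\
  exists2 g : nat -> Y, forall n, T (g n) & tends0 (fun n => BY (g n - f) (g n - f)).

Lemma closure_of_sub f : T f -> closure_of f.
Proof.
move=> Tf; split; first exact: TS.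
by exists (fun=> f) => // e e0; exists 0%N => n _; rewrite subrr (ph_B0 HY) //; exact: (ph_0 HY).
Qed.

Lemma closure_ofP f : SY f -> (forall e : R, 0 < e -> exists2 g, T g & BY (g - f) (g - f) < e) ->
  closure_of f.
Proof.
move=> Sf h; split => //.
have /choice[g hg] : forall n, exists g, T g /\ BY (g - f) (g - f) < n.+1%:R^-1.
  move=> n; have p : (0 : R) < n.+1%:R^-1 by rewrite invr_gt0.
  by have [g Tg gf] := h _ p; exists g.
exists g; first by move=> n; case: (hg n).
apply: (@tends0_le R _ (fun n => n.+1%:R^-1) 1 _ _ (@tends0_invn R)) => // n.
by rewrite mul1r ltW //; case: (hg n).
Qed.

Lemma closure_of_complete : ph_complete closure_of BY.
Proof.
apply: complete_sub cY; first by move=> f [].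
move=> u v hu Sv uv; apply: closure_ofP => // e e0.
have e4 : 0 < e / 4 by rewrite divr_gt0.
have [N hN] := uv _ e4; have [SN [g Tg gu]] := hu N; have [M hM] := gu _ e4.
exists (g M) => //; rewrite -(subrK (u N) (g M)) -addrA.
have S1 := ph_B HY (TS (Tg M)) SN; have S2 := ph_B HY SN Sv.
apply: le_lt_trans (ph_sqD_le HY S1 S2) _.
by move: (hN N (leqnn N)) (hM M (leqnn M)); lra.
Qed.

Lemma closure_of_prehilbert : prehilbert scY closure_of BY.
Proof.
apply: (prehilbert_sub (S := SY)) => //.
- by move=> f [].
- exact: closure_of_sub.
- move=> f f' [Sf [g Tg gf]] [Sf' [g' Tg' gf']]; split; first exact: (ph_D HY).
  exists (fun n => g n + g' n); first by move=> n; exact: TD.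
  apply: (tends0_le (C := 2) _ _ (tends0D gf gf')) => // n; rewrite mulrDr.
  rewrite opprD addrACA; apply: (ph_sqD_le HY); apply: (ph_B HY) => //; exact: TS.
- move=> f [Sf [g Tg gf]]; split; first exact: (ph_N HY).
  exists (fun n => - g n); first by move=> n; exact: TN.
  apply: (tends0_le (C := 1) _ _ gf) => // n.
  by rewrite mul1r -opprD (ph_BN HY) ?(ph_NB HY) ?opprK //; do ?apply: (ph_N HY);
    apply: (ph_D HY) => //; do ?apply: (ph_N HY) => //; exact: TS.
- move=> t f [Sf [g Tg gf]]; split; first exact: (ph_Z HY).
  exists (fun n => scY t (g n)); first by move=> n; exact: TZ.
  apply: (tends0_le (C := t ^+ 2) _ _ gf) => [|n]; first exact: sqr_ge0.
  have Sg := TS (Tg n).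
  rewrite !(ph_sqB HY) ?(ph_sqZ HY) // ?(ph_BZ HY) ?(ph_ZB HY) //; do ?exact: (ph_Z HY).
  by rewrite le_eqVlt; apply/orP; left; apply/eqP; ring.
Qed.

(** [riesz] on the closure of [T] represents the functional by some g in that closure. Then f - g is
    orthogonal to [T], hence null as [T] is total, and the bound at g reads (B f f)^2 <= K B f f. *)
Lemma dual_norm f K : 0 <= K -> SY f ->
  (forall g, T g -> BY f g ^+ 2 <= K * BY g g) -> BY f f <= K.
Proof.
move=> K0 Sf h; have HC := closure_of_prehilbert.
have lb g : closure_of g -> BY f g ^+ 2 <= K * BY g g.
  move=> [Sg [k Tk kg]].
  have Kp : Num.sqrt K ^+ 2 = K by rewrite sqr_sqrtr.
  have hk : tends0 (fun n => phn BY (k n - g)).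
    by apply: (tends0_phn HY) => // n; apply: (ph_B HY) => //; exact: TS.
  have le1 n : phn BY f * phn BY (k n - g) >= `|BY f (k n) - BY f g|.
    rewrite -(ph_NB HY Sg) // -(ph_DB HY) //; last exact: (ph_N HY); last exact: TS.
    by apply: (phn_CS HY) => //; apply: (ph_B HY) => //; exact: TS.
  have le2 n : `|BY f (k n)| <= Num.sqrt K * phn BY (k n).
    rewrite -(@ler_pXn2r _ 2) ?nnegrE ?mulr_ge0 ?sqrtr_ge0 //.
    by rewrite exprMn Kp (phn_sq HY) ?real_normK ?num_real ?h //; exact: TS.
  have le3 n : phn BY (k n) <= phn BY g + phn BY (k n - g).
    by rewrite -{1}(subrK g (k n)) addrC (phnD HY) //; apply: (ph_B HY) => //; exact: TS.
  have key : `|BY f g| - Num.sqrt K * phn BY g <= 0.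
    apply: (tends0_le0 (q := fun n => (phn BY f + Num.sqrt K) * phn BY (k n - g))); last first.
      by apply: (tends0_le (C := phn BY f + Num.sqrt K) _ _ hk) => //; rewrite addr_ge0 ?phn_ge0 ?sqrtr_ge0.
    move=> n; rewrite mulrDl.
    have t1 : `|BY f g| <= `|BY f (k n)| + `|BY f (k n) - BY f g|.
      by have := ler_normB (BY f (k n)) (BY f (k n) - BY f g); rewrite opprB addrCA subrr addr0.
    have t2 := ler_wpM2l (sqrtr_ge0 K) (le3 n); rewrite mulrDr in t2.
    by move: t1 t2 (le1 n) (le2 n); lra.
  rewrite subr_le0 in key.
  rewrite -Kp -(phn_sq HY Sg) -exprMn -[BY f g ^+ 2]real_normK ?num_real //.
  by rewrite ler_pXn2r ?nnegrE ?mulr_ge0 ?sqrtr_ge0 // phn_ge0.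
have [|||g cg hg] := riesz HC (l := BY f) (K := K) closure_of_complete.
- by move=> u v [Su _] [Sv _]; rewrite (ph_DB HY).
- by move=> t u [Su _]; rewrite (ph_ZB HY).
- exact: lb.
have [Sg _] := cg.
have z : BY (f - g) (f - g) = 0.
  apply: Ttotal; first exact: (ph_B HY).
  move=> k Tk; have Sk := TS Tk; rewrite (ph_BD HY) ?(ph_BN HY) //; last exact: (ph_N HY).
  by rewrite hg ?subrr //; exact: closure_of_sub.
have Ss := ph_B HY Sf Sg.
have e1 : BY f f = BY f g.
  have := ph_null HY Ss Sf z; rewrite (ph_BD HY) ?(ph_BN HY) //; last exact: (ph_N HY).
  by move/eqP; rewrite subr_eq0 (ph_C HY Sg Sf) => /eqP.
have e2 : BY g g = BY f g by exact: hg.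
have := lb g cg; rewrite e2 -e1 => hh.
have f0 := ph_ge0 HY Sf; have [->|fn0] := eqVneq (BY f f) 0 => //.
by rewrite -(@ler_pM2r _ (BY f f)) ?lt_def ?fn0 // -expr2.
Qed.

(* The functionals [u |-> BY (G u) g], for g in the unit ball of T, are
   pointwise bounded by the norm of G u. *)
Lemma closed_graph (G : X -> Y) :
  (forall u, SX u -> SY (G u)) ->
  (forall g u v, T g -> SX u -> SX v -> BY (G (u + v)) g = BY (G u) g + BY (G v) g) ->
  (forall g t u, T g -> SX u -> BY (G (scX t u)) g = t * BY (G u) g) ->
  (forall g, T g -> exists K, forall u, SX u -> BY (G u) g ^+ 2 <= K * BX u u) ->
  exists2 C, 0 <= C & forall u, SX u -> BY (G u) (G u) <= C * BX u u.
Proof.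
move=> GS GD GZ Gb.
pose I := {g : Y | T g /\ BY g g <= 1}.
have K_ (g : I) : {K | forall u, SX u -> BY (G u) (projT1 g) ^+ 2 <= K * BX u u}.
  by case: g => g [Tg g1]; apply/cid; exact: Gb.
have [||||C C0 hC] := @uniform_boundedness _ _ _ _ _ HX I (fun g u => BY (G u) (projT1 g)) (fun g => projT1 (K_ g)) cX.
- by move=> [g [Tg g1]] u v Su Sv; exact: GD.
- by move=> [g [Tg g1]] t u Su; exact: GZ.
- by move=> g u Su; exact: (projT2 (K_ g)).
- move=> u Su; exists (phn BY (G u)) => -[g [Tg g1]] /=.
  apply: le_trans (phn_CS HY (GS _ Su) (TS Tg)) _; rewrite ler_piMr ?phn_ge0 //.
  by rewrite (phn_le HY) ?expr1n //; exact: TS.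
exists C => // u Su; apply: dual_norm; first by rewrite mulr_ge0 // (ph_ge0 HX).
  exact: GS.
move=> g Tg; have Sg := TS Tg.
have [g0|g0] := eqVneq (BY g g) 0.
  by rewrite (ph_C HY (GS _ Su) Sg) (ph_null HY Sg (GS _ Su) g0) expr0n mulr_ge0 ?(ph_ge0 HY) ?mulr_ge0 ?(ph_ge0 HX).
have gp : 0 < BY g g by rewrite lt_def g0 (ph_ge0 HY).
have np : 0 < phn BY g by rewrite lt_def phn_ge0 andbT; apply: contra_neq g0 => z; rewrite -(phn_sq HY) // z expr0n.
have Tz : T (scY (phn BY g)^-1 g) by exact: TZ.
have h1 : BY (scY (phn BY g)^-1 g) (scY (phn BY g)^-1 g) <= 1.
  by rewrite (ph_sqZ HY) // exprVn (phn_sq HY) // mulVf.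
have := hC (exist _ _ (conj Tz h1)) u Su; rewrite /= (ph_ZB HY) //; last exact: GS.
by rewrite exprMn exprVn (phn_sq HY) // mulrC ler_pdivrMr.
Qed.

End ClosedGraph.

Section LinearShapes.
Variables (R : realType) (T : Type).
Local Notation C := R[i].

(** Facts are proved once for c u + v; these identities extract sums, opposites and real multiples
    from them. *)
Lemma vlinD (u v : T -> 'rV[C]_3) : (fun x => 1 *: u x + v x) = u + v.
Proof. by apply/funext => x; rewrite scale1r. Qed.
Lemma vlinN (u : T -> 'rV[C]_3) : (fun x => -1 *: u x + (0 : T -> 'rV[C]_3) x) = - u.
Proof. by apply/funext => x; rewrite scaleN1r addr0. Qed.
Lemma vlinZ t (u : T -> 'rV[C]_3) : (fun x => t%:C%C *: u x + (0 : T -> 'rV[C]_3) x) = vscale t u.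
Proof. by apply/funext => x; rewrite addr0. Qed.
Lemma slinD (u v : T -> C) : (fun x => 1 * u x + v x) = u + v.
Proof. by apply/funext => x; rewrite mul1r. Qed.
Lemma slinN (u : T -> C) : (fun x => -1 * u x + (0 : T -> C) x) = - u.
Proof. by apply/funext => x; rewrite mulN1r addr0. Qed.
Lemma slinZ t (u : T -> C) : (fun x => t%:C%C * u x + (0 : T -> C) x) = cscale t u.
Proof. by apply/funext => x; rewrite addr0. Qed.

End LinearShapes.

Definition ctends (R : realType) (z : nat -> R[i]) (w : R[i]) :=
  tends0 (fun n => `|complex.Re (z n) - complex.Re w|) /\
  tends0 (fun n => `|complex.Im (z n) - complex.Im w|).

Lemma ctends_eq (R : realType) (x y : nat -> R[i]) a b : (forall n, x n = y n) ->
  ctends x a -> ctends y b -> a = b.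
Proof.
move=> xy [h1 h2] [k1 k2]; apply/eqP; rewrite eq_complex; apply/andP; split; apply/eqP.
  by apply: tends0_eq h1 k1 => n; rewrite xy.
by apply: tends0_eq h2 k2 => n; rewrite xy.
Qed.

Lemma ctendsN (R : realType) (x : nat -> R[i]) a : ctends x a -> ctends (fun n => - x n) (- a).
Proof.
move=> [h1 h2]; split; [apply: (tends0_le (C := 1) _ _ h1)|apply: (tends0_le (C := 1) _ _ h2)] => // n;
  by rewrite !raddfN -opprD normrN mul1r.
Qed.

Section CintLimits.
Context d (T : measurableType d) (R : realType).
Variables (mu : {measure set T -> \bar R}) (D : set T).
Hypothesis mD : measurable D.
Local Notation C := R[i].
Local Notation vf := (T -> 'rV[C]_3).

Lemma Cint_mul_lim (f : nat -> T -> C) g a : (forall n, L2 mu D (f n)) -> L2 mu D g -> L2 mu D a ->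
  tends0 (fun n => cdot mu D (f n - g) (f n - g)) ->
  ctends (fun n => Cint mu D (fun x => f n x * a x)) (Cint mu D (fun x => g x * a x)).
Proof.
move=> hf hg ha h; have Hc := cdot_prehilbert mu mD.
have [h1 h2] := (ph_lim Hc hf hg (L2_conj mD ha) h, ph_lim Hc hf hg (L2_iconj mD ha) h).
rewrite Cint_mulE //; split; [apply: (tends0_le (C := 1) _ _ h1)|apply: (tends0_le (C := 1) _ _ h2)] => // n;
  by rewrite mul1r Cint_mulE.
Qed.

Lemma Cint_dotv_lim (f : nat -> vf) g a : (forall n, L2v mu D (f n)) -> L2v mu D g -> L2v mu D a ->
  tends0 (fun n => vdot mu D (f n - g) (f n - g)) ->
  ctends (fun n => Cint mu D (fun x => dotv (f n x) (a x))) (Cint mu D (fun x => dotv (g x) (a x))).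
Proof.
move=> hf hg ha h; have Hc := vdot_prehilbert mu mD.
have [h1 h2] := (ph_lim Hc hf hg (L2v_conj mD ha) h, ph_lim Hc hf hg (L2v_iconj mD ha) h).
rewrite Cint_dotvE //; split; [apply: (tends0_le (C := 1) _ _ h1)|apply: (tends0_le (C := 1) _ _ h2)] => // n;
  by rewrite mul1r Cint_dotvE.
Qed.

End CintLimits.

(** * X_T as a complete space, and its gradient bound *)

Section XTSpace.
Variables (R : realType) (Omega : set (pt R)).
Local Notation P := (pt R).
Local Notation C := R[i].
Local Notation mu := (leb3 R).
Local Notation D := (Omega : set (mpt R)).
Hypothesis oO : open Omega.
Hypothesis bO : bounded_set Omega.
Let mO : measurable D := mOmega oO.
Local Notation Hv := (vdot_prehilbert mu mO).
Local Notation Hs := (cdot_prehilbert mu mO).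

Lemma is_wcurl0 : is_wcurl Omega 0 0.
Proof.
split; first exact: (ph_0 Hv).
by move=> phi _; apply: eq_Cint => x _; rewrite /dotv !big1 // => i _; rewrite mxE mul0r.
Qed.

Lemma rel_div0 : rel_div Omega 0 0.
Proof.
split; first exact: (ph_0 Hs).
move=> phi G _ _; rewrite (_ : (fun x => _) = fun=> 0); last first.
  by apply/funext => x; rewrite /dotv !big1 // => i _; rewrite mxE mul0r.
rewrite (_ : (fun x => _ * _) = fun=> 0) ?Cint0 ?oppr0 //.
by apply/funext => x; rewrite mul0r.
Qed.

(** X_T is built by two graph constructions: first the curl over L^2, then [rel_div] over the
    result. *)
Definition curl_dom := graph_dom (L2v mu D) (is_wcurl Omega).
Definition curl_form := graph_form (vdot mu D) (vdot mu D) (wcurl Omega).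

Lemma is_wcurlD u v w z : L2v mu D u -> L2v mu D v -> is_wcurl Omega u w -> is_wcurl Omega v z ->
  is_wcurl Omega (u + v) (w + z).
Proof. by move=> hu hv h k; have := wcurl_lin oO bO 1 hu hv h k; rewrite !vlinD. Qed.

Lemma is_wcurlN u w : L2v mu D u -> is_wcurl Omega u w -> is_wcurl Omega (- u) (- w).
Proof. by move=> hu h; have := wcurl_lin oO bO (-1) hu (ph_0 Hv) h is_wcurl0; rewrite !vlinN. Qed.

Lemma is_wcurlZ t u w : L2v mu D u -> is_wcurl Omega u w -> is_wcurl Omega (vscale t u) (vscale t w).
Proof. by move=> hu h; have := wcurl_lin oO bO t%:C%C hu (ph_0 Hv) h is_wcurl0; rewrite !vlinZ. Qed.

Lemma curl_prehilbert : prehilbert vscale curl_dom curl_form.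
Proof.
apply: (graph_prehilbert Hv Hv (rel := is_wcurl Omega)).
- by move=> u w [].
- exact: is_wcurl0.
- exact: is_wcurlD.
- exact: is_wcurlN.
- exact: is_wcurlZ.
- by move=> u w z _; exact: wcurl_unique.
- by move=> u w _; exact: wcurlP.
Qed.

Lemma curl_complete : ph_complete curl_dom curl_form.
Proof.
refine (graph_complete Hv Hv (rel := is_wcurl Omega) _ _ _ _ _ _ (vdot_complete (mu := mu) mO) (vdot_complete (mu := mu) mO)).
- by move=> u w [].
- exact: is_wcurlD.
- exact: is_wcurlN.
- by move=> u w z _; exact: wcurl_unique.
- by move=> u w _; exact: wcurlP.
- move=> u v w z Su Sv Sz uw uv wz; split=> // phi tp.
  apply: (ctends_eq _ (Cint_dotv_lim mO Su Sv (curl_L2v oO bO tp) uv)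
    (Cint_dotv_lim mO _ Sz (test_vec_L2v oO bO tp) wz)).
    by move=> n; have [_ ->] := uw n.
  by move=> n; have [] := uw n.
Qed.

Definition XTform := graph_form curl_form (cdot mu D) (wdiv Omega).

Lemma XTE : XT Omega = graph_dom curl_dom (rel_div Omega).
Proof. by apply/funext => u; apply/propext; exact: XTP. Qed.

Lemma rel_divD u v w z : L2v mu D u -> L2v mu D v -> rel_div Omega u w -> rel_div Omega v z ->
  rel_div Omega (u + v) (w + z).
Proof. by move=> hu hv h k; have := rel_div_lin oO 1 hu hv h k; rewrite vlinD slinD. Qed.

Lemma rel_divN u w : L2v mu D u -> rel_div Omega u w -> rel_div Omega (- u) (- w).
Proof. by move=> hu h; have := rel_div_lin oO (-1) hu (ph_0 Hv) h rel_div0; rewrite vlinN slinN. Qed.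

Lemma rel_divZ t u w : L2v mu D u -> rel_div Omega u w -> rel_div Omega (vscale t u) (cscale t w).
Proof. by move=> hu h; have := rel_div_lin oO t%:C%C hu (ph_0 Hv) h rel_div0; rewrite vlinZ slinZ. Qed.

Lemma rel_div_unique u w z : rel_div Omega u w -> rel_div Omega u z -> cdot mu D (w - z) (w - z) = 0.
Proof. by move=> h k; apply: (wdiv_unique oO bO (u := u)); exact: rel_div_wdiv. Qed.

Lemma rel_div_D u w : curl_dom u -> rel_div Omega u w -> rel_div Omega u (wdiv Omega u).
Proof. by move=> cu h; apply: XT_rel_div => //; apply/XTP => //; split=> //; exists w. Qed.

Lemma XT_prehilbert : prehilbert vscale (XT Omega) XTform.
Proof.
rewrite XTE; apply: (graph_prehilbert curl_prehilbert Hs (rel := rel_div Omega)).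
- by move=> u w [].
- exact: rel_div0.
- by move=> u v w z [Su _] [Sv _]; exact: rel_divD.
- by move=> u w [Su _]; exact: rel_divN.
- by move=> t u w [Su _]; exact: rel_divZ.
- by move=> u w z _; exact: rel_div_unique.
- exact: rel_div_D.
Qed.

Lemma XT_complete : ph_complete (XT Omega) XTform.
Proof.
rewrite XTE; refine (graph_complete curl_prehilbert Hs (rel := rel_div Omega) _ _ _ _ _ _ curl_complete (cdot_complete (mu := mu) mO)).
- by move=> u w [].
- by move=> u v w z [Su _] [Sv _]; exact: rel_divD.
- by move=> u w [Su _]; exact: rel_divN.
- by move=> u w z _; exact: rel_div_unique.
- exact: rel_div_D.
- move=> u v w z Su [Sv cv] Sz uw uv wz; split=> // phi G hp hG; have [G2 _] := hG.
  have Su' n : L2v mu D (u n) by case: (Su n).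
  have uv' : tends0 (fun n => vdot mu D (u n - v) (u n - v)).
    apply: (tends0_le (C := 1) _ _ uv) => // n; rewrite mul1r lerDl (ph_ge0 Hv) //.
    have [_ [k hk]] := Su n; have [k' hk'] := cv.
    by have [] := wcurlP (is_wcurlD (Su' n) (ph_N Hv Sv) hk (is_wcurlN Sv hk')).
  have hw n : L2 mu D (w n) by case: (uw n).
  apply: (ctends_eq _ (Cint_dotv_lim mO Su' Sv G2 uv') (ctendsN (Cint_mul_lim mO hw Sz hp wz))).
  by move=> n; have [_ e] := uw n; rewrite (e phi).
Qed.

Lemma XTformE u v : XTform u v = vdot mu D u v + vdot mu D (wcurl Omega u) (wcurl Omega v)
  + cdot mu D (wdiv Omega u) (wdiv Omega v).
Proof. by []. Qed.

Lemma XT_wdiv_L2 u : XT Omega u -> L2 mu D (wdiv Omega u).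
Proof. by move=> /(XT_rel_div oO bO)[]. Qed.

Lemma XT_wcurl_L2v u : XT Omega u -> L2v mu D (wcurl Omega u).
Proof. by move=> /XT_wcurl[]. Qed.

Lemma sqXTE u : XT Omega u -> sqXT Omega u = XTform u u.
Proof.
move=> hu; rewrite XTformE /sqXT (sqL2E mO (XT_wdiv_L2 hu)) (sqL2vE mO (XT_wcurl_L2v hu)).
by rewrite (sqL2vE mO (XT_L2v hu)).
Qed.

Lemma test_total (f : P -> C) : L2 mu D f ->
  (forall g, test_function Omega g -> cdot mu D f g = 0) -> cdot mu D f f = 0.
Proof.
move=> hf h; apply: (fundamental_complex oO bO) => // phi tp.
rewrite Cint_mulE //; last exact: test_L2.
rewrite (h (conjf phi)) ?(h (iconjf phi)) //; last exact: conjf_test.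
exact: (testZ 'i%C (conjf_test tp)).
Qed.

(** For a fixed test function g, the product of the i-th derivative of u_j with g is minus that of
    u_j with the i-th derivative of g, hence bounded on X_T. The closed graph theorem gives a
    constant for each pair (i, j), and their sum serves for all. *)
Lemma XT_grad_bound : (forall u, XT Omega u -> forall j, exists G, is_wgrad Omega (vcomp j u) G) ->
  exists2 K, 0 <= K & forall u, XT Omega u -> forall j,
    vdot mu D (wgrad Omega (vcomp j u)) (wgrad Omega (vcomp j u)) <= K * XTform u u.
Proof.
move=> hG.
have hw u j : XT Omega u -> is_wgrad Omega (vcomp j u) (wgrad Omega (vcomp j u)).
  by move=> /hG /(_ j)[G /wgradP].
(* The weak gradient is tested with conj g, since the real product of F and g is the real part of
   the integral of F conj g. *)
have pair u i j g : XT Omega u -> test_function Omega g ->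
    cdot mu D (vcomp i (wgrad Omega (vcomp j u))) g = - cdot mu D (vcomp j u) (dpartial i g).
  move=> hu tg; have [h2 e] := hw u j hu; have [sg _] := tg.
  have := e _ (conjf_test tg) i; rewrite dpartial_conjf //.
  have l1 : L2 mu D (conjf (dpartial i g)) by apply: L2_conj => //; apply: test_L2 => //; exact: test_dpartial.
  have l2 : L2 mu D (conjf g) by apply: L2_conj => //; exact: test_L2.
  rewrite (Cint_mulE mO (XT_L2v hu j) l1) (Cint_mulE mO (h2 i) l2) !conjfK => -[-> _].
  by rewrite opprK.
have one i j : exists2 K, 0 <= K & forall u, XT Omega u ->
    cdot mu D (vcomp i (wgrad Omega (vcomp j u))) (vcomp i (wgrad Omega (vcomp j u))) <= K * XTform u u.
  refine (closed_graph XT_prehilbert Hs XT_complete (cdot_complete (mu := mu) mO) (T := test_function Omega) _ _ _ _ _ _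
    (G := fun u => vcomp i (wgrad Omega (vcomp j u))) _ _ _ _).
  - by move=> f tf; exact: test_L2.
  - exact: test0.
  - by move=> f g; exact: testD.
  - move=> f /(testZ (-1)); congr test_function.
    by apply/funext => x; rewrite mulN1r.
  - by move=> t f; exact: testZ.
  - exact: test_total.
  - by move=> u hu; have [h2 _] := hw u j hu; exact: h2.
  - move=> g u v tg hu hv; have huv := ph_D XT_prehilbert hu hv.
    have l2 : L2 mu D (dpartial i g) := test_L2 oO bO (test_dpartial i tg).
    rewrite (pair _ i j g huv tg) (pair _ i j g hu tg) (pair _ i j g hv tg) -opprD vcompD.
    by congr (- _); exact: (ph_BD Hs (XT_L2v hu j) (XT_L2v hv j) l2).
  - move=> g t u tg hu; have htu := ph_Z XT_prehilbert t hu.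
    have l2 : L2 mu D (dpartial i g) := test_L2 oO bO (test_dpartial i tg).
    rewrite (pair _ i j g htu tg) (pair _ i j g hu tg) mulrN vcompZ.
    by congr (- _); exact: (ph_BZ Hs t (XT_L2v hu j) l2).
  - move=> g tg; have l2 : L2 mu D (dpartial i g) by apply: test_L2 => //; exact: test_dpartial.
    exists (cdot mu D (dpartial i g) (dpartial i g)) => u hu; rewrite pair // sqrrN.
    apply: le_trans (ph_CS Hs (XT_L2v hu j) l2) _.
    rewrite mulrC; apply: ler_wpM2l; first exact: (ph_ge0 Hs).
    rewrite XTformE -addrA /vdot (bigD1 j) //= -addrA lerDl; apply: addr_ge0.
      by apply: sumr_ge0 => k _; apply: (ph_ge0 Hs); exact: XT_L2v hu k.
    by apply: addr_ge0; [exact: (ph_ge0 Hv (XT_wcurl_L2v hu))|exact: (ph_ge0 Hs (XT_wdiv_L2 hu))].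
have /choice[K hK] : forall p : 'I_3 * 'I_3, exists K, 0 <= K /\ forall u, XT Omega u ->
    cdot mu D (vcomp p.1 (wgrad Omega (vcomp p.2 u))) (vcomp p.1 (wgrad Omega (vcomp p.2 u))) <= K * XTform u u.
  by move=> [i j]; have [K K0 h] := one i j; exists K.
exists (\sum_p K p); first by apply: sumr_ge0 => p _; case: (hK p).
move=> u hu j; have X0 := ph_ge0 XT_prehilbert hu.
apply: (@le_trans _ _ (\sum_i K (i, j) * XTform u u)).
  by apply: ler_sum => i _; have [_] := hK (i, j); exact.
rewrite -mulr_suml; apply: ler_wpM2r => //.
rewrite [leRHS](eq_bigr (fun p => K (p.1, p.2))); last by move=> [].
rewrite -(pair_bigA _ (fun i k => K (i, k))) /=; apply: ler_sum => i _.
by rewrite (bigD1 j) //= lerDl sumr_ge0 // => k _; case: (hK (i, k)).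
Qed.

End XTSpace.

(** * The trace inequality below a graph *)

Section LineInequality.
Variable R : realType.
Local Notation L := (@lebesgue_measure R).

(** The fundamental theorem of calculus, then Cauchy-Schwarz against 1 on [x, y]. The half-open
    interval on the right matches the cells of the grid. *)
Lemma FTC_sq_le (f f' : R -> R) (x y a b : R) : a <= x -> x < y -> y <= b ->
  continuous f' -> (forall t : R, is_derive t (1 : R) f (f' t)) ->
  (((f x - f y) ^+ 2)%:E <= (b - a)%:E * \int[L]_(t in `[a, b[) ((f' t) ^+ 2)%:E)%E.
Proof.
move=> ax xy yb cf' df.
have cf : continuous f by move=> t; apply/differentiable_continuous/derivable1_diffP; case: (df t).
have mxy : measurable (`[x, y]%classic : set (measurableTypeR R)) by exact: measurable_itv.
have mf' (A : set (measurableTypeR R)) : measurable A -> measurable_fun A f'.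
  by move=> mA; apply: measurable_funTS; exact: continuous_measurable_fun.
have ftc : (\int[L]_(t in `[x, y]) (f' t)%:E = (f y)%:E - (f x)%:E)%E.
  apply: continuous_FTC2 => //.
  - exact: continuous_subspaceT.
  - split; [by move=> t _; case: (df t)|apply: cvg_at_right_filter; exact: cf|apply: cvg_at_left_filter; exact: cf].
  - by move=> t _; rewrite derive1E; case: (df t).
have Lxy : L `[x, y]%classic = (y - x)%:E by rewrite lebesgue_measure_itv /= lte_fin xy.
have Ic (c : R) : (\int[L]_(t in `[x, y]) c%:E = (c * (y - x))%:E)%E.
  by rewrite (integral_cst L mxy c%:E) EFinM; congr (_ * _)%E; exact: Lxy.
have h1 : rL2 L `[x, y]%classic (cst 1).
  split; first exact: measurable_cst.
  by rewrite [X in (X < _)%E](Ic (1 ^+ 2)) ltry.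
have h2 : rL2 L `[x, y]%classic f'.
  split; first exact: mf'.
  have [t0 _ tM] : exists2 c, c \in `[x, y] & forall t, t \in `[x, y] -> (f' t) ^+ 2 <= (f' c) ^+ 2.
    apply: EVT_max; first exact: ltW.
    by apply: continuous_subspaceT => t; exact: (continuous_comp (cf' t) (@exprn_continuous R 2 (f' t))).
  apply: (@le_lt_trans _ _ (\int[L]_(t in `[x, y]) ((f' t0) ^+ 2)%:E)%E).
    apply: ge0_le_integral => //.
    - by move=> t _; rewrite lee_fin sqr_ge0.
    - by apply/measurable_EFinP/measurable_funX; exact: mf'.
  by rewrite Ic ltry.
have := ph_CS (rL2_prehilbert L mxy) h2 h1.
have -> : rdot L `[x, y]%classic f' (cst 1) = f y - f x.
  rewrite /rdot /Rintegral; under eq_integral do rewrite mulr1.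
  by rewrite ftc -EFinB.
have -> : rdot L `[x, y]%classic (cst 1) (cst 1) = y - x.
  apply: EFin_inj; rewrite rdotE //.
  by rewrite [LHS](Ic (1 ^+ 2)) expr1n mul1r.
move=> CS; have h : (((f x - f y) ^+ 2)%:E <= (rdot L `[x, y]%classic f' f')%:E * (y - x)%:E)%E.
  by rewrite -EFinM lee_fin -sqrrN opprB.
apply: le_trans h _; rewrite rdotE //.
rewrite muleC; apply: lee_pmul.
- by rewrite lee_fin subr_ge0 ltW.
- by apply: integral_ge0 => t _; rewrite lee_fin sqr_ge0.
- by rewrite lee_fin; lra.
have mE (A : set (measurableTypeR R)) : measurable A -> measurable_fun A (fun t => ((f' t) ^+ 2)%:E).
  by move=> mA; apply/measurable_EFinP/measurable_funX; exact: mf'.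
rewrite -integral_itv_bndo_bndc; last exact: mE.
apply: ge0_subset_integral => //; first exact: mE.
  by move=> t _; rewrite lee_fin sqr_ge0.
by move=> t; rewrite /= !in_itv /= => /andP[h1' h2']; apply/andP; split; [exact: le_trans h1'|exact: lt_le_trans yb].
Qed.

Lemma line_sq_le (f f' : R -> R) (x y a b : R) : a <= x <= b -> a <= y <= b ->
  continuous f' -> (forall t : R, is_derive t (1 : R) f (f' t)) ->
  (((f x - f y) ^+ 2)%:E <= (b - a)%:E * \int[L]_(t in `[a, b[) ((f' t) ^+ 2)%:E)%E.
Proof.
move=> /andP[ax xb] /andP[ay yb] cf df; have [xy|xy|->] := ltgtP x y.
- exact: FTC_sq_le.
- by rewrite -sqrrN opprB; exact: FTC_sq_le.
- rewrite subrr expr0n; apply: mule_ge0; first by rewrite lee_fin subr_ge0 (le_trans ay).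
  by apply: integral_ge0 => t _; rewrite lee_fin sqr_ge0.
Qed.

End LineInequality.

Section TonelliIn.
Context d1 d2 (T1 : measurableType d1) (T2 : measurableType d2) (R : realType).
Variables (m1 : {sigma_finite_measure set T1 -> \bar R}) (m2 : {sigma_finite_measure set T2 -> \bar R}).
Variables (A : set T1) (B : set T2) (X : T1 * T2 -> \bar R).
Hypothesis mA : measurable A.
Hypothesis mB : measurable B.
Hypothesis mX : measurable_fun setT X.
Hypothesis X0 : forall z, (0 <= X z)%E.

(** Extension by 0 off the rectangle reduces the statements on A x B to Tonelli's theorem on the
    whole product. *)
Let Y := X \_ (A `*` B).

Let mY : measurable_fun setT Y.
Proof. by apply/(measurable_restrictT X (measurableX mA mB)); exact: measurable_funTS. Qed.

Let Y0 z : (0 <= Y z)%E. Proof. by rewrite /Y patchE; case: ifP. Qed.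

Lemma inner_in x : (\int[m2]_y Y (x, y) = if x \in A then \int[m2]_(y in B) X (x, y) else 0)%E.
Proof.
rewrite [in RHS]integral_mkcond; case: ifPn => xA.
  by apply: eq_integral => y _; rewrite /Y !patchE in_setX xA.
by apply: integral0_eq => y _; rewrite /Y patchE in_setX (negbTE xA).
Qed.

Lemma inner_in' y : (\int[m1]_x Y (x, y) = if y \in B then \int[m1]_(x in A) X (x, y) else 0)%E.
Proof.
rewrite [in RHS]integral_mkcond; case: ifPn => xA.
  by apply: eq_integral => x _; rewrite /Y !patchE in_setX xA andbT.
by apply: integral0_eq => x _; rewrite /Y patchE in_setX (negbTE xA) andbF.
Qed.

Lemma prod_in : (\int[m1 \x m2]_(z in A `*` B) X z = \int[m1]_(x in A) \int[m2]_(y in B) X (x, y))%E.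
Proof.
rewrite integral_mkcond (@fubini_tonelli1 _ _ _ _ _ m1 m2 Y mY Y0) [RHS]integral_mkcond.
by apply: eq_integral => x _; rewrite /fubini_F inner_in patchE.
Qed.

Lemma tonelli_in : (\int[m1]_(x in A) \int[m2]_(y in B) X (x, y)
  = \int[m2]_(y in B) \int[m1]_(x in A) X (x, y))%E.
Proof.
rewrite integral_mkcond [RHS]integral_mkcond.
transitivity (\int[m1]_x \int[m2]_y Y (x, y))%E.
  by apply: eq_integral => x _; rewrite inner_in patchE.
rewrite (@fubini_tonelli _ _ _ _ _ m1 m2 Y mY Y0).
by apply: eq_integral => x _; rewrite inner_in' patchE.
Qed.

Lemma measurable_in : measurable_fun A (fun x => \int[m2]_(y in B) X (x, y))%E.
Proof.
apply/(measurable_restrictT _ mA).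
rewrite (_ : _ \_ A = fun x => \int[m2]_y Y (x, y))%E; last first.
  by apply/funext => x; rewrite inner_in patchE.
exact: (@measurable_fun_fubini_tonelli_F _ _ _ _ _ m2 Y mY Y0).
Qed.

End TonelliIn.

Lemma integral_scale d (T : measurableType d) (R : realType) (mu : {measure set T -> \bar R})
    (D : set T) (t : R) (f : T -> \bar R) : measurable D -> 0 <= t -> (forall x, 0 <= f x)%E ->
  measurable_fun setT f -> (\int[mu]_(x in D) (t%:E * f x) = t%:E * \int[mu]_(x in D) f x)%E.
Proof.
by move=> mD t0 f0 mf; rewrite ge0_integralZl //; exact: measurable_funTS.
Qed.

Lemma integral_add d (T : measurableType d) (R : realType) (mu : {measure set T -> \bar R})
    (D : set T) (f g : T -> \bar R) : measurable D -> (forall x, 0 <= f x)%E -> (forall x, 0 <= g x)%E ->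
  measurable_fun setT f -> measurable_fun setT g ->
  (\int[mu]_(x in D) (f x + g x) = \int[mu]_(x in D) f x + \int[mu]_(x in D) g x)%E.
Proof. by move=> mD f0 g0 mf mg; rewrite ge0_integralD //; exact: measurable_funTS. Qed.

(** * One cell of the graph and a box below it *)

Section CellInequality.
Variable R : realType.
Local Notation P := (pt R).
Local Notation mR := (measurableTypeR R).
Local Notation L := (@lebesgue_measure R).

Lemma box_in (A B I : set mR) (X : mpt R -> \bar R) : measurable A -> measurable B -> measurable I ->
  measurable_fun setT X -> (forall z, 0 <= X z)%E ->
  (\int[leb3 R]_(z in (A `*` B) `*` I) X z = \int[L]_(a in A) \int[L]_(b in B) \int[L]_(s in I) X (a, b, s))%E.
Proof.
move=> mA mB mI mX X0; have mAB := measurableX mA mB.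
have := @prod_in _ _ _ _ _ (@sleb2 R) L _ _ _ mAB mI mX X0 => ->.
pose Z (y : mR * mR) : \bar R := (\int[L]_(s in I) X (y, s))%E.
have mZ : measurable_fun setT Z by apply: (@measurable_in _ _ _ _ _ L setT I).
have Z0 y : (0 <= Z y)%E by apply: integral_ge0.
exact: (@prod_in _ _ _ _ _ L L A B Z mA mB mZ Z0).
Qed.

Lemma box_in_bsa (A B I : set mR) (X : mpt R -> \bar R) : measurable A -> measurable B -> measurable I ->
  measurable_fun setT X -> (forall z, 0 <= X z)%E ->
  (\int[leb3 R]_(z in (A `*` B) `*` I) X z = \int[L]_(b in B) \int[L]_(s in I) \int[L]_(a in A) X (a, b, s))%E.
Proof.
move=> mA mB mI mX X0; rewrite (box_in mA mB mI mX X0).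
pose Z (y : mR * mR) : \bar R := (\int[L]_(s in I) X (y, s))%E.
have mZ : measurable_fun setT Z by apply: (@measurable_in _ _ _ _ _ L setT I).
have Z0 y : (0 <= Z y)%E by apply: integral_ge0.
rewrite (@tonelli_in _ _ _ _ _ L L A B Z mA mB mZ Z0); apply: eq_integral => b _.
apply: (@tonelli_in _ _ _ _ _ L L A I (fun y => X (y.1, b, y.2))) => //.
apply: measurableT_comp mX _; apply: measurable_fun_pair; last exact: measurable_snd.
by apply: measurable_fun_pair; [exact: measurable_fst|exact: measurable_cst].
Qed.

Lemma box_in_asb (A B I : set mR) (X : mpt R -> \bar R) : measurable A -> measurable B -> measurable I ->
  measurable_fun setT X -> (forall z, 0 <= X z)%E ->
  (\int[leb3 R]_(z in (A `*` B) `*` I) X z = \int[L]_(a in A) \int[L]_(s in I) \int[L]_(b in B) X (a, b, s))%E.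
Proof.
move=> mA mB mI mX X0; rewrite (box_in mA mB mI mX X0); apply: eq_integral => a _.
apply: (@tonelli_in _ _ _ _ _ L L B I (fun y => X (a, y.1, y.2))) => //.
apply: measurableT_comp mX _; apply: measurable_fun_pair; last exact: measurable_snd.
by apply: measurable_fun_pair; [exact: measurable_cst|exact: measurable_fst].
Qed.

Variables (W : P -> R) (sW : rsmooth W).

Definition sqd (j : 'I_3) (z : mpt R) : \bar R := ((rpart j W z) ^+ 2)%:E.

Lemma sqd_ge0 j z : (0 <= sqd j z)%E. Proof. by rewrite lee_fin sqr_ge0. Qed.

Lemma measurable_sqd j : measurable_fun setT (sqd j).
Proof.
apply/measurable_EFinP; apply: measurable_funX; apply: continuous_measurable3; apply: rsmooth_continuous.
exact: rsmooth_rpart.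
Qed.

Lemma W_line (x : P) j (t : R) :
  is_derive t (1 : R) (fun s => W (x + s *: unitv R j)) (rpart j W (x + t *: unitv R j)).
Proof. by apply: is_derive_line; apply/diff_derivable/rsmooth_diff. Qed.

Lemma continuous_line (x : P) j (f : P -> R) : continuous f ->
  continuous (fun t : R => f (x + t *: unitv R j)).
Proof.
move=> cf t; apply: (@continuous_comp _ _ _ (fun t : R => x + t *: unitv R j) f); last exact: cf.
by apply: cvgD; [exact: cvg_cst|apply: cvgZl; exact: cvg_id].
Qed.

Lemma W_line_le (x : P) j (s t a b : R) : a <= s <= b -> a <= t <= b ->
  (((W (x + s *: unitv R j) - W (x + t *: unitv R j)) ^+ 2)%:E <=
    (b - a)%:E * \int[L]_(r in `[a, b[) sqd j (x + r *: unitv R j)%R)%E.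
Proof.
move=> hs ht; apply: (line_sq_le (f := fun s => W (x + s *: unitv R j)) (f' := fun s => rpart j W (x + s *: unitv R j)) hs ht) => [|r]; last exact: W_line.
exact/continuous_line/rsmooth_continuous/rsmooth_rpart.
Qed.

Lemma line0 (a b s : R) : (0, b, s) + a *: unitv R 0 = (a, b, s) :> P.
Proof.
apply: coordf_inj => j; rewrite coordfD coordfZ coordf_unitv /coordf !mxE.
by case: j => -[|[|[|//]]] h /=; rewrite ?mulr1 ?mulr0 ?add0r ?addr0.
Qed.

Lemma line1 (a b s : R) : (a, 0, s) + b *: unitv R 1 = (a, b, s) :> P.
Proof.
apply: coordf_inj => j; rewrite coordfD coordfZ coordf_unitv /coordf !mxE.
by case: j => -[|[|[|//]]] h /=; rewrite ?mulr1 ?mulr0 ?add0r ?addr0.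
Qed.

Lemma line2 (a b s : R) : (a, b, 0) + s *: unitv R 2 = (a, b, s) :> P.
Proof.
apply: coordf_inj => j; rewrite coordfD coordfZ coordf_unitv /coordf !mxE.
by case: j => -[|[|[|//]]] h /=; rewrite ?mulr1 ?mulr0 ?add0r ?addr0.
Qed.

Lemma sqrD3_le (p q r : R) : (p + q + r) ^+ 2 <= 3 * p ^+ 2 + 3 * q ^+ 2 + 3 * r ^+ 2.
Proof.
have := sqr_ge0 (p - q); have := sqr_ge0 (q - r); have := sqr_ge0 (p - r).
by rewrite !expr2; nra.
Qed.

Variables (g : R * R -> R) (mg : measurable_fun setT (g : mR * mR -> mR)).
Variables (a1 a2 c d k : R).
Hypothesis d0 : 0 < d.
Hypothesis k0 : 0 < k.

Let seg (a : R) : set mR := `[a, a + d[%classic.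
Let Q1 : set mR := seg a1.
Let Q2 : set mR := seg a2.
Let I3 : set mR := seg c.
Let Q : set (mR * mR) := Q1 `*` Q2.
Let B : set (mpt R) := Q `*` I3.

(** The cube B of side d lies below the graph over Q, at depth at most k d. *)
Hypothesis hg : forall y, Q y -> g y - k * d <= c /\ c + d <= g y.

Definition under_strip (h : R) : set (mpt R) := [set z | g z.1 - h <= z.2 < g z.1].

Lemma measurable_under_strip h : measurable (under_strip h).
Proof.
have m1 : measurable_fun setT (fun z : mpt R => z.2 - g z.1 : mR).
  by apply: measurable_funB; [exact: measurable_snd|exact: measurableT_comp mg measurable_fst].
have := m1 measurableT `[- h, 0[%classic (measurable_itv _).
rewrite setTI; congr measurable; apply/seteqP; split=> z; rewrite /under_strip /= in_itv /= => /andP[h1 h2];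
  by apply/andP; split; lra.
Qed.

Let mQ1 : measurable Q1. Proof. exact: measurable_itv. Qed.
Let mQ2 : measurable Q2. Proof. exact: measurable_itv. Qed.
Let mI3 : measurable I3. Proof. exact: measurable_itv. Qed.
Let mQ : measurable Q. Proof. exact: measurableX. Qed.
Let mB : measurable B. Proof. exact: measurableX. Qed.

Let L_itv (a : R) : L (seg a) = d%:E.
Proof. by rewrite lebesgue_measure_itv /= lte_fin ltrDl d0 -EFinB addrAC subrr add0r. Qed.

Let Lcst (a : R) (x : \bar R) : (\int[L]_(t in seg a) x = x * d%:E)%E.
Proof. by rewrite (integral_cst L (measurable_itv _) x); congr (_ * _)%E; exact: L_itv. Qed.

Definition vert (y : mR * mR) : \bar R := (\int[L]_s (sqd 2%R \_ (under_strip (k * d))) (y, s))%E.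

Lemma vertE y : vert y = (\int[L]_(s in `[(g y - k * d)%R, g y[) sqd 2%R (y, s))%E.
Proof.
rewrite /vert [RHS]integral_mkcond; apply: eq_integral => s _; rewrite !patchE.
congr (if _ then _ else _); apply/idP/idP; by rewrite !inE /under_strip /= ?in_itv.
Qed.

Lemma vert_ge0 y : (0 <= vert y)%E.
Proof. by apply: integral_ge0 => s _; rewrite patchE; case: ifP => // _; exact: sqd_ge0. Qed.

Lemma measurable_vert : measurable_fun setT vert.
Proof.
apply: inner_measurable.
  by apply/(measurable_restrictT _ (measurable_under_strip _)); apply: measurable_funTS; exact: measurable_sqd.
by move=> z; rewrite patchE; case: ifP => // _; exact: sqd_ge0.
Qed.

Lemma vert_in : (\int[leb2 R]_(y in Q) vert y =
  \int[leb3 R]_(z in (Q `*` setT) `&` under_strip (k * d)) sqd 2%R z)%E.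
Proof.
rewrite [RHS]integral_mkcondr.
have mX : measurable_fun setT (sqd 2%R \_ (under_strip (k * d))).
  by apply/(measurable_restrictT _ (measurable_under_strip _)); apply: measurable_funTS; exact: measurable_sqd.
have X0 z : (0 <= (sqd 2%R \_ (under_strip (k * d))) z)%E.
  by rewrite patchE; case: ifP => // _; exact: sqd_ge0.
by have := @prod_in _ _ _ _ _ (@sleb2 R) L _ _ _ mQ measurableT mX X0 => ->.
Qed.

Definition horiz (b s : R) : \bar R := (\int[L]_(a in Q1) sqd 0%R (a, b, s))%E.
Definition horiz' (a s : R) : \bar R := (\int[L]_(b in Q2) sqd 1%R (a, b, s))%E.

Lemma horiz_ge0 b s : (0 <= horiz b s)%E. Proof. by apply: integral_ge0 => ? _; exact: sqd_ge0. Qed.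
Lemma horiz'_ge0 b s : (0 <= horiz' b s)%E. Proof. by apply: integral_ge0 => ? _; exact: sqd_ge0. Qed.

(** From the graph point go down to the height of z, then along the first and the second axis. Each
    leg is bounded by [W_line_le], and 3 comes from the square of a sum of three terms. Integrals
    over full sides make the bounds depend on few of the variables. *)
Lemma path_le (y : mR * mR) (z : mpt R) : Q y -> B z ->
  (((W (y, g y) - W z) ^+ 2)%:E <= (3 * (k * d))%:E * vert y + (3 * d)%:E * horiz y.2 z.2
     + (3 * d)%:E * horiz' z.1.1 z.2)%E.
Proof.
case: y z => [y1 y2] [[z1 z2] s] Qy [[/= hz1 hz2] hs].
have [gk gd] := hg Qy; case: Qy => /= hy1 hy2.
move: hz1 hz2 hs hy1 hy2; rewrite /Q1 /Q2 /I3 /seg /= !in_itv /=.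
move=> /andP[z1a z1b] /andP[z2a z2b] /andP[sa sb] /andP[y1a y1b] /andP[y2a y2b].
pose p := W (y1, y2, g (y1, y2)) - W (y1, y2, s).
pose q := W (y1, y2, s) - W (z1, y2, s).
pose r := W (z1, y2, s) - W (z1, z2, s).
have -> : W (y1, y2, g (y1, y2)) - W (z1, z2, s) = p + q + r by rewrite /p /q /r; ring.
apply: (@le_trans _ _ (3 * p ^+ 2 + 3 * q ^+ 2 + 3 * r ^+ 2)%:E); first by rewrite lee_fin sqrD3_le.
have c3 : (0 : R) <= 3 by [].
have mul3 (u : R) (l : \bar R) (v : R) : ((u ^+ 2)%:E <= v%:E * l -> (3 * u ^+ 2)%:E <= (3 * v)%:E * l)%E.
  by move=> h; rewrite !EFinM -muleA; apply: lee_wpmul2l.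
rewrite !EFinD; apply: leeD; first apply: leeD; apply: mul3.
- rewrite vertE; have := @W_line_le (y1, y2, 0) 2 (g (y1, y2)) s (g (y1, y2) - k * d) (g (y1, y2)).
  rewrite !line2 => /(_ _ _)/le_trans; apply.
  + by rewrite lexx andbT lerBlDr lerDl mulr_ge0 // ltW.
  + by apply/andP; split; [exact: le_trans gk sa|rewrite (le_trans (ltW sb))].
  + rewrite opprB addrC subrK; apply: lee_wpmul2l; first by rewrite lee_fin mulr_ge0 // ltW.
    by under eq_integral do rewrite line2.
- have := @W_line_le (0, y2, s) 0 y1 z1 a1 (a1 + d).
  rewrite !line0 => /(_ _ _)/le_trans; apply.
  + by rewrite y1a ltW.
  + by rewrite z1a ltW.
  + rewrite addrAC subrr add0r; apply: lee_wpmul2l; first by rewrite lee_fin ltW.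
    by under eq_integral do rewrite line0.
- have := @W_line_le (z1, 0, s) 1 y2 z2 a2 (a2 + d).
  rewrite !line1 => /(_ _ _)/le_trans; apply.
  + by rewrite y2a ltW.
  + by rewrite z2a ltW.
  + rewrite addrAC subrr add0r; apply: lee_wpmul2l; first by rewrite lee_fin ltW.
    by under eq_integral do rewrite line1.
Qed.

Lemma measurable_horiz : measurable_fun setT (fun y : mR * mR => horiz y.1 y.2).
Proof.
apply: (@measurable_in _ _ _ _ _ L setT Q1 (fun w : (mR * mR) * mR => sqd 0%R (w.2, w.1.1, w.1.2))) => //; last by move=> z; exact: sqd_ge0.
apply: measurableT_comp (measurable_sqd _) _.
have m1 := @measurable_fst _ _ (mR * mR)%type mR; have m2 := @measurable_snd _ _ (mR * mR)%type mR.
apply: mpt_measurable_fun; [exact: m2| |].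
  exact: measurableT_comp measurable_fst m1.
exact: measurableT_comp measurable_snd m1.
Qed.

Lemma measurable_horiz' : measurable_fun setT (fun y : mR * mR => horiz' y.1 y.2).
Proof.
apply: (@measurable_in _ _ _ _ _ L setT Q2 (fun w : (mR * mR) * mR => sqd 1%R (w.1.1, w.2, w.1.2))) => //; last by move=> z; exact: sqd_ge0.
apply: measurableT_comp (measurable_sqd _) _.
have m1 := @measurable_fst _ _ (mR * mR)%type mR; have m2 := @measurable_snd _ _ (mR * mR)%type mR.
apply: mpt_measurable_fun; [|exact: m2|].
  exact: measurableT_comp measurable_fst m1.
exact: measurableT_comp measurable_snd m1.
Qed.

Lemma measurable_horiz2 (b : R) : measurable_fun setT (fun z : mpt R => horiz b z.2).
Proof.
have m : measurable_fun setT (fun z : mpt R => (b, z.2) : mR * mR).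
  by apply: measurable_fun_pair; [exact: measurable_cst|exact: measurable_snd].
by have := measurableT_comp measurable_horiz m.
Qed.

Lemma measurable_horiz'13 : measurable_fun setT (fun z : mpt R => horiz' z.1.1 z.2).
Proof.
have m : measurable_fun setT (fun z : mpt R => (z.1.1, z.2) : mR * mR).
  apply: measurable_fun_pair; last exact: measurable_snd.
  exact: measurableT_comp measurable_fst measurable_fst.
by have := measurableT_comp measurable_horiz' m.
Qed.

Definition layer (b : R) : \bar R := (\int[L]_(s in I3) horiz b s)%E.

Lemma layer_ge0 b : (0 <= layer b)%E.
Proof. by apply: integral_ge0 => s _; exact: horiz_ge0. Qed.

Lemma measurable_layer : measurable_fun setT (layer : mR -> \bar R).
Proof.
by apply: (@measurable_in _ _ _ _ _ L setT I3 (fun y => horiz y.1 y.2)) => //;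
  [exact: measurable_horiz|move=> y; exact: horiz_ge0].
Qed.

Let leb3_B : leb3 R B = (d ^+ 3)%:E.
Proof. by rewrite leb3_box // !L_itv -!EFinM; congr (_%:E); ring. Qed.

Let leb2_Q : leb2 R Q = (d ^+ 2)%:E.
Proof.
transitivity (L (seg a1) * L (seg a2))%E; last by rewrite !L_itv -EFinM expr2.
exact: (@product_measure1E _ _ _ _ _ L L Q1 Q2 mQ1 mQ2).
Qed.

Lemma int_B_layer y : (\int[leb3 R]_(z in B) horiz y z.2 = (d ^+ 2)%:E * layer y)%E.
Proof.
have mX : measurable_fun setT (fun z : mpt R => horiz y z.2).
  exact: measurable_horiz2.
rewrite (box_in mQ1 mQ2 mI3 mX (fun z => horiz_ge0 _ _)).
transitivity (\int[L]_(a in Q1) (layer y * d%:E))%E.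
  by apply: eq_integral => a _; exact: (Lcst a2 (layer y)).
by rewrite [LHS](Lcst a1 (layer y * d%:E)%E) -muleA muleC -EFinM expr2.
Qed.

(** The integrand does not depend on the second coordinate, whose integration only contributes a
    factor d; the remaining integrals make up the box integral. *)
Lemma int_B_horiz' : (\int[leb3 R]_(z in B) horiz' z.1.1 z.2 = d%:E * \int[leb3 R]_(z in B) sqd 1%R z)%E.
Proof.
have mX : measurable_fun setT (fun z : mpt R => horiz' z.1.1 z.2).
  exact: measurable_horiz'13.
rewrite (box_in mQ1 mQ2 mI3 mX (fun z => horiz'_ge0 _ _)).
rewrite (box_in_asb mQ1 mQ2 mI3 (measurable_sqd 1) (sqd_ge0 1)).
have mZ : measurable_fun setT (fun a : mR => \int[L]_(s in I3) horiz' a s)%E.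
  by apply: (@measurable_in _ _ _ _ _ L setT I3 (fun y => horiz' y.1 y.2)) => //;
    [exact: measurable_horiz'|move=> y; exact: horiz'_ge0].
rewrite -ge0_integralZl //; first last.
- by rewrite lee_fin ltW.
- by move=> a _; apply: integral_ge0 => s _; exact: horiz'_ge0.
- exact: measurable_funTS.
by apply: eq_integral => a _; rewrite [LHS](Lcst a2 (\int[L]_(s in I3) horiz' a s)%E) muleC.
Qed.

Lemma int_Q_layer : (\int[leb2 R]_(y in Q) layer y.2 = d%:E * \int[leb3 R]_(z in B) sqd 0%R z)%E.
Proof.
have mX : measurable_fun setT (fun y : mR * mR => layer y.2).
  exact: measurableT_comp measurable_layer measurable_snd.
have := @prod_in _ _ _ _ _ L L Q1 Q2 _ mQ1 mQ2 mX (fun y => layer_ge0 _) => ->.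
rewrite [LHS](Lcst a1 (\int[L]_(b in Q2) layer b)%E).
by rewrite muleC (box_in_bsa mQ1 mQ2 mI3 (measurable_sqd 0) (sqd_ge0 0)).
Qed.

Definition cell_avg : R := (\int[leb3 R]_(z in B) W z) / d ^+ 3.

Lemma W_rL2 (w0 : R) : rL2 (leb3 R) B (fun z => w0 - W z).
Proof.
have bB : bounded_set (B : set P).
  have [M hM] : exists M, B `<=` cube M.
    exists (`|a1| + `|a2| + `|c| + d) => -[[x y] z] [[/= h1 h2] h3].
    move: h1 h2 h3; rewrite /Q1 /Q2 /I3 /seg /= !in_itv /= => /andP[? ?] /andP[? ?] /andP[? ?].
    have := ler_norm a1; have := ler_norm (- a1); have := ler_norm a2; have := ler_norm (- a2).
    have := ler_norm c; have := ler_norm (- c); rewrite !normrN => *.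
    by split; [split|]; rewrite /= in_itv /=; apply/andP; split; lra.
  have [K [Kr hK]] := compact_bounded (@cube_compact R M).
  by exists K; split=> // r Kr' x /hM; exact: hK.
apply: continuous_rL2 => //; first by rewrite leb3_B ltry.
by move=> z; apply: cvgB; [exact: cvg_cst|exact: rsmooth_continuous].
Qed.

(** w0^2 <= 2 m^2 + 2 (w0 - m)^2 for the average m, and (w0 - m)^2 is at most the average of (w0 -
    W)^2 by Cauchy-Schwarz. *)
Lemma cell_jensen (w0 : R) : ((w0 ^+ 2)%:E <= (2 * cell_avg ^+ 2)%:E +
  (2 / d ^+ 3)%:E * \int[leb3 R]_(z in B) ((w0 - W z) ^+ 2)%:E)%E.
Proof.
have d3 : 0 < d ^+ 3 by rewrite exprn_gt0.
have H := rL2_prehilbert (leb3 R) mB; have r1 := W_rL2 w0.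
have rW : rL2 (leb3 R) B W.
  by have := ph_N H (W_rL2 0); congr rL2; apply/funext => z; rewrite -[LHS]/(- (0 - W z)) sub0r opprK.
have Ic (t : R) : (\int[leb3 R]_(z in B) t%:E = (t * d ^+ 3)%:E)%E.
  by rewrite (integral_cst (leb3 R) mB t%:E) EFinM; congr (_ * _)%E; exact: leb3_B.
have rc (t : R) : rL2 (leb3 R) B (cst t).
  by split; [exact: measurable_cst|rewrite [X in (X < _)%E](Ic (t ^+ 2)) ltry].
have rdot1 t : rdot (leb3 R) B (cst t) (cst 1) = t * d ^+ 3.
  by rewrite /rdot /Rintegral; under eq_integral do rewrite mulr1; rewrite [X in fine X](Ic t).
have := ph_CS H r1 (rc 1); rewrite rdot1 mul1r.
have -> : rdot (leb3 R) B (fun z => w0 - W z) (cst 1) = d ^+ 3 * (w0 - cell_avg).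
  have e : (fun z => w0 - W z) = cst w0 - W by [].
  rewrite e (ph_BD H (rc w0) (ph_N H rW) (rc 1)) (ph_BN H rW (rc 1)) rdot1.
  have -> : rdot (leb3 R) B W (cst 1) = d ^+ 3 * cell_avg.
    rewrite /cell_avg mulrC divfK ?gt_eqF //.
    by rewrite /rdot /Rintegral; under eq_integral do rewrite mulr1.
  by ring.
rewrite -(rdotE r1) -EFinM -EFinD lee_fin; move: (rdot _ _ _ _) => X.
rewrite exprMn (expr2 (d ^+ 3)) -mulrA [leRHS]mulrC ler_pM2l // => h.
have h2 : (w0 - cell_avg) ^+ 2 <= X / d ^+ 3 by rewrite ler_pdivlMr // mulrC.
(* This square is exactly 2 m^2 + 2 (w0 - m)^2 - w0^2. *)
have := sqr_ge0 (w0 - 2 * cell_avg) => h3.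
rewrite (_ : 2 / d ^+ 3 * X = 2 * (X / d ^+ 3)); last by rewrite mulrAC mulrA.
by move: h2 h3; move: (X / _) => Y; rewrite !expr2; nra.
Qed.

(** [cell_jensen] at every graph point, with the integral over the box bounded by [path_le], then
    integrated over Q. Every gradient term ends with a factor d: 2/d^3 from the average, 3 d or 3 k
    d from the paths, and powers of d from the variables that do not occur. *)
Lemma cell_le : (\int[leb2 R]_(y in Q) ((W (y, g y)) ^+ 2)%:E <=
  (2 * d ^+ 2 * cell_avg ^+ 2)%:E
  + ((6 * k * d)%:E * \int[leb3 R]_(z in (Q `*` setT) `&` under_strip (k * d)) sqd 2%R z
  + ((6 * d)%:E * \int[leb3 R]_(z in B) sqd 0%R z + (6 * d)%:E * \int[leb3 R]_(z in B) sqd 1%R z)))%E.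
Proof.
have d3 : 0 < d ^+ 3 by rewrite exprn_gt0.
pose I1 := (\int[leb3 R]_(z in B) sqd 1%R z)%E.
have I1_0 : (0 <= I1)%E by apply: integral_ge0 => z _; exact: sqd_ge0.
have kd : 0 <= k * d by rewrite mulr_ge0 // ltW.
have [[d_0 k_0] d3_0] := (ltW d0, ltW k0, ltW d3).
have le_eq (u v : \bar R) : u = v -> (u <= v)%E by move=> ->.
have c0 (t : R) : 0 <= t -> (0 <= t%:E :> \bar R)%E by rewrite lee_fin.
have ptw y : Q y -> (((W (y, g y)) ^+ 2)%:E <= (2 * cell_avg ^+ 2)%:E + ((6 * k * d)%:E * vert y
    + (6%:E * layer y.2 + (6 / d)%:E * I1)))%E.
  move=> Qy; apply: le_trans (cell_jensen (W (y, g y))) _; apply: leeD => //.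
  have m1 : measurable_fun setT (fun z : mpt R => (3 * d)%:E * horiz y.2 z.2)%E.
    by apply: measurable_funeM; exact: measurable_horiz2.
  have m2 : measurable_fun setT (fun z : mpt R => (3 * d)%:E * horiz' z.1.1 z.2)%E.
    by apply: measurable_funeM; exact: measurable_horiz'13.
  have t3 : 0 <= 3 * d by rewrite mulr_ge0.
  have p1 z : (0 <= (3 * d)%:E * horiz y.2 z)%E := mule_ge0 (c0 _ t3) (horiz_ge0 _ _).
  have p2 z z' : (0 <= (3 * d)%:E * horiz' z z')%E := mule_ge0 (c0 _ t3) (horiz'_ge0 _ _).
  have p0 : (0 <= (3 * (k * d))%:E * vert y)%E by apply: mule_ge0; [apply: c0; rewrite mulr_ge0|exact: vert_ge0].
  have m0 := @measurable_cst _ _ (mpt R) _ setT ((3 * (k * d))%:E * vert y)%E.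
  have m01 := emeasurable_funD m0 m1.
  have m3 := emeasurable_funD m01 m2.
  have step : (\int[leb3 R]_(z in B) ((W (y, g y) - W z) ^+ 2)%:E <=
      (3 * (k * d))%:E * vert y * (d ^+ 3)%:E + (3 * d)%:E * ((d ^+ 2)%:E * layer y.2)
      + (3 * d)%:E * (d%:E * I1))%E.
    apply: (@le_trans _ _ (\int[leb3 R]_(z in B) ((3 * (k * d))%:E * vert y + (3 * d)%:E * horiz y.2 z.2
     + (3 * d)%:E * horiz' z.1.1 z.2))%E).
      apply: ge0_le_integral.
      - exact: mB.
      - by move=> z _; rewrite lee_fin sqr_ge0.
      - by apply/measurable_EFinP; apply: measurable_funX; have [] := W_rL2 (W (y, g y)).
      - exact: measurable_funTS m3.
      - by move=> z Bz; exact: path_le.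
    rewrite (integral_add (leb3 R) mB (fun z => adde_ge0 p0 (p1 z.2)) (fun z => p2 z.1.1 z.2) m01 m2).
    rewrite (integral_add (leb3 R) mB (fun z => p0) (fun z => p1 z.2) m0 m1).
    rewrite (integral_cst (leb3 R) mB) leb3_B.
    have e1 : (\int[leb3 R]_(x in B) ((3 * d)%:E * horiz y.2 x.2) = (3 * d)%:E * \int[leb3 R]_(x in B) horiz y.2 x.2)%E.
      apply: integral_scale; [exact: mB|exact: t3| |exact: measurable_horiz2].
      by move=> z; exact: horiz_ge0.
    have e2 : (\int[leb3 R]_(x in B) ((3 * d)%:E * horiz' x.1.1 x.2) = (3 * d)%:E * \int[leb3 R]_(x in B) horiz' x.1.1 x.2)%E.
      apply: integral_scale; [exact: mB|exact: t3| |exact: measurable_horiz'13].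
      by move=> z; exact: horiz'_ge0.
    apply: leeD; [apply: leeD; [exact: lexx|]|]; apply: le_eq.
      exact: etrans e1 (congr1 _ (int_B_layer _)).
    exact: etrans e2 (congr1 _ int_B_horiz').
  apply: le_trans (lee_wpmul2l (c0 _ (divr_ge0 (ler0n R 2) d3_0)) step) _.
  have g1 : (0 <= (3 * (k * d))%:E * vert y * (d ^+ 3)%:E)%E by apply: mule_ge0 => //; exact: c0.
  have g2 : (0 <= (3 * d)%:E * ((d ^+ 2)%:E * layer y.2))%E.
    by apply: mule_ge0; [apply: c0; rewrite mulr_ge0|apply: mule_ge0; [apply: c0; rewrite exprn_ge0|exact: layer_ge0]].
  have g3 : (0 <= (3 * d)%:E * (d%:E * I1))%E.
    by apply: mule_ge0; [apply: c0; rewrite mulr_ge0|apply: mule_ge0 => //; exact: c0].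
  rewrite ge0_muleDr //; last exact: adde_ge0.
  rewrite ge0_muleDr // -addeA.
  rewrite (muleC (_ * vert y)%E) !muleA -!EFinM.
  have e1 : 2 / d ^+ 3 * d ^+ 3 * (3 * (k * d)) = 6 * k * d by rewrite divfK ?gt_eqF //; ring.
  have e2 : 2 / d ^+ 3 * (3 * d) * d ^+ 2 = 6.
    rewrite (_ : _ * d ^+ 2 = 6 * (d ^+ 3 / d ^+ 3)); last by ring.
    by rewrite divff ?mulr1 // gt_eqF.
  have e3 : 2 / d ^+ 3 * (3 * d) * d = 6 / d.
    by field; rewrite gt_eqF.
  by rewrite e1 e2 e3.
have t6 : 0 <= 6 * k * d by rewrite !mulr_ge0.
have s6 : (0 : R) <= 6 by [].
have ml0 : measurable_fun setT (fun y : mR * mR => layer y.2) := measurableT_comp measurable_layer measurable_snd.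
have mv := @measurable_funeM _ _ _ setT _ (6 * k * d)%:E measurable_vert.
have ml := @measurable_funeM _ _ _ setT _ (6%:E : \bar R) ml0.
have q1 y : (0 <= (6 * k * d)%:E * vert y)%E := mule_ge0 (c0 _ t6) (vert_ge0 y).
have q2 y : (0 <= 6%:E * layer y)%E := mule_ge0 (c0 _ s6) (layer_ge0 y).
have q3 : (0 <= (6 / d)%:E * I1)%E by apply: mule_ge0 => //; apply: c0; rewrite divr_ge0.
have q0 : (0 <= (2 * cell_avg ^+ 2)%:E :> \bar R)%E by apply: c0; rewrite mulr_ge0 // sqr_ge0.
have mc0 := @measurable_cst _ _ (mR * mR)%type _ setT (2 * cell_avg ^+ 2)%:E.
have mc1 := @measurable_cst _ _ (mR * mR)%type _ setT ((6 / d)%:E * I1)%E.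
have m1 := emeasurable_funD ml mc1; have m2 := emeasurable_funD mv m1; have m3 := emeasurable_funD mc0 m2.
have r1 y : (0 <= 6%:E * layer y + (6 / d)%:E * I1)%E := adde_ge0 (q2 y) q3.
have r2 y : (0 <= (6 * k * d)%:E * vert y + (6%:E * layer y.2 + (6 / d)%:E * I1))%E := adde_ge0 (q1 y) (r1 _).
apply: (@le_trans _ _ (\int[leb2 R]_(y in Q) ((2 * cell_avg ^+ 2)%:E + ((6 * k * d)%:E * vert y
    + (6%:E * layer y.2 + (6 / d)%:E * I1))))%E).
  apply: ge0_le_integral.
  - exact: mQ.
  - by move=> y _; rewrite lee_fin sqr_ge0.
  - apply/measurable_EFinP; apply: measurable_funX; apply: measurable_funTS.
    have mW := continuous_measurable3 (rsmooth_continuous sW).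
    have mg' : measurable_fun setT (fun y : mR * mR => (y, g y) : mpt R).
      by apply: measurable_fun_pair; [exact: measurable_id|exact: mg].
    by have := measurableT_comp mW mg'.
  - exact: measurable_funTS m3.
  - exact: ptw.
rewrite (integral_add (leb2 R) mQ (fun y => q0) r2 mc0 m2).
rewrite (integral_cst (leb2 R) mQ) leb2_Q -EFinM (mulrC _ (d ^+ 2)) (mulrC 2 (d ^+ 2)) mulrA.
apply: leeD => //.
rewrite (integral_add (leb2 R) mQ q1 (fun y => r1 y.2) mv m1).
apply: leeD.
  exact: le_eq (etrans (integral_scale (leb2 R) mQ t6 vert_ge0 measurable_vert) (congr1 _ vert_in)).
apply: le_trans (le_eq _ _ (integral_add (leb2 R) mQ (fun y => q2 y.2) (fun y => q3) ml mc1)) _.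
apply: leeD; apply: le_eq.
  apply: etrans (integral_scale (leb2 R) mQ s6 (fun y => layer_ge0 y.2) ml0) _.
  by apply: etrans (congr1 _ int_Q_layer) _; rewrite muleA -EFinM.
apply: etrans (integral_cst (leb2 R) mQ _) _; rewrite leb2_Q muleAC -EFinM.
by congr (_%:E * _)%E; rewrite expr2 mulrA divfK // gt_eqF.
Qed.

End CellInequality.

(** A grid of cells replaces the single cell; its side d is the parameter that makes the gradient
    term small. *)
Section PatchInequality.
Variable R : realType.
Local Notation P := (pt R).
Local Notation mR := (measurableTypeR R).
Local Notation L := (@lebesgue_measure R).

Definition sqgrad (W : P -> R) (z : mpt R) : \bar R := (\sum_j (rpart j W z) ^+ 2)%:E.

Lemma sqd_sqgrad W j z : (sqd W j z <= sqgrad W z)%E.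
Proof. by rewrite lee_fin (bigD1 j) //= lerDl sumr_ge0 // => i _; exact: sqr_ge0. Qed.

Lemma sqgrad_ge0 W z : (0 <= sqgrad W z)%E.
Proof. by rewrite lee_fin sumr_ge0 // => i _; exact: sqr_ge0. Qed.

Lemma measurable_sqgrad W : rsmooth W -> measurable_fun setT (sqgrad W).
Proof.
move=> sW; apply/measurable_EFinP; apply: measurable_sum => j; apply: measurable_funX.
by apply: continuous_measurable3; apply: rsmooth_continuous; exact: rsmooth_rpart.
Qed.

Definition square (a1 a2 d : R) : set (mR * mR) := `[a1, a1 + d[%classic `*` `[a2, a2 + d[%classic.

Lemma measurable_square a1 a2 d : measurable (square a1 a2 d).
Proof. by apply: measurableX; exact: measurable_itv. Qed.

(** The three gradient terms of [cell_le] are merged into the full gradient on the strip: 6 k + 6 +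
    6. As the average is the integral over d^3, 2 d^2 times its square has the coefficient 2 /
    d^4. *)
Lemma cell_grad_le (W : P -> R) (g : R * R -> R) (a1 a2 c d k h : R) : rsmooth W ->
  measurable_fun setT (g : mR * mR -> mR) -> 0 < d -> 0 < k -> k * d <= h ->
  (forall y, square a1 a2 d y -> g y - k * d <= c /\ c + d <= g y) ->
  (\int[leb2 R]_(y in square a1 a2 d) ((W (y, g y)) ^+ 2)%:E <=
   (2 / d ^+ 4 * (\int[leb3 R]_(z in square a1 a2 d `*` `[c, c + d[%classic) W z) ^+ 2)%:E
   + ((6 * k + 12) * d)%:E * \int[leb3 R]_(z in (square a1 a2 d `*` setT) `&` under_strip g h) sqgrad W z)%E.
Proof.
move=> sW mg d0 k0 kh hg; apply: le_trans (cell_le sW mg d0 k0 hg) _.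
have mS e : measurable ((square a1 a2 d `*` setT) `&` under_strip g e).
  by apply: measurableI; [apply: measurableX => //; exact: measurable_square|exact: measurable_under_strip].
pose S := ((square a1 a2 d `*` setT) `&` under_strip g h).
have mono (A : set (mpt R)) j : measurable A -> A `<=` S ->
    (\int[leb3 R]_(z in A) sqd W j z <= \int[leb3 R]_(z in S) sqgrad W z)%E.
  move=> mA AS; apply: (@le_trans _ _ (\int[leb3 R]_(z in A) sqgrad W z)%E).
    apply: ge0_le_integral => //.
    - by move=> z _; exact: sqd_ge0.
    - by apply: measurable_funTS; exact: measurable_sqd.
    - by apply: measurable_funTS; exact: measurable_sqgrad.
    - by move=> z _; exact: sqd_sqgrad.
  apply: ge0_subset_integral => //; first exact: mS.
    by apply: measurable_funTS; exact: measurable_sqgrad.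
  by move=> z _; exact: sqgrad_ge0.
pose I := (\int[leb3 R]_(z in S) sqgrad W z)%E.
have I0 : (0 <= I)%E by apply: integral_ge0 => z _; exact: sqgrad_ge0.
apply: leeD.
  rewrite lee_fin /cell_avg exprMn exprVn -exprM le_eqVlt; apply/orP; left; apply/eqP.
  rewrite mulrCA [RHS]mulrC; congr (_ * _); rewrite (_ : (3 * 2 = 4 + 2)%N) // exprD.
  by rewrite invfM mulrA mulrAC mulfK // expf_neq0 // gt_eqF.
have c1 : 0 <= 6 * k * d by rewrite !mulr_ge0 // ltW.
have c2 : 0 <= 6 * d by rewrite mulr_ge0 // ltW.
apply: (@le_trans _ _ ((6 * k * d)%:E * I + ((6 * d)%:E * I + (6 * d)%:E * I))%E).
  have mB : measurable (square a1 a2 d `*` `[c, c + d[%classic).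
    by apply: measurableX; [exact: measurable_square|exact: measurable_itv].
  have BS : square a1 a2 d `*` `[c, c + d[%classic `<=` S.
    move=> [y s] [/= Qy]; rewrite in_itv /= => /andP[s1 s2]; split => //.
    have [h1 h2] := hg y Qy; rewrite /under_strip /=; apply/andP; split; last exact: lt_le_trans h2.
    by rewrite (le_trans _ s1) // (le_trans _ h1) // lerB.
  apply: leeD; last apply: leeD.
  - apply: lee_wpmul2l; first by rewrite lee_fin.
    apply: mono; first exact: mS.
    apply: setIS => z; rewrite /under_strip /= => /andP[z1 ->]; rewrite andbT.
    by rewrite (le_trans _ z1) // lerB.
  - by apply: lee_wpmul2l; [rewrite lee_fin|exact: mono].
  - by apply: lee_wpmul2l; [rewrite lee_fin|exact: mono].
rewrite -!ge0_muleDl ?lee_fin ?addr_ge0 // -!EFinD.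
by rewrite (_ : 6 * k * d + _ = (6 * k + 12) * d); last ring.
Qed.

Lemma grid_cover (rho t : R) (n : nat) : 0 < rho -> (0 < n)%N -> - rho <= t < rho ->
  exists i : 'I_n, t \in `[- rho + i%:R * (2 * rho / n%:R), - rho + i%:R * (2 * rho / n%:R) + 2 * rho / n%:R[.
Proof.
move=> r0 n0 /andP[t1 t2]; set d := 2 * rho / n%:R.
have d0 : 0 < d by rewrite divr_gt0 ?mulr_gt0 // ltr0n.
have nd : n%:R * d = 2 * rho by rewrite /d mulrC divfK // pnatr_eq0 -lt0n.
have x0 : 0 <= (t + rho) / d by apply: divr_ge0; [lra|exact: ltW].
have /andP[h1 h2] := truncn_itv x0; set i := Num.truncn _ in h1 h2.
have lin : (i < n)%N.
  rewrite -(ltr_nat R); apply: le_lt_trans h1 _; rewrite ltr_pdivrMr // nd; lra.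
exists (Ordinal lin); rewrite in_itv /=.
move: h1 h2; rewrite ler_pdivlMr // ltr_pdivrMr // -natr1 mulrDl mul1r => h1 h2.
by apply/andP; split; lra.
Qed.

Lemma grid_disjoint (a d t : R) (i j : nat) : 0 < d ->
  t \in `[a + i%:R * d, a + i%:R * d + d[ -> t \in `[a + j%:R * d, a + j%:R * d + d[ -> i = j.
Proof.
move=> d0; rewrite !in_itv /= => /andP[i1 i2] /andP[j1 j2].
have h (p q : nat) : a + p%:R * d <= t -> t < a + q%:R * d + d -> (p <= q)%N.
  move=> h1 h2; rewrite -ltnS -(ltr_nat R) -(ltr_pM2r d0) -natr1 mulrDl mul1r; lra.
by apply/eqP; rewrite eqn_leq !h.
Qed.

(** The square is divided into n^2 squares of side d, each with its own box. The strips over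
    different squares are disjoint, so the gradient integrals add up to one integral over the whole
    strip. *)
Lemma patch_le (g : R * R -> R) (rho h M eps : R) :
  measurable_fun setT (g : mR * mR -> mR) -> 0 < rho -> 0 < h -> 0 <= M -> 0 < eps ->
  (forall y y', square (- rho) (- rho) (2 * rho) y -> square (- rho) (- rho) (2 * rho) y' ->
     `|g y - g y'| <= M * (`|y.1 - y'.1| + `|y.2 - y'.2|)) ->
  exists (n : nat) (b : R) (B : 'I_n * 'I_n -> set (mpt R)), [/\ 0 <= b,
    forall i, measurable (B i) /\
      B i `<=` (square (- rho) (- rho) (2 * rho) `*` setT) `&` under_strip g h
    & forall W, rsmooth W ->
      (\int[leb2 R]_(y in square (- rho) (- rho) (2 * rho)) ((W (y, g y)) ^+ 2)%:E <=
       (\sum_i b * (\int[leb3 R]_(z in B i) W z) ^+ 2)%:E + eps%:E *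
       \int[leb3 R]_(z in (square (- rho) (- rho) (2 * rho) `*` setT) `&` under_strip g h) sqgrad W z)%E].
Proof.
move=> mg r0 h0 M0 e0 gL.
(* On a cell, g differs from its value at the corner by at most 2 M d. The box with top g(corner) -
   2 M d is thus below the graph, and its bottom is at most 4 M d + d = k d below it. *)
pose k := 4 * M + 1; have k0 : 0 < k by rewrite ltr_wpDl // mulr_ge0.
(* n > X gives both k d <= h, which keeps the boxes in the strip, and (6 k + 12) d <= eps. *)
pose X := 2 * rho * (k / h + (6 * k + 12) / eps).
have X0 : 0 <= X.
  by rewrite mulr_ge0 ?mulr_ge0 ?addr_ge0 ?divr_ge0 ?addr_ge0 ?mulr_ge0 // ltW.
pose n := (Num.truncn X).+1; pose d := 2 * rho / n%:R.
have n0 : 0 < n%:R :> R by rewrite ltr0n.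
have d0 : 0 < d by rewrite divr_gt0 ?mulr_gt0.
have Xn : X < n%:R by have /andP[] := truncn_itv X0.
have dX (t u : R) : 0 < u -> 2 * rho * (t / u) <= X -> t * d <= u.
  move=> u0 tX; rewrite /d mulrA ler_pdivrMr // -ler_pdivrMl //.
  by apply: le_trans (ltW Xn); apply: le_trans tX; rewrite le_eqVlt; apply/orP; left; apply/eqP; ring.
have kd : k * d <= h.
  apply: dX => //; apply: ler_wpM2l; first by rewrite mulr_ge0 // ltW.
  by rewrite lerDl; apply: divr_ge0; [rewrite addr_ge0 ?mulr_ge0 // ltW|exact: ltW].
have ed : (6 * k + 12) * d <= eps.
  apply: dX => //; apply: ler_wpM2l; first by rewrite mulr_ge0 // ltW.
  by rewrite lerDr divr_ge0 // ltW.
pose a (i : nat) : R := - rho + i%:R * d.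
pose Q (p : 'I_n * 'I_n) := square (a p.1) (a p.2) d.
have mQ p : measurable (Q p) by exact: measurable_square.
pose S := square (- rho) (- rho) (2 * rho).
have aS (i : 'I_n) t : t \in `[a i, a i + d[ -> t \in `[- rho, - rho + 2 * rho[.
  have nd : n%:R * d = 2 * rho by rewrite /d mulrC divfK // gt_eqF.
  have i1 : i%:R * d + d <= 2 * rho.
    by rewrite -nd -{2}[d]mul1r -mulrDl natr1; apply: ler_wpM2r; [exact: ltW|rewrite ler_nat].
  have i0 : 0 <= i%:R * d by rewrite mulr_ge0 // ltW.
  by rewrite !in_itv /= /a => /andP[h1 h2]; apply/andP; split; lra.
have QS p : Q p `<=` S by move=> y [h1 h2]; split; [exact: (aS p.1)|exact: (aS p.2)].
pose c (p : 'I_n * 'I_n) := g (a p.1, a p.2) - 2 * M * d - d.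
have aQ p : Q p (a p.1, a p.2) by split; rewrite /= in_itv /= lexx ltrDl.
have hc p y : Q p y -> g y - k * d <= c p /\ c p + d <= g y.
  move=> Qy; have := gL _ _ (QS _ _ Qy) (QS _ _ (aQ p)); rewrite /= => hL.
  have [/= ] := Qy; rewrite !in_itv /= => /andP[y1 y1'] /andP[y2 y2'].
  have b1 : `|y.1 - a p.1| <= d by rewrite ger0_norm; lra.
  have b2 : `|y.2 - a p.2| <= d by rewrite ger0_norm; lra.
  have : `|g y - g (a p.1, a p.2)| <= M * (d + d).
    by apply: le_trans hL _; apply: ler_wpM2l => //; exact: lerD.
  rewrite ler_norml /c /k => /andP[g1 g2]; split; lra.
pose B p := Q p `*` `[c p, c p + d[%classic.
pose U p := (Q p `*` setT) `&` under_strip g h.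
pose UU := (S `*` setT) `&` under_strip g h.
have mU p : measurable (U p).
  by apply: measurableI; [apply: measurableX => //|exact: measurable_under_strip].
have mUU : measurable UU.
  by apply: measurableI; [apply: measurableX => //; exact: measurable_square|exact: measurable_under_strip].
have dis (p q : 'I_n * 'I_n) y : Q p y -> Q q y -> p = q.
  case: p q => [p1 p2] [q1 q2] [/= h1 h2] [h3 h4].
  by rewrite (val_inj (grid_disjoint d0 h1 h3)) (val_inj (grid_disjoint d0 h2 h4)).
exists n, (2 / d ^+ 4), B; split.
- by rewrite divr_ge0 ?exprn_ge0 // ltW.
- move=> p; split; first by apply: measurableX => //; exact: measurable_itv.
  move=> [y s] [/= Qy]; rewrite in_itv /= => /andP[s1 s2]; split; first by split=> //; exact: QS Qy.
  have [h1 h2] := hc p y Qy; rewrite /under_strip /=; apply/andP; split; last exact: lt_le_trans h2.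
  by rewrite (le_trans _ s1) // (le_trans _ h1) // lerB.
- move=> W sW; pose J y := (((W (y, g y)) ^+ 2)%:E : \bar R).
  have mJ A : measurable A -> measurable_fun A J.
    move=> mA; apply/measurable_EFinP; apply: measurable_funX; apply: measurable_funTS.
    have mW := continuous_measurable3 (rsmooth_continuous sW).
    have mg' : measurable_fun setT (fun y : mR * mR => (y, g y) : mpt R).
      by apply: measurable_fun_pair; [exact: measurable_id|exact: mg].
    by have := measurableT_comp mW mg'.
  have J0 y : (0 <= J y)%E by rewrite lee_fin sqr_ge0.
  pose E := index_enum ('I_n * 'I_n)%type.
  have uE : uniq E by exact: index_enum_uniq.
  have triv (T : Type) (F : 'I_n * 'I_n -> set T) (pr : T -> mR * mR) :
      (forall p x, F p x -> Q p (pr x)) -> trivIset [set` E] F.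
    move=> FQ p q _ _ [x [Fp Fq]]; exact: dis (FQ _ _ Fp) (FQ _ _ Fq).
  have mD : measurable (\big[setU/set0]_(p <- E) Q p) by exact: bigsetU_measurable.
  apply: (@le_trans _ _ (\int[leb2 R]_(y in \big[setU/set0]_(p <- E) Q p) J y)%E).
    apply: ge0_subset_integral => //; first exact: measurable_square.
      exact: mJ.
      by move=> y _; exact: J0.
    move=> y [/= h1 h2].
    have e2 : - rho + 2 * rho = rho by ring.
    rewrite !in_itv /= e2 in h1 h2.
    have [i hi] := grid_cover r0 (ltn0Sn (Num.truncn X)) h1; have [j hj] := grid_cover r0 (ltn0Sn (Num.truncn X)) h2.
    by rewrite -bigcup_seq; exists (i, j); [rewrite /= mem_index_enum|split].
  rewrite ge0_integral_bigsetU //; first last.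
  - exact: mJ.
  - by apply: (triv _ _ id).
  apply: (@le_trans _ _ (\sum_(p <- E) ((2 / d ^+ 4 * (\int[leb3 R]_(z in B p) W z) ^+ 2)%:E
     + ((6 * k + 12) * d)%:E * \int[leb3 R]_(z in U p) sqgrad W z))%E).
    by apply: lee_sum => p _; apply: cell_grad_le => //; exact: hc.
  rewrite big_split /= sumEFin; apply: leeD => //.
  have cp : (0 <= ((6 * k + 12) * d)%:E :> \bar R)%E.
    by rewrite lee_fin mulr_ge0 ?addr_ge0 ?mulr_ge0 // ltW.
  rewrite -ge0_sume_distrr; last by move=> p _; apply: integral_ge0 => z _; exact: sqgrad_ge0.
  have mUb : measurable (\big[setU/set0]_(p <- E) U p) by exact: bigsetU_measurable.
  have mG A : measurable A -> measurable_fun A (sqgrad W).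
    by move=> mA; apply: measurable_funTS; exact: measurable_sqgrad.
  have := @ge0_integral_bigsetU _ _ _ (leb3 R) _ U (sqgrad W) E mU uE _ (mG _ mUb) (fun z _ => sqgrad_ge0 W z).
  move=> <-; last by apply: (triv _ _ fst) => p z [[]].
  have I0 A : (0 <= \int[leb3 R]_(z in A) sqgrad W z)%E by apply: integral_ge0 => z _; exact: sqgrad_ge0.
  apply: lee_pmul; [exact: cp|exact: I0|by rewrite lee_fin|].
  apply: ge0_subset_integral => //; first exact: mG.
    by move=> z _; exact: sqgrad_ge0.
  rewrite -bigcup_seq => z [p _] [[Qz _] zs]; split => //; split => //; exact: QS Qz.
Qed.

End PatchInequality.

(** * Charts and the outer normal *)

Section EuclideanBalls.
Variable R : realType.
Local Notation P := (pt R).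

Lemma sum3_ind (K : (P -> R) -> Prop) (F : 'I_3 -> P -> R) :
  (forall f g, K f -> K g -> K (f + g)) -> (forall i, K (F i)) -> K (fun x => \sum_i F i x).
Proof.
move=> hD hF; have h := hD _ _ (hD _ _ (hF 0) (hF 1)) (hF 2%R).
rewrite (_ : (fun x => _) = (F 0 + F 1) + F 2%R) //.
apply/funext => x; rewrite !big_ord_recr big_ord0 /= add0r -[RHS]/(F 0 x + F 1 x + F 2%R x).
by congr (F _ x + F _ x + F _ x); exact/val_inj.
Qed.

Lemma continuous_sum3 (F : 'I_3 -> P -> R) : (forall i, continuous (F i)) ->
  continuous (fun x => \sum_i F i x).
Proof.
move=> h; apply: (sum3_ind (K := fun f => continuous f)) h => f g cf cg x.
by apply: cvgD; [exact: cf|exact: cg].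
Qed.

Lemma sqlen_ge0 (x : P) : 0 <= sqlen x.
Proof. by apply: sumr_ge0 => i _; exact: sqr_ge0. Qed.

Lemma sqlen0 : sqlen (0 : P) = 0.
Proof. by rewrite sqlenE /= expr0n /= !addr0. Qed.

Lemma eballE (x0 : P) r x : eball x0 r x <-> sqlen (x - x0) < r ^+ 2.
Proof. by []. Qed.

Lemma sqlen_continuous : continuous (@sqlen R).
Proof.
have E : @sqlen R = fun x : P => \sum_i (coordf i x) * (coordf i x).
  by apply/funext => x; apply: eq_bigr => i _; rewrite expr2.
rewrite E; apply: (continuous_sum3 (F := fun i x => coordf i x * coordf i x)) => i x.
by apply: cvgM; exact: coordf_continuous.
Qed.

Lemma eball_open (x0 : P) r : open (eball x0 r).
Proof.
have c : continuous (fun x : P => sqlen (x - x0)).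
  move=> x; apply: (@continuous_comp _ _ _ (fun x : P => x - x0) (@sqlen R)); last exact: sqlen_continuous.
  by apply: cvgB; [exact: cvg_id|exact: cvg_cst].
have -> : eball x0 r = (fun x : P => sqlen (x - x0)) @^-1` `]-oo, (r ^+ 2)[%classic.
  by apply/seteqP; split=> x; rewrite /= in_itv.
by move/continuousP: c; apply; exact: interval_open.
Qed.

Lemma eball_center (x0 : P) r : 0 < r -> eball x0 r x0.
Proof. by move=> r0; apply/eballE; rewrite subrr sqlen0 exprn_gt0. Qed.

Lemma coordf_lt (x : P) r j : 0 < r -> sqlen x < r ^+ 2 -> `|coordf j x| < r.
Proof.
move=> r0 h; have : `|coordf j x| ^+ 2 < r ^+ 2.
  rewrite real_normK ?num_real //; apply: le_lt_trans h.
  by rewrite /sqlen (bigD1 j) //= lerDl sumr_ge0 // => i _; exact: sqr_ge0.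
by rewrite ltr_pXn2r // nnegrE ltW.
Qed.

Lemma nbhs0_cube (U : set P) : nbhs (0 : P) U -> exists2 d : R, 0 < d & forall x, (forall j, `|coordf j x| < d) -> U x.
Proof.
move=> /nbhs_ballP[d /= d0 h]; exists d => // x hx; apply: h.
by split; [split|]; rewrite /ball /= sub0r normrN; [move: (hx 0)|move: (hx 1)|move: (hx 2%R)]; rewrite /coordf mxE.
Qed.

End EuclideanBalls.

(** * Change of orthonormal frame *)

Section AffineFrame.
Variables (R : realType) (x0 : pt R) (e : 'M[R]_3).
Hypothesis he : e *m e^T = 1%:M.
Local Notation P := (pt R).

Definition frame (z : P) : P := x0 + rot e z.
Definition frame_inv (x : P) : P := rot e^T (x - x0).

Lemma frame_orthT : e^T *m e = 1%:M. Proof. exact: mulmx1C. Qed.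

Lemma frameK : cancel frame frame_inv.
Proof. by move=> z; rewrite /frame /frame_inv addrAC subrr add0r (rotK he). Qed.

Lemma frame_invK : cancel frame_inv frame.
Proof. by move=> x; rewrite /frame /frame_inv (rotK frame_orthT) addrC subrK. Qed.

Lemma frame_sub z : frame z - x0 = rot e z.
Proof. by rewrite /frame addrAC subrr add0r. Qed.

Lemma sqlen_frame z : sqlen (frame z - x0) = sqlen z.
Proof. by rewrite frame_sub sqlen_rot. Qed.

Lemma frameD z w : frame (z + w) = frame z + rot e w.
Proof. by rewrite /frame rotD addrA. Qed.

Lemma coordsZ a (x : P) : coords (a *: x) = a *: coords x.
Proof. by apply/rowP => j; rewrite [RHS]mxE; exact: coordfZ. Qed.

Lemma rotZ a x : rot e (a *: x) = a *: rot e x.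
Proof.
by rewrite -[RHS]coordsK coordsZ /rot of_coordsK coordsZ scalemxAl.
Qed.

Lemma coordf_rot j x : coordf j (rot e x) = \sum_i coordf i x * e i j.
Proof. by rewrite /coordf of_coordsK mxE. Qed.

Lemma frame_continuous : continuous frame.
Proof.
have c j : continuous (fun z => coordf j (frame z)).
  rewrite (_ : (fun z => _) = fun z => coordf j x0 + \sum_i coordf i z * e i j); last first.
    by apply/funext => z; rewrite coordfD coordf_rot.
  move=> z; apply: cvgD; first exact: cvg_cst.
  move: z; apply: (continuous_sum3 (F := fun i z => coordf i z * e i j)) => i z.
  by apply: cvgM; [exact: coordf_continuous|exact: cvg_cst].
have -> : frame = fun z => \sum_i coordf i (frame z) *: unitv R i.
  by apply/funext => z; rewrite -sum_unitv.
under eq_fun do rewrite !big_ord_recr big_ord0 /=.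
by move=> z; apply: cvgD; [apply: cvgD; [apply: cvgD; [exact: cvg_cst|]|]|]; apply: cvgZl; exact: c.
Qed.

Lemma frame_measurable : measurable_fun setT (frame : mpt R -> mpt R).
Proof. exact: (measurable_addf (measurable_cst _) (@rot_measurable R e)). Qed.

Lemma frame_inv_measurable : measurable_fun setT (frame_inv : mpt R -> mpt R).
Proof. exact: (measurableT_comp (@rot_measurable R e^T) (measurable_translate (- x0))). Qed.

Lemma integral_frame (f : mpt R -> \bar R) : measurable_fun setT f -> (forall x, 0 <= f x)%E ->
  (\int[leb3 R]_x f (frame x) = \int[leb3 R]_x f x)%E.
Proof.
move=> mf f0; rewrite -(integral_translate x0 mf f0) -(integral_rot he (g := fun x => f ((x : P) + x0))) //.
  by apply: eq_integral => x _; rewrite /frame addrC.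
exact: (measurableT_comp mf (measurable_translate x0)).
Qed.

Lemma integral_frame_sgn (f : P -> R) : measurable_fun setT (f : mpt R -> R) ->
  (\int[leb3 R]_x (f (frame x))%:E = \int[leb3 R]_x (f x)%:E)%E.
Proof.
move=> mf; have mE : measurable_fun setT ((EFin \o f) : mpt R -> \bar R) by apply/measurable_EFinP.
rewrite integralE [RHS]integralE; congr (_ - _)%E.
  have := integral_frame (measurable_funepos mE) (fun x => funepos_ge0 _ x).
  by move=> <-; apply: eq_integral => x _; rewrite !funeposE.
have := integral_frame (measurable_funeneg mE) (fun x => funeneg_ge0 _ x).
by move=> <-; apply: eq_integral => x _; rewrite !funenegE.
Qed.

Lemma frame_line z j t : frame (z + t *: unitv R j) = frame z + t *: rot e (unitv R j).
Proof. by rewrite frameD rotZ. Qed.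

Lemma diff_frame (w : P -> R) : rsmooth w -> forall j z,
  rpart j (w \o frame) z = \sum_i e j i * rpart i w (frame z).
Proof.
move=> sw j z; have dw := rsmooth_diff (frame z) sw.
transitivity ('D_(rot e (unitv R j)) w (frame z)).
  have E : (fun h : R => h^-1 *: (((w \o frame) \o shift z) (h *: unitv R j) - (w \o frame) z)) =
      (fun h : R => h^-1 *: ((w \o shift (frame z)) (h *: rot e (unitv R j)) - w (frame z))).
    by apply/funext => h /=; rewrite (addrC (h *: _)) frame_line (addrC (frame z)).
  by rewrite /rpart /derive E.
rewrite deriveE // diff_rpart //; apply: eq_bigr => i _; congr (_ * _).
rewrite coordf_rot (bigD1 j) //= coordf_unitv eqxx mul1r big1 ?addr0 // => k kj.
by rewrite coordf_unitv eq_sym (negbTE kj) mul0r.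
Qed.

Lemma frame_differentiable z : differentiable frame z.
Proof.
have -> : frame = (fun z => cst x0 z + rot e z) by [].
apply: differentiableD; first exact: differentiable_cst.
have lin : linear (rot e) by move=> a u v; rewrite rotD rotZ.
pose f := GRing.isLinear.Build _ _ _ _ (rot e) lin.
pose F : {linear P -> P} := HB.pack (rot e) f.
apply: (@linear_differentiable _ _ _ F).
move=> y; have := @frame_continuous y; rewrite /frame => h.
have -> : (F : P -> P) = (fun z => - x0 + frame z) by apply/funext => u; rewrite /frame addKr.
by apply: cvgD; [exact: cvg_cst|exact: frame_continuous].
Qed.

(** By the chain rule the functions u o frame with u smooth are closed under partial derivatives, so
    [rsmooth_coind] applies. *)
Lemma rsmooth_frame (w : P -> R) : rsmooth w -> rsmooth (w \o frame).
Proof.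
move=> sw; apply: (rsmooth_coind (Q := fun f => exists2 u, rsmooth u & f = u \o frame)); last by exists w.
move=> _ [u su ->]; split=> [x|j].
  by apply: differentiable_comp; [exact: frame_differentiable|exact: rsmooth_diff].
exists (fun x => \sum_i e j i * rpart i u x); last by apply/funext => z; rewrite diff_frame.
apply: (sum3_ind (F := fun i x => e j i * rpart i u x)); first by move=> f g; exact: rsmoothD.
by move=> i; apply: rsmoothZ; exact: rsmooth_rpart.
Qed.

(** The gradient in frame coordinates is the image of the gradient under the orthogonal map
    [rot e^T], which preserves lengths. *)
Lemma sqgrad_frame (w : P -> R) z : rsmooth w -> sqgrad (w \o frame) z = sqgrad w (frame z).
Proof.
move=> sw; pose v : P := of_coords (\row_i rpart i w (frame z)).
have vE i : coordf i v = rpart i w (frame z) by rewrite /coordf of_coordsK mxE.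
congr (_%:E); transitivity (sqlen (rot e^T v)).
  apply: eq_bigr => j _; congr (_ ^+ 2); rewrite diff_frame //.
  rewrite -/(coordf j _) /coordf of_coordsK mxE; apply: eq_bigr => i _.
  by rewrite -/(coordf i v) vE [e^T _ _]mxE mulrC.
rewrite sqlen_rot; last by rewrite trmxK frame_orthT.
by apply: eq_bigr => i _; rewrite -/(coordf i v) vE.
Qed.

End AffineFrame.

(** * C^{1,1} functions of two variables *)

Section PlaneFunctions.
Variable R : realType.
Local Notation T2 := (R * R)%type.

Lemma lipschitz_bound (f : T2 -> R) : lipschitz f ->
  exists2 k, 0 <= k & forall x y, `|f x - f y| <= k * `|x - y|.
Proof.
move=> [M [Mr hM]]; exists (`|M| + 1); first by rewrite addr_ge0.
have M1 : M < `|M| + 1 by rewrite (le_lt_trans (ler_norm M)) // ltrDl.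
by move=> x y; have := hM _ M1 (x, y); apply.
Qed.

Lemma lipschitz_continuous (f : T2 -> R) : lipschitz f -> continuous f.
Proof.
move=> /lipschitz_bound[k k0 hk] x; apply/cvgrPdist_lt => e e0.
have k1 : 0 < k + 1 by rewrite ltr_wpDl.
have hb : nbhs x (ball x (e / (k + 1))) by apply: nbhsx_ballx; rewrite divr_gt0.
apply: (filterS _ hb) => y; rewrite -ball_normE /= => h.
apply: le_lt_trans (hk x y) _; apply: (@le_lt_trans _ _ ((k + 1) * `|x - y|)).
  by apply: ler_wpM2r => //; rewrite lerDl.
by rewrite mulrC -ltr_pdivlMr.
Qed.

Lemma axis_lip (f f' : R -> R) (a b M : R) : (forall t : R, is_derive t (1 : R) f (f' t)) ->
  (forall t, t \in `[Num.min a b, Num.max a b] -> `|f' t| <= M) -> `|f a - f b| <= M * `|a - b|.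
Proof.
move=> df; wlog ab : a b / a <= b.
  move=> h; have /orP[ab|ba] := le_total a b; first exact: h.
  by rewrite minC maxC distrC (distrC a); exact: h.
rewrite min_l ?max_r // => hM.
have cf : {within `[a, b], continuous f}.
  by apply: continuous_subspaceT => s; apply/differentiable_continuous/derivable1_diffP; case: (df s).
have [c cab] := MVT_segment ab (fun s _ => df s) cf.
rewrite distrC => ->; rewrite normrM (distrC a); apply: ler_wpM2r => //; exact: hM.
Qed.

Definition d1 (g : T2 -> R) : T2 -> R := 'D_(1 : R, 0 : R) g.
Definition d2 (g : T2 -> R) : T2 -> R := 'D_(0 : R, 1 : R) g.

Lemma C11_differentiable (g : T2 -> R) : C11 g -> forall y, differentiable g y. Proof. by case. Qed.

Lemma C11_continuous (g : T2 -> R) : C11 g -> continuous g.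
Proof. by move=> [dg _ _] y; apply: differentiable_continuous. Qed.

Lemma C11_cd1 (g : T2 -> R) : C11 g -> continuous (d1 g).
Proof. by move=> [_ h _]; exact: lipschitz_continuous. Qed.

Lemma C11_cd2 (g : T2 -> R) : C11 g -> continuous (d2 g).
Proof. by move=> [_ _ h]; exact: lipschitz_continuous. Qed.

Lemma derive_plane (g : T2 -> R) y w : differentiable g y ->
  'D_w g y = w.1 * d1 g y + w.2 * d2 g y.
Proof.
move=> dg; have e : w = w.1 *: (1 : R, 0 : R) + w.2 *: (0 : R, 1 : R).
  case: w => a b; congr pair; rewrite /=.
    by rewrite -[_ *: _]/(_ * _) -[b *: _]/(_ * _) mulr1 mulr0 addr0.
  by rewrite -[_ *: _]/(_ * _) -[b *: _]/(_ * _) mulr1 mulr0 add0r.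
rewrite deriveE // {1}e linearD !linearZ /d1 /d2 !deriveE //.
Qed.

Lemma between_bound (rho a b t : R) : `|a| <= rho -> `|b| <= rho ->
  t \in `[Num.min a b, Num.max a b] -> `|t| <= rho.
Proof.
rewrite !ler_norml in_itv /= => /andP[? ?] /andP[? ?] /andP[]; rewrite ge_min le_max.
by move=> /orP[?|?] /orP[?|?]; apply/andP; split; lra.
Qed.

(** The partial derivatives are Lipschitz, hence bounded on the square by their values at 0 plus a
    multiple of rho. Two points are joined by a segment along each axis. *)
Lemma C11_lip (g : T2 -> R) (rho : R) : C11 g -> 0 < rho -> exists M, [/\ 0 <= M,
   forall y, `|y.1| <= rho -> `|y.2| <= rho -> `|d1 g y| <= M /\ `|d2 g y| <= M &
   forall y y' : T2, `|y.1| <= rho -> `|y.2| <= rho -> `|y'.1| <= rho -> `|y'.2| <= rho ->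
     `|g y - g y'| <= M * (`|y.1 - y'.1| + `|y.2 - y'.2|)].
Proof.
move=> [dg l1 l2] r0; have [k1 k1_0 h1] := lipschitz_bound l1; have [k2 k2_0 h2] := lipschitz_bound l2.
pose M := `|d1 g 0| + `|d2 g 0| + (k1 + k2) * rho.
have rle : 0 <= rho by exact: ltW.
have M1 : `|d1 g 0| + k1 * rho <= M.
  by rewrite /M mulrDl addrACA lerDl addr_ge0 // mulr_ge0.
have M2 : `|d2 g 0| + k2 * rho <= M.
  by rewrite /M mulrDl addrACA lerDr addr_ge0 // mulr_ge0.
have bd (f : T2 -> R) k y : 0 <= k -> (forall x y, `|f x - f y| <= k * `|x - y|) ->
    `|y.1| <= rho -> `|y.2| <= rho -> `|f y| <= `|f 0| + k * rho.
  move=> k0 hk y1 y2; rewrite -(subrK (f 0) (f y)) addrC.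
  apply: le_trans (ler_normD _ _) _; rewrite lerD2l; apply: le_trans (hk _ _) _.
  by apply: ler_wpM2l => //; rewrite subr0 prod_normE ge_max y1 y2.
have dM y : `|y.1| <= rho -> `|y.2| <= rho -> `|d1 g y| <= M /\ `|d2 g y| <= M.
  move=> y1 y2; split; [apply: le_trans M1|apply: le_trans M2]; exact: bd.
exists M; split => //; first by rewrite /M !addr_ge0 // mulr_ge0 // addr_ge0.
move=> [a b] [a' b'] /= ya yb ya' yb'; rewrite mulrDr.
rewrite -(subrKA (g (a', b))); apply: le_trans (ler_normD _ _) _; apply: lerD.
- have L (t : R) : (0, b) + t *: (1 : R, 0 : R) = (t, b) :> T2.
    by rewrite -[LHS]/(0 + t * 1, b + t * 0) mulr1 mulr0 add0r addr0.
  have D (t : R) : is_derive t (1 : R) (fun s => g (s, b)) (d1 g (t, b)).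
    have := @is_derive_line R _ g (0, b) (1 : R, 0 : R) t; rewrite L => h.
    have {h} := h (diff_derivable (dg _)); under eq_fun do rewrite L; exact.
  by apply: (axis_lip D) => t ht; have [] := dM (t, b) (between_bound ya ya' ht) yb.
- have L (t : R) : (a', 0) + t *: (0 : R, 1 : R) = (a', t) :> T2.
    by rewrite -[LHS]/(a' + t * 0, 0 + t * 1) mulr1 mulr0 add0r addr0.
  have D (t : R) : is_derive t (1 : R) (fun s => g (a', s)) (d2 g (a', t)).
    have := @is_derive_line R _ g (a', 0) (0 : R, 1 : R) t; rewrite L => h.
    have {h} := h (diff_derivable (dg _)); under eq_fun do rewrite L; exact.
  by apply: (axis_lip D) => t ht; have [] := dM (a', t) ya' (between_bound yb yb' ht).
Qed.

Lemma derive_shift (g : T2 -> R) (a : T2) (c : R) v y :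
  'D_v (fun y => g (y + a) - c) y = 'D_v g (y + a).
Proof.
rewrite /derive.
have E : (fun h : R => h^-1 *: (((fun y => g (y + a) - c) \o shift y) (h *: v) - (g (y + a) - c))) =
   (fun h : R => h^-1 *: ((g \o shift (y + a)) (h *: v) - g (y + a))).
  by apply/funext => h /=; rewrite opprB addrA subrK addrA.
by rewrite E.
Qed.

Lemma C11_shift (g : T2 -> R) (a : T2) : C11 g -> C11 (fun y => g (y + a) - g a).
Proof.
move=> [dg l1 l2]; split.
- move=> y; apply: differentiableB; last exact: differentiable_cst.
  by apply: (@differentiable_comp _ _ _ _ (fun y : T2 => y + a) g).
- have {l1}[k k0 hk] := lipschitz_bound l1; exists k; split; first exact: num_real.
  move=> M kM [x y] _ /=; rewrite !derive_shift; apply: le_trans (hk _ _) _.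
  by rewrite opprD addrACA subrr addr0; apply: ler_wpM2r => //; exact: ltW.
- have {l2}[k k0 hk] := lipschitz_bound l2; exists k; split; first exact: num_real.
  move=> M kM [x y] _ /=; rewrite !derive_shift; apply: le_trans (hk _ _) _.
  by rewrite opprD addrACA subrr addr0; apply: ler_wpM2r => //; exact: ltW.
Qed.

Lemma plane_measurable (f : T2 -> R) : continuous f ->
  measurable_fun setT (f : (measurableTypeR R * measurableTypeR R)%type -> measurableTypeR R).
Proof.
move=> cf; have h : measurable_fun setT ((f \o fst) : mpt R -> measurableTypeR R).
  apply: continuous_measurable3 => x; apply: (@continuous_comp _ _ _ fst f); last exact: cf.
  exact: cvg_fst.
have m : measurable_fun setT (fun y : measurableTypeR R * measurableTypeR R => (y, 0) : mpt R).
  by apply: measurable_fun_pair; [exact: measurable_id|exact: measurable_cst].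
by have := measurableT_comp h m.
Qed.

End PlaneFunctions.

(** * The boundary inside one chart *)

Section ChartGeometry.
Variables (R : realType) (Omega : set (pt R)).
Local Notation P := (pt R).
Local Notation mR := (measurableTypeR R).
Hypothesis oO : open Omega.

Lemma boundary_notin x : boundary Omega x -> ~ Omega x.
Proof. by move=> [_ nx] Ox; apply: nx; move: oO; rewrite openE => h; exact: h. Qed.

Lemma boundary_nbhs x U : boundary Omega x -> nbhs x U -> Omega `&` U !=set0.
Proof. by move=> [cx _]; exact: cx. Qed.

Lemma boundary_closed : closed (boundary Omega).
Proof.
rewrite /boundary setDE; apply: closedI; first exact: closed_closure.
by apply: open_closedC; exact: open_interior.
Qed.

Section OneChart.
Variables (x0 : P) (e : 'M[R]_3) (g : R * R -> R) (r : R).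
Hypothesis ch : chart Omega x0 e g r.

Let r0 : 0 < r. Proof. by case: ch. Qed.
Let he : e *m e^T = 1%:M. Proof. by case: ch. Qed.
Let gC : C11 g. Proof. by case: ch. Qed.

Lemma chartE z : sqlen z < r ^+ 2 -> (Omega (frame x0 e z) <-> z.2 < g z.1).
Proof.
case: ch => _ _ _ h zr; have := h (frame x0 e z); rewrite /= frame_sub /rot of_coordsK -mulmxA he mulmx1.
rewrite /coords !mxE /=; case: z zr => [[a b] c] /= zr; apply.
by apply/eballE; rewrite sqlen_frame.
Qed.

Lemma graph_pointE y : graph_point x0 e g y = frame x0 e (y, g y).
Proof. by case: y. Qed.

Lemma gz_continuous : continuous (fun z : P => z.2 - g z.1).
Proof.
move=> z; apply: cvgB; first exact: cvg_snd.
apply: (@continuous_comp _ _ _ fst g); first exact: cvg_fst.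
exact: C11_continuous.
Qed.

(** A point below the graph is in Omega, which is open. A point above the graph has a neighbourhood
    that misses Omega. Neither is a boundary point. *)
Lemma boundary_graph z : sqlen z < r ^+ 2 -> boundary Omega (frame x0 e z) -> z.2 = g z.1.
Proof.
move=> zr bz; have nO := boundary_notin bz.
apply/eqP; rewrite eq_le; apply/andP; split; last first.
  by rewrite leNgt; apply/negP => h; apply: nO; apply/chartE.
rewrite leNgt; apply/negP => h.
pose U := [set w : P | sqlen w < r ^+ 2 /\ 0 < w.2 - g w.1].
have oU : open U.
  have -> : U = (@sqlen R @^-1` `]-oo, (r ^+ 2)[%classic) `&` ((fun w : P => w.2 - g w.1) @^-1` `]0, +oo[%classic).
    by apply/seteqP; split=> w; rewrite /U /= !in_itv /= ?andbT.
  apply: openI; first by move/continuousP: (@sqlen_continuous R); apply; exact: interval_open.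
  by move/continuousP: gz_continuous; apply; exact: interval_open.
have oV : open (frame_inv x0 e @^-1` U).
  move/continuousP: (@frame_continuous R (- rot e^T x0) e^T) => /(_ U oU); congr open.
  have -> // : frame_inv x0 e = frame (- rot e^T x0) e^T.
  by apply/funext => x; rewrite /frame /frame_inv rotD rotN addrC.
have Vz : (frame_inv x0 e @^-1` U) (frame x0 e z).
  by rewrite /preimage /= frameK //; split=> //; rewrite subr_gt0.
have [x [Ox [xr hx]]] := boundary_nbhs bz (open_nbhs_nbhs (conj oV Vz)).
move: Ox; rewrite -(frame_invK x0 he x) => /(chartE xr).
by move: hx; rewrite subr_gt0 => /ltW; rewrite leNgt => /negP.
Qed.

Lemma boundary_graph_inv x : eball x0 r x -> boundary Omega x ->
  sqlen (frame_inv x0 e x) < r ^+ 2 /\ (frame_inv x0 e x).2 = g (frame_inv x0 e x).1.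
Proof.
move=> /eballE xr bx; have s : sqlen (frame_inv x0 e x) < r ^+ 2.
  by rewrite -(sqlen_frame x0 he) frame_invK.
by split=> //; apply: boundary_graph => //; rewrite frame_invK.
Qed.

Lemma nbhs_sqlen z : sqlen z < r ^+ 2 -> exists2 d, 0 < d & forall w, (forall j, `|coordf j w| < d) -> sqlen (z + w) < r ^+ 2.
Proof.
move=> zr; apply: (@nbhs0_cube R [set w | sqlen (z + w) < r ^+ 2]).
have oU : open [set w : P | sqlen (z + w) < r ^+ 2].
  have c : continuous (fun w : P => sqlen (z + w)).
    move=> x; apply: (@continuous_comp _ _ _ (fun w : P => z + w) (@sqlen R)); last exact: sqlen_continuous.
    by apply: cvgD; [exact: cvg_cst|exact: cvg_id].
  move/continuousP: c => /(_ _ (@interval_open R -oo%O (BLeft (r ^+ 2)) isT isT)).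
  by congr open; apply/seteqP; split=> w; rewrite /= in_itv.
by apply: open_nbhs_nbhs; split=> //; rewrite /= addr0.
Qed.

(** [outer_normal] looks only at charts centred at the point itself; keeping the frame and
    translating g provides one at every boundary point of a given chart. *)
Lemma chart_recenter z : sqlen z < r ^+ 2 -> z.2 = g z.1 ->
  exists r', chart Omega (frame x0 e z) e (fun y => g (y + z.1) - g z.1) r'.
Proof.
move=> zr zg; have [d d0 hd] := nbhs_sqlen zr; exists d; split => //; first exact: C11_shift.
move=> x /eballE xd; rewrite /=.
move: (xd); set w := rot e^T (x - frame x0 e z) => _.
have xE : x = frame x0 e (z + w) by rewrite frameD /w (rotK (frame_orthT he)) addrC subrK.
have wd : sqlen w < d ^+ 2 by rewrite /w sqlen_rot // trmxK; exact: frame_orthT.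
have wE : coords (x - frame x0 e z) *m e^T = coords w by rewrite /w /rot of_coordsK.
have wE1 j : (coords (x - frame x0 e z) *m e^T) 0 j = coords w 0 j by rewrite wE.
rewrite !wE1 {1}xE; apply: iff_trans (chartE (hd w (fun j => coordf_lt j d0 wd))) _.
move: (w) => [[a b] c]; rewrite !mxE /= ltrBrDl (addrC _ c) -zg addrC.
by rewrite (addrC z.1 (a, b)).
Qed.

Definition chart_normal_at (y : R * R) : 'rV[R]_3 :=
  (Num.sqrt (1 + d1 g y ^+ 2 + d2 g y ^+ 2))^-1 *: (coords (- d1 g y, - d2 g y, 1) *m e).

Lemma normal_gt0 y : 0 < 1 + d1 g y ^+ 2 + d2 g y ^+ 2.
Proof. by rewrite -addrA ltr_pwDl // addr_ge0 // sqr_ge0. Qed.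

Lemma chart_normal_unit y : \sum_i chart_normal_at y 0 i ^+ 2 = 1.
Proof.
have n0 := normal_gt0 y.
under eq_bigr do rewrite mxE exprMn.
rewrite -mulr_sumr exprVn sqr_sqrtr ?ltW //.
have -> : \sum_i (coords (- d1 g y, - d2 g y, 1) *m e) 0 i ^+ 2 = 1 + d1 g y ^+ 2 + d2 g y ^+ 2.
  have := sqlen_rot (- d1 g y, - d2 g y, 1) he; rewrite /rot {1}/sqlen of_coordsK => ->.
  by rewrite sqlenE /= !sqrrN expr1n; ring.
by rewrite mulVf // gt_eqF.
Qed.

Lemma chart_normal_dot y (v : P) : \sum_i coordf i v * chart_normal_at y 0 i =
  (Num.sqrt (1 + d1 g y ^+ 2 + d2 g y ^+ 2))^-1 *
  ((rot e^T v).2 - (rot e^T v).1.1 * d1 g y - (rot e^T v).1.2 * d2 g y).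
Proof.
under eq_bigr do rewrite mxE mulrCA.
rewrite -mulr_sumr; congr (_ * _).
have -> : \sum_i coordf i v * (coords (- d1 g y, - d2 g y, 1) *m e) 0 i =
   (coords v *m (coords (- d1 g y, - d2 g y, 1) *m e)^T) 0 0.
  by rewrite mxE; apply: eq_bigr => i _; rewrite [_^T _ _]mxE.
rewrite trmx_mul mulmxA -[coords v *m e^T]of_coordsK -[of_coords _]/(rot e^T v) mxE.
move: (rot e^T v) => [[a b] c]; rewrite !big_ord_recr big_ord0 /= add0r.
have T i : (coords (- d1 g y, - d2 g y, 1))^T i 0 = coords (- d1 g y, - d2 g y, 1) 0 i by rewrite mxE.
by rewrite !T /coords !mxE /=; ring.
Qed.

Hypothesis bx0 : boundary Omega x0.

Lemma chart_g0 : g 0 = 0.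
Proof.
have r00 : rot e 0 = 0 by have := rotZ e 0 0; rewrite !scale0r.
have h : boundary Omega (frame x0 e 0) by rewrite /frame r00 addr0.
by have := boundary_graph _ h; rewrite sqlen0 exprn_gt0 //= => /(_ isT) <-.
Qed.

(* Moving from x0 along v leaves or enters Omega according to the sign of the
   product of v with the normal of any chart; hence the normal is unique. *)
Lemma chart_normal_side (v : P) :
  (\sum_i coordf i v * chart_normal_at 0 0 i < 0 -> \forall t \near (0 : R)^'+, Omega (x0 + t *: v)) /\
  (0 < \sum_i coordf i v * chart_normal_at 0 0 i -> \forall t \near (0 : R)^'+, ~ Omega (x0 + t *: v)).
Proof.
set z := rot e^T v; pose m := z.1.1 * d1 g 0 + z.1.2 * d2 g 0.
have s0 : 0 < (Num.sqrt (1 + d1 g 0 ^+ 2 + d2 g 0 ^+ 2))^-1 by rewrite invr_gt0 sqrtr_gt0 normal_gt0.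
have xE t : x0 + t *: v = frame x0 e (t *: z) by rewrite /frame rotZ /z (rotK (frame_orthT he)).
have nr : \forall t \near (0 : R)^'+, sqlen (t *: z) < r ^+ 2.
  have s00 : sqlen (0 : P) < r ^+ 2 by rewrite sqlen0 exprn_gt0.
  have [d d0 hd] := nbhs_sqlen s00.
  (* [sqlen z + 1] bounds the absolute value of each coordinate of z, since |a| <= a^2 + 1. *)
  have K0 : 0 < sqlen z + 1 by rewrite ltr_wpDl // sqlen_ge0.
  have dK : 0 < d / (sqlen z + 1) by rewrite divr_gt0.
  near=> t; have t0 : 0 < t by near: t; exact: nbhs_right_gt.
  have td : t < d / (sqlen z + 1) by near: t; exact: nbhs_right_lt.
  rewrite -[t *: z]add0r; apply: hd => j; rewrite coordfZ normrM gtr0_norm //.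
  apply: (@le_lt_trans _ _ (t * (sqlen z + 1))); last by rewrite -ltr_pdivlMr.
  rewrite ler_pM2l //; have h1 : coordf j z ^+ 2 <= sqlen z.
    by rewrite /sqlen (bigD1 j) //= lerDl sumr_ge0 // => i _; exact: sqr_ge0.
  have := sqr_ge0 (`|coordf j z| - 1); have : `|coordf j z| ^+ 2 = coordf j z ^+ 2 by rewrite real_normK ?num_real.
  by have := normr_ge0 (coordf j z); nra.
(* m is the derivative of g at 0 along the horizontal part of z, and g 0 = 0. So the sign of z.2 - m
   decides whether t z is above or below the graph for small t > 0. *)
have lim : (fun t : R => t^-1 * g (t *: z.1)) @ (0 : R)^'+ --> m.
  have dg : differentiable g 0 by exact: C11_differentiable.
  have [dv] : is_derive 0 z.1 g m.
    by split; [exact: diff_derivable|rewrite derive_plane].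
  move: dv => /cvgP/[swap] dE; rewrite /derive in dE => _.
  have dv : derivable g 0 z.1 by exact: diff_derivable.
  move: dv; rewrite /derivable => /cvg_ex[l hl].
  have lE : l = m by rewrite -dE; apply/esym/cvg_lim.
  rewrite -lE; apply: cvg_dnbhs_at_right; apply: cvg_trans hl.
  apply: near_eq_cvg; apply: nearW => t /=.
  by rewrite chart_g0 addr0 subr0.
have sgn : \sum_i coordf i v * chart_normal_at 0 0 i =
    (Num.sqrt (1 + d1 g 0 ^+ 2 + d2 g 0 ^+ 2))^-1 * (z.2 - m).
  by rewrite chart_normal_dot -/z /m opprD addrA.
split; rewrite sgn.
  rewrite pmulr_rlt0 // subr_lt0 => zm.
  have h : \forall t \near (0 : R)^'+, z.2 < t^-1 * g (t *: z.1) by exact: (cvgr_gt _ lim).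
  near=> t; have t0 : 0 < t by near: t; exact: nbhs_right_gt.
  rewrite xE; apply/chartE; first by near: t.
  have : z.2 < t^-1 * g (t *: z.1) by near: t.
  by rewrite ltr_pdivlMl.
rewrite pmulr_rgt0 // subr_gt0 => zm.
have h : \forall t \near (0 : R)^'+, t^-1 * g (t *: z.1) < z.2 by exact: (cvgr_lt _ lim).
near=> t; have t0 : 0 < t by near: t; exact: nbhs_right_gt.
rewrite xE => /chartE h2; have : t^-1 * g (t *: z.1) < z.2 by near: t.
rewrite ltr_pdivrMl // => h3.
have /h2 : sqlen (t *: z) < r ^+ 2 by near: t.
by rewrite ltNge => /negP; apply; exact: ltW.
Unshelve. all: by end_near. Qed.

End OneChart.

End ChartGeometry.

(** * Uniqueness and measurability of the outer normal *)

Section OuterNormal.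
Variables (R : realType) (Omega : set (pt R)).
Local Notation P := (pt R).
Local Notation mR := (measurableTypeR R).
Hypothesis oO : open Omega.

(** For unit vectors n and n' with product s < 1, the direction v = n' - n has v . n = s - 1 < 0 and
    v . n' = 1 - s > 0. By [chart_normal_side], x + t v would be both inside and outside Omega for
    small t > 0. *)
Lemma chart_normal_unique x e g r e' g' r' : boundary Omega x ->
  chart Omega x e g r -> chart Omega x e' g' r' -> chart_normal e g = chart_normal e' g'.
Proof.
move=> bx c c'; have [_ he _ _] := c; have [_ he' _ _] := c'.
set n := chart_normal e g; set n' := chart_normal e' g'.
pose s := \sum_i n 0 i * n' 0 i.
have u : \sum_i n 0 i ^+ 2 = 1 := chart_normal_unit c 0.
have u' : \sum_i n' 0 i ^+ 2 = 1 := chart_normal_unit c' 0.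
have d2s : \sum_i (n' 0 i - n 0 i) ^+ 2 = 2 - 2 * s.
  transitivity (\sum_i n' 0 i ^+ 2 + \sum_i n 0 i ^+ 2 - 2 * s); last by rewrite u u'.
  by rewrite /s mulr_sumr -sumrN -!big_split; apply: eq_bigr => i _ /=; ring.
have d0 : 0 <= \sum_i (n' 0 i - n 0 i) ^+ 2 by apply: sumr_ge0 => i _; exact: sqr_ge0.
apply/eqP; apply: contraT => nn; exfalso.
have s1 : s < 1.
  rewrite lt_neqAle; apply/andP; split; last by move: d0; rewrite d2s; lra.
  apply: contra nn => /eqP sE; apply/eqP/rowP => i; apply/eqP.
  have z : \sum_i (n' 0 i - n 0 i) ^+ 2 = 0 by rewrite d2s sE; ring.
  have := @psumr_eq0P _ _ xpredT (fun i => (n' 0 i - n 0 i) ^+ 2) (fun i _ => sqr_ge0 _) z i isT.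
  by move/eqP; rewrite sqrf_eq0 subr_eq0 eq_sym.
pose v : P := of_coords (n' - n).
have vE i : coordf i v = n' 0 i - n 0 i by rewrite /coordf of_coordsK !mxE.
have vn : \sum_i coordf i v * n 0 i = s - 1.
  by rewrite -u /s -sumrB; apply: eq_bigr => i _; rewrite vE; ring.
have vn' : \sum_i coordf i v * n' 0 i = 1 - s.
  by rewrite -u' /s -sumrB; apply: eq_bigr => i _; rewrite vE; ring.
have [h1 _] := chart_normal_side oO c bx v.
have [_ h2] := chart_normal_side oO c' bx v.
have a1 : \forall t \near (0 : R)^'+, Omega (x + t *: v) by apply: h1; rewrite [ltLHS]vn subr_lt0.
have a2 : \forall t \near (0 : R)^'+, ~ Omega (x + t *: v) by apply: h2; rewrite [ltRHS]vn' subr_gt0.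
by have [t [p1 p2]] := filter_ex (filterI a1 a2).
Qed.

(** Recentring at x and uniqueness. The normal is thus given by one continuous formula on the whole
    chart, which yields its measurability. *)
Lemma outer_normalE x0 e g r x : chart Omega x0 e g r ->
  eball x0 r x -> boundary Omega x ->
  outer_normal Omega x = chart_normal_at e g (frame_inv x0 e x).1.
Proof.
move=> c xr bx; have [_ he gC _] := c.
have [zr zg] := boundary_graph_inv oO c xr bx; set z := frame_inv x0 e x in zr zg *.
have [r' c1] := chart_recenter c zr zg.
have xz : frame x0 e z = x by rewrite /z frame_invK.
rewrite xz in c1.
have : exists n, exists e g r, chart Omega x e g r /\ n = chart_normal e g.
  by exists (chart_normal e (fun y => g (y + z.1) - g z.1)), e, (fun y => g (y + z.1) - g z.1), r'.
move=> /(xgetPex 0) [e2 [g2 [r2 [c2 E]]]]; rewrite [LHS]E.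
rewrite (chart_normal_unique bx c2 c1) /chart_normal /chart_normal_at /d1 /d2.
by rewrite !derive_shift -[(0, 0)]/(0 : R * R) add0r.
Qed.

Lemma chart_normal_continuous x0 e (g : R * R -> R) i : e *m e^T = 1%:M -> C11 g ->
  continuous (fun x => chart_normal_at e g (frame_inv x0 e x).1 0 i).
Proof.
move=> he gC; have cf : continuous (frame_inv x0 e).
  have -> // : frame_inv x0 e = frame (- rot e^T x0) e^T.
    by apply/funext => x; rewrite /frame /frame_inv rotD rotN addrC.
  exact: frame_continuous.
have cc (f : R * R -> R) : continuous f -> continuous (fun x => f (frame_inv x0 e x).1).
  move=> hf x; apply: (@continuous_comp _ _ _ (fun x => (frame_inv x0 e x).1) f); last exact: hf.
  by apply: (@continuous_comp _ _ _ (frame_inv x0 e) fst); [exact: cf|exact: cvg_fst].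
have c1 := cc _ (C11_cd1 gC); have c2 := cc _ (C11_cd2 gC).
have cj (j : 'I_3) : continuous (fun x => coords (- d1 g (frame_inv x0 e x).1, - d2 g (frame_inv x0 e x).1, 1) 0 j).
  pose F (k : nat) (x : P) := [:: - d1 g (frame_inv x0 e x).1; - d2 g (frame_inv x0 e x).1; 1]`_k.
  rewrite (_ : (fun x => _) = F j); last by apply/funext => y; rewrite mxE.
  case: j => -[|[|[|//]]] h x.
  - exact: (cvgN (c1 x)).
  - exact: (cvgN (c2 x)).
  - exact: cvg_cst.
under eq_fun do rewrite mxE; move=> x; apply: cvgM.
  apply: cvgV; first by rewrite gt_eqF // sqrtr_gt0 normal_gt0.
  apply: (@continuous_comp _ _ _ (fun x => 1 + d1 g (frame_inv x0 e x).1 ^+ 2 + d2 g (frame_inv x0 e x).1 ^+ 2) Num.sqrt); last exact: sqrt_continuous.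
  apply: cvgD; [apply: cvgD; first exact: cvg_cst|].
    exact: (continuous_comp (c1 x) (@exprn_continuous R 2 _)).
  exact: (continuous_comp (c2 x) (@exprn_continuous R 2 _)).
have E : (fun x => (coords (- d1 g (frame_inv x0 e x).1, - d2 g (frame_inv x0 e x).1, 1) *m e) 0 i) =
    fun x => \sum_j coords (- d1 g (frame_inv x0 e x).1, - d2 g (frame_inv x0 e x).1, 1) 0 j * e j i.
  by apply/funext => y; rewrite mxE.
rewrite -[X in _ --> X]/((fun x => (coords (- d1 g (frame_inv x0 e x).1, - d2 g (frame_inv x0 e x).1, 1) *m e) 0 i) x) E.
move: x; apply: (continuous_sum3 (F := fun j x => coords (- d1 g (frame_inv x0 e x).1, - d2 g (frame_inv x0 e x).1, 1) 0 j * e j i)) => j x.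
by apply: cvgM; [exact: cj|exact: cvg_cst].
Qed.

Hypothesis bO : bounded_set Omega.
Hypothesis Oc : C11_boundary Omega.

Lemma boundary_bounded : exists M, boundary Omega `<=` cube M.
Proof.
have [M M0 OM] := bounded_cube bO; exists M => x [cx _].
have cM : closed (@cube R M) by apply: compact_closed; [exact: norm_hausdorff|exact: cube_compact].
by apply: cM; apply: closure_subset cx.
Qed.

Lemma boundary_compact : compact (boundary Omega).
Proof.
have [M BM] := boundary_bounded.
exact: subclosed_compact (@boundary_closed R Omega) (@cube_compact R M) BM.
Qed.

Lemma boundary_measurable : measurable (boundary Omega : set (mpt R)).
Proof. exact: closed_measurable3 (@boundary_closed R Omega). Qed.

(** If every finite family of balls left out some boundary point, the sets left out would generate a
    proper filter on a compact set; but a cluster point p is separated from it by the ball around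
    p. *)
Lemma boundary_cover (rho : P -> R) : (forall x, boundary Omega x -> 0 < rho x) ->
  exists2 s : seq P, (forall x, x \in s -> boundary Omega x) &
    forall x, boundary Omega x -> exists2 y, y \in s & eball y (rho y) x.
Proof.
move=> r0; apply: contrapT => nh.
pose D := [set s : seq P | forall x, x \in s -> boundary Omega x].
pose U (s : seq P) := [set x | boundary Omega x /\ forall y, y \in s -> ~ eball y (rho y) x].
have FF : ProperFilter (filter_from D U).
  apply: filter_from_proper.
    apply: filter_from_filter; first by exists [::].
    move=> s t Ds Dt; exists (s ++ t); first by move=> x; rewrite mem_cat => /orP[/Ds|/Dt].
    by move=> x [bx hx]; split; split=> // y yy; apply: hx; rewrite mem_cat yy ?orbT.
  move=> s Ds; apply: contrapT => ne; apply: nh; exists s => // x bx.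
  apply: contrapT => nx; apply: ne; exists x; split=> // y ys yx; apply: nx; by exists y.
have FB : filter_from D U (boundary Omega) by exists [::] => // x [].
have [p [bp cp]] := boundary_compact FF FB.
have Up : filter_from D U (U [:: p]) by exists [:: p] => // x; rewrite inE => /eqP ->.
have nb : nbhs p (eball p (rho p)).
  by apply: open_nbhs_nbhs; split; [exact: eball_open|apply: eball_center; exact: r0].
by have [x [[_ hx] px]] := cp _ _ Up nb; exact: (hx p (mem_head _ _) px).
Qed.

Lemma measurable_boundary (f : mpt R -> R) (rho : P -> R) :
  (forall x, boundary Omega x -> 0 < rho x) ->
  (forall x, boundary Omega x -> measurable_fun ((boundary Omega `&` eball x (rho x)) : set (mpt R)) f) ->
  measurable_fun (boundary Omega : set (mpt R)) f.
Proof.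
move=> r0 hf; have [s sB cov] := boundary_cover r0.
have m y : measurable ((boundary Omega `&` eball y (rho y)) : set (mpt R)).
  by apply: measurableI; [exact: boundary_measurable|apply: open_measurable3; exact: eball_open].
have h (t : seq P) : (forall x, x \in t -> boundary Omega x) -> 
    measurable (\big[setU/set0]_(y <- t) ((boundary Omega `&` eball y (rho y)) : set (mpt R))) /\
    measurable_fun (\big[setU/set0]_(y <- t) ((boundary Omega `&` eball y (rho y)) : set (mpt R))) f.
  elim: t => [|y t IH] ht; first by rewrite big_nil; split=> //; exact: measurable_fun_set0.
  rewrite big_cons; have [|m1 m2] := IH; first by move=> x xt; apply: ht; rewrite inE xt orbT.
  split; first exact: measurableU.
  apply/measurable_funU => //; split=> //; apply: hf; apply: ht; exact: mem_head.
have [_] := h s sB; congr measurable_fun; rewrite -bigcup_seq; apply/seteqP; split=> x.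
  by move=> [y _ []].
by move=> bx; have [y ys yx] := cov x bx; exists y.
Qed.

Lemma outer_normal_measurable i :
  measurable_fun (boundary Omega : set (mpt R)) (fun x => outer_normal Omega x 0 i).
Proof.
have /choice[q hq] : forall x, exists q : 'M[R]_3 * (R * R -> R) * R, boundary Omega x -> chart Omega x q.1.1 q.1.2 q.2.
  move=> x; have [bx|nb] := pselect (boundary Omega x); last by exists (1%:M, cst 0, 0).
  by have [e [g [r c]]] := Oc bx; exists (e, g, r).
apply: (measurable_boundary (rho := fun x => (q x).2)).
  by move=> x /hq[].
move=> x bx; have c := hq x bx; have [_ he gC _] := c.
apply: (@eq_measurable_fun _ _ _ _ _ (fun y => chart_normal_at (q x).1.1 (q x).1.2 (frame_inv x (q x).1.1 y).1 0 i)).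
  by move=> y; rewrite inE => -[yb yr]; rewrite (outer_normalE c yr yb).
apply: measurable_funTS; apply: continuous_measurable3; exact: chart_normal_continuous.
Qed.

Lemma outer_normal_unit x : boundary Omega x -> \sum_i outer_normal Omega x 0 i ^+ 2 = 1.
Proof.
move=> bx; have [e [g [r c]]] := Oc bx; have [r0 he _ _] := c.
by rewrite (outer_normalE c (eball_center x r0) bx) (chart_normal_unit c).
Qed.

End OuterNormal.

(** * The trace inequality on the boundary *)

Lemma jacobian_continuous (R : realType) (g : R * R -> R) : C11 g ->
  continuous (fun y : R * R => Num.sqrt (1 + d1 g y ^+ 2 + d2 g y ^+ 2)).
Proof.
move=> gC y.
have c1 : continuous (fun x => d1 g x) := C11_cd1 gC.
have c2 : continuous (fun x => d2 g x) := C11_cd2 gC.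
apply: (@continuous_comp _ _ _ (fun y => 1 + d1 g y ^+ 2 + d2 g y ^+ 2) Num.sqrt); last exact: sqrt_continuous.
apply: cvgD; [apply: cvgD; first exact: cvg_cst|].
  exact: (continuous_comp (c1 y) (@exprn_continuous R 2 _)).
exact: (continuous_comp (c2 y) (@exprn_continuous R 2 _)).
Qed.

Section SurfaceTrace.
Variables (R : realType) (Omega : set (pt R)) (sigma : {measure set (mpt R) -> \bar R}).
Local Notation P := (pt R).
Local Notation mR := (measurableTypeR R).
Local Notation D := (Omega : set (mpt R)).
Hypothesis oO : open Omega.
Hypothesis bO : bounded_set Omega.
Hypothesis Oc : C11_boundary Omega.
Hypothesis ss : is_surface_measure Omega sigma.

Section Patch.
Variables (x0 : P) (e : 'M[R]_3) (g : R * R -> R) (r : R).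
Hypothesis bx0 : boundary Omega x0.
Hypothesis ch : chart Omega x0 e g r.

Let r0 : 0 < r. Proof. by case: ch. Qed.
Let he : e *m e^T = 1%:M. Proof. by case: ch. Qed.
Let gC : C11 g. Proof. by case: ch. Qed.
Let mg : measurable_fun setT (g : mR * mR -> mR) := plane_measurable (C11_continuous gC).

Let Gp (y : mR * mR) : mpt R := frame x0 e (y, g y).

Lemma graph_measurable : measurable_fun setT Gp.
Proof.
have m : measurable_fun setT (fun y : mR * mR => (y, g y) : mpt R).
  by apply: measurable_fun_pair; [exact: measurable_id|exact: mg].
exact: (measurableT_comp (@frame_measurable R x0 e) m).
Qed.

(** All radii are shrunk until a strip of fixed depth below the graph stays where the chart
    describes Omega. *)
Lemma patch_data : exists rho h M, [/\ [/\ 0 < rho, rho <= r, 0 < h & 0 <= M],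
  forall y y', square (- rho) (- rho) (2 * rho) y -> square (- rho) (- rho) (2 * rho) y' ->
     `|g y - g y'| <= M * (`|y.1 - y'.1| + `|y.2 - y'.2|),
  (square (- rho) (- rho) (2 * rho) `*` setT) `&` under_strip g h `<=` [set z | Omega (frame x0 e z)],
  (forall y, eball x0 rho (Gp y) -> square (- rho) (- rho) (2 * rho) y) &
  (forall y, square (- rho) (- rho) (2 * rho) y ->
     Num.sqrt (1 + d1 g y ^+ 2 + d2 g y ^+ 2) <= 1 + 2 * M)].
Proof.
have g0 : g 0 = 0 := chart_g0 oO ch bx0.
have s0 : sqlen (0 : P) < r ^+ 2 by rewrite sqlen0 exprn_gt0.
have [d d0 hd] := nbhs_sqlen s0.
have [M [M0 hM1 hM2]] := C11_lip gC d0.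
have M1 : 0 < 4 * (M + 1) by rewrite mulr_gt0 // ltr_wpDl.
(* 2 M rho <= d / 2 bounds |g| by d / 2 on the square, so the strip of depth d / 4 keeps its heights
   below d in absolute value; rho <= d / 2 does the same for the horizontal coordinates. *)
pose rho := Num.min r (Num.min (d / 2) (d / (4 * (M + 1)))).
have rho0 : 0 < rho by rewrite !lt_min r0 !divr_gt0.
have rr : rho <= r by rewrite /rho ge_min lexx.
have rd : rho <= d / 2 by rewrite /rho !ge_min lexx orbT.
have rM : 4 * M * rho <= d.
  have h : rho <= d / (4 * (M + 1)) by rewrite /rho !ge_min lexx !orbT.
  by move: h; rewrite ler_pdivlMr // => h; have := ltW rho0; nra.
have sq y : square (- rho) (- rho) (2 * rho) y -> `|y.1| <= rho /\ `|y.2| <= rho.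
  move=> [/=]; rewrite !in_itv /= => /andP[h1 h2] /andP[h3 h4].
  by rewrite !ler_norml; split; apply/andP; split; lra.
have rd' : rho <= d by apply: le_trans rd _; lra.
have sqd' y : square (- rho) (- rho) (2 * rho) y -> `|y.1| <= d /\ `|y.2| <= d.
  by move=> /sq[h1 h2]; split; [exact: le_trans h1 _|exact: le_trans h2 _].
exists rho, (d / 4), M; split.
- by split=> //; rewrite divr_gt0.
- by move=> y y' /sqd'[h1 h2] /sqd'[h3 h4]; exact: hM2.
- move=> [y s] [[/= Qy _]]; rewrite /under_strip /= => /andP[s1 s2].
  have [h1 h2] := sq y Qy; have [h1' h2'] := sqd' y Qy.
  have gy : `|g y| <= d / 2.
    have := hM2 y 0 h1' h2'; rewrite g0 !subr0 /= normr0 => /(_ (ltW d0) (ltW d0)) h.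
    by apply: le_trans h _; nra.
  have zr : sqlen (y, s) < r ^+ 2.
    rewrite -[(y, s)]add0r; apply: hd => j.
    have sd : `|s| < d by move: gy; rewrite ler_norml ltr_norml => /andP[? ?]; apply/andP; split; lra.
    rewrite /coordf mxE; case: y h1 h2 {Qy gy h1' h2' s1 s2} => a b /= h1 h2.
    by case: j => -[|[|[|//]]] hj /=; [apply: le_lt_trans h1 _|apply: le_lt_trans h2 _|exact: sd]; lra.
  exact/(chartE ch zr).
- move=> y /eballE; rewrite /Gp sqlen_frame // => h.
  have := coordf_lt 0 rho0 h; have := coordf_lt 1 rho0 h; rewrite /coordf !mxE /=.
  case: y {h} => a b /=; rewrite !ltr_norml => /andP[? ?] /andP[? ?].
  by split; rewrite /= in_itv /=; apply/andP; split; lra.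
- move=> y /sqd'[h1 h2]; have [k1 k2] := hM1 y h1 h2.
  have p : 0 <= 1 + 2 * M by rewrite addr_ge0 // mulr_ge0.
  (* Both partial derivatives are at most M in absolute value, and 1 + 2 M^2 <= (1 + 2 M)^2. *)
  rewrite -[leRHS](ger0_norm p) -sqrtr_sqr ler_wsqrtr //.
  have q1 : d1 g y ^+ 2 <= M ^+ 2 by rewrite -[d1 g y ^+ 2]real_normK ?num_real // ler_pXn2r ?nnegrE.
  have q2 : d2 g y ^+ 2 <= M ^+ 2 by rewrite -[d2 g y ^+ 2]real_normK ?num_real // ler_pXn2r ?nnegrE.
  by move: q1 q2; nra.
Qed.

Lemma patch_surface rho M (A : set (mpt R)) : rho <= r -> 0 <= M -> measurable A -> A `<=` eball x0 rho ->
  (forall y, eball x0 rho (Gp y) -> square (- rho) (- rho) (2 * rho) y) ->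
  (forall y, square (- rho) (- rho) (2 * rho) y -> Num.sqrt (1 + d1 g y ^+ 2 + d2 g y ^+ 2) <= 1 + 2 * M) ->
  0 < rho ->
  (sigma A <= (1 + 2 * M)%:E * leb2 R (Gp @^-1` A))%E.
Proof.
move=> rr M0 mA Ar hs hJ rho0.
have mGA : measurable (Gp @^-1` A) by rewrite -[X in measurable X]setTI; exact: graph_measurable.
have AE : A `<=` eball x0 r.
  move=> x /Ar /eballE h; apply/eballE; apply: lt_le_trans h _.
  by rewrite ler_pXn2r ?nnegrE //; exact: ltW.
have [_ sf] := ss; rewrite (sf x0 e g r bx0 ch A mA AE).
rewrite (_ : graph_point x0 e g @^-1` A = Gp @^-1` A); last first.
  by apply/seteqP; split=> y; rewrite /preimage /= graph_pointE.
apply: (@le_trans _ _ (\int[leb2 R]_(y in Gp @^-1` A) (cst (1 + 2 * M)%:E y))%E); last first.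
  by rewrite integral_cst.
have mJ : measurable_fun setT (fun y : mR * mR => (Num.sqrt (1 + d1 g y ^+ 2 + d2 g y ^+ 2))).
  exact: (plane_measurable (jacobian_continuous gC)).
apply: ge0_le_integral.
- exact: mGA.
- by move=> y _; rewrite lee_fin sqrtr_ge0.
- by apply/measurable_EFinP; apply: measurable_funTS; exact: mJ.
- exact: measurable_cst.
- by move=> y Ay; rewrite lee_fin; apply: hJ; apply: hs; exact: Ar.
Qed.

(** The bound for sets becomes one for integrals by comparing two measures: [sigma] restricted to A,
    and 1 + 2 M times the image of plane Lebesgue measure under the graph map. *)
Lemma patch_integral rho M (A : set (mpt R)) (f : mpt R -> \bar R) : rho <= r -> 0 <= M -> measurable A ->
  A `<=` eball x0 rho ->
  (forall y, eball x0 rho (Gp y) -> square (- rho) (- rho) (2 * rho) y) ->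
  (forall y, square (- rho) (- rho) (2 * rho) y -> Num.sqrt (1 + d1 g y ^+ 2 + d2 g y ^+ 2) <= 1 + 2 * M) ->
  0 < rho -> measurable_fun setT f -> (forall x, 0 <= f x)%E ->
  (\int[sigma]_(x in A) f x <= (1 + 2 * M)%:E *
     \int[leb2 R]_(y in square (- rho) (- rho) (2 * rho)) f (Gp y))%E.
Proof.
move=> rr M0 mA Ar hs hJ rho0 mf f0.
have K0 : 0 <= 1 + 2 * M by rewrite addr_ge0 // mulr_ge0.
pose K : {nonneg R} := NngNum K0.
pose m1 := mrestr sigma mA.
unshelve epose (pf := (pushforward (leb2 R) Gp : {measure set (mpt R) -> \bar R})); first exact: graph_measurable.
pose m2 := mscale K pf.
have m12 S : measurable S -> (m1 S <= m2 S)%E.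
  move=> mS; rewrite /m1 /m2 /mrestr /mscale /pushforward /=.
  have mSA : measurable (S `&` A) by exact: measurableI.
  apply: (@le_trans _ _ ((1 + 2 * M)%:E * leb2 R (Gp @^-1` (S `&` A)))%E).
    by apply: (@patch_surface rho) => // x [_]; exact: Ar.
  apply: lee_wpmul2l; first by rewrite lee_fin.
  apply: le_measure; rewrite ?inE; [| |by move=> y []].
    by rewrite -[X in measurable X]setTI; exact: graph_measurable.
  by rewrite -[X in measurable X]setTI; exact: graph_measurable.
apply: (@le_trans _ _ (\int[m2]_(x in A) f x)%E).
  apply: (@le_trans _ _ (\int[m1]_(x in A) f x)%E).
    rewrite le_eqVlt; apply/orP; left; apply/eqP; apply: eq_measure_integral => S mS SA.
    exact: (esym (congr1 sigma (setIidl SA))).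
  exact: ge0_le_measure_integral.
rewrite /m2 ge0_integral_mscale //; last exact: measurable_funTS.
apply: lee_wpmul2l; first by rewrite lee_fin.
rewrite ge0_integral_pushforward //; [|exact: graph_measurable|exact: measurable_funTS].
apply: ge0_subset_integral.
- by rewrite -[X in measurable X]setTI; exact: graph_measurable.
- exact: measurable_square.
- by apply: measurable_funTS; exact: (measurableT_comp mf graph_measurable).
- by move=> y _; exact: f0.
- by move=> y Ay; apply: hs; exact: Ar.
Qed.

(** [patch_le] carried over to space by the isometry [frame]. The functions psi are multiples of the
    indicators of the transported boxes, which lie in Omega; eps is divided by 1 + 2 M in advance to
    absorb the area factor. *)
Lemma patch_trace : exists2 rho, 0 < rho & forall eps, 0 < eps ->
  exists n (psi : 'I_n * 'I_n -> mpt R -> R), (forall i, rL2 (leb3 R) D (psi i)) /\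
  forall (w : P -> R) (A : set (mpt R)), rsmooth w -> measurable A -> A `<=` eball x0 rho ->
  (\int[sigma]_(x in A) ((w x) ^+ 2)%:E <=
    (\sum_i (rdot (leb3 R) D w (psi i)) ^+ 2)%:E + eps%:E * \int[leb3 R]_(x in D) sqgrad w x)%E.
Proof.
have [rho [h [M [[rho0 rr h0 M0] gL strip hs hJ]]]] := patch_data.
exists rho => // eps e0.
have K0 : 0 < 1 + 2 * M by rewrite ltr_pwDl // mulr_ge0.
have eK : 0 < eps / (1 + 2 * M) by rewrite divr_gt0.
have [n [b [B [b0 hB hW]]]] := patch_le mg rho0 h0 M0 eK gL.
have mO : measurable D := mOmega oO.
pose C i : set (mpt R) := frame_inv x0 e @^-1` (B i).
have mC i : measurable (C i).
  rewrite -[X in measurable X]setTI; apply: (@frame_inv_measurable R x0 e) => //.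
  by have [] := hB i.
have CO i : C i `<=` Omega.
  by move=> x Cx; rewrite -(frame_invK x0 he x); apply: strip; have [_] := hB i; exact.
(* Chosen so that the square of the product of w with t times the indicator is (1 + 2 M) b times the
   squared integral over the box. *)
pose t := Num.sqrt ((1 + 2 * M) * b).
have t2 : t ^+ 2 = (1 + 2 * M) * b by rewrite sqr_sqrtr // mulr_ge0 // ltW.
exists n, (fun i x => t * \1_(C i) x); split.
  move=> i; split.
    by apply: measurable_funM => //; apply: measurable_indic.
  apply: (@le_lt_trans _ _ (\int[leb3 R]_(x in D) (cst (t ^+ 2)%:E x))%E).
    apply: ge0_le_integral => //.
    - by move=> x _; rewrite lee_fin sqr_ge0.
    - by apply/measurable_EFinP; apply: measurable_funX; apply: measurable_funM => //; exact: measurable_indic.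
    - move=> x _; rewrite lee_fin exprMn indicE; case: (x \in C i); rewrite ?expr1n ?mulr1 //.
      by rewrite expr0n mulr0 sqr_ge0.
  rewrite integral_cst // lte_mul_pinfty ?lee_fin ?sqr_ge0 //; exact: Omega_fin.
move=> w A sw mA Ar.
have mw : measurable_fun setT (w : mpt R -> R) := continuous_measurable3 (rsmooth_continuous sw).
have mw2 : measurable_fun setT (fun x : mpt R => ((w x) ^+ 2)%:E) by apply/measurable_EFinP; exact: measurable_funX.
apply: le_trans (patch_integral rr M0 mA Ar hs hJ rho0 mw2 (fun x => _)) _.
  by move=> x; rewrite lee_fin sqr_ge0.
apply: le_trans (lee_wpmul2l _ (hW _ (rsmooth_frame x0 e sw))) _; first by rewrite lee_fin ltW.
have I0 (F : P -> R) S : (0 <= \int[leb3 R]_(z in S) sqgrad F z)%E.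
  by apply: integral_ge0 => z _; exact: sqgrad_ge0.
have s0 : 0 <= \sum_i b * (\int[leb3 R]_(z in B i) (w \o frame x0 e) z) ^+ 2.
  by apply: sumr_ge0 => i _; rewrite mulr_ge0 // sqr_ge0.
rewrite ge0_muleDr; [|by rewrite lee_fin|by apply: mule_ge0; [rewrite lee_fin; exact: ltW|exact: I0]].
apply: leeD.
  rewrite -EFinM lee_fin mulr_sumr; apply: ler_sum => i _; rewrite mulrA -t2 -exprMn.
  rewrite le_eqVlt; apply/orP; left; apply/eqP; congr (_ ^+ 2).
  have [mB BS] := hB i.
  have rw : rL2 (leb3 R) D w.
    apply: continuous_rL2 => //; [exact: Omega_fin|exact: rsmooth_continuous].
  rewrite /rdot.
  have -> : \int[leb3 R]_(z in B i) (w \o frame x0 e) z = \int[leb3 R]_(x in D) (w x * \1_(C i) x).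
    rewrite /Rintegral; congr fine; rewrite integral_mkcond [RHS]integral_mkcond.
    have mwC : measurable_fun setT (fun x : mpt R => w x * \1_(C i) x).
      by apply: measurable_funM => //; exact: measurable_indic.
    have h2 := integral_frame_sgn x0 he mwC.
    apply: etrans (etrans _ h2) _.
      apply: eq_integral => z _; rewrite patchE indicE.
      have -> : (frame x0 e z \in C i) = (z \in B i).
        by apply/idP/idP; rewrite !inE /C /preimage /= frameK.
      by case: (z \in B i); rewrite ?mulr1 ?mulr0.
    apply: eq_integral => x _; rewrite patchE indicE.
    case: (boolP (x \in D)) => // xD; case: (boolP (x \in C i)) => xC; last by rewrite mulr0.
    by move: xD; rewrite (mem_set (CO i x (set_mem xC))).
  under [RHS]eq_Rintegral do rewrite mulrCA.
  rewrite RintegralZl //.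
  have h1 : rL2 (leb3 R) D (\1_(C i)).
    split; first exact: measurable_indic.
    apply: (@le_lt_trans _ _ (\int[leb3 R]_(x in D) (cst 1%:E x))%E).
      apply: ge0_le_integral => //.
      - by apply/measurable_EFinP; apply: measurable_funX; exact: measurable_indic.
      - by move=> x _; rewrite lee_fin indicE; case: (x \in C i); rewrite ?expr1n ?expr0n.
    by rewrite integral_cst // mul1e; exact: Omega_fin.
  exact: (rL2_integrable mO rw h1).
have KE (x : \bar R) : ((1 + 2 * M)%:E * ((eps / (1 + 2 * M))%:E * x) <= eps%:E * x)%E.
  by rewrite muleA -EFinM mulrC divfK ?gt_eqF.
apply: le_trans (KE _) _.
apply: lee_wpmul2l; first by rewrite lee_fin ltW.
rewrite [leRHS]integral_mkcond.
have mF : measurable_fun setT ((sqgrad w) \_ D).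
  by apply/(measurable_restrictT _ mO); apply: measurable_funTS; exact: measurable_sqgrad.
have F0 x : (0 <= ((sqgrad w) \_ D) x)%E by rewrite patchE; case: ifP => // _; exact: sqgrad_ge0.
have mS : measurable (((square (- rho) (- rho) (2 * rho) : set (mR * mR)) `*` (setT : set mR)) `&`
    under_strip g h : set (mpt R)).
  apply: measurableI; last exact: measurable_under_strip.
  by apply: measurableX => //; exact: measurable_square.
rewrite -(integral_frame x0 he mF F0) integral_mkcond.
apply: ge0_le_integral => //.
- by move=> z _; rewrite patchE; case: ifP => // _; exact: sqgrad_ge0.
- apply/(measurable_restrictT _ mS).
  by apply: measurable_funTS; apply: measurable_sqgrad; exact: rsmooth_frame.
- exact: (measurableT_comp mF (@frame_measurable R x0 e)).
- move=> z _; rewrite patchE; case: ifP => [/set_mem zS|_]; last exact: F0.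
  by rewrite sqgrad_frame // patchE ifT //; exact/mem_set/(strip z zS).
Qed.

End Patch.

End SurfaceTrace.

(** * Patching over a finite cover *)

Section TraceInequality.
Variables (R : realType) (Omega : set (pt R)) (sigma : {measure set (mpt R) -> \bar R}).
Local Notation P := (pt R).
Local Notation mu := (leb3 R).
Local Notation D := (Omega : set (mpt R)).
Local Notation G := (boundary Omega : set (mpt R)).
Hypothesis oO : open Omega.
Hypothesis bO : bounded_set Omega.
Hypothesis Oc : C11_boundary Omega.
Hypothesis ss : is_surface_measure Omega sigma.

Let mO : measurable D := mOmega oO.

Let mG : measurable G := boundary_measurable Omega.

Definition trace_bound (A : set (mpt R)) := forall eps : R, 0 < eps ->
  exists (I : finType) (psi : I -> mpt R -> R), (forall i, rL2 mu D (psi i)) /\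
  forall w : P -> R, rsmooth w ->
  (\int[sigma]_(x in A) ((w x) ^+ 2)%:E <=
    (\sum_i (rdot mu D w (psi i)) ^+ 2)%:E + eps%:E * \int[mu]_(x in D) sqgrad w x)%E.

(** The functions psi are put together along a disjoint sum of index types, each set using eps / 2.
    As eps is arbitrary, the property survives all finite unions. *)
Lemma trace_boundU A B : measurable A -> measurable B -> trace_bound A -> trace_bound B ->
  trace_bound (A `|` B).
Proof.
move=> mA mB hA hB eps e0; have e2 : 0 < eps / 2 by rewrite divr_gt0.
have [I [psi [psi2 hpsi]]] := hA _ e2; have [J [chi [chi2 hchi]]] := hB _ e2.
exists (I + J)%type, (fun i => match i with inl i => psi i | inr j => chi j end); split.
  by case.
move=> w sw; rewrite big_sumType /=.
have mw2 : measurable_fun setT (fun x : mpt R => ((w x) ^+ 2)%:E).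
  apply/measurable_EFinP; apply: measurable_funX.
  exact: (continuous_measurable3 (rsmooth_continuous sw)).
have w0 x : (0 <= ((w x) ^+ 2)%:E)%E by rewrite lee_fin sqr_ge0.
have h1 : (\int[sigma]_(x in A `|` B) ((w x) ^+ 2)%:E <=
  \int[sigma]_(x in A) ((w x) ^+ 2)%:E + \int[sigma]_(x in B) ((w x) ^+ 2)%:E)%E.
  have -> : A `|` B = A `|` (B `\` A).
    by rewrite setDE setUIr setUCr setIT.
  rewrite ge0_integral_setU //; [|exact: measurableD|exact: measurable_funTS|].
    by apply: leeD => //; apply: ge0_subset_integral => //; [exact: measurableD|exact: measurable_funTS].
  by apply/disj_setPS => x [? []].
apply: le_trans h1 _; apply: le_trans (leeD (hpsi w sw) (hchi w sw)) _.
set S1 := \sum_i _; set S2 := \sum_i _; set W := (\int[mu]_(x in D) _)%E.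
have W0 : (0 <= W)%E by apply: integral_ge0 => x _; exact: sqgrad_ge0.
have E (x : \bar R) : (0 <= x)%E ->
  (S1%:E + (eps / 2)%:E * x + (S2%:E + (eps / 2)%:E * x) <= (S1 + S2)%:E + eps%:E * x)%E.
  case: x => [x| |] //= _; first by rewrite -!EFinM -!EFinD lee_fin; lra.
  by rewrite !gt0_muley ?lte_fin // !addey // leey.
exact: E.
Qed.

Lemma trace_bound_boundary : trace_bound G.
Proof.
have : forall x0, exists rho, boundary Omega x0 ->
    0 < rho /\ trace_bound (G `&` eball x0 rho).
  move=> x0; have [bx|nb] := pselect (boundary Omega x0); last by exists 0.
  have [e [g [r ch]]] := Oc bx.
  have [rho rho0 h] := patch_trace oO bO ss bx ch; exists rho => _; split=> // eps e0.
  have [n [psi [p2 hp]]] := h eps e0; exists ('I_n * 'I_n)%type, psi; split=> // w sw.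
  apply: hp => //; apply: measurableI; first exact: mG.
  by apply: open_measurable3; exact: eball_open.
move=> /choice[rho hrho].
have [s sB cov] := boundary_cover bO (fun x bx => (hrho x bx).1).
have -> : G = [set x | boundary Omega x /\ exists2 y, y \in s & eball y (rho y) x].
  by apply/seteqP; split=> x => [bx|[]] //; split=> //; exact: cov.
suff : trace_bound [set x | boundary Omega x /\ exists2 y, y \in s & eball y (rho y) x] /\
  measurable [set x : mpt R | boundary Omega x /\ exists2 y, y \in s & eball y (rho y) x].
  by case.
elim: s sB {cov} => [|y s IH] sB.
  have -> : [set x : mpt R | boundary Omega x /\ exists2 y, y \in [::] & eball y (rho y) x] = set0.
    by apply/seteqP; split=> x // [_ []].
  split=> // eps e0; exists 'I_0, (fun=> 0); split=> [[]//|w sw].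
  rewrite integral_set0 big_ord0 add0e; apply: mule_ge0; first by rewrite lee_fin ltW.
  by apply: integral_ge0 => x _; exact: sqgrad_ge0.
have [|h1 m1] := IH; first by move=> x xs; apply: sB; rewrite inE xs orbT.
have [r0 h2] := hrho y (sB y (mem_head _ _)).
have m2 : measurable (G `&` eball y (rho y) : set (mpt R)).
  by apply: measurableI; [exact: mG|apply: open_measurable3; exact: eball_open].
have -> : [set x : mpt R | boundary Omega x /\ exists2 z, z \in y :: s & eball z (rho z) x] =
  (G `&` eball y (rho y)) `|` [set x : mpt R | boundary Omega x /\ exists2 z, z \in s & eball z (rho z) x].
  apply/seteqP; split=> x.
    move=> [bx [z]]; rewrite inE => /orP[/eqP ->|zs] hz; first by left.
    by right; split=> //; exists z.
  move=> [[bx hx]|[bx [z zs hz]]]; split=> //; first by exists y => //; exact: mem_head.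
  by exists z => //; rewrite inE zs orbT.
by split; [exact: trace_boundU|exact: measurableU].
Qed.

(** The right-hand side is finite, so the same inequality also shows that w is square integrable for
    [sigma]. *)
Lemma smooth_trace_le eps : 0 < eps ->
  exists (I : finType) (psi : I -> mpt R -> R), (forall i, rL2 mu D (psi i)) /\
  forall w : P -> R, rsmooth w -> rL2 sigma G w /\
    rdot sigma G w w <= \sum_i (rdot mu D w (psi i)) ^+ 2
      + eps * \sum_j rdot mu D (rpart j w) (rpart j w).
Proof.
move=> e0; have [I [psi [p2 hp]]] := trace_bound_boundary e0.
exists I, psi; split=> // w sw.
have mw : measurable_fun G (w : mpt R -> R).
  by apply: measurable_funTS; exact: (continuous_measurable3 (rsmooth_continuous sw)).
have rw j : rL2 mu D (rpart j w).
  apply: continuous_rL2 => //; first exact: Omega_fin.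
  by apply: rsmooth_continuous; exact: rsmooth_rpart.
refine (rdot_lt_rL2 mw _).
apply: le_trans (hp w sw) _; rewrite EFinD EFinM; apply: leeD => //.
apply: lee_wpmul2l; first by rewrite lee_fin ltW.
rewrite /sqgrad -sumEFin.
under eq_integral do rewrite -sumEFin.
rewrite ge0_integral_sum //; last first.
- by move=> j x _; rewrite lee_fin sqr_ge0.
- by move=> j; apply/measurable_EFinP; apply: measurable_funX; have [] := rw j.
by apply: lee_sum => j _; rewrite (rdotE (rw j)).
Qed.

End TraceInequality.

(** * Traces *)

Lemma ph_null_sq (R : realType) (V : zmodType) (sc : R -> V -> V) S (B : V -> V -> R) w z :
  prehilbert sc S B -> S w -> S z -> B (w - z) (w - z) = 0 -> B w w = B z z.
Proof.
move=> H Sw Sz e; rewrite (ph_null_eq H Sw Sz Sw e) (ph_C H) //.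
exact: (ph_null_eq H Sw Sz Sz e).
Qed.

Section Traces.
Variables (R : realType) (Omega : set (pt R)) (sigma : {measure set (mpt R) -> \bar R}).
Local Notation P := (pt R).
Local Notation C := R[i].
Local Notation mu := (leb3 R).
Local Notation D := (Omega : set (mpt R)).
Local Notation G := (boundary Omega : set (mpt R)).
Hypothesis oO : open Omega.
Hypothesis bO : bounded_set Omega.
Hypothesis Oc : C11_boundary Omega.
Hypothesis ss : is_surface_measure Omega sigma.

Let mO : measurable D := mOmega oO.
Let mG : measurable G := boundary_measurable Omega.
Local Notation Hv := (vdot_prehilbert mu mO).
Local Notation Hs := (cdot_prehilbert mu mO).
Local Notation HG := (cdot_prehilbert sigma mG).
Local Notation HvG := (vdot_prehilbert sigma mG).

Lemma smooth_L2_boundary (f : P -> C) : smooth f -> L2 sigma G f.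
Proof.
move=> sf; apply: (proj2 (L2P sigma mG f)) => b.
have [I [psi [_ h]]] := smooth_trace_le oO bO Oc ss (@ltr01 R).
exact: (h _ (smooth_part b sf)).1.
Qed.

(** The part of the trace bound without derivatives: finitely many L^2 coordinates. It gives the
    compactness, as bounded sequences of such coordinates can be made to converge. *)
Definition lowq (I : finType) (psi : I -> mpt R -> R) (f : P -> C) : R :=
  \sum_i \sum_b (rdot mu D (part b f) (psi i)) ^+ 2.

Section Lowq.
Variables (I : finType) (psi : I -> mpt R -> R).
Hypothesis psi2 : forall i, rL2 mu D (psi i).

Lemma lowq_le (f : P -> C) : L2 mu D f ->
  lowq psi f <= (\sum_i rdot mu D (psi i) (psi i)) * cdot mu D f f.
Proof.
move=> /L2P f2; rewrite /lowq mulr_suml; apply: ler_sum => i _.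
rewrite mulr_sumr; apply: ler_sum => b _; rewrite mulrC.
  by apply: (ph_CS (rL2_prehilbert mu mO)); [exact: f2|exact: psi2].
Qed.

Lemma lowqD (f g : P -> C) : L2 mu D f -> L2 mu D g ->
  lowq psi (f + g) <= 2 * lowq psi f + 2 * lowq psi g.
Proof.
move=> /L2P f2 /L2P g2; rewrite /lowq !mulr_sumr -big_split /=; apply: ler_sum => i _.
rewrite !mulr_sumr -big_split /=; apply: ler_sum => b _.
rewrite partD (ph_BD (rL2_prehilbert mu mO) (f2 mO b) (g2 mO b) (psi2 i)).
set x := rdot _ _ _ _; set y := rdot _ _ _ _.
by have := sqr_ge0 (x - y); nra.
Qed.

End Lowq.

Lemma smooth_trace_complex eps : 0 < eps ->
  exists (I : finType) (psi : I -> mpt R -> R), (forall i, rL2 mu D (psi i)) /\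
  forall w : P -> C, smooth w ->
    cdot sigma G w w <= lowq psi w + eps * vdot mu D (grad w) (grad w).
Proof.
move=> e0; have [I [psi [p2 h]]] := smooth_trace_le oO bO Oc ss e0.
exists I, psi; split=> // w sw; rewrite /cdot.
apply: le_trans (ler_sum _ (fun b _ => (h _ (smooth_part b sw)).2)) _.
rewrite big_split /= -mulr_sumr exchange_big /=; apply: lerD => //.
rewrite ler_pM2l // exchange_big /= /vdot; apply: ler_sum => j _; rewrite /cdot.
have -> : vcomp j (grad w) = dpartial j w by apply/funext => x; rewrite /vcomp mxE.
by apply: ler_sum => b _; rewrite part_dpartial.
Qed.

Lemma wgrad_D f g F K : L2 mu D f -> L2 mu D g -> is_wgrad Omega f F -> is_wgrad Omega g K ->
  is_wgrad Omega (f + g) (F + K).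
Proof. by move=> f2 g2 hF hK; have := wgrad_lin oO bO 1 f2 g2 hF hK; rewrite vlinD slinD. Qed.

Lemma wgrad_B f g F K : L2 mu D f -> L2 mu D g -> is_wgrad Omega f F -> is_wgrad Omega g K ->
  is_wgrad Omega (f - g) (F - K).
Proof.
move=> f2 g2 hF hK; have := wgrad_lin oO bO (-1) g2 f2 hK hF.
have -> : (fun x => -1 * g x + f x) = f - g by apply/funext => x; rewrite mulN1r addrC.
by have -> : (fun x => -1 *: K x + F x) = F - K by apply/funext => x; rewrite scaleN1r addrC.
Qed.

Lemma sqH1E f F : L2 mu D f -> is_wgrad Omega f F ->
  sqH1 Omega f = cdot mu D f f + vdot mu D F F.
Proof.
move=> f2 hF; have hW := wgradP hF.
rewrite /sqH1 sqL2E // sqL2vE //; last by case: hW.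
congr (_ + _); apply: (ph_null_sq Hv); [by case: hW|by case: hF|].
exact: (wgrad_unique oO bO hW hF).
Qed.

(** The sequence of [is_trace] with [K n] any weak gradient of w n - f instead of the chosen
    [wgrad]; this form is stable under linear combinations and conjugation. *)
Definition approximates (f g : P -> C) (w : nat -> P -> C) (K : nat -> vfield R) :=
  [/\ forall n, smooth (w n), forall n, is_wgrad Omega (w n - f) (K n),
    tends0 (fun n => cdot mu D (w n - f) (w n - f)),
    tends0 (fun n => vdot mu D (K n) (K n)) &
    tends0 (fun n => cdot sigma G (w n - g) (w n - g))].

Lemma is_traceP f g : is_trace Omega sigma f g <->
  [/\ H1 Omega f, L2 sigma G g & exists w K, approximates f g w K].
Proof.
have B0 (u : P -> C) : L2 mu D u -> 0 <= cdot mu D u u by move=> h; exact: (ph_ge0 Hs).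
have V0 (u : vfield R) : L2v mu D u -> 0 <= vdot mu D u u by move=> h; exact: (ph_ge0 Hv).
have G0 (u : P -> C) : L2 sigma G u -> 0 <= cdot sigma G u u by move=> h; exact: (ph_ge0 HG).
split=> -[[f2 [F hF]] g2].
  move=> [w [sw w1 w2]]; split=> //; first by split=> //; exists F.
  have ww n := smooth_L2_Omega oO bO (sw n).
  have h n : is_wgrad Omega (w n - f) (grad (w n) - F).
    by apply: wgrad_B => //; exact: wgrad_smooth.
  have L n : L2 mu D (w n - f) by apply: (ph_B Hs).
  have LG n : L2 sigma G (w n - g) by apply: (ph_B HG) => //; exact: smooth_L2_boundary.
  have LV n : L2v mu D (grad (w n) - F) by case: (h n).
  have E n := sqH1E (L n) (h n).
  have t1 : tends0 (fun n => sqH1 Omega (w n - f)).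
    by apply/tends0P => // n; rewrite E addr_ge0 // ?B0 // V0.
  exists w, (fun n => grad (w n) - F); split=> //.
  - apply: (@tends0_le _ _ _ 1 _ _ t1) => // n; rewrite mul1r E lerDl; exact: V0.
  - apply: (@tends0_le _ _ _ 1 _ _ t1) => // n; rewrite mul1r E lerDr; exact: B0.
  - have E2 n : sqL2 sigma G (w n - g) = cdot sigma G (w n - g) (w n - g) by rewrite sqL2E.
    have t2 : tends0 (fun n => sqL2 sigma G (w n - g)).
      by apply/tends0P => // n; rewrite E2; exact: G0.
    by apply: (@tends0_le _ _ _ 1 _ _ t2) => // n; rewrite mul1r E2.
move=> [w [K [sw h t1 t2 t3]]]; split=> //; first by split=> //; exists F.
have ww n := smooth_L2_Omega oO bO (sw n).
have L n : L2 mu D (w n - f) by apply: (ph_B Hs).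
have LG n : L2 sigma G (w n - g) by apply: (ph_B HG) => //; exact: smooth_L2_boundary.
have LV n : L2v mu D (K n) by case: (h n).
have E n := sqH1E (L n) (h n).
have E2 n : sqL2 sigma G (w n - g) = cdot sigma G (w n - g) (w n - g) by rewrite sqL2E.
exists w; split=> //.
  apply/tends0P; first by move=> n; rewrite E addr_ge0 // ?B0 // V0.
  apply: (@tends0_le _ _ _ 1 _ _ (tends0D t1 t2)) => // n; by rewrite mul1r E.
apply/tends0P; first by move=> n; rewrite E2; exact: G0.
by apply: (@tends0_le _ _ _ 1 _ _ t3) => // n; rewrite mul1r E2.
Qed.

(** The smooth inequality at the limit of an approximating sequence. Two squared triangle
    inequalities, from g to w n and from w n back to f, cost a factor 4: hence eps / 4 and the
    doubled psi. *)
Lemma trace_le eps : 0 < eps ->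
  exists (I : finType) (psi : I -> mpt R -> R), (forall i, rL2 mu D (psi i)) /\
  forall f g F, is_trace Omega sigma f g -> is_wgrad Omega f F ->
    cdot sigma G g g <= lowq psi f + eps * vdot mu D F F.
Proof.
move=> e0; have e4 : 0 < eps / 4 by rewrite divr_gt0.
have [I [psi [p2 h]]] := smooth_trace_complex e4.
exists I, (fun i x => 2 * psi i x); split; first by move=> i; exact: rL2Z.
move=> f g F /is_traceP[[f2 _] g2 [w [K [sw hK t1 t2 t3]]]] hF.
have -> : lowq (fun i x => 2 * psi i x) f = 4 * lowq psi f.
  rewrite /lowq mulr_sumr; apply: eq_bigr => i _; rewrite mulr_sumr; apply: eq_bigr => b _.
  have fb : rL2 mu D (part b f) by have /L2P := f2; exact.
  by rewrite (ph_ZB (rL2_prehilbert mu mO)) // exprMn; congr (_ * _); ring.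
set Q := \sum_i rdot mu D (psi i) (psi i).
have Q0 : 0 <= Q by apply: sumr_ge0 => i _; exact: (ph_ge0 (rL2_prehilbert mu mO)).
(* The factors of the three errors: 4 Q in L^2 through [lowq_le], eps for the gradient and 2 on the
   boundary. *)
pose C1 := 4 * Q + eps + 2.
have C0 : 0 <= C1 by rewrite /C1 !addr_ge0 // ?mulr_ge0 // ltW.
suff H n : cdot sigma G g g - (4 * lowq psi f + eps * vdot mu D F F) <=
    C1 * (cdot mu D (w n - f) (w n - f) + vdot mu D (K n) (K n) + cdot sigma G (w n - g) (w n - g)).
  rewrite -subr_le0; apply: (@tends0_le0 _ _ (fun n => C1 * (cdot mu D (w n - f) (w n - f)
    + vdot mu D (K n) (K n) + cdot sigma G (w n - g) (w n - g)))) => //.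
  exact: (tends0_le C0 (fun n => lexx _) (tends0D (tends0D t1 t2) t3)).
have w2 := smooth_L2_Omega oO bO (sw n).
have wG := smooth_L2_boundary (sw n).
have L : L2 mu D (w n - f) by apply: (ph_B Hs).
have LG : L2 sigma G (w n - g) by apply: (ph_B HG).
have LK : L2v mu D (K n) by case: (hK n).
have LF : L2v mu D F by case: hF.
have h1 : cdot sigma G g g <= 2 * cdot sigma G (w n) (w n) + 2 * cdot sigma G (w n - g) (w n - g).
  by have := ph_sqB_le HG wG LG; rewrite opprB addrC subrK.
have h2 := h _ (sw n).
have h3 : lowq psi (w n) <= 2 * lowq psi (w n - f) + 2 * lowq psi f.
  by have := lowqD p2 L f2; rewrite subrK.
have h4 := lowq_le p2 L.
have h5 : vdot mu D (grad (w n)) (grad (w n)) <= 2 * vdot mu D (K n) (K n) + 2 * vdot mu D F F.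
  have hg : is_wgrad Omega (w n) (K n + F) by rewrite -[w n](subrK f); exact: wgrad_D.
  have hw := wgrad_smooth oO bO (sw n).
  rewrite (ph_null_sq Hv _ _ (wgrad_unique oO bO hw hg)); last 2 first.
  - by case: hw.
  - by case: hg.
  exact: (ph_sqD_le Hv).
have a1 : 0 <= cdot mu D (w n - f) (w n - f) by exact: (ph_ge0 Hs).
have a2 : 0 <= vdot mu D (K n) (K n) by exact: (ph_ge0 Hv).
have a3 : 0 <= cdot sigma G (w n - g) (w n - g) by exact: (ph_ge0 HG).
move: h1 h2 h3 h4 h5 a1 a2 a3; rewrite -/Q /C1.
move: (cdot sigma G g g) (cdot sigma G (w n) (w n)) (cdot sigma G (w n - g) (w n - g))
  (lowq psi (w n)) (lowq psi (w n - f)) (lowq psi f) (cdot mu D (w n - f) (w n - f))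
  (vdot mu D (K n) (K n)) (vdot mu D F F) (vdot mu D (grad (w n)) (grad (w n))).
clear C1 C0; move: Q Q0 => q q0; clear -e0 q0.
move=> a b c d1 d2 d3 x y z t h1 h2 h3 h4 h5 x0 y0 c0.
have h6 : eps / 4 * t <= eps / 4 * (2 * y + 2 * z) by apply: ler_wpM2l => //; lra.
have h7 : 0 <= q * y by exact: mulr_ge0.
have h8 : 0 <= q * c by exact: mulr_ge0.
have h9 : 0 <= eps * x by apply: mulr_ge0 => //; exact: ltW.
have h10 : 0 <= eps * y by apply: mulr_ge0 => //; exact: ltW.
have h11 : 0 <= eps * c by apply: mulr_ge0 => //; exact: ltW.
by lra.
Qed.

End Traces.

(** * Complex scalars in the real products *)

Section ComplexScaling.
Context d (T : measurableType d) (R : realType).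
Variables (mu : {measure set T -> \bar R}) (D : set T).
Hypothesis mD : measurable D.
Local Notation C := R[i].
Local Notation vf := (T -> 'rV[C]_3).

Lemma cdot_Cint (f g : T -> C) : L2 mu D f -> L2 mu D g ->
  cdot mu D f g = complex.Re (Cint mu D (fun x => f x * conjf g x)).
Proof. by move=> f2 g2; rewrite Cint_mulE //; [rewrite /= conjfK|exact: L2_conj]. Qed.

(** Multiplication by c has the adjoint multiplication by conj c also for the real product; complex
    linearity of the solution map rests on this. *)
Lemma cdot_mulc c (f g : T -> C) : L2 mu D f -> L2 mu D g ->
  cdot mu D (fun x => c * f x) g = cdot mu D f (fun x => conjc c * g x).
Proof.
move=> f2 g2; rewrite !cdot_Cint //; try exact: L2Zc.
congr complex.Re; congr Cint; apply/funext => x.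
by rewrite /conjf rmorphM /= conjcK mulrCA mulrA.
Qed.

Lemma mul_conj_sqmod (c : C) : conjc c * c = (sqmod c)%:C%C.
Proof. by case: c => a b; apply/eqP; rewrite eq_complex /=; apply/andP; split; apply/eqP; rewrite /sqmod /=; ring. Qed.

Lemma cdot_sqZ c (f : T -> C) : L2 mu D f ->
  cdot mu D (fun x => c * f x) (fun x => c * f x) = sqmod c * cdot mu D f f.
Proof.
move=> f2; rewrite cdot_mulc //; last exact: L2Zc.
have -> : (fun x => conjc c * (c * f x)) = cscale (sqmod c) f.
  by apply/funext => x; rewrite mulrA mul_conj_sqmod.
exact: (ph_ZB (cdot_prehilbert mu mD)).
Qed.

Lemma vcomp_mulc i c (u : vf) : vcomp i (fun x => c *: u x) = (fun x => c * vcomp i u x).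
Proof. by apply/funext => x; rewrite /vcomp mxE. Qed.

Lemma vdot_mulc c (u v : vf) : L2v mu D u -> L2v mu D v ->
  vdot mu D (fun x => c *: u x) v = vdot mu D u (fun x => conjc c *: v x).
Proof.
by move=> u2 v2; rewrite /vdot; apply: eq_bigr => i _; rewrite !vcomp_mulc (cdot_mulc c (u2 i) (v2 i)).
Qed.

Lemma vdot_sqZ c (u : vf) : L2v mu D u ->
  vdot mu D (fun x => c *: u x) (fun x => c *: u x) = sqmod c * vdot mu D u u.
Proof.
by move=> u2; rewrite /vdot mulr_sumr; apply: eq_bigr => i _; rewrite !vcomp_mulc (cdot_sqZ c (u2 i)).
Qed.

Lemma cdot_lin_le c (f g : T -> C) : L2 mu D f -> L2 mu D g ->
  cdot mu D (fun x => c * f x + g x) (fun x => c * f x + g x) <=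
    2 * sqmod c * cdot mu D f f + 2 * cdot mu D g g.
Proof.
move=> f2 g2; rewrite -mulrA -cdot_sqZ //.
by apply: (ph_sqD_le (cdot_prehilbert mu mD)) => //; exact: L2Zc.
Qed.

Lemma L2vZc c (u : vf) : L2v mu D u -> L2v mu D (fun x => c *: u x).
Proof.
move=> u2 i; have := L2Zc mD c (u2 i); congr (L2 _ _).
by apply/funext => x; rewrite mxE.
Qed.

Lemma vdot_lin_le c (u v : vf) : L2v mu D u -> L2v mu D v ->
  vdot mu D (fun x => c *: u x + v x) (fun x => c *: u x + v x) <=
    2 * sqmod c * vdot mu D u u + 2 * vdot mu D v v.
Proof.
move=> u2 v2; rewrite -mulrA -vdot_sqZ //.
by apply: (ph_sqD_le (vdot_prehilbert mu mD)) => //; exact: L2vZc.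
Qed.

Lemma cdot_conj (f g : T -> C) : cdot mu D (conjf f) (conjf g) = cdot mu D f g.
Proof.
rewrite !cdotE; congr (_ + _); rewrite /rdot; apply: eq_Rintegral => x _.
  by rewrite /part /conjf; case: (f x) => a b; case: (g x) => a' b' /=; rewrite mulrNN.
by rewrite /part /conjf; case: (f x) => a b; case: (g x) => a' b' /=.
Qed.

Lemma vdot_conj (u v : vf) : vdot mu D (vconj u) (vconj v) = vdot mu D u v.
Proof. by apply: eq_bigr => i _; rewrite !vcomp_conj cdot_conj. Qed.

End ComplexScaling.

(** * Linearity, conjugation and uniqueness of traces *)

Section TraceAlgebra.
Variables (R : realType) (Omega : set (pt R)) (sigma : {measure set (mpt R) -> \bar R}).
Local Notation P := (pt R).
Local Notation C := R[i].
Local Notation mu := (leb3 R).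
Local Notation D := (Omega : set (mpt R)).
Local Notation G := (boundary Omega : set (mpt R)).
Hypothesis oO : open Omega.
Hypothesis bO : bounded_set Omega.
Hypothesis Oc : C11_boundary Omega.
Hypothesis ss : is_surface_measure Omega sigma.

Let mO : measurable D := mOmega oO.
Let mG : measurable G := boundary_measurable Omega.
Local Notation Hv := (vdot_prehilbert mu mO).
Local Notation Hs := (cdot_prehilbert mu mO).
Local Notation HG := (cdot_prehilbert sigma mG).
Local Notation HvG := (vdot_prehilbert sigma mG).
Local Notation tP := (is_traceP oO bO Oc ss).

Lemma sqmod2_ge0 (c : C) : 0 <= 2 * sqmod c.
Proof. by rewrite mulr_ge0 // sqmod_ge0. Qed.

Lemma tends0_lin (p q r : nat -> R) a : 0 <= a -> (forall n, r n <= a * p n + 2 * q n) ->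
  tends0 p -> tends0 q -> tends0 r.
Proof.
move=> a0 h hp hq; apply: (@tends0_le _ _ (fun n => a * p n + 2 * q n) 1) => //.
  by move=> n; rewrite mul1r.
by apply: tends0D; [apply: (tends0_le a0 (fun n => lexx _) hp)|apply: (@tends0_le _ _ _ 2 _ _ hq)].
Qed.

Lemma is_trace_lin c f g f' g' : is_trace Omega sigma f g -> is_trace Omega sigma f' g' ->
  is_trace Omega sigma (fun x => c * f x + f' x) (fun x => c * g x + g' x).
Proof.
move=> /tP[[f2 [F hF]] g2 [w [K [sw hK t1 t2 t3]]]] /tP[[f2' [F' hF']] g2' [w' [K' [sw' hK' t1' t2' t3']]]].
apply/tP; split.
- by split; [exact: L2_lin|exists (fun x => c *: F x + F' x); exact: wgrad_lin].
- exact: L2_lin.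
have e (k k' : P -> C) (h h' : P -> C) : (fun x => c * k x + k' x) - (fun x => c * h x + h' x) =
    (fun x => c * (k - h) x + (k' - h') x).
  apply/funext => x; rewrite -[LHS]/(c * k x + k' x - (c * h x + h' x)).
  by rewrite -[RHS]/(c * (k x - h x) + (k' x - h' x)) mulrBr opprD addrACA.
have L n : L2 mu D (w n - f) by apply: (ph_B Hs) => //; exact: smooth_L2_Omega.
have L' n : L2 mu D (w' n - f') by apply: (ph_B Hs) => //; exact: smooth_L2_Omega.
have LG n : L2 sigma G (w n - g) by apply: (ph_B HG) => //; exact: smooth_L2_boundary.
have LG' n : L2 sigma G (w' n - g') by apply: (ph_B HG) => //; exact: smooth_L2_boundary.
have LK n : L2v mu D (K n) by case: (hK n).
have LK' n : L2v mu D (K' n) by case: (hK' n).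
exists (fun n x => c * w n x + w' n x), (fun n x => c *: K n x + K' n x); split.
- by move=> n; apply: smoothD => //; exact: smoothZ.
- by move=> n; rewrite e; exact: wgrad_lin.
- by apply: (tends0_lin (sqmod2_ge0 c) _ t1 t1') => n; rewrite e; exact: cdot_lin_le.
- by apply: (tends0_lin (sqmod2_ge0 c) _ t2 t2') => n; exact: vdot_lin_le.
- by apply: (tends0_lin (sqmod2_ge0 c) _ t3 t3') => n; rewrite e; exact: cdot_lin_le.
Qed.

Lemma is_trace_conj f g : is_trace Omega sigma f g -> is_trace Omega sigma (conjf f) (conjf g).
Proof.
move=> /tP[[f2 [F hF]] g2 [w [K [sw hK t1 t2 t3]]]].
have e (k h : P -> C) : conjf k - conjf h = conjf (k - h).
  by apply/funext => x; rewrite -[LHS]/(conjc (k x) - conjc (h x)) -rmorphB.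
have L n : L2 mu D (w n - f) by apply: (ph_B Hs) => //; exact: smooth_L2_Omega.
apply/tP; split.
- by split; [exact: L2_conj|exists (vconj F); exact: wgrad_conj].
- exact: L2_conj.
exists (fun n => conjf (w n)), (fun n => vconj (K n)); split.
- by move=> n; exact: smooth_conjf.
- by move=> n; rewrite e; exact: wgrad_conj.
- by apply: (@tends0_le _ _ _ 1 _ _ t1) => // n; rewrite mul1r e cdot_conj.
- by apply: (@tends0_le _ _ _ 1 _ _ t2) => // n; rewrite mul1r vdot_conj.
- by apply: (@tends0_le _ _ _ 1 _ _ t3) => // n; rewrite mul1r e cdot_conj.
Qed.

Lemma is_wgrad_null f : L2 mu D f -> cdot mu D f f = 0 -> is_wgrad Omega f 0.
Proof.
move=> f2 f0; split; first exact: (ph_0 Hv).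
move=> phi tphi i; have h : L2 mu D (dpartial i phi) by apply: test_L2 => //; exact: test_dpartial.
have z2 : L2 mu D (0 : P -> C) by exact: (ph_0 Hs).
rewrite (Cint_mul_null mO f2 z2 h) ?subr0 //.
rewrite -[X in _ = - X]/(Cint mu D (fun x => (0 : 'rV[C]_3) 0 i * phi x)).
have e0 (a b : P -> C) : (forall x, a x = 0) -> (forall x, b x = 0) -> Cint mu D a = - Cint mu D b.
  move=> ha hb; have -> : a = (fun=> 0) by exact/funext.
  have -> : b = (fun=> 0) by exact/funext.
  by rewrite Cint0 oppr0.
by apply: e0 => x; rewrite ?mxE mul0r.
Qed.

(** A null f has the weak gradient 0, and its coordinates in [lowq] are 0, so [trace_le] leaves
    nothing. Uniqueness of traces follows by linearity. *)
Lemma is_trace_null f g : is_trace Omega sigma f g -> cdot mu D f f = 0 -> cdot sigma G g g = 0.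
Proof.
move=> h f0; have := h; move=> /tP[[f2 _] g2 _].
have [I [psi [p2 hp]]] := trace_le oO bO Oc ss (@ltr01 R).
have v0 : vdot mu D 0 0 = 0 := ph_B0 Hv (ph_0 Hv).
have := hp f g 0 h (is_wgrad_null f2 f0); rewrite v0 mulr0 addr0 => h1.
apply/eqP; rewrite eq_le (ph_ge0 HG) // andbT; apply: le_trans h1 _.
by have := lowq_le oO p2 f2; rewrite f0 mulr0.
Qed.

Definition rel_trace (u g : vfield R) := forall i, is_trace Omega sigma (vcomp i u) (vcomp i g).

Lemma rel_trace_L2v u g : rel_trace u g -> L2v sigma G g.
Proof. by move=> h i; case: (h i). Qed.

Lemma rel_trace_lin c u g v k : rel_trace u g -> rel_trace v k ->
  rel_trace (fun x => c *: u x + v x) (fun x => c *: g x + k x).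
Proof.
move=> h1 h2 i; have := is_trace_lin c (h1 i) (h2 i).
by congr is_trace; apply/funext => x; rewrite /vcomp !mxE.
Qed.

Lemma rel_trace_conj u g : rel_trace u g -> rel_trace (vconj u) (vconj g).
Proof. by move=> h i; rewrite !vcomp_conj; exact: is_trace_conj. Qed.

Lemma rel_trace_null u g : rel_trace u g -> vdot mu D u u = 0 -> vdot sigma G g g = 0.
Proof.
move=> h u0; have u2 i : L2 mu D (vcomp i u) by case: (h i) => -[].
rewrite /vdot big1 // => i _; apply: is_trace_null (h i) _.
apply/eqP; rewrite eq_le (ph_ge0 Hs) // andbT -u0 /vdot (bigD1 i) //= lerDl.
by apply: sumr_ge0 => j _; exact: (ph_ge0 Hs).
Qed.

Lemma rel_trace0 : rel_trace 0 0.
Proof.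
move=> i; apply/tP; have z2 : L2 mu D (0 : P -> C) by exact: (ph_0 Hs).
have w0 : is_wgrad Omega 0 0 by apply: is_wgrad_null => //; exact: (ph_B0 Hs).
have -> : vcomp i (0 : vfield R) = 0 by apply/funext => x; rewrite /vcomp mxE.
split; [by split=> //; exists 0|exact: (ph_0 HG)|].
have t0 (q : nat -> R) : (forall n, q n = 0) -> tends0 q by move=> h e e0; exists 0%N => n _; rewrite h.
exists (fun=> 0), (fun=> 0); split.
- by move=> n; exact: smooth_cst.
- by move=> n; rewrite subr0.
- by apply: t0 => n; rewrite subr0; exact: (ph_B0 Hs).
- by apply: t0 => n; exact: (ph_B0 Hv (ph_0 Hv)).
- by apply: t0 => n; rewrite subr0; exact: (ph_B0 HG (ph_0 HG)).
Qed.

Lemma rel_trace_unique u g g' : rel_trace u g -> rel_trace u g' ->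
  vdot sigma G (g - g') (g - g') = 0.
Proof.
move=> h h'; have := rel_trace_lin (-1) h' h.
have -> : (fun x => -1 *: g' x + g x) = g - g' by apply/funext => x; rewrite scaleN1r addrC.
have -> : (fun x => -1 *: u x + u x) = 0 by apply/funext => x; rewrite scaleN1r addNr.
by move=> /rel_trace_null; apply; exact: (ph_B0 Hv (ph_0 Hv)).
Qed.

Lemma traceP u : (exists g, rel_trace u g) -> rel_trace u (trace Omega sigma u).
Proof.
by move=> h; have : [set g : vfield R | forall i, is_trace Omega sigma (fun x => u x 0 i) (fun x => g x 0 i)]
  (trace Omega sigma u) by apply: xgetPex.
Qed.

Lemma traceN u : ~ (exists g, rel_trace u g) -> trace Omega sigma u = 0.
Proof. by move=> h; apply: xgetPN => g hg; apply: h; exists g. Qed.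

Lemma trace_eq u g a : rel_trace u g -> L2v sigma G a ->
  vdot sigma G (trace Omega sigma u) a = vdot sigma G g a.
Proof.
move=> h a2; have h' := traceP (ex_intro _ g h).
by apply: (ph_null_eq HvG) => //; [exact: rel_trace_L2v h'|exact: rel_trace_L2v h|exact: (rel_trace_unique h' h)].
Qed.

(** A field without trace gets the default value 0, which is in L^2 as well. *)
Lemma trace_L2v u : L2v sigma G (trace Omega sigma u).
Proof.
have [h|h] := pselect (exists g, rel_trace u g); first exact: rel_trace_L2v (traceP h).
by rewrite traceN //; exact: (ph_0 HvG).
Qed.

End TraceAlgebra.

(** * The energy form *)

(* Locked, as are [tr], [BL2] and [bdot] below: a failed conversion test between
   two values of these functions unfolds them down to the integrals. *)
HB.lock Definition volume_form (R : realType) (Omega : set (pt R)) (theta alpha : R)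
    (u v : vfield R) : R :=
  vdot (leb3 R) (Omega : set (mpt R)) (wcurl Omega u) (wcurl Omega v)
  - alpha * vdot (leb3 R) (Omega : set (mpt R)) u v
  + theta * cdot (leb3 R) (Omega : set (mpt R)) (wdiv Omega u) (wdiv Omega v).

Section Energy.
Variables (R : realType) (Omega : set (pt R)).
Variables (theta alpha : R).
Local Notation volume_form := (volume_form Omega theta alpha).
Local Notation P := (pt R).
Local Notation C := R[i].
Local Notation mu := (leb3 R).
Local Notation D := (Omega : set (mpt R)).
Hypothesis oO : open Omega.
Hypothesis bO : bounded_set Omega.

Let mO : measurable D := mOmega oO.
Local Notation Hv := (vdot_prehilbert mu mO).
Local Notation Hs := (cdot_prehilbert mu mO).
Local Notation HX := (XT_prehilbert oO bO).

Lemma form_congr (a b c a' b' c' : R) : a = a' -> b = b' -> c = c' ->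
  a - alpha * b + theta * c = a' - alpha * b' + theta * c'.
Proof. by move=> -> -> ->. Qed.

Lemma volume_formC u v : XT Omega u -> XT Omega v -> volume_form u v = volume_form v u.
Proof.
move=> hu hv; rewrite volume_form.unlock; exact: (form_congr (ph_C Hv (XT_wcurl_L2v hu) (XT_wcurl_L2v hv))
  (ph_C Hv (XT_L2v hu) (XT_L2v hv)) (ph_C Hs (XT_wdiv_L2 oO bO hu) (XT_wdiv_L2 oO bO hv))).
Qed.

(** The curl and divergence of u may be replaced by any other representatives, since these differ by
    null vectors. This is how the form is linear although the choices are not. *)
Lemma volume_form_rel u w h v : XT Omega u -> is_wcurl Omega u w -> rel_div Omega u h -> XT Omega v ->
  volume_form u v = vdot mu D w (wcurl Omega v) - alpha * vdot mu D u v
    + theta * cdot mu D h (wdiv Omega v).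
Proof.
move=> hu hw hh hv; rewrite volume_form.unlock; congr (_ - _ + theta * _).
  apply: (ph_null_eq Hv (XT_wcurl_L2v hu) _ (XT_wcurl_L2v hv)); first by case: hw.
  exact: (wcurl_unique oO bO (XT_wcurl hu) hw).
apply: (ph_null_eq Hs (XT_wdiv_L2 oO bO hu) _ (XT_wdiv_L2 oO bO hv)); first by case: hh.
exact: (rel_div_unique oO bO (XT_rel_div oO bO hu) hh).
Qed.

Lemma volume_formD u v w : XT Omega u -> XT Omega v -> XT Omega w ->
  volume_form (u + v) w = volume_form u w + volume_form v w.
Proof.
move=> hu hv hw.
have e := volume_form_rel (ph_D HX hu hv)
  (is_wcurlD oO bO (XT_L2v hu) (XT_L2v hv) (XT_wcurl hu) (XT_wcurl hv))
  (rel_divD oO (XT_L2v hu) (XT_L2v hv) (XT_rel_div oO bO hu) (XT_rel_div oO bO hv)) hw.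
rewrite e (ph_BD Hv (XT_wcurl_L2v hu) (XT_wcurl_L2v hv) (XT_wcurl_L2v hw)).
rewrite (ph_BD Hv (XT_L2v hu) (XT_L2v hv) (XT_L2v hw)).
rewrite (ph_BD Hs (XT_wdiv_L2 oO bO hu) (XT_wdiv_L2 oO bO hv) (XT_wdiv_L2 oO bO hw)) volume_form.unlock.
have aux (a a' b b' c c' : R) : a + a' - alpha * (b + b') + theta * (c + c') =
  (a - alpha * b + theta * c) + (a' - alpha * b' + theta * c') by ring.
exact: aux.
Qed.

Lemma volume_form_mulc c u v : XT Omega u -> XT Omega v ->
  volume_form (fun x => c *: u x) v = volume_form u (fun x => conjc c *: v x).
Proof.
have lin a w : (fun x => a *: w x) = (fun x => a *: w x + (0 : vfield R) x).
  by apply/funext => x; rewrite addr0.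
have lins (a : C) (w : P -> C) : (fun x => a * w x) = (fun x => a * w x + (0 : P -> C) x).
  by apply/funext => x; rewrite addr0.
have X0 : XT Omega 0 by exact: (ph_0 HX).
have hX a w : XT Omega w -> XT Omega (fun x => a *: w x).
  by move=> hw; rewrite lin; exact: XT_lin.
have hc a w : XT Omega w -> is_wcurl Omega (fun x => a *: w x) (fun x => a *: wcurl Omega w x).
  move=> hw; rewrite lin [X in is_wcurl _ _ X]lin; apply: wcurl_lin => //.
  - exact: XT_L2v.
  - exact: (ph_0 Hv).
  - exact: XT_wcurl.
  - exact: is_wcurl0.
have hd a w : XT Omega w -> rel_div Omega (fun x => a *: w x) (fun x => a * wdiv Omega w x).
  move=> hw; rewrite lin lins; apply: rel_div_lin => //.
  - exact: XT_L2v.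
  - exact: (ph_0 Hv).
  - exact: (XT_rel_div oO bO hw).
  - exact: rel_div0.
move=> hu hv.
rewrite (volume_form_rel (hX c u hu) (hc c u hu) (hd c u hu) hv).
rewrite (volume_formC hu (hX (conjc c) v hv)).
rewrite (volume_form_rel (hX (conjc c) v hv) (hc (conjc c) v hv) (hd (conjc c) v hv) hu).
have L := XT_L2v hu; have L' := XT_L2v hv.
have Lc := XT_wcurl_L2v hu; have Lc' := XT_wcurl_L2v hv.
have Ld := XT_wdiv_L2 oO bO hu; have Ld' := XT_wdiv_L2 oO bO hv.
exact: (form_congr
  (etrans (vdot_mulc mO c Lc Lc') (ph_C Hv Lc (L2vZc mO (conjc c) Lc')))
  (etrans (vdot_mulc mO c L L') (ph_C Hv L (L2vZc mO (conjc c) L')))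
  (etrans (cdot_mulc mO c Ld Ld') (ph_C Hs Ld (L2Zc mO (conjc c) Ld')))).
Qed.

Lemma volume_formZ t u v : XT Omega u -> XT Omega v ->
  volume_form (vscale t u) v = t * volume_form u v.
Proof.
move=> hu hv.
have e := volume_form_rel (ph_Z HX t hu) (is_wcurlZ oO bO t (XT_L2v hu) (XT_wcurl hu))
  (rel_divZ oO t (XT_L2v hu) (XT_rel_div oO bO hu)) hv.
rewrite e (ph_BZ Hv t (XT_wcurl_L2v hu) (XT_wcurl_L2v hv)).
rewrite (ph_BZ Hv t (XT_L2v hu) (XT_L2v hv)) (ph_BZ Hs t (XT_wdiv_L2 oO bO hu) (XT_wdiv_L2 oO bO hv)) volume_form.unlock.
by ring.
Qed.

Lemma XT_conji v : XT Omega v -> XT Omega (viconj v).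
Proof.
move=> hv; have := XT_lin oO bO 'i%C (XT_conj oO bO hv) (ph_0 HX).
by congr XT; apply/funext => x; rewrite addr0.
Qed.

(** Real and imaginary parts as in [Cint_mulE], using that conj and i conj of the chosen derivatives
    of v are derivatives of conj v and i conj v. *)
Lemma volume_calL u v : XT Omega u -> XT Omega v ->
  Cint mu D (fun x => dotv (wcurl Omega u x) (wcurl Omega v x))
  - alpha%:C%C * Cint mu D (fun x => dotv (u x) (v x))
  + theta%:C%C * Cint mu D (fun x => wdiv Omega u x * wdiv Omega v x)
  = (volume_form u (vconj v) +i* volume_form u (viconj v))%C.
Proof.
move=> hu hv.
have L := XT_L2v hu; have L' := XT_L2v hv.
have Lc := XT_wcurl_L2v hu; have Lc' := XT_wcurl_L2v hv.
have Ld := XT_wdiv_L2 oO bO hu; have Ld' := XT_wdiv_L2 oO bO hv.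
have hw := wcurl_conj oO bO L' (XT_wcurl hv).
have hh := rel_div_conj oO bO L' (XT_rel_div oO bO hv).
have hv1 := XT_conj oO bO hv; have hv2 := XT_conji hv.
have z2 : L2v mu D 0 by exact: (ph_0 Hv).
have e2 : viconj v = (fun x => 'i%C *: vconj v x + (0 : vfield R) x) by apply/funext => x; rewrite addr0.
have hw2 : is_wcurl Omega (viconj v) (viconj (wcurl Omega v)).
  have := wcurl_lin oO bO 'i%C (L2v_conj mO L') z2 hw (is_wcurl0 oO).
  by rewrite -e2; congr is_wcurl; apply/funext => x; rewrite addr0.
have hh2 : rel_div Omega (viconj v) (iconjf (wdiv Omega v)).
  have := rel_div_lin oO 'i%C (L2v_conj mO L') z2 hh (rel_div0 oO).
  by rewrite -e2; congr rel_div; apply/funext => x; rewrite addr0.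
rewrite (Cint_dotvE mO Lc Lc') (Cint_dotvE mO L L') (Cint_mulE mO Ld Ld').
rewrite (volume_formC hu hv1) (volume_form_rel hv1 hw hh hu).
rewrite (volume_formC hu hv2) (volume_form_rel hv2 hw2 hh2 hu).
rewrite (ph_C Hv (L2v_conj mO Lc') Lc) (ph_C Hv (L2v_conj mO L') L) (ph_C Hs (L2_conj mO Ld') Ld).
rewrite (ph_C Hv (L2v_iconj mO Lc') Lc) (ph_C Hv (L2v_iconj mO L') L) (ph_C Hs (L2_iconj mO Ld') Ld).
have aux (a a' b b' c c' : R) :
    ((a +i* a')%C - alpha%:C%C * (b +i* b')%C + theta%:C%C * (c +i* c')%C : C) =
    ((a - alpha * b + theta * c) +i* (a' - alpha * b' + theta * c'))%C.
  by apply/eqP; rewrite eq_complex /=; apply/andP; split; apply/eqP; ring.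
exact: aux.
Qed.

Lemma volume_form_le : exists2 K, 0 <= K & forall u, XT Omega u ->
  volume_form u u <= K * XTform Omega u u.
Proof.
exists (1 + `|alpha| + `|theta|); first by rewrite !addr_ge0.
move=> u hu; rewrite XTformE volume_form.unlock.
have := ph_ge0 Hv (XT_wcurl_L2v hu); have := ph_ge0 Hv (XT_L2v hu); have := ph_ge0 Hs (XT_wdiv_L2 oO bO hu).
move: (vdot mu D u u) (vdot mu D (wcurl Omega u) (wcurl Omega u))
  (cdot mu D (wdiv Omega u) (wdiv Omega u)) => b a c c0 b0 a0; clear hu u.
have h1 : - alpha <= `|alpha| by rewrite -normrN ler_norm.
have h2 : theta <= `|theta| by rewrite ler_norm.
have k1 : - alpha * b <= `|alpha| * b by exact: ler_wpM2r.
have k2 : theta * c <= `|theta| * c by exact: ler_wpM2r.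
have n1 := normr_ge0 alpha; have n2 := normr_ge0 theta.
have : 0 <= `|alpha| * a by exact: mulr_ge0.
have : 0 <= `|alpha| * c by exact: mulr_ge0.
have : 0 <= `|theta| * a by exact: mulr_ge0.
have : 0 <= `|theta| * b by exact: mulr_ge0.
by lra.
Qed.

End Energy.

(** * Convergent subsequences *)

(** An ultrafilter on a compact segment has a cluster point, and each neighbourhood of it, or else
    its complement, belongs to the ultrafilter. *)
Lemma ultra_bounded (R : realType) (U : set_system nat) (a : nat -> R) (M : R) :
  UltraFilter U -> (forall n, `|a n| <= M) ->
  exists l, forall e : R, 0 < e -> U [set n | `|a n - l| < e].
Proof.
move=> uU aM; have pU := @ultra_proper _ _ uU.
have UM : (a @ U) `[- M, M]%classic.
  by apply: (@filterE _ U _ (a @^-1` _)) => n; rewrite /= in_itv /= -ler_norml; exact: aM.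
have [l [_ cl]] := segment_compact (fmap_proper_filter a pU) UM.
exists l => e e0; have [//|h] := in_ultra_setVsetC [set n | `|a n - l| < e] uU.
have A : (a @ U) [set x | e <= `|x - l|].
  have : U (a @^-1` [set x | e <= `|x - l|]) by apply: filterS h => n /= /negP; rewrite -leNgt.
  by [].
have [x [/= x1 x2]] := cl _ _ A (nbhsx_ballx l e e0).
by move: x2; rewrite /ball /= distrC ltNge x1.
Qed.

(** Along a fixed ultrafilter the finitely many l_i converge for every e at once, so no subsequence
    has to be extracted for each e. The hypothesis bounds q by these coordinates up to e. *)
Lemma cauchy_subsequence (R : realType) (q : nat -> nat -> R) :
  (forall e : R, 0 < e -> exists (I : finType) (l : I -> nat -> R) (M : R),
     (forall i n, `|l i n| <= M) /\ forall n m, q n m <= \sum_i (l i n - l i m) ^+ 2 + e) ->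
  exists2 k : nat -> nat, {homo k : m n / (m < n)%N} & cauchy_wrt (fun n m => q (k n) (k m)).
Proof.
move=> h; have [U [uU FU]] := ultraFilterLemma (eventually_filter).
have pU := @ultra_proper _ _ uU.
have small (e : R) : 0 < e -> exists2 S, U S & forall n m, S n -> S m -> q n m < e.
  move=> e0; have e2 : 0 < e / 2 by rewrite divr_gt0.
  have [I [l [M [lM ql]]]] := h _ e2.
  have /choice[x hx] i := ultra_bounded uU (lM i).
  (* As d <= 1, each square is at most (2 d)^2 <= 4 d, and the sum of these over I is at most e /
     2. *)
  pose d := Num.min 1 (e / (8 * (#|I|%:R + 1))).
  have I0 : 0 < 8 * (#|I|%:R + 1) :> R by rewrite mulr_gt0 // ltr_wpDl.
  have d0 : 0 < d by rewrite lt_min ltr01 divr_gt0.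
  exists [set n | forall i, `|l i n - x i| < d]; first by apply: filter_forall => i; exact: hx.
  move=> n m Sn Sm; apply: le_lt_trans (ql n m) _.
  have t i : (l i n - l i m) ^+ 2 <= 4 * d.
    have := Sn i; have := Sm i; have : d <= 1 by rewrite /d ge_min lexx.
    by rewrite !ltr_norml => d1 /andP[? ?] /andP[? ?]; nra.
  have : \sum_i (l i n - l i m) ^+ 2 <= \sum_(i : I) 4 * d by apply: ler_sum.
  rewrite sumr_const -mulr_natl => hs.
  have : d <= e / (8 * (#|I|%:R + 1)) by rewrite /d ge_min lexx orbT.
  rewrite ler_pdivlMr // => hd; move: hs hd (ler0n R #|I|); set c := #|I|%:R; set s := \sum_i _.
  by move=> hs hd c0; nra.
have /choice[S hS] (j : nat) : exists S, U S /\ forall n m, S n -> S m -> q n m < j.+1%:R^-1.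
  by have [|S US hS] := small (j.+1%:R^-1); [rewrite invr_gt0|exists S].
(* The ultrafilter contains all tails, so its sets contain arbitrarily large numbers. Each k j lies
   in S 0, ..., S j, which makes the whole tail from N on lie in S N. *)
have next (j N : nat) : exists n, (N <= n)%N /\ forall i : 'I_j.+1, S i n.
  have UT : U [set n | forall i : 'I_j.+1, S i n] by apply: filter_forall => i; have [] := hS i.
  have UN : U [set n | (N <= n)%N] by apply: FU; exact: nbhs_infty_ge.
  by have [n [n1 n2]] := filter_ex (filterI UN UT); exists n.
have [nx hnx] : exists nx : nat -> nat -> nat, forall j N, (N <= nx j N)%N /\ forall i : 'I_j.+1, S i (nx j N).
  have /choice[nx hnx] (j : nat) : exists f : nat -> nat, forall N, (N <= f N)%N /\ forall i : 'I_j.+1, S i (f N).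
    by have /choice[f hf] := next j; exists f.
  by exists nx.
pose k := fix k j := if j is j'.+1 then nx j (k j').+1 else nx 0%N 0%N.
have kS j (i : 'I_j.+1) : S i (k j) by case: j i => [|j] i; [exact: (hnx 0%N 0%N).2|exact: (hnx j.+1 (k j).+1).2].
exists k.
  by apply: homo_ltn => [y x z|j]; [exact: ltn_trans|have [] := hnx j.+1 (k j).+1].
move=> e e0; have [N hN] := tends0_invn e0; exists N => n m Nn Nm.
apply: lt_trans (hN N (leqnn N)).
have [_] := hS N; apply.
  exact: (kS n (Ordinal (Nn : N < n.+1)%N)).
exact: (kS m (Ordinal (Nm : N < m.+1)%N)).
Qed.

(** * Tangential fields on the boundary *)

Lemma ae_mono2 d (T : measurableType d) (R : realType) (mu : {measure set T -> \bar R})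
    (P Q S : T -> Prop) : (forall x, P x -> Q x -> S x) ->
  {ae mu, forall x, P x} -> {ae mu, forall x, Q x} -> {ae mu, forall x, S x}.
Proof. by move=> h; apply: filterS2. Qed.

Lemma ae_mono d (T : measurableType d) (R : realType) (mu : {measure set T -> \bar R})
    (P Q : T -> Prop) : (forall x, P x -> Q x) -> {ae mu, forall x, P x} -> {ae mu, forall x, Q x}.
Proof. by move=> h; apply: filterS. Qed.

Section NullFunctions.
Context d (T : measurableType d) (R : realType).
Variables (mu : {measure set T -> \bar R}) (D : set T).
Hypothesis mD : measurable D.
Local Notation C := R[i].
Local Notation vf := (T -> 'rV[C]_3).

Lemma rdot_ae (f : T -> R) : rL2 mu D f ->
  rdot mu D f f = 0 <-> {ae mu, forall x, D x -> f x = 0}.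
Proof.
move=> hf; have [mf _] := hf.
have mf2 : measurable_fun D (fun x => (f x ^+ 2)%:E).
  by apply/measurable_EFinP; exact: measurable_funX.
have ae1 : (\int[mu]_(x in D) `|(f x ^+ 2)%:E| = 0)%E <-> rdot mu D f f = 0.
  under eq_integral do rewrite gee0_abs ?lee_fin ?sqr_ge0 //.
  by rewrite -rdotE //; split=> [[]|->].
rewrite -ae1 (ae_eq_integral_abs mu mD mf2); split; apply: filterS => x h Dx.
  by have /eqP := h Dx; rewrite eqe sqrf_eq0 => /eqP.
by rewrite h // expr0n.
Qed.

Lemma cdot_ae (f : T -> C) : L2 mu D f ->
  cdot mu D f f = 0 <-> {ae mu, forall x, D x -> f x = 0}.
Proof.
move=> /(L2P mu mD) f2; rewrite /cdot; split=> [h|h].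
  have : forall b, {ae mu, forall x, D x -> part b f x = 0}.
    move=> b; apply/(rdot_ae (f2 b)); apply/eqP; rewrite eq_le (ph_ge0 (rL2_prehilbert mu mD)) //.
    rewrite andbT -h (bigD1 b) //= lerDl; apply: sumr_ge0 => c _.
    exact: (ph_ge0 (rL2_prehilbert mu mD)).
  move=> /filter_forall; apply: filterS => x fx Dx.
  by apply: (@part_inj _ _ f (fun=> 0)) => b; rewrite fx //; case: b.
rewrite big1 // => b _; apply/(rdot_ae (f2 b)); apply: filterS h => x fx Dx.
by rewrite /part fx //; case: b.
Qed.

Lemma vdot_ae (u : vf) : L2v mu D u ->
  vdot mu D u u = 0 <-> {ae mu, forall x, D x -> u x = 0}.
Proof.
move=> u2; have Hc := cdot_prehilbert mu mD; split=> [h|h].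
  have : forall i, {ae mu, forall x, D x -> vcomp i u x = 0}.
    move=> i; apply/(cdot_ae (u2 i)); apply/eqP; rewrite eq_le (ph_ge0 Hc (u2 i)) andbT.
    rewrite -h /vdot (bigD1 i) //= lerDl; apply: sumr_ge0 => j _; exact: (ph_ge0 Hc (u2 j)).
  move=> /filter_forall; apply: filterS => x fx Dx.
  by apply/rowP => i; rewrite mxE; exact: fx.
rewrite /vdot big1 // => i _; apply/(cdot_ae (u2 i)); apply: filterS h => x fx Dx.
by rewrite /vcomp fx // mxE.
Qed.

Lemma vdot_ae_eq (u v : vf) : L2v mu D u -> L2v mu D v ->
  vdot mu D (u - v) (u - v) = 0 <-> {ae mu, forall x, D x -> u x = v x}.
Proof.
move=> u2 v2; rewrite vdot_ae; last exact: (ph_B (vdot_prehilbert mu mD)).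
split; apply: filterS => x h Dx; apply/eqP; rewrite -subr_eq0.
  by apply/eqP; exact: h.
by rewrite subr_eq0; apply/eqP/eqP; rewrite subr_eq0; apply/eqP; exact: h.
Qed.

(** For the components of the outer normal, which are measurable and at most 1 in absolute value on
    the boundary. *)
Lemma L2_mul_real (r : T -> R) (f : T -> C) : measurable_fun D r ->
  (forall x, D x -> `|r x| <= 1) -> L2 mu D f ->
  L2 mu D (fun x => (r x)%:C%C * f x) /\
  cdot mu D (fun x => (r x)%:C%C * f x) (fun x => (r x)%:C%C * f x) <= cdot mu D f f.
Proof.
move=> mr r1 /(L2P mu mD) f2.
have E b : part b (fun x => (r x)%:C%C * f x) = (fun x => r x * part b f x).
  by apply/funext => x; rewrite /part; case: (f x) b => s t [] /=; rewrite mul0r ?addr0 ?subr0.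
have h b : rL2 mu D (fun x => r x * part b f x) /\
    rdot mu D (fun x => r x * part b f x) (fun x => r x * part b f x) <= rdot mu D (part b f) (part b f).
  have [mf _] := f2 b.
  refine (rdot_lt_rL2 (measurable_funM mr mf) _); rewrite rdotE //.
  apply: ge0_le_integral => //.
  - by move=> x _; rewrite lee_fin sqr_ge0.
  - by apply/measurable_EFinP; apply: measurable_funX; exact: measurable_funM.
  - by apply/measurable_EFinP; exact: measurable_funX.
  - move=> x Dx; rewrite lee_fin exprMn ler_piMl ?sqr_ge0 //.
    by rewrite -real_normK ?num_real // expr_le1 ?r1.
split; first by apply/(L2P mu mD) => b; rewrite E; case: (h b).
by rewrite /cdot; apply: ler_sum => b _; rewrite E; case: (h b).
Qed.

End NullFunctions.

Lemma crossvE (K : comPzRingType) (a b : 'rV[K]_3) :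
  [/\ crossv a b 0 0 = a 0 1 * b 0 2 - a 0 2 * b 0 1,
      crossv a b 0 1 = a 0 2 * b 0 0 - a 0 0 * b 0 2 &
      crossv a b 0 2 = a 0 0 * b 0 1 - a 0 1 * b 0 0].
Proof.
by split; rewrite mxE; congr (_ - _); congr (_ * _); congr (_ 0 _); apply/val_inj.
Qed.

Lemma sum3 (V : nmodType) (F : 'I_3 -> V) : \sum_i F i = F 0 + F 1 + F 2.
Proof.
rewrite !big_ord_recl big_ord0 addr0 addrA.
by congr (F _ + F _ + F _); apply/val_inj.
Qed.

Lemma cross_cross (K : comPzRingType) (n a : 'rV[K]_3) :
  crossv n (crossv a n) = dotv n n *: a - dotv n a *: n.
Proof.
apply/rowP => i.
have [e0 e1 e2] := crossvE n (crossv a n); have [f0 f1 f2] := crossvE a n.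
move: e0 e1 e2; rewrite f0 f1 f2 => e0 e1 e2.
have [->|->|->] : [\/ i = 0, i = 1 | i = 2].
  by case: i => -[|[|[|//]]] ?; [constructor 1|constructor 2|constructor 3]; apply/val_inj.
- by rewrite e0 !mxE /dotv !sum3; ring.
- by rewrite e1 !mxE /dotv !sum3; ring.
- by rewrite e2 !mxE /dotv !sum3; ring.
Qed.

Lemma dotv_cross_cross (K : comPzRingType) (n a h : 'rV[K]_3) :
  dotv (crossv n (crossv a n)) h = dotv n n * dotv a h - dotv n a * dotv n h.
Proof.
by rewrite cross_cross /dotv !sum3 !mxE; ring.
Qed.

Lemma dotvC (K : comPzRingType) (a b : 'rV[K]_3) : dotv a b = dotv b a.
Proof. by apply: eq_bigr => i _; rewrite mulrC. Qed.

Section Tangential.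
Variables (R : realType) (Omega : set (pt R)) (sigma : {measure set (mpt R) -> \bar R}).
Local Notation C := R[i].
Local Notation G := (boundary Omega : set (mpt R)).
Hypothesis oO : open Omega.
Hypothesis bO : bounded_set Omega.
Hypothesis Oc : C11_boundary Omega.

Let mG : measurable G := boundary_measurable Omega.
Local Notation HG := (cdot_prehilbert sigma mG).
Local Notation HvG := (vdot_prehilbert sigma mG).
Local Notation nu := (nu Omega).

(** By [cross_cross] this is g - (nu . g) nu on the boundary, the orthogonal projection to the
    tangent plane. *)
Definition tangential (g : vfield R) : vfield R := fun x => crossv (nu x) (crossv (g x) (nu x)).

Lemma dotv_nu x : boundary Omega x -> dotv (nu x) (nu x) = 1.
Proof.
move=> bx; have := outer_normal_unit oO Oc bx => /(congr1 (fun r : R => r%:C%C)) h.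
rewrite -[RHS]h rmorph_sum; apply: eq_bigr => i _.
by rewrite !mxE expr2 rmorphM.
Qed.

Lemma dotv_nu_tangential g x : boundary Omega x -> dotv (nu x) (tangential g x) = 0.
Proof. by move=> bx; rewrite dotvC dotv_cross_cross dotv_nu // mul1r mulr1 (dotvC (g x)) subrr. Qed.

Lemma dotv_tangential g h x : boundary Omega x -> dotv (nu x) h = 0 ->
  dotv (tangential g x) h = dotv (g x) h.
Proof. by move=> bx h0; rewrite dotv_cross_cross dotv_nu // h0 mulr0 mul1r subr0. Qed.

Lemma dotv_nu_conj x h : dotv (nu x) (conjv h) = conjc (dotv (nu x) h).
Proof.
rewrite -dotv_conj; congr dotv; apply/rowP => i; rewrite !mxE /=.
by apply/eqP; rewrite eq_complex /= oppr0 !eqxx.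
Qed.

(** A component is a difference of two products with components of nu, so its square costs 2 + 2
    times squares of components of g; each component of g occurs twice, as shifts modulo 3 permute
    the indices. *)
Lemma cross_nu_L2v g : L2v sigma G g ->
  L2v sigma G (fun x => crossv (nu x) (g x)) /\
  vdot sigma G (fun x => crossv (nu x) (g x)) (fun x => crossv (nu x) (g x)) <= 4 * vdot sigma G g g.
Proof.
move=> g2.
pose N i x := outer_normal Omega x 0 i.
have N1 i x : G x -> `|N i x| <= 1.
  move=> bx; rewrite -(@expr_le1 _ 2) // real_normK ?num_real // -(outer_normal_unit oO Oc bx).
  by rewrite (bigD1 i) //= lerDl; apply: sumr_ge0 => j _; exact: sqr_ge0.
have m i j := L2_mul_real mG (outer_normal_measurable oO bO Oc i) (N1 i) (g2 j).
have E i : vcomp i (fun x => crossv (nu x) (g x)) =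
    (fun x => (N (i + 1) x)%:C%C * vcomp (i + 2) g x) - (fun x => (N (i + 2) x)%:C%C * vcomp (i + 1) g x).
  by apply/funext => x; rewrite /vcomp !mxE.
split.
  by move=> i; rewrite -[fun x => _]/(vcomp i (fun x => crossv (nu x) (g x))) E;
    apply: (ph_B HG); [exact: (m _ _).1|exact: (m _ _).1].
have h i : cdot sigma G (vcomp i (fun x => crossv (nu x) (g x))) (vcomp i (fun x => crossv (nu x) (g x))) <=
    2 * cdot sigma G (vcomp (i + 2) g) (vcomp (i + 2) g) + 2 * cdot sigma G (vcomp (i + 1) g) (vcomp (i + 1) g).
  rewrite E; apply: le_trans (ph_sqB_le HG (m _ _).1 (m _ _).1) _.
  by apply: lerD; rewrite ler_pM2l //; exact: (m _ _).2.
apply: le_trans (ler_sum _ (fun i _ => h i)) _.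
rewrite big_split /= -!mulr_sumr.
have sh (k : 'I_3) (F : 'I_3 -> R) : \sum_i F (i + k) = \sum_i F i.
  by rewrite [RHS](reindex_inj (addIr k)).
rewrite (sh 2 (fun i => cdot sigma G (vcomp i g) (vcomp i g))).
rewrite (sh 1 (fun i => cdot sigma G (vcomp i g) (vcomp i g))) /vdot.
by move: (\sum_i _) => s; lra.
Qed.

Lemma tangential_L2v g : L2v sigma G g -> L2v sigma G (tangential g) /\
  vdot sigma G (tangential g) (tangential g) <= 16 * vdot sigma G g g.
Proof.
move=> g2; have [h1 h2] := cross_nu_L2v g2.
have E x : crossv (g x) (nu x) = -1 *: crossv (nu x) (g x).
  by apply/rowP => i; rewrite !mxE; ring.
have k1 : L2v sigma G (fun x => crossv (g x) (nu x)).
  have := L2vZc mG (-1) h1; congr L2v; apply/funext => x; exact: esym (E x).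
have k2 : vdot sigma G (fun x => crossv (g x) (nu x)) (fun x => crossv (g x) (nu x)) <= 4 * vdot sigma G g g.
  have -> : (fun x => crossv (g x) (nu x)) = (fun x => -1 *: crossv (nu x) (g x)) by apply/funext.
  by rewrite vdot_sqZ // /sqmod /= oppr0 expr0n addr0 sqrrN expr1n mul1r.
have [l1 l2] := cross_nu_L2v k1; split=> //.
by apply: le_trans l2 _; move: k2; set a := vdot _ _ _ _; set b := vdot _ _ _ _; lra.
Qed.

Lemma tangential_TL2 g : L2v sigma G g -> TL2 Omega sigma (tangential g).
Proof.
move=> g2; split; first exact: (tangential_L2v g2).1.
by apply: aeW => x bx; exact: dotv_nu_tangential.
Qed.

Lemma TL2_lin c f g : TL2 Omega sigma f -> TL2 Omega sigma g ->
  TL2 Omega sigma (fun x => c *: f x + g x).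
Proof.
move=> [f2 f0] [g2 g0]; split; first exact: L2v_lin.
apply: ae_mono2 f0 g0 => x f0 g0 bx.
have -> : dotv (nu x) (c *: f x + g x) = c * dotv (nu x) (f x) + dotv (nu x) (g x).
  by rewrite /dotv !sum3 !mxE; ring.
by rewrite f0 // g0 // mulr0 addr0.
Qed.

End Tangential.

(** * From the map f to trace to the operator on tangential fields *)

Section Conclusion.
Variables (R : realType) (Omega : set (pt R)) (sigma : {measure set (mpt R) -> \bar R}).
Local Notation C := R[i].
Local Notation G := (boundary Omega : set (mpt R)).
Hypothesis oO : open Omega.
Hypothesis bO : bounded_set Omega.
Hypothesis Oc : C11_boundary Omega.

Let mG : measurable G := boundary_measurable Omega.
Local Notation HvG := (vdot_prehilbert sigma mG).
Local Notation tang := (tangential Omega).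
Local Notation tL := (tangential_L2v oO bO Oc).

Lemma vdot_Cint (u h : vfield R) : L2v sigma G u -> L2v sigma G h ->
  vdot sigma G u h = complex.Re (Cint sigma G (fun x => dotv (u x) (vconj h x))).
Proof. by move=> u2 h2; rewrite (Cint_dotvE mG u2 (L2v_conj mG h2)) vconjK. Qed.

(** A tangential h does not see the normal part of g. As h is tangential only almost everywhere, it
    is first replaced by its projection, tangential at every boundary point. *)
Lemma vdot_tangential g h : L2v sigma G g -> TL2 Omega sigma h ->
  vdot sigma G (tang g) h = vdot sigma G g h.
Proof.
move=> g2 [h2 h0]; have t2 := (tL g2).1; have s2 := (tL h2).1.
have e : vdot sigma G (h - tang h) (h - tang h) = 0.
  apply/(vdot_ae_eq mG h2 s2); apply: ae_mono h0 => x h0 bx.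
  by rewrite /tangential cross_cross dotv_nu // h0 // scale1r scale0r subr0.
have n u : L2v sigma G u -> vdot sigma G u h = vdot sigma G u (tang h).
  move=> u2; rewrite (ph_C HvG u2 h2) (ph_C HvG u2 s2).
  exact: (ph_null_eq HvG h2 s2 u2 e).
rewrite (n _ t2) (n _ g2) (vdot_Cint t2 s2) (vdot_Cint g2 s2); congr complex.Re.
apply: eq_Cint => x /set_mem bx; apply: dotv_tangential => //.
by rewrite dotv_nu_conj dotv_nu_tangential // conjc0.
Qed.

Variable U : vfield R -> vfield R.
Hypothesis U2 : forall f, L2v sigma G (U f).
Hypothesis Ueq : forall f g, TL2 Omega sigma f -> TL2 Omega sigma g -> TL2eq Omega sigma f g ->
  TL2eq Omega sigma (U f) (U g).
Hypothesis Ulin : forall c f g, TL2 Omega sigma f -> TL2 Omega sigma g ->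
  TL2eq Omega sigma (U (fun x => c *: f x + g x)) (fun x => c *: U f x + U g x).
Hypothesis Usym : forall f g, TL2 Omega sigma f -> TL2 Omega sigma g ->
  vdot sigma G (U f) g = vdot sigma G f (U g).
Hypothesis Ucpt : forall (f : nat -> vfield R) M, (forall n, TL2 Omega sigma (f n)) ->
  (forall n, vdot sigma G (f n) (f n) <= M) ->
  exists2 k : nat -> nat, {homo k : m n / (m < n)%N} &
    cauchy_wrt (fun n m => vdot sigma G (U (f (k n)) - U (f (k m))) (U (f (k n)) - U (f (k m)))).

Let A (f : vfield R) : vfield R := - tang (U f).

Lemma tangentialN g : - tang g = tang (- g).
Proof.
apply/funext => x; rewrite -[LHS]/(- tang g x) /tangential; apply/rowP => i.
by rewrite -[(- g) x]/(- g x) !mxE; ring.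
Qed.

Lemma L2vN g : L2v sigma G g -> L2v sigma G (- g).
Proof. exact: (ph_N HvG). Qed.

Lemma opp_tangential_operator : TL2_operator Omega sigma A.
Proof.
split.
- by move=> f hf; rewrite /A tangentialN; apply: tangential_TL2 => //; exact: L2vN.
- move=> f g hf hg e; apply: ae_mono (Ueq hf hg e) => x h bx.
  by rewrite -[LHS]/(- tang (U f) x) -[RHS]/(- tang (U g) x) /tangential h.
- move=> c f g hf hg; apply: ae_mono (Ulin c hf hg) => x h bx.
  rewrite -[LHS]/(- tang (U (fun x => c *: f x + g x)) x).
  rewrite -[RHS]/(c *: - tang (U f) x + - tang (U g) x) /tangential h //.
  by apply/rowP => i; rewrite !mxE; ring.
Qed.

Lemma opp_tangential_compact : TL2_compact Omega sigma A.
Proof.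
move=> f hf [M hM].
have [k hk cau] : exists2 k : nat -> nat, {homo k : m n / (m < n)%N} &
    cauchy_wrt (fun n m => vdot sigma G (U (f (k n)) - U (f (k m))) (U (f (k n)) - U (f (k m)))).
  by apply: (Ucpt hf (M := M)) => n; rewrite -sqL2vE //; case: (hf n).
have [|g g2 tg] := @vdot_complete _ _ _ sigma _ mG (fun n => U (f (k n))) _ cau; first by [].
exists k, (- tang g); split=> //.
  by rewrite tangentialN; apply: tangential_TL2 => //; exact: L2vN.
have E n : A (f (k n)) - - tang g = tang (- (U (f (k n)) - g)).
  apply/funext => x; rewrite -[LHS]/(- tang (U (f (k n))) x - - tang g x) /tangential.
  by rewrite -[(- (U (f (k n)) - g)) x]/(- (U (f (k n)) x - g x)); apply/rowP => i; rewrite !mxE; ring.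
have L n : L2v sigma G (U (f (k n)) - g) by apply: (ph_B HvG).
have T n := tL (L2vN (L n)).
apply/tends0P; first by move=> n; rewrite E (sqL2vE mG (T n).1); exact: (ph_ge0 HvG (T n).1).
apply: (@tends0_le _ _ _ 16 _ _ tg) => // n; rewrite E (sqL2vE mG (T n).1).
apply: le_trans (T n).2 _; rewrite ler_pM2l // (ph_BN HvG (L n) (L2vN (L n))).
by rewrite (ph_NB HvG (L n) (L n)) opprK.
Qed.

(** The imaginary part of the scalar product of f and g is the real product of f with i g. Real
    symmetry of U, applied to g and to i g, gives both parts once U (i g) = i U g almost
    everywhere. *)
Lemma opp_tangential_selfadjoint : TL2_selfadjoint Omega sigma A.
Proof.
have Z2 : TL2 Omega sigma 0.
  split; first exact: (ph_0 HvG).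
  by apply: aeW => x bx; rewrite /dotv big1 // => i _; rewrite (_ : (0 : vfield R) x 0 i = 0) ?mulr0 ?mxE.
(* Linearity with c = 1 at f = g = 0 reads U 0 = U 0 + U 0. *)
have U0 : {ae sigma, forall x, G x -> U 0 x = 0}.
  have := Ulin 1 Z2 Z2; rewrite vlinD addr0; apply: ae_mono => x h bx.
  have := h bx; rewrite scale1r => /eqP; rewrite -subr_eq0 opprD addrA subrr add0r oppr_eq0.
  by move=> /eqP.
have AE u h : L2v sigma G u -> TL2 Omega sigma h -> vdot sigma G (- tang u) h = - vdot sigma G u h.
  by move=> u2 hh; rewrite (ph_BN HvG (tL u2).1 hh.1) vdot_tangential.
have iL h : TL2 Omega sigma h -> TL2 Omega sigma (fun x => 'i%C *: h x).
  move=> hh; have := TL2_lin 'i%C hh Z2; congr TL2; apply/funext => x; exact: addr0.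
have iU g : TL2 Omega sigma g ->
    vdot sigma G ((fun x => 'i%C *: U g x) - U (fun x => 'i%C *: g x))
     ((fun x => 'i%C *: U g x) - U (fun x => 'i%C *: g x)) = 0.
  move=> hg; apply/(vdot_ae_eq mG (L2vZc mG _ (U2 g)) (U2 _)).
  apply: ae_mono2 U0 (Ulin 'i%C hg Z2) => x h1 h2 bx.
  have -> : (fun x => 'i%C *: g x) = (fun x => 'i%C *: g x + (0 : vfield R) x).
    by apply/funext => y; rewrite addr0.
  by rewrite h2 // h1 // addr0.
have E (u h : vfield R) : L2v sigma G u -> L2v sigma G h -> TL2dot Omega sigma u h =
    (vdot sigma G u h +i* vdot sigma G u (fun x => 'i%C *: h x))%C.
  move=> u2 h2; rewrite /TL2dot (Cint_dotvE mG u2 (L2v_conj mG h2)) vconjK; congr (_ +i* _)%C.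
  congr (vdot _ _ _ _); apply/funext => x; rewrite /viconj /vconj; congr (_ *: _).
  by apply/rowP => i; rewrite !mxE conjcK.
move=> f g hf hg.
have Af2 h : L2v sigma G (A h) by apply: L2vN; exact: (tL (U2 h)).1.
rewrite (E _ _ (Af2 f) hg.1) (E _ _ hf.1 (Af2 g)).
have sym h : TL2 Omega sigma h -> vdot sigma G (A f) h = vdot sigma G f (A h).
  move=> hh; rewrite AE // Usym // (ph_C HvG hf.1 (Af2 h)) AE // (ph_C HvG hf.1 (U2 h)) //.
rewrite sym // (sym _ (iL _ hg)); congr (_ +i* _)%C.
have i2 := L2vZc mG 'i%C (Af2 g).
rewrite (ph_C HvG hf.1 (Af2 _)) (ph_C HvG hf.1 i2).
have t2 := L2vZc mG 'i%C (U2 g).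
have -> : (fun x => 'i%C *: A g x) = - tang (fun x => 'i%C *: U g x).
  apply/funext => x; rewrite -[RHS]/(- tang (fun x => 'i%C *: U g x) x) -[A g x]/(- tang (U g) x) /tangential.
  by apply/rowP => i; rewrite !mxE; ring.
rewrite !AE //; congr (- _).
exact/esym/(ph_null_eq HvG t2 (U2 _) hf.1 (iU g hg)).
Qed.

End Conclusion.

(** * Solutions *)

Lemma scale0E (R : realType) (T : Type) c (u : T -> 'rV[R[i]]_3) :
  (fun x => c *: u x + (0 : T -> 'rV[R[i]]_3) x) = (fun x => c *: u x).
Proof. by apply/funext => x; rewrite addr0. Qed.

Lemma vcompB (R : realType) (T : Type) i (u v : T -> 'rV[R[i]]_3) :
  vcomp i (u - v) = vcomp i u - vcomp i v.
Proof. by apply/funext => x; rewrite /vcomp !mxE. Qed.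

Lemma partB (R : realType) (T : Type) b (f g : T -> R[i]) : part b (f - g) = part b f - part b g.
Proof.
rewrite partD; congr (_ + _); apply/funext => x.
by rewrite -[RHS]/(- part b g x) /part -[(- g) x]/(- g x); case: b; case: (g x).
Qed.

Lemma lowqB (R : realType) (Omega : set (pt R)) (I : finType) (psi : I -> mpt R -> R)
    (f g : pt R -> R[i]) : open Omega ->
  (forall i, rL2 (leb3 R) (Omega : set (mpt R)) (psi i)) ->
  L2 (leb3 R) (Omega : set (mpt R)) f -> L2 (leb3 R) (Omega : set (mpt R)) g ->
  lowq Omega psi (f - g) = \sum_i \sum_b (rdot (leb3 R) (Omega : set (mpt R)) (part b f) (psi i)
    - rdot (leb3 R) (Omega : set (mpt R)) (part b g) (psi i)) ^+ 2.
Proof.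
move=> oO p2 f2 g2; have mO := mOmega oO; have HR := rL2_prehilbert (leb3 R) mO.
have /(L2P (leb3 R) mO) fb := f2; have /(L2P (leb3 R) mO) gb := g2.
apply: eq_bigr => i _; apply: eq_bigr => b _; rewrite partB.
by rewrite (ph_BD HR (fb b) (ph_N HR (gb b)) (p2 i)) (ph_BN HR (gb b) (p2 i)).
Qed.

Lemma vdotE d (T : measurableType d) (R : realType) (mu : {measure set T -> \bar R}) (D : set T)
    (u v : T -> 'rV[R[i]]_3) : vdot mu D u v = \sum_i cdot mu D (vcomp i u) (vcomp i v).
Proof. by []. Qed.

HB.lock Definition tr (R : realType) (Omega : set (pt R))
    (sigma : {measure set (mpt R) -> \bar R}) (u : vfield R) : vfield R := trace Omega sigma u.

HB.lock Definition BL2 (R : realType) (Omega : set (pt R))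
    (sigma : {measure set (mpt R) -> \bar R}) (u : vfield R) : Prop :=
  L2v sigma (boundary Omega : set (mpt R)) u.

HB.lock Definition bdot (R : realType) (Omega : set (pt R))
    (sigma : {measure set (mpt R) -> \bar R}) (u v : vfield R) : R :=
  vdot sigma (boundary Omega : set (mpt R)) u v.

Section BoundaryForm.
Variables (R : realType) (Omega : set (pt R)) (sigma : {measure set (mpt R) -> \bar R}).
Local Notation G := (boundary Omega : set (mpt R)).
Local Notation tr := (tr Omega sigma).
Local Notation BL2 := (BL2 Omega sigma).
Local Notation bdot := (bdot Omega sigma).
Let mG : measurable G := boundary_measurable Omega.

Lemma BL2E u : BL2 u = L2v sigma G u.
Proof. by rewrite BL2.unlock. Qed.

Lemma trE u : tr u = trace Omega sigma u.
Proof. by rewrite tr.unlock. Qed.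

Lemma bdotE u v : bdot u v = \sum_i cdot sigma G (vcomp i u) (vcomp i v).
Proof. by rewrite bdot.unlock. Qed.

Lemma bdot_prehilbert : prehilbert vscale BL2 bdot.
Proof. rewrite ?bdot.unlock ?BL2.unlock; exact: (vdot_prehilbert sigma mG). Qed.

Lemma bdotC u v : BL2 u -> BL2 v -> bdot u v = bdot v u.
Proof. exact: (ph_C bdot_prehilbert). Qed.

Lemma bdotD u v w : BL2 u -> BL2 v -> BL2 w -> bdot (u + v) w = bdot u w + bdot v w.
Proof. exact: (ph_BD bdot_prehilbert). Qed.

Lemma bdotZ t u w : BL2 u -> BL2 w -> bdot (vscale t u) w = t * bdot u w.
Proof. exact: (ph_BZ bdot_prehilbert). Qed.

Lemma trace_BL2 u : BL2 (tr u).
Proof. rewrite BL2.unlock trE; exact: trace_L2v. Qed.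

Lemma BL2Zc c u : BL2 u -> BL2 (fun x => c *: u x).
Proof. rewrite ?bdot.unlock ?BL2.unlock; exact: (L2vZc mG). Qed.

Lemma BL2_conj u : BL2 u -> BL2 (vconj u).
Proof. rewrite ?bdot.unlock ?BL2.unlock; exact: (L2v_conj mG). Qed.

Lemma BL2_iconj u : BL2 u -> BL2 (viconj u).
Proof. rewrite ?bdot.unlock ?BL2.unlock; exact: (L2v_iconj mG). Qed.

Lemma bdot_mulc c u v : BL2 u -> BL2 v ->
  bdot (fun x => c *: u x) v = bdot u (fun x => conjc c *: v x).
Proof. rewrite ?bdot.unlock ?BL2.unlock; exact: (vdot_mulc mG). Qed.

Lemma bdot_ae_eq u v : BL2 u -> BL2 v ->
  bdot (u - v) (u - v) = 0 <-> {ae sigma, forall x, G x -> u x = v x}.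
Proof. rewrite ?bdot.unlock ?BL2.unlock; exact: (vdot_ae_eq mG). Qed.

Lemma sq_bdot u : BL2 u -> sqL2v sigma G u = bdot u u.
Proof. rewrite ?bdot.unlock ?BL2.unlock; exact: (sqL2vE mG). Qed.

Lemma Cint_bdot u v : BL2 u -> BL2 v ->
  Cint sigma G (fun x => dotv (u x) (v x)) = (bdot u (vconj v) +i* bdot u (viconj v))%C.
Proof. rewrite ?bdot.unlock ?BL2.unlock; exact: (Cint_dotvE mG). Qed.

Hypothesis oO : open Omega.
Hypothesis bO : bounded_set Omega.
Hypothesis Oc : C11_boundary Omega.
Hypothesis ss : is_surface_measure Omega sigma.

Lemma tr_eq u g a : rel_trace Omega sigma u g -> BL2 a -> bdot (tr u) a = bdot g a.
Proof. rewrite bdot.unlock BL2.unlock trE; exact: trace_eq. Qed.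

End BoundaryForm.

Section Solutions.
Variables (R : realType) (Omega : set (pt R)) (sigma : {measure set (mpt R) -> \bar R}).
Variables (theta alpha eta : R).
Local Notation P := (pt R).
Local Notation C := R[i].
Local Notation mu := (leb3 R).
Local Notation D := (Omega : set (mpt R)).
Local Notation G := (boundary Omega : set (mpt R)).
Local Notation tr := (tr Omega sigma).
Hypothesis oO : open Omega.
Hypothesis bO : bounded_set Omega.
Hypothesis Oc : C11_boundary Omega.
Hypothesis ss : is_surface_measure Omega sigma.
Hypothesis coer : coercive_XT Omega sigma alpha theta eta.

Let mO : measurable D := mOmega oO.
Let mG : measurable G := boundary_measurable Omega.
Local Notation Hv := (vdot_prehilbert mu mO).
Local Notation Hs := (cdot_prehilbert mu mO).
Local Notation HG := (cdot_prehilbert sigma mG).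
Local Notation HX := (XT_prehilbert oO bO).
Local Notation has_trace u := (exists g, rel_trace Omega sigma u g).

Local Notation BL2 := (BL2 Omega sigma).
Local Notation bdot := (bdot Omega sigma).
Local Notation Hb := (bdot_prehilbert Omega sigma).
Local Notation tL := (trace_BL2 Omega sigma).

Definition energy (u v : vfield R) : R :=
  volume_form Omega theta alpha u v + eta * bdot (tr u) (tr v).

Lemma energy_coercive : exists2 k, 0 < k & forall u, XT Omega u ->
  k * XTform Omega u u <= energy u u.
Proof.
have [k k0 h] := coer; exists k => // u hu; have := h u hu.
rewrite (sqXTE oO bO hu) (sqL2vE mO (XT_wcurl_L2v hu)) (sqL2vE mO (XT_L2v hu)).
by rewrite (sqL2E mO (XT_wdiv_L2 oO bO hu)) -trE (sq_bdot (tL u)) /energy volume_form.unlock.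
Qed.

Lemma vdot_le_XTform u : XT Omega u -> vdot mu D u u <= XTform Omega u u.
Proof.
move=> hu; rewrite XTformE -addrA lerDl addr_ge0 //.
  exact: (ph_ge0 Hv (XT_wcurl_L2v hu)).
exact: (ph_ge0 Hs (XT_wdiv_L2 oO bO hu)).
Qed.

(** The real form of the variational equation: [energy u v] is the real part of [calL] at u and conj
    v, and the fields v and i v together carry the complex equation. *)
Definition sol (f u : vfield R) := XT Omega u /\
  forall v, XT Omega v -> energy u v = bdot f (tr v).

(** * The case where every field of X_T has a trace *)

Section AllTraces.
Hypothesis allT : forall u, XT Omega u -> has_trace u.

Lemma tr_rel u : XT Omega u -> rel_trace Omega sigma u (tr u).
Proof. by move=> /allT; rewrite trE; exact: traceP. Qed.

(** Stated inside a product, since the chosen trace of conj u and the conjugate of the chosen trace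
    of u agree only up to a null field. *)
Lemma tr_conj u a : XT Omega u -> BL2 a ->
  bdot a (tr (vconj u)) = bdot a (vconj (tr u)).
Proof.
move=> hu a2; have h := rel_trace_conj oO bO Oc ss (tr_rel hu).
have t2 := BL2_conj (tL u).
by rewrite (bdotC a2 (tL _)) (tr_eq oO bO Oc ss h a2) (bdotC t2 a2).
Qed.

Lemma rel_trace_scale c u g : rel_trace Omega sigma u g ->
  rel_trace Omega sigma (fun x => c *: u x) (fun x => c *: g x).
Proof.
by move=> h; have := rel_trace_lin oO bO Oc ss c h (rel_trace0 oO bO Oc ss); rewrite !scale0E.
Qed.

Lemma tr_iconj u a : XT Omega u -> BL2 a ->
  bdot a (tr (viconj u)) = bdot a (viconj (tr u)).
Proof.
move=> hu a2; have h := rel_trace_scale 'i%C (rel_trace_conj oO bO Oc ss (tr_rel hu)).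
have t2 := BL2_iconj (tL u).
by rewrite (bdotC a2 (tL _)) (tr_eq oO bO Oc ss h a2) (bdotC t2 a2).
Qed.

Lemma tr_mulc c u a : XT Omega u -> BL2 a ->
  bdot (tr (fun x => c *: u x)) a = bdot (fun x => c *: tr u x) a.
Proof. by move=> hu a2; exact: (tr_eq oO bO Oc ss (rel_trace_scale c (tr_rel hu)) a2). Qed.

Lemma trD u v a : XT Omega u -> XT Omega v -> BL2 a ->
  bdot (tr (u + v)) a = bdot (tr u) a + bdot (tr v) a.
Proof.
move=> hu hv a2; have := rel_trace_lin oO bO Oc ss 1 (tr_rel hu) (tr_rel hv); rewrite !vlinD => h.
exact: etrans (tr_eq oO bO Oc ss h a2) (bdotD (tL u) (tL v) a2).
Qed.

(** Additivity of the boundary term comes from the existence of all traces: with default values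
    [trace] would not be additive. Positivity is coercivity. *)
Lemma energy_prehilbert : prehilbert vscale (XT Omega) energy.
Proof.
have [k k0 hk] := energy_coercive.
split.
- exact: (ph_0 HX).
- exact: (ph_D HX).
- exact: (ph_N HX).
- exact: (ph_Z HX).
- move=> u v hu hv; rewrite /energy (volume_formC _ _ oO bO hu hv).
  by rewrite (bdotC (tL u) (tL v)).
- move=> u v w hu hv hw; rewrite /energy (volume_formD _ _ oO bO hu hv hw).
  by rewrite (trD hu hv (tL w)) mulrDr addrACA.
- move=> t u w hu hw; rewrite /energy (volume_formZ _ _ oO bO t hu hw).
  have h2 := bdotZ t (tL u) (tL w).
  by rewrite (tr_mulc t%:C%C hu (tL w)) h2 mulrDr mulrCA.
- move=> u hu; apply: le_trans (hk u hu); rewrite mulr_ge0 //; first exact: ltW.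
  exact: (ph_ge0 HX).
Qed.

Lemma wgrad_XT u : XT Omega u -> forall j, exists F, is_wgrad Omega (vcomp j u) F.
Proof. by move=> /allT[g h] j; have [[_ [F hF]] _ _] := h j; exists F. Qed.

(** [trace_le] with eps = 1 for each component: [lowq_le] bounds the coordinates and [XT_grad_bound]
    the gradient, the latter counted three times. *)
Lemma trace_bounded : exists2 K, 0 <= K & forall u, XT Omega u ->
  bdot (tr u) (tr u) <= K * XTform Omega u u.
Proof.
have [K K0 hK] := XT_grad_bound oO bO wgrad_XT.
have [I [psi [p2 hp]]] := trace_le oO bO Oc ss (@ltr01 R).
set Q := \sum_i rdot mu D (psi i) (psi i).
have Q0 : 0 <= Q by apply: sumr_ge0 => i _; exact: (ph_ge0 (rL2_prehilbert mu mO)).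
exists (Q + 3 * K); first by rewrite addr_ge0 // mulr_ge0.
move=> u hu.
have h i : cdot sigma G (vcomp i (tr u)) (vcomp i (tr u)) <=
    Q * cdot mu D (vcomp i u) (vcomp i u) + K * XTform Omega u u.
  have [F hF] := wgrad_XT hu i.
  apply: le_trans (hp _ _ _ (tr_rel hu i) (wgradP hF)) _; rewrite mul1r.
  by apply: lerD; [exact: (lowq_le oO p2 (XT_L2v hu i))|exact: hK].
rewrite bdotE; apply: le_trans (ler_sum _ (fun i _ => h i)) _.
rewrite big_split /= -mulr_sumr sumr_const card_ord -vdotE.
have := ler_wpM2l Q0 (vdot_le_XTform hu); rewrite -mulr_natl.
by move: (vdot _ _ _ _) (XTform _ _ _) => s t; lra.
Qed.

Lemma energy_le : exists2 K, 0 <= K & forall u, XT Omega u -> energy u u <= K * XTform Omega u u.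
Proof.
have [K K0 hK] := volume_form_le theta alpha oO bO.
have [L L0 hL] := trace_bounded.
exists (K + `|eta| * L); first by rewrite addr_ge0 // mulr_ge0.
move=> u hu; rewrite mulrDl /energy; apply: lerD; first exact: hK.
rewrite -mulrA; apply: (@le_trans _ _ (`|eta| * bdot (tr u) (tr u))).
  by rewrite ler_wpM2r ?ler_norm //; exact: (ph_ge0 Hb (tL u)).
by apply: ler_wpM2l; last exact: hL.
Qed.

(** Coercivity and [energy_le] make the energy equivalent to the form of X_T, which is complete. *)
Lemma energy_complete : ph_complete (XT Omega) energy.
Proof.
have [k k0 hk] := energy_coercive; have [K K0 hK] := energy_le.
move=> u hu cau.
have sub n m : XT Omega (u n - u m) by exact: (ph_B HX (hu n) (hu m)).
have [|v hv tv] := XT_complete oO bO hu.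
  move=> e e0; have [N hN] := cau (k * e) (mulr_gt0 k0 e0); exists N => n m Nn Nm.
  by rewrite -(ltr_pM2l k0); apply: le_lt_trans (hk _ (sub n m)) (hN n m Nn Nm).
exists v => //; apply: (tends0_le K0 _ tv) => n; apply: hK; exact: (ph_B HX (hu n) hv).
Qed.

Lemma sol_ex f : BL2 f -> exists u, sol f u.
Proof.
move=> f2; have [k k0 hk] := energy_coercive; have [L L0 hL] := trace_bounded.
have F0 := ph_ge0 Hb f2.
have [|||u hu h] := @riesz _ _ _ _ _ energy_prehilbert (fun v => bdot f (tr v))
  (bdot f f * L / k) energy_complete.
- move=> u v hu hv; rewrite (bdotC f2 (tL _)) (trD hu hv f2).
  by rewrite (bdotC f2 (tL u)) (bdotC f2 (tL v)).
- move=> t u hu; rewrite (bdotC f2 (tL _)) (tr_mulc t%:C%C hu f2).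
  by rewrite (bdotZ t (tL u) f2) (bdotC f2 (tL u)).
- move=> u hu; apply: le_trans (ph_CS Hb f2 (tL u)) _.
  rewrite -!mulrA; apply: ler_wpM2l => //; apply: le_trans (hL u hu) _; apply: ler_wpM2l => //.
  by rewrite ler_pdivlMl //; exact: hk.
by exists u.
Qed.

Lemma calL_energy u v : XT Omega u -> XT Omega v ->
  calL Omega sigma alpha theta eta u v = (energy u (vconj v) +i* energy u (viconj v))%C.
Proof.
move=> hu hv; rewrite /calL (volume_calL _ _ oO bO hu hv) -!trE (Cint_bdot (tL u) (tL v)).
rewrite -(tr_conj hv (tL u)) -(tr_iconj hv (tL u)) /energy.
have aux (a b s t : R) : ((a +i* b)%C + eta%:C%C * (s +i* t)%C : C) = ((a + eta * s) +i* (b + eta * t))%C.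
  by apply/eqP; rewrite eq_complex /=; apply/andP; split; apply/eqP; ring.
exact: aux.
Qed.

Lemma calJ_vdot f v : BL2 f -> XT Omega v ->
  calJ Omega sigma f v = (bdot f (tr (vconj v)) +i* bdot f (tr (viconj v)))%C.
Proof.
by move=> f2 hv; rewrite /calJ -trE (Cint_bdot f2 (tL v)) (tr_conj hv f2) (tr_iconj hv f2).
Qed.

(** Existence makes the choice in [calLinv] a true solution; the real part of its equation at conj v
    is the equation of [sol]. *)
Lemma sol_calLinv f : BL2 f ->
  sol f (calLinv Omega sigma alpha theta eta (calJ Omega sigma f)).
Proof.
move=> f2; set l := calJ Omega sigma f; have [u0 [hu0 e0]] := sol_ex f2.
have [hu e] : [set u : vfield R | XT Omega u /\ forall phi, XT Omega phi ->
    calL Omega sigma alpha theta eta u phi = l phi] (calLinv Omega sigma alpha theta eta l).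
  apply: xgetPex; exists u0; split=> // v hv; rewrite /l calL_energy // calJ_vdot //.
  have hv1 := XT_conj oO bO hv; have hv2 := XT_conji oO bO hv.
  by rewrite (e0 _ hv1) (e0 _ hv2).
split; first exact: hu.
move=> v hv; have hv' := XT_conj oO bO hv.
have := e _ hv'; rewrite /l (calL_energy hu hv') (calJ_vdot f2 hv') vconjK.
by move=> /(congr1 (@complex.Re R)).
Qed.

(** The energy of u - v is the product of f - g with a trace, hence 0, and coercivity makes u - v
    null. With f = g it compares the chosen solution to any other. *)
Lemma sol_unique f g u v : BL2 f -> BL2 g ->
  {ae sigma, forall x, G x -> f x = g x} -> sol f u -> sol g v ->
  {ae sigma, forall x, G x -> tr u x = tr v x}.
Proof.
move=> f2 g2 /(bdot_ae_eq f2 g2) fg [hu eu] [hv ev].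
have HE := energy_prehilbert; have hw := ph_B HX hu hv.
have [k k0 hk] := energy_coercive.
have w0 : energy (u - v) (u - v) = 0.
  rewrite (ph_BD HE hu (ph_N HX hv) hw) (ph_BN HE hv hw) (eu _ hw) (ev _ hw).
  by rewrite (ph_null_eq Hb f2 g2 (tL _) fg) subrr.
have X0 := ph_ge0 HX hw; have := hk _ hw; rewrite w0 pmulr_rle0 // => X1.
have V0 : vdot mu D (u - v) (u - v) = 0.
  apply/eqP; rewrite eq_le (ph_ge0 Hv (XT_L2v hw)) andbT.
  exact: le_trans (vdot_le_XTform hw) X1.
apply/(bdot_ae_eq (tL u) (tL v)).
rewrite bdot.unlock; apply: (rel_trace_null oO bO Oc ss _ V0).
have := rel_trace_lin oO bO Oc ss (-1) (tr_rel hv) (tr_rel hu).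
by congr rel_trace; apply/funext => x; rewrite scaleN1r addrC.
Qed.

(** Only real linearity is part of the pre-Hilbert laws; the complex factor c is moved to the test
    field as conj c in the volume form, in the boundary term and in the datum. *)
Lemma sol_lin c f g u v : BL2 f -> BL2 g -> sol f u -> sol g v ->
  sol (fun x => c *: f x + g x) (fun x => c *: u x + v x).
Proof.
move=> f2 g2 [hu eu] [hv ev]; split; first exact: XT_lin.
have hc a w : XT Omega w -> XT Omega (fun x => a *: w x).
  by move=> hw; have := XT_lin oO bO a hw (ph_0 HX); rewrite scale0E.
move=> w hw; have HE := energy_prehilbert.
rewrite -[X in energy X _]/((fun x => c *: u x) + v) (ph_BD HE (hc c u hu) hv hw) (ev _ hw).
have -> := bdotD (BL2Zc c f2) g2 (tL w).
congr (_ + _); rewrite (bdot_mulc c f2 (tL w)).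
have cw := hc (conjc c) w hw.
rewrite (bdotC f2 (BL2Zc _ (tL w))) -(tr_mulc (conjc c) hw f2) (bdotC (tL _) f2) -(eu _ cw).
rewrite /energy (volume_form_mulc _ _ oO bO c hu hw); congr (_ + eta * _).
rewrite (tr_mulc c hu (tL w)) (bdot_mulc c (tL u) (tL w)).
rewrite (bdotC (tL u) (BL2Zc _ (tL w))) -(tr_mulc (conjc c) hw (tL u)).
exact: (bdotC (tL _) (tL u)).
Qed.

(** Each solution tests the equation of the other: both sides are the energy of u and v. *)
Lemma sol_sym f g u v : BL2 f -> BL2 g -> sol f u -> sol g v ->
  bdot (tr u) g = bdot f (tr v).
Proof.
move=> f2 g2 [hu eu] [hv ev]; rewrite -(eu _ hv) (bdotC (tL u) g2) -(ev _ hu).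
exact: (ph_C energy_prehilbert).
Qed.

(** With X the squared norm of u, coercivity and the equation at v = u give (k X)^2 <= (f, tr u)^2
    <= |M| L X. *)
Lemma sol_bounded M : exists2 B, 0 <= B & forall f u, BL2 f ->
  bdot f f <= M -> sol f u -> XTform Omega u u <= B.
Proof.
have [k k0 hk] := energy_coercive; have [L L0 hL] := trace_bounded.
exists (`|M| * L / k ^+ 2); first by rewrite divr_ge0 ?sqr_ge0 // mulr_ge0.
move=> f u f2 fM [hu eu]; have h := hk u hu.
have X0 := ph_ge0 HX hu; have h2 := hL u hu; have F0 := ph_ge0 Hb f2.
have h3 := ph_CS Hb f2 (tL u); rewrite -(eu _ hu) in h3.
have h4 : bdot f f * bdot (tr u) (tr u) <= `|M| * (L * XTform Omega u u).
  by apply: ler_pM => //; [exact: (ph_ge0 Hb (tL u))|exact: le_trans fM (ler_norm M)].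
rewrite ler_pdivlMr ?exprn_gt0 //.
move: h h3 h4 X0; move: (energy u u) (XTform Omega u u) (bdot f f * _) => e X y h h3 h4 X0.
have [->|Xp] := eqVneq X 0; first by rewrite mul0r mulr_ge0.
have {}Xp : 0 < X by rewrite lt0r Xp.
have h5 : (k * X) ^+ 2 <= e ^+ 2 by rewrite ler_pXn2r ?nnegrE ?mulr_ge0 //; [exact: ltW|apply: le_trans h; rewrite mulr_ge0 // ltW].
rewrite -(ler_pM2l Xp); have -> : X * (X * k ^+ 2) = (k * X) ^+ 2 by ring.
apply: le_trans h5 _; apply: le_trans h3 _; apply: le_trans h4 _.
by rewrite mulrA mulrC.
Qed.

(** The solutions are bounded in X_T, and so are their gradients. [trace_le] bounds the trace of a
    difference by finitely many coordinates plus a small multiple of the gradient, as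
    [cauchy_subsequence] requires. *)
Lemma sol_compact M (f u : nat -> vfield R) : (forall n, BL2 (f n)) ->
  (forall n, bdot (f n) (f n) <= M) -> (forall n, sol (f n) (u n)) ->
  exists2 k : nat -> nat, {homo k : m n / (m < n)%N} &
    cauchy_wrt (fun n m => bdot (tr (u (k n)) - tr (u (k m))) (tr (u (k n)) - tr (u (k m)))).
Proof.
move=> f2 fM fu; have [B B0 hB] := sol_bounded M.
have [K K0 hK] := XT_grad_bound oO bO wgrad_XT.
have uX n : XT Omega (u n) := (fu n).1.
have uB n : XTform Omega (u n) (u n) <= B by exact: hB (f2 n) (fM n) (fu n).
apply: (@cauchy_subsequence R (fun n m => bdot (tr (u n) - tr (u m)) (tr (u n) - tr (u m)))).
move=> e e0.
(* The gradient terms are at most (e / c) K 4 B for each of three components, in total e (c - 1) / c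
   <= e; the added 1 makes c positive. *)
pose c := 12 * (K * B) + 1; have c0 : 0 < c by rewrite ltr_wpDl // !mulr_ge0.
have [I [psi [p2 hp]]] := trace_le oO bO Oc ss (divr_gt0 e0 c0).
set Q := \sum_i rdot mu D (psi i) (psi i).
have HR := rL2_prehilbert mu mO.
have r0 i := ph_ge0 HR (p2 i).
have part2 (v : vfield R) i b : XT Omega v -> rL2 mu D (part b (vcomp i v)).
  by move=> hv; have /(L2P mu mO) := XT_L2v hv i; exact.
have partle n i b : rdot mu D (part b (vcomp i (u n))) (part b (vcomp i (u n))) <= B.
  apply: le_trans (uB n); apply: le_trans (vdot_le_XTform (uX n)).
  apply: (@le_trans _ _ (cdot mu D (vcomp i (u n)) (vcomp i (u n)))).
    by rewrite /cdot (bigD1 b) //= lerDl; apply: sumr_ge0 => b' _; exact: (ph_ge0 HR (part2 _ i b' (uX n))).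
  rewrite vdotE (bigD1 i) //= lerDl; apply: sumr_ge0 => j _; exact: (ph_ge0 Hs (XT_L2v (uX n) j)).
(* One coordinate for each component of the field, each psi and each of the real and imaginary
   parts. Their squares are at most B Q, so B Q + 1 bounds them. *)
exists ('I_3 * (I * bool))%type, (fun i n => rdot mu D (part i.2.2 (vcomp i.1 (u n))) (psi i.2.1)), (B * Q + 1).
split=> [[i [j b]] n /=|n m].
  have h1 : rdot mu D (part b (vcomp i (u n))) (psi j) ^+ 2 <= B * Q.
    apply: le_trans (ph_CS HR (part2 _ i b (uX n)) (p2 j)) _.
    apply: ler_pM; [exact: (ph_ge0 HR (part2 _ i b (uX n)))|exact: r0|exact: partle|].
    by rewrite /Q (bigD1 j) //= lerDl; apply: sumr_ge0 => j' _; exact: r0.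
  rewrite ler_norml; move: h1; set x := rdot _ _ _ _; set y := B * Q => h1.
  by apply/andP; split; nra.
have hw : XT Omega (u n - u m) by exact: (ph_B HX).
have wB : XTform Omega (u n - u m) (u n - u m) <= 4 * B.
  apply: le_trans (ph_sqB_le HX (uX n) (uX m)) _; have -> : 4 * B = 2 * B + 2 * B by ring.
  by apply: lerD; rewrite ler_pM2l.
have hr : rel_trace Omega sigma (u n - u m) (tr (u n) - tr (u m)).
  have := rel_trace_lin oO bO Oc ss (-1) (tr_rel (uX m)) (tr_rel (uX n)).
  by congr rel_trace; apply/funext => x; rewrite scaleN1r addrC.
have h i : cdot sigma G (vcomp i (tr (u n) - tr (u m))) (vcomp i (tr (u n) - tr (u m))) <=
    lowq Omega psi (vcomp i (u n - u m)) + e / c * (K * (4 * B)).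
  have [F hF] := wgrad_XT hw i.
  apply: le_trans (hp _ _ _ (hr i) (wgradP hF)) _; rewrite lerD2l.
  apply: ler_wpM2l; first by rewrite divr_ge0 // ltW.
  by apply: le_trans (hK _ hw i) _; exact: ler_wpM2l.
rewrite bdotE; apply: le_trans (ler_sum _ (fun i _ => h i)) _.
rewrite big_split /= sumr_const card_ord; apply: lerD.
  pose F (p : 'I_3 * (I * bool)) := (rdot mu D (part p.2.2 (vcomp p.1 (u n))) (psi p.2.1)
    - rdot mu D (part p.2.2 (vcomp p.1 (u m))) (psi p.2.1)) ^+ 2.
  rewrite -[leRHS]/(\sum_p F p) -(pair_bigA _ (fun i q => F (i, q))); apply: ler_sum => i _.
  rewrite -(pair_bigA _ (fun j b => F (i, (j, b)))) vcompB.
  by rewrite (lowqB oO p2 (XT_L2v (uX n) i) (XT_L2v (uX m) i)).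
have -> : e / c * (K * (4 * B)) *+ 3 = e * ((c - 1) / c).
  by rewrite -mulr_natl /c; field; rewrite -/c gt_eqF.
apply: ler_piMr; first exact: ltW.
by rewrite ler_pdivrMr // mul1r gerBl.
Qed.

End AllTraces.
End Solutions.

(** * Fields without trace *)

(** Continuity at t = 0 made explicit: if c < 0, the chosen t makes the first two terms at most - c
    / 2. It passes from the fields t phi0 + u to u. *)
Lemma quad_ge0_limit (R : realType) (a b c : R) :
  (forall t : R, t != 0 -> 0 <= t ^+ 2 * a + t * b + c) -> 0 <= c.
Proof.
move=> h; rewrite leNgt; apply/negP => c0.
pose s := `|a| + `|b| + 1.
have s0 : 0 < s by rewrite ltr_wpDl // addr_ge0.
pose t := Num.min 1 (- c / (2 * s)).
have t0 : 0 < t by rewrite lt_min ltr01 divr_gt0 ?oppr_gt0 // mulr_gt0.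
have t1 : t <= 1 by rewrite /t ge_min lexx.
have t2 : t * (2 * s) <= - c by rewrite -ler_pdivlMr ?mulr_gt0 // /t ge_min lexx orbT.
have := h t; rewrite gt_eqF // => /(_ isT).
have ha := ler_norm a; have hb := ler_norm b.
have k1 : t ^+ 2 * a <= t * `|a|.
  apply: (@le_trans _ _ (t ^+ 2 * `|a|)); first by rewrite ler_wpM2l ?sqr_ge0.
  by rewrite ler_wpM2r // expr2 ler_piMl // ltW.
have k2 : t * b <= t * `|b| by rewrite ler_wpM2l // ltW.
by move: t2; rewrite /s; nra.
Qed.

Lemma realC_mulV (R : realType) (t : R) : t != 0 -> (t^-1)%:C%C * t%:C%C = 1 :> R[i].
Proof.
move=> t0; apply/eqP; rewrite eq_complex /= !mul0r !mulr0 subr0 addr0.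
by rewrite (mulVf t0) !eqxx.
Qed.

Section MissingTrace.
Variables (R : realType) (Omega : set (pt R)) (sigma : {measure set (mpt R) -> \bar R}).
Variables (theta alpha eta : R).
Local Notation P := (pt R).
Local Notation C := R[i].
Local Notation mu := (leb3 R).
Local Notation D := (Omega : set (mpt R)).
Local Notation G := (boundary Omega : set (mpt R)).
Local Notation tr := (tr Omega sigma).
Hypothesis oO : open Omega.
Hypothesis bO : bounded_set Omega.
Hypothesis Oc : C11_boundary Omega.
Hypothesis ss : is_surface_measure Omega sigma.
Hypothesis coer : coercive_XT Omega sigma alpha theta eta.

Let mO : measurable D := mOmega oO.
Local Notation Hv := (vdot_prehilbert mu mO).
Local Notation HX := (XT_prehilbert oO bO).
Local Notation Hb := (bdot_prehilbert Omega sigma).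
Local Notation has_trace u := (exists g, rel_trace Omega sigma u g).
Local Notation vf := (volume_form Omega theta alpha).

Variable phi0 : vfield R.
Hypothesis X0 : XT Omega phi0.
Hypothesis N0 : ~ has_trace phi0.

Lemma tr_none u : ~ has_trace u -> tr u = 0.
Proof. by rewrite trE; exact: traceN. Qed.

Lemma has_trace_lin c u v : has_trace u -> has_trace v -> has_trace (fun x => c *: u x + v x).
Proof.
by move=> [g hg] [k hk]; exists (fun x => c *: g x + k x); exact: rel_trace_lin.
Qed.

(** Otherwise phi0 = t^-1 (- u + (t phi0 + u)) would be a combination of fields with trace. *)
Lemma no_trace_shift (t : R) u : t != 0 -> has_trace u -> ~ has_trace (vscale t phi0 + u).
Proof.
move=> t0 hu hw; apply: N0.
have h := has_trace_lin (-1) hu hw.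
have := has_trace_lin (t^-1)%:C%C h (ex_intro _ 0 (rel_trace0 oO bO Oc ss)).
suff -> : (fun x => (t^-1)%:C%C *: (-1 *: u x + (vscale t phi0 + u) x) + (0 : vfield R) x) = phi0 by [].
apply/funext => x; rewrite -[(vscale t phi0 + u) x]/(vscale t phi0 x + u x) /vscale addr0 scaleN1r addrC addrK scalerA.
rewrite (realC_mulV t0); exact: scale1r.
Qed.

Lemma no_trace_conj u : ~ has_trace u -> ~ has_trace (vconj u).
Proof.
by move=> h [g hg]; apply: h; exists (vconj g); rewrite -(vconjK u); exact: rel_trace_conj.
Qed.

Lemma volume_coercive : exists2 k, 0 < k & forall u, XT Omega u -> k * XTform Omega u u <= vf u u.
Proof.
have [k k0 hk] := energy_coercive oO bO coer; exists k => //.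
have none u : XT Omega u -> ~ has_trace u -> k * XTform Omega u u <= vf u u.
  move=> hu nu; have := hk u hu; rewrite /energy (tr_none nu).
  by have -> : bdot Omega sigma 0 0 = 0 := ph_B0 Hb (ph_0 Hb); rewrite mulr0 addr0.
move=> u hu; have [hT|] := pselect (has_trace u); last exact: none.
rewrite -subr_ge0.
(* The volume form minus k times the norm of X_T, taken at t phi0 + u, is a quadratic polynomial in
   t; it is nonnegative for t != 0 and has the wanted quantity as its constant term. *)
apply: (@quad_ge0_limit _ (vf phi0 phi0 - k * XTform Omega phi0 phi0)
  (2 * (vf phi0 u - k * XTform Omega phi0 u))) => t t0.
have ht := ph_Z HX t X0.
have := none _ (ph_D HX ht hu) (no_trace_shift t0 hT); rewrite -subr_ge0.
have e1 := ph_sqD HX ht hu; have e2 := ph_sqZ HX t X0; have e3 := ph_BZ HX t X0 hu.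
rewrite e1 e2 e3.
have hw := ph_D HX ht hu.
rewrite (volume_formD _ _ oO bO ht hu hw) (volume_formZ _ _ oO bO t X0 hw).
rewrite (volume_formC _ _ oO bO X0 hw) (volume_formC _ _ oO bO hu hw).
rewrite (volume_formD _ _ oO bO ht hu X0) (volume_formD _ _ oO bO ht hu hu).
rewrite (volume_formZ _ _ oO bO t X0 X0) (volume_formZ _ _ oO bO t X0 hu).
rewrite (volume_formC _ _ oO bO hu X0).
move: (vf phi0 phi0) (vf phi0 u) (vf u u) (XTform Omega phi0 phi0) (XTform Omega phi0 u) (XTform Omega u u).
by move=> a b c x y z h; apply: le_trans h _; rewrite le_eqVlt; apply/orP; left; apply/eqP; ring.
Qed.

(** Testing with a field without trace kills the boundary term and the datum. A v with trace is the
    difference of phi0 + v and phi0, both without trace, so the volume form of u vanishes on all of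
    X_T, in particular at u. *)
Lemma calL_null (f u : vfield R) : XT Omega u ->
  (forall phi, XT Omega phi -> calL Omega sigma alpha theta eta u phi = calJ Omega sigma f phi) ->
  vdot mu D u u = 0.
Proof.
move=> hu e.
have dot0 (a : vfield R) : Cint sigma G (fun x => dotv (a x) ((0 : vfield R) x)) = 0.
  have -> : (fun x => dotv (a x) ((0 : vfield R) x)) = fun=> 0.
    by apply/funext => x; rewrite /dotv big1 // => i _; rewrite mxE mulr0.
  exact: Cint0.
have none v : XT Omega v -> ~ has_trace v -> vf u v = 0.
  move=> hv nv; have hv' := XT_conj oO bO hv.
  have := e _ hv'; rewrite /calL /calJ (volume_calL _ _ oO bO hu hv') (traceN (no_trace_conj nv)).
  by rewrite !dot0 mulr0 addr0 vconjK => /(congr1 (@complex.Re R)).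
have all v : XT Omega v -> vf u v = 0.
  move=> hv; have [hT|] := pselect (has_trace v); last exact: none.
  have h1 : vscale 1 phi0 = phi0 by apply/funext => x; rewrite /vscale scale1r.
  have hw := ph_D HX X0 hv.
  have := no_trace_shift (@oner_neq0 R) hT; rewrite h1 => nw.
  have := none _ hw nw; rewrite (volume_formC _ _ oO bO hu hw) (volume_formD _ _ oO bO X0 hv hu).
  rewrite (volume_formC _ _ oO bO X0 hu) (none _ X0 N0) add0r => <-.
  exact: (volume_formC _ _ oO bO hu hv).
have [k k0 hk] := volume_coercive.
have := hk _ hu; rewrite (all _ hu) pmulr_rle0 // => h.
apply/eqP; rewrite eq_le (ph_ge0 Hv (XT_L2v hu)) andbT.
exact: le_trans (vdot_le_XTform oO bO hu) h.
Qed.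

(** If the equation has no solution, [calLinv] returns 0, so its value is null in both cases. A null
    field has a null trace, or the default trace 0. *)
Lemma trace_calLinv_null f :
  {ae sigma, forall x, G x ->
    trace Omega sigma (calLinv Omega sigma alpha theta eta (calJ Omega sigma f)) x = 0}.
Proof.
set u := calLinv _ _ _ _ _ _.
have u0 : vdot mu D u u = 0.
  have [h|h] := pselect (exists u, XT Omega u /\ forall phi, XT Omega phi ->
      calL Omega sigma alpha theta eta u phi = calJ Omega sigma f phi).
    by have [hu e] := xgetPex 0 h; exact: (calL_null hu e).
  have -> : u = 0 by apply: xgetPN => v hv; apply: h; exists v.
  exact: (ph_B0 Hv (ph_0 Hv)).
have mG := boundary_measurable Omega.
apply: (vdot_ae mG (@trace_L2v _ _ sigma u)).1.
have [h|h] := pselect (has_trace u).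
  by apply: (rel_trace_null oO bO Oc ss _ u0); exact: traceP.
by rewrite traceN //; exact: (ph_B0 (vdot_prehilbert sigma mG) (ph_0 (vdot_prehilbert sigma mG))).
Qed.

End MissingTrace.

Section TraceOperators.
Variables (R : realType) (Omega : set (pt R)) (sigma : {measure set (mpt R) -> \bar R}).
Local Notation G := (boundary Omega : set (mpt R)).

(* The properties of the map from f to the trace of the solution with datum f
   that make its tangential part compact and self-adjoint. *)
Definition trace_operator (U : vfield R -> vfield R) : Prop :=
  [/\ forall f, L2v sigma G (U f),
      forall f g, TL2 Omega sigma f -> TL2 Omega sigma g -> TL2eq Omega sigma f g ->
        TL2eq Omega sigma (U f) (U g),
      forall a f g, TL2 Omega sigma f -> TL2 Omega sigma g ->
        TL2eq Omega sigma (U (fun x => a *: f x + g x)) (fun x => a *: U f x + U g x),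
      forall f g, TL2 Omega sigma f -> TL2 Omega sigma g -> vdot sigma G (U f) g = vdot sigma G f (U g)
    & forall (f : nat -> vfield R) M, (forall n, TL2 Omega sigma (f n)) ->
      (forall n, vdot sigma G (f n) (f n) <= M) ->
      exists2 k : nat -> nat, {homo k : m n / (m < n)%N} &
        cauchy_wrt (fun n m => vdot sigma G (U (f (k n)) - U (f (k m))) (U (f (k n)) - U (f (k m))))].

(** All clauses are identities between null fields, and any subsequence is Cauchy. *)
Lemma trace_operator_null (U : vfield R -> vfield R) : (forall f, L2v sigma G (U f)) ->
  (forall f, {ae sigma, forall x, G x -> U f x = 0}) -> trace_operator U.
Proof.
move=> U2 Unull; have mG : measurable G := boundary_measurable Omega.
have HvG := vdot_prehilbert sigma mG.
have U0 f : vdot sigma G (U f) (U f) = 0 by apply: (vdot_ae mG (U2 f)).2; exact: Unull.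
split=> //.
- by move=> f g _ _ _; apply: ae_mono2 (Unull f) (Unull g) => x h1 h2 bx; rewrite h1 // h2.
- move=> a f g _ _; have h3 : {ae sigma, forall x, G x -> U f x = 0 /\ U g x = 0}.
    by apply: ae_mono2 (Unull f) (Unull g) => x h1 h2 bx; split; [exact: h1|exact: h2].
  apply: ae_mono2 (Unull (fun x => a *: f x + g x)) h3 => x h0 h bx.
  by have [h1 h2] := h bx; rewrite h0 // h1 h2 scaler0 addr0.
- move=> f g [f2 _] [g2 _].
  have h1 := ph_null HvG (U2 f) g2 (U0 f); have h2 := ph_null HvG (U2 g) f2 (U0 g).
  by have h3 := ph_C HvG f2 (U2 g); rewrite h1 h3 h2.
- move=> f M _ _; exists id => // e e0; exists 0%N => n m _ _.
  have -> // : vdot sigma G (U (f n) - U (f m)) (U (f n) - U (f m)) = 0.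
  apply: (vdot_ae_eq mG (U2 _) (U2 _)).2.
  by apply: ae_mono2 (Unull (f n)) (Unull (f m)) => x h1 h2 bx; rewrite h1 // h2.
Qed.

Variables (theta alpha eta : R).
Hypothesis oO : open Omega.
Hypothesis bO : bounded_set Omega.
Hypothesis Oc : C11_boundary Omega.
Hypothesis ss : is_surface_measure Omega sigma.
Hypothesis coer : coercive_XT Omega sigma alpha theta eta.
Hypothesis allT : forall u, XT Omega u -> exists g, rel_trace Omega sigma u g.

Local Notation sl f := (calLinv Omega sigma alpha theta eta (calJ Omega sigma f)).

Lemma trace_operator_solution :
  trace_operator (fun f => tr Omega sigma (sl f)).
Proof.
have mG : measurable G := boundary_measurable Omega.
have S f := sol_calLinv oO bO Oc ss coer allT (f := f).
have T2 f : TL2 Omega sigma f -> BL2 Omega sigma f by rewrite BL2E => -[].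
split.
- by move=> f; rewrite -BL2E; exact: trace_BL2.
- move=> f g /T2 f2 /T2 g2 e.
  exact: (sol_unique oO bO Oc ss coer allT f2 g2 e (S f f2) (S g g2)).
- move=> a f g hf hg; have f2 := T2 _ hf; have g2 := T2 _ hg.
  have h2 := T2 _ (TL2_lin a hf hg).
  have Sl := sol_lin oO bO Oc ss coer allT a f2 g2 (S f f2) (S g g2).
  have refl : {ae sigma, forall x, G x -> a *: f x + g x = a *: f x + g x} by apply: aeW.
  have h := sol_unique oO bO Oc ss coer allT h2 h2 refl (S _ h2) Sl.
  (* The combination of the chosen traces and the chosen trace of the combination are traces of one
     field, hence equal almost everywhere. *)
  have r1 := rel_trace_lin oO bO Oc ss a (tr_rel allT (S f f2).1) (tr_rel allT (S g g2).1).
  have r2 := tr_rel allT Sl.1.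
  have h' := (vdot_ae_eq mG (rel_trace_L2v r2) (rel_trace_L2v r1)).1 (rel_trace_unique oO bO Oc ss r2 r1).
  apply: ae_mono2 h h' => x e1 e2 bx.
  exact: etrans (e1 bx) (e2 bx).
- move=> f g /T2 f2 /T2 g2.
  have := sol_sym oO bO Oc ss coer allT f2 g2 (S f f2) (S g g2); rewrite bdot.unlock; exact.
- move=> f M hf hM.
  have fM n : bdot Omega sigma (f n) (f n) <= M by rewrite bdot.unlock.
  have := sol_compact oO bO Oc ss coer allT (fun n => T2 _ (hf n)) fM (fun n => S _ (T2 _ (hf n))).
  rewrite bdot.unlock; exact.
Qed.

End TraceOperators.

Theorem theorem3p18 (R : realType) (Omega : set (pt R))
    (sigma : {measure set (mpt R) -> \bar R}) (theta alpha eta c : R)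
    (Omega_bounded : bounded_set Omega) (Omega_connected : connected Omega)
    (Omega_open : open Omega) (Omega_C11 : C11_boundary Omega)
    (sigma_surface : is_surface_measure Omega sigma)
    (theta_gt0 : 0 < theta) (alpha_lt : (alpha%:E < A1 Omega theta)%E)
    (c_ge0 : 0 <= c)
    (c_coercive : forall eta', c <= eta' ->
       coercive_XT Omega sigma alpha theta eta')
    (eta_ge : c <= eta) :
  [/\ TL2_operator Omega sigma (calA Omega sigma alpha theta eta),
      TL2_compact Omega sigma (calA Omega sigma alpha theta eta)
    & TL2_selfadjoint Omega sigma (calA Omega sigma alpha theta eta)].
Proof.
have coer := c_coercive eta eta_ge.
(* [calA] is by definition minus the tangential part of this map. *)
suff [U2 Ueq Ulin Usym Ucpt] : trace_operator Omega sigma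
    (fun f => trace Omega sigma (calLinv Omega sigma alpha theta eta (calJ Omega sigma f))).
  split.
  - exact: (opp_tangential_operator Omega_open Omega_bounded Omega_C11 U2 Ueq Ulin).
  - exact: (opp_tangential_compact Omega_open Omega_bounded Omega_C11 U2 Ucpt).
  - exact: (opp_tangential_selfadjoint Omega_open Omega_bounded Omega_C11 U2 Ulin Usym).
have [allT|] := pselect (forall u, XT Omega u -> exists g, rel_trace Omega sigma u g).
  have := trace_operator_solution Omega_open Omega_bounded Omega_C11 sigma_surface coer allT.
  by rewrite tr.unlock.
move=> /existsNP[phi0 /not_implyP[X0 N0]].
apply: trace_operator_null => f; first exact: trace_L2v.
exact: (trace_calLinv_null Omega_open Omega_bounded Omega_C11 sigma_surface coer X0 N0 f).
Qed.
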